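(* Let $K$ be a number field and let $\rho=\{\rho_v\}_{v\in M_K}$ be an adelic measure. Then $h_\rho$ is a Weil height whose essential minimum is nonnegative; that is, the difference $h_\rho-h_{\rm nv}$ is uniformly bounded on $\mathbb P^1(\overline K)$, and for every $\varepsilon>0$ the set $\{\alpha\in\mathbb P^1(\overline K):\ h_\rho(\alpha)<-\varepsilon\}$ is finite.
   Context: Places. $K$ is a number field with algebraic closure $\overline K$. $M_K$ is the set of absolute values $|\cdot|_v$ on $K$ extending the usual absolute value ($v$ infinite) or some $p$-adic absolute value with $|p|_p=p^{-1}$ ($v$ finite) of $\mathbb Q$. $K_v$ is the completion, $\mathbb Q_v$ the closure of $\mathbb Q$ in $K_v$, $N_v=[K_v:\mathbb Q_v]/[K:\mathbb Q]$, $\|\cdot\|_v=|\cdot|_v^{N_v}$, and $\mathbb C_v$ is the completion of an algebraic closure of $K_v$. Berkovich line. If $v$ is infinite, $\mathsf P^1(\mathbb C_v)=\mathbb P^1(\mathbb C_v)$ (Riemann sphere). If $v$ is finite, $\mathsf A^1(\mathbb C_v)$ is the set of multiplicative seminorms on $\mathbb C_v[T]$ extending $|\cdot|_v$, and $\mathsf P^1(\mathbb C_v)=\mathsf A^1(\mathbb C_v)\cup\{\infty\}$ is the Berkovich projective line (compact); it contains $\mathbb P^1(\mathbb C_v)$, a point $z\in\mathbb C_v$ being identified with the seminorm $P\mapsto|P(z)|_v$; $\mathbb H_v=\mathsf P^1(\mathbb C_v)\setminus\mathbb P^1(\mathbb C_v)$. Order: $\mathcal S\le\mathcal S'$ iff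 $\mathcal S(P)\le\mathcal S'(P)$ for all $P$; $\mathcal S\wedge\mathcal S'$ is the least upper bound; $\mathrm{diam}(\mathcal S)=\inf_{z\in\mathbb C_v}\mathcal S(T-z)$; $\sup\{\mathcal S,\mathcal S'\}=\mathrm{diam}(\mathcal S\wedge\mathcal S')$ (equal to $|z-z'|_v$ on $\mathbb C_v$). $\mathcal S_{\rm can}$ is the Gauss norm (sup norm on the closed unit ball). $d(\mathcal S,\mathcal S')=2\log\sup\{\mathcal S,\mathcal S'\}-\log\mathrm{diam}(\mathcal S)-\log\mathrm{diam}(\mathcal S')$ is a distance on $\mathbb H_v$. $\mathsf P^1(\mathbb C_v)$ is uniquely path connected; for $\mathcal S,\mathcal S'$ let $\mathcal S''$ be the unique point common to the three segments joining pairwise $\mathcal S,\mathcal S',\mathcal S_{\rm can}$, and put $\langle\mathcal S,\mathcal S'\rangle=d(\mathcal S'',\mathcal S_{\rm can})$ if $\mathcal S''\in\mathbb H_v$, $\infty$ otherwise. Laplacian. If $v$ is infinite, $\Delta=dd^c=\frac1{2\pi}(\partial_x^2+\partial_y^2)\,dx\wedge dy$ in the sense of distributions on $\mathbb P^1(\mathbb C_v)$. If $v$ is finite and $\mu$ is a finite signed Borel measure of total mass $0$, $\Delta g=\mu$ means that $g(\mathcal S)=c-\int\langle\mathcal S,\mathcal S'\rangle\,d\mu(\mathcal S')$ on $\mathbb H_v$ for some constant $c$; saying that $g$ is continuous means it extends to a continuous real function on $\mathsf P^1(\mathbb C_v)$. Energy. Let $\mathrm{Diag}_v=\{(z,z):z\in\mathbb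 C_v\}$. When the integrand is integrable, $(\mu,\nu)_v=-\int\log|z-w|_v\,d\mu(z)\otimes d\nu(w)$ over $\mathbb C_v\times\mathbb C_v\setminus\mathrm{Diag}_v$ for $v$ infinite, and $(\mu,\nu)_v=-\int\log\sup\{\mathcal S,\mathcal S'\}\,d\mu(\mathcal S)\otimes d\nu(\mathcal S')$ over $\mathsf A^1(\mathbb C_v)\times\mathsf A^1(\mathbb C_v)\setminus\mathrm{Diag}_v$ for $v$ finite. Put $(\!(\mu,\nu)\!)_v=N_v(\mu,\nu)_v$. Adelic measures and heights. $\lambda_v$ is the normalized Lebesgue measure on the unit circle for $v$ infinite, and the Dirac mass at $\mathcal S_{\rm can}$ for $v$ finite. An adelic measure $\rho=\{\rho_v\}_{v\in M_K}$ is the data, for each $v\in M_K$, of a probability measure $\rho_v$ on $\mathsf P^1(\mathbb C_v)$ such that $\rho_v=\lambda_v$ for all but finitely many $v$, and $\rho_v=\lambda_v+\Delta g_v$ with $g_v$ continuous for every $v$. For a finite nonempty set $F$, $[F]=|F|^{-1}\sum_{\alpha\in F}[\alpha]$, where $[\alpha]$ is the Dirac mass. A $\mathrm{Gal}(\overline K/K)$-invariant finite $F\subset\mathbb P^1(\overline K)$ is viewed in $\mathbb P^1(\mathbb C_v)$ through any $K$-embedding $\overline K\to\mathbb C_v$. For such $F$, $h_\rho(F)=\frac12\sum_{v\in M_K}(\!([F]-\rho_v,[F]-\rho_v)\!)_v$ (only finitely many terms are nonzero), and for $\alpha\in\mathbb P^1(\overline K)$, $h_\rho(\alpha)=h_\rho(F)$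 with $F$ the Galois orbit of $\alpha$ over $K$. The naive height is $h_{\rm nv}(\alpha)=|F|^{-1}\sum_{\beta\in F}\sum_{v\in M_K}\log^+\|\beta\|_v$ with $F$ the Galois orbit of $\alpha\in\overline K$, and $h_{\rm nv}(\infty)=0$. *)

(* Defs.v *)
From HB Require Import structures.
From mathcomp Require Import all_boot all_order all_algebra all_field.
From mathcomp Require Import finmap.
From mathcomp Require Import complex.
From mathcomp Require Import all_classical all_reals all_analysis.
From mathcomp Require Import measurable_realfun.

Set Implicit Arguments.
Unset Strict Implicit.
Unset Printing Implicit Defensive.

Import Order.TTheory GRing.Theory Num.Theory.
Import numFieldNormedType.Exports.

Local Open Scope classical_set_scope.
Local Open Scope ring_scope.
Local Open Scope complex_scope.

Definition absolute_value (R : realType) (F : fieldType) (a : F -> R) : Prop :=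
  [/\ forall x, 0 <= a x,
      forall x, a x = 0 <-> x = 0,
      forall x y, a (x * y) = a x * a y
    & forall x y, a (x + y) <= a x + a y].

Record valField (R : realType) := ValField {
  vf_field :> fieldType;
  vabs : vf_field -> R;
  vabsP : absolute_value vabs }.

Section ValuedFields.
Variables (R : realType) (L : valField R).

Definition vclosure (A : set L) : set L :=
  [set x | forall e : R, 0 < e -> exists2 a, A a & vabs (x - a) < e].

Definition vcomplete : Prop :=
  forall u : nat -> L,
    (forall e : R, 0 < e ->
      exists N, forall m n, (N <= m)%N -> (N <= n)%N -> vabs (u m - u n) < e) ->
    exists l, forall e : R, 0 < e ->
      exists N, forall n, (N <= n)%N -> vabs (u n - l) < e.

Definition coefs_in (E : set L) (P : {poly L}) : Prop := forall i, E P`_i.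

Definition subfield_of (E : set L) : Prop :=
  E 1 /\ forall x y, E x -> E y -> E (x - y) /\ E (x / y).

Definition algebraic_closure_of (E W : set L) : Prop :=
  [/\ E `<=` W,
      subfield_of W,
      forall x, W x -> exists P : {poly L}, [/\ P != 0, coefs_in E P & root P x]
    & forall P : {poly L}, coefs_in W P -> (1 < size P)%N ->
        exists2 x, W x & root P x].

Definition is_basis (E0 E : set L) (n : nat) (e : 'I_n -> L) : Prop :=
  (forall i, E (e i)) /\
  (forall x, E x -> exists! c : {ffun 'I_n -> L},
     (forall i, E0 (c i)) /\ x = \sum_(i < n) c i * e i).

(* [E : E0] when finite; get picks the unique n *)
Definition degree_over (E0 E : set L) : nat :=
  get [set n | exists e : 'I_n -> L, is_basis E0 E e].

End ValuedFields.

Section ComplexField.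
Variable R : realType.

Let complex_abs (z : R[i]) : R := Normc.normc z.

Lemma complex_absP : absolute_value complex_abs.
Proof.
split.
- by case=> a b; rewrite /complex_abs /=; exact: sqrtr_ge0.
- move=> x; split; first exact: Normc.eq0_normc.
  by move=> ->; exact: Normc.normc0.
- exact: Normc.normcM.
- exact: le_normcD.
Qed.

Definition complexV : valField R := ValField complex_absP.

End ComplexField.

Definition padic_abs (R : realType) (p : nat) (q : rat) : R :=
  if q == 0 then 0
  else (p%:R ^+ logn p `|denq q|%N) / (p%:R ^+ logn p `|numq q|%N).

Record infinite_place (R : realType) (K : fieldExtType rat) := InfinitePlace {
  inf_abs :> K -> R;
  inf_absP : absolute_value inf_abs;
  inf_abs_rat : forall q : rat, inf_abs (ratr q) = `|ratr q| }.

Record finite_place (R : realType) (K : fieldExtType rat) := FinitePlace {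
  fin_abs :> K -> R;
  fin_absP : absolute_value fin_abs;
  fin_abs_rat : exists2 p : nat, prime p &
    forall q : rat, fin_abs (ratr q) = padic_abs R p q }.

HB.instance Definition _ (R : realType) (K : fieldExtType rat) :=
  gen_eqMixin (infinite_place R K).
HB.instance Definition _ (R : realType) (K : fieldExtType rat) :=
  gen_choiceMixin (infinite_place R K).
HB.instance Definition _ (R : realType) (K : fieldExtType rat) :=
  gen_eqMixin (finite_place R K).
HB.instance Definition _ (R : realType) (K : fieldExtType rat) :=
  gen_choiceMixin (finite_place R K).

Section LocalFields.
Variables (R : realType) (K : fieldExtType rat).

(* K_v is realized as the closure of K in the complete field L, and Q_v as the
   closure of Q. *)
Definition local_field (L : valField R) (s : K -> L) : set L :=
  vclosure (range s).

Definition rat_closure (L : valField R) : set L :=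
  vclosure (range (fun q : rat => ratr q : L)).
Arguments rat_closure : clear implicits.

(* L, with the embedding s : K -> L, is the completion of an algebraic closure
   of the completion of K at the absolute value v. *)
Definition is_Cv (v : K -> R) (L : valField R) (s : K -> L) : Prop :=
  [/\ forall x, vabs (s x) = v x,
      vcomplete L
    & exists W : set L,
        algebraic_closure_of (local_field s) W /\ vclosure W = setT].

Definition Nv (L : valField R) (s : K -> L) : R :=
  (degree_over (rat_closure L) (local_field s))%:R / (\dim {: K})%:R.

(* For v infinite, K_v is R or C, so that C_v is taken to be C; its absolute
   value is the usual one. *)
Record inf_completion (v : infinite_place R K) := InfCompletion {
  inf_emb : {rmorphism K -> R[i]};
  inf_embP : is_Cv v (L := complexV R) inf_emb }.

Record fin_completion (v : finite_place R K) := FinCompletion {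
  fin_C :> valField R;
  fin_emb : {rmorphism K -> fin_C};
  fin_embP : is_Cv v fin_emb }.

Record completions := Completions {
  Cinf : forall v : infinite_place R K, inf_completion v;
  Cfin : forall v : finite_place R K, fin_completion v }.

End LocalFields.

Definition borel (X : ptopologicalType) := g_sigma_algebraType (@open X).
HB.instance Definition _ (X : ptopologicalType) :=
  Measurable.copy (borel X) (g_sigma_algebraType (@open X)).

Section SignedMeasures.
Context d (T : measurableType d) (R : realType).

(* A finite signed measure is presented as a difference spos - sneg of finite
   measures. The two parts need not be mutually singular: integrals below do
   not depend on the presentation as soon as they converge. *)
Record signed_measure := SignedMeasure {
  spos : {finite_measure set T -> \bar R};
  sneg : {finite_measure set T -> \bar R} }.

Definition signed_integral (mu : signed_measure) (f : T -> R) : R :=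
  \int[spos mu]_x f x - \int[sneg mu]_x f x.

(* minus the integral of k over D against the product mu (x) nu *)
Definition energy (D : set (T * T)) (k : T * T -> R) (mu nu : signed_measure) :=
  - ((\int[(spos mu \x spos nu)%E]_(p in D) k p
      + \int[(sneg mu \x sneg nu)%E]_(p in D) k p)
     - (\int[(spos mu \x sneg nu)%E]_(p in D) k p
        + \int[(sneg mu \x spos nu)%E]_(p in D) k p)).

Definition empirical (s : seq T) : set T -> \bar R :=
  mscale ((size s)%:R^-1)%:nng (msum (fun n => dirac (nth point s n)) (size s)).

HB.instance Definition _ s := Measure.on (empirical s).

Let empirical_fin s : fin_num_fun (empirical s).
Proof.
move=> A mA; rewrite /empirical /mscale /= fin_numM//.
by rewrite /msum; apply/sum_fin_numP => i _ _; exact: fin_num_measure.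
Qed.

HB.instance Definition _ s := @Measure_isFinite.Build _ T R (empirical s) (empirical_fin s).

End SignedMeasures.

Arguments empirical {d T} R s.

Section RiemannSphere.
Variable R : realType.

Definition riemann_sphere : Type := one_point_compactification (R[i])^o.

HB.instance Definition _ := PointedTopological.on riemann_sphere.

Definition circle_map (t : measurableTypeR R) : borel riemann_sphere :=
  Some (cos t +i* sin t).

Let circle_map_continuous : continuous (circle_map : R -> riemann_sphere).
Proof.
move=> t.
apply: (@continuous_comp R (R[i])^o riemann_sphere
  (fun t => cos t +i* sin t) Some); last first.
  exact: one_point_compactification_some_continuous.
apply/(@cvgrPdist_lt _ (R[i])^o) => e; case: e => e1 e2; rewrite ltcE /= => /andP[/eqP -> e0].
have e20 : 0 < e1 / 2 by rewrite divr_gt0.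
have /cvgrPdist_lt/(_ _ e20) hc := @continuous_cos R t.
have /cvgrPdist_lt/(_ _ e20) hs := @continuous_sin R t.
near=> x.
rewrite [ltLHS](_ : _ = (Normc.normc
  ((cos t - cos x) +i* 0 + 0 +i* (sin t - sin x)))%:C)%C; last first.
  by rewrite normc_def /= !addr0 add0r.
rewrite ltcE eqxx andTb.
apply: (@le_lt_trans _ _ (Normc.normc ((cos t - cos x) +i* 0)
  + Normc.normc (0 +i* (sin t - sin x)))); first exact: le_normcD.
rewrite /Normc.normc expr0n addr0 add0r !sqrtr_sqr [e1]splitr.
by apply: ltrD; near: x.
Unshelve. all: by end_near. Qed.

Let circle_map_measurable : measurable_fun setT circle_map.
Proof.
apply: measurability => //.
move=> _ [B oB <-]; rewrite setTI.
apply: open_measurable.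
by move/continuousP: circle_map_continuous; apply.
Qed.

HB.instance Definition _ :=
  isMeasurableFun.Build _ _ (measurableTypeR R) (borel riemann_sphere) circle_map
    circle_map_measurable.

Let two_pi_gt0 : 0 < 2 * pi :> R.
Proof. by rewrite mulr_gt0// pi_gt0. Qed.

(* the normalized Lebesgue measure on the unit circle *)
Definition circle_measure : set (borel riemann_sphere) -> \bar R :=
  distribution (uniform_prob two_pi_gt0) circle_map.
HB.instance Definition _ := Probability.on circle_measure.

(* d/dx for b = true, d/dy for b = false *)
Definition partial (b : bool) (f : R * R -> R) : R * R -> R :=
  fun p => 'D_(if b then (1, 0) else (0, 1) : R * R) f p.

Definition partials (s : seq bool) (f : R * R -> R) : R * R -> R :=
  foldr partial f s.

Definition smooth (f : R * R -> R) : Prop :=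
  forall s : seq bool, continuous (partials s f) /\
    forall (b : bool) p,
      derivable (partials s f) p (if b then (1, 0) else (0, 1) : R * R).

Definition laplace (f : R * R -> R) (p : R * R) : R :=
  partials [:: true; true] f p + partials [:: false; false] f p.

Definition chart0 (p : R * R) : riemann_sphere := Some (p.1 +i* p.2).

(* z |-> 1/z, sending 0 to infinity *)
Definition chartoo (p : R * R) : riemann_sphere :=
  if p == 0 then None else Some (p.1 +i* p.2)^-1.

Definition smooth_sphere (phi : riemann_sphere -> R) : Prop :=
  smooth (phi \o chart0) /\ smooth (phi \o chartoo).

(* dd^c g = mu as distributions on the sphere. For phi smooth, dd^c phi is a
   smooth 2-form, so that the point at infinity is negligible and <dd^c g, phi>
   is the integral of g dd^c phi over the affine chart. *)
Definition sphere_laplacian (g : riemann_sphere -> R)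
    (mu : signed_measure (borel riemann_sphere) R) : Prop :=
  forall phi : riemann_sphere -> R, smooth_sphere phi ->
    \int[(@lebesgue_measure R \x @lebesgue_measure R)%E]_p
      (g (chart0 p) * ((2 * pi)^-1 * laplace (phi \o chart0) p))
    = signed_integral mu phi.

Definition sphere_kernel (p : borel riemann_sphere * borel riemann_sphere) : R :=
  if p is (Some z, Some w) then ln (vabs (z - w : complexV R)) else 0.

Definition sphere_offdiag : set (borel riemann_sphere * borel riemann_sphere) :=
  [set p | exists z w : R[i], p = (Some z, Some w) /\ z <> w].

Definition sphere_energy (mu nu : signed_measure (borel riemann_sphere) R) : R :=
  energy sphere_offdiag sphere_kernel mu nu.

End RiemannSphere.

Arguments circle_measure : clear implicits.

Section Berkovich.
Variables (R : realType) (L : valField R).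

(* the multiplicative seminorms on L[T] extending the absolute value of L *)
Record berk_A1 := BerkA1 {
  snorm :> {poly L} -> R;
  snorm_ge0 : forall P, 0 <= snorm P;
  snormD : forall P Q, snorm (P + Q) <= snorm P + snorm Q;
  snormM : forall P Q, snorm (P * Q) = snorm P * snorm Q;
  snormC : forall c : L, snorm c%:P = vabs c }.

HB.instance Definition _ := gen_eqMixin berk_A1.
HB.instance Definition _ := gen_choiceMixin berk_A1.
(* the topology of A^1 is the coarsest one making all S |-> S(P) continuous *)
HB.instance Definition _ := Topological.copy berk_A1
  (initial_topology (fun S : berk_A1 => snorm S : {ptws {poly L} -> R})).

Lemma point_normD (z : L) (P Q : {poly L}) :
  vabs (P + Q).[z] <= vabs P.[z] + vabs Q.[z].
Proof. by rewrite hornerD; have [_ _ _] := vabsP L; apply. Qed.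

Lemma point_normM (z : L) (P Q : {poly L}) :
  vabs (P * Q).[z] = vabs P.[z] * vabs Q.[z].
Proof. by rewrite hornerM; have [_ _ + _] := vabsP L; apply. Qed.

Lemma point_normC (z c : L) : vabs (c%:P).[z] = vabs c.
Proof. by rewrite hornerC. Qed.

Definition berk_point (z : L) : berk_A1 :=
  @BerkA1 (fun P => vabs P.[z]) (fun P => let: And4 h _ _ _ := vabsP L in h _)
    (point_normD z) (point_normM z) (point_normC z).

HB.instance Definition _ := isPointed.Build berk_A1 (berk_point 0).

Definition berk_P1 : Type := one_point_compactification berk_A1.
HB.instance Definition _ := PointedTopological.on berk_P1.

Definition berk_H : set berk_A1 := [set S | forall z, S <> berk_point z].

Definition berk_le (S S' : berk_A1) : Prop := forall P, S P <= S' P.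

Definition berk_join (S S' : berk_A1) : berk_A1 :=
  get [set M | [/\ berk_le S M, berk_le S' M &
    forall N, berk_le S N -> berk_le S' N -> berk_le M N]].

Definition diam (S : berk_A1) : R :=
  inf [set S ('X - z%:P) | z in [set: L]].

Definition berk_sup (S S' : berk_A1) : R := diam (berk_join S S').

(* Characterized as the point whose seminorm is the sup norm on the closed unit
   ball: for general L the sup norm need not be multiplicative. *)
Definition berk_can : berk_A1 :=
  get [set S : berk_A1 | forall P : {poly L},
    S P = sup [set vabs P.[z] | z in [set z : L | vabs z <= 1]]].

Definition berk_dist (S S' : berk_A1) : R :=
  2 * ln (berk_sup S S') - ln (diam S) - ln (diam S').

(* the image of the unique injective path from x to y, a point if x = y *)
Definition berk_segment (x y : berk_P1) : set berk_P1 :=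
  [set z | (x = y /\ z = x) \/
    exists gamma : R -> berk_P1,
      [/\ {within `[0, 1], continuous gamma},
          {in `[0, 1] &, injective gamma},
          gamma 0 = x, gamma 1 = y & (gamma @` `[0, 1]) z]].

Definition berk_median (x y : berk_P1) : berk_P1 :=
  get (berk_segment x y `&` berk_segment x (Some berk_can)
       `&` berk_segment y (Some berk_can)).

Definition berk_pairing (x y : berk_P1) : \bar R :=
  if berk_median x y is Some s then
    if `[< berk_H s >] then (berk_dist s berk_can)%:E else +oo%E
  else +oo%E.

(* Delta g = mu, which only involves the values of g on H *)
Definition berk_laplacian (g : berk_P1 -> R)
    (mu : signed_measure (borel berk_P1) R) : Prop :=
  exists c : R, forall S, berk_H S ->
    ((g (Some S))%:E = c%:E -
      (\int[spos mu]_y berk_pairing (Some S) y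
       - \int[sneg mu]_y berk_pairing (Some S) y))%E.

Definition berk_kernel (p : borel berk_P1 * borel berk_P1) : R :=
  if p is (Some s, Some t) then ln (berk_sup s t) else 0.

Definition berk_offdiag : set (borel berk_P1 * borel berk_P1) :=
  [set p | exists S S' : berk_A1, p = (Some S, Some S') /\
     ~ exists z : L, S = berk_point z /\ S' = berk_point z].

Definition berk_energy (mu nu : signed_measure (borel berk_P1) R) : R :=
  energy berk_offdiag berk_kernel mu nu.

Definition gauss_measure : set (borel berk_P1) -> \bar R :=
  dirac (Some berk_can : borel berk_P1).
HB.instance Definition _ := Probability.on gauss_measure.

End Berkovich.

Arguments gauss_measure {R} L _.

Section AdelicMeasures.
Variables (R : realType) (K : fieldExtType rat) (C : completions R K).

Record adelic_measure := AdelicMeasure {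
  rho_inf : forall v : infinite_place R K,
    probability (borel (riemann_sphere R)) R;
  rho_fin : forall v : finite_place R K,
    probability (borel (berk_P1 (Cfin C v))) R;
  rho_inf_cofinite : finite_set [set v |
    ~ forall A, measurable A -> rho_inf v A = circle_measure R A];
  rho_fin_cofinite : finite_set [set v |
    ~ forall A, measurable A -> rho_fin v A = gauss_measure (Cfin C v) A];
  rho_inf_potential : forall v, exists2 g : riemann_sphere R -> R,
    continuous g &
    sphere_laplacian g (SignedMeasure (rho_inf v) (circle_measure R));
  rho_fin_potential : forall v, exists2 g : berk_P1 (Cfin C v) -> R,
    continuous g &
    berk_laplacian g (SignedMeasure (rho_fin v) (gauss_measure (Cfin C v))) }.

End AdelicMeasures.

Section Heights.
Variables (R : realType) (K : fieldExtType rat) (C : completions R K).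
Variables (Kbar : closedFieldType) (iota : {rmorphism K -> Kbar}).

(* a choice, for every place v, of a K-embedding of Kbar into C_v *)
Record embeddings := Embeddings {
  tau_inf : forall v : infinite_place R K, {rmorphism Kbar -> R[i]};
  tau_fin : forall v : finite_place R K, {rmorphism Kbar -> Cfin C v};
  tau_infK : forall v x, tau_inf v (iota x) = inf_emb (Cinf C v) x;
  tau_finK : forall v x, tau_fin v (iota x) = fin_emb (Cfin C v) x }.

Definition galois_group : set {rmorphism Kbar -> Kbar} :=
  [set f : {rmorphism Kbar -> Kbar} | bijective f /\ forall x, f (iota x) = iota x].

(* P^1(Kbar) is represented by option Kbar, with None for infinity. *)
Definition galois_orbit (alpha : option Kbar) : {fset option Kbar} :=
  fset_set [set omap f alpha | f in galois_group].

Variable tau : embeddings.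

Definition inf_point (v : infinite_place R K) (a : option Kbar)
    : borel (riemann_sphere R) :=
  omap (tau_inf tau v) a.

Definition fin_point (v : finite_place R K) (a : option Kbar)
    : borel (berk_P1 (Cfin C v)) :=
  omap (fun z => berk_point (tau_fin tau v z)) a.

Definition N_inf (v : infinite_place R K) : R :=
  Nv (L := complexV R) (inf_emb (Cinf C v)).

Definition N_fin (v : finite_place R K) : R := Nv (fin_emb (Cfin C v)).

Definition height_set (rho : adelic_measure C) (F : {fset option Kbar}) : R :=
  let mu_inf v := SignedMeasure
    (empirical R [seq inf_point v a | a <- F]) (rho_inf rho v) in
  let mu_fin v := SignedMeasure
    (empirical R [seq fin_point v a | a <- F]) (rho_fin rho v) in
  2^-1 *
   (\sum_(v \in [set: infinite_place R K])
      (N_inf v * sphere_energy (mu_inf v) (mu_inf v))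
    + \sum_(v \in [set: finite_place R K])
      (N_fin v * berk_energy (mu_fin v) (mu_fin v))).

Definition height (rho : adelic_measure C) (alpha : option Kbar) : R :=
  height_set rho (galois_orbit alpha).

Definition log_plus (x : R) : R := ln (Num.max 1 x).

Definition naive_height (alpha : option Kbar) : R :=
  let F := galois_orbit alpha in
  if alpha is None then 0 else
  (#|` F|%:R)^-1 * \sum_(b <- F)
    (if b is Some z then
      \sum_(v \in [set: infinite_place R K])
        log_plus (vabs (tau_inf tau v z : complexV R) `^ N_inf v)
      + \sum_(v \in [set: finite_place R K])
        log_plus (vabs (tau_fin tau v z) `^ N_fin v)
     else 0).

End Heights.

(* Main.v *)
Require Import Defs.
From HB Require Import structures.
From mathcomp Require Import all_boot all_order all_algebra all_field.
From mathcomp Require Import finmap.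
From mathcomp Require Import complex.
From mathcomp Require Import all_classical all_reals all_analysis.
From mathcomp Require Import measurable_realfun.
From mathcomp Require Import ring lra zify.

Set Implicit Arguments.
Unset Strict Implicit.
Unset Printing Implicit Defensive.

Import Order.TTheory GRing.Theory Num.Theory.
Import numFieldNormedType.Exports.

Local Open Scope classical_set_scope.
Local Open Scope ring_scope.

(* Write F for a Galois orbit with n elements. At every place, expanding the
   energy gives
     (([F] - rho_v, [F] - rho_v)) = E_v(oo) + (2/n) sum_F p_v - n^-2 sum_{x <> y in F} log |x - y|_v
   up to the weight N_v, where E_v(oo) is the energy of the point at infinity and
   the potential p_v differs from log^+ |.|_v by a bounded function because g_v is
   continuous. By the product formula the discriminant terms add up to 0 over all
   places, so that h_rho - h_nv is bounded.
   For the essential minimum, the logarithmic kernel is approximated by regular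
   kernels which are conditionally of negative type: (1/2) log (|z - w|^2 + e^2)
   suitably normalized on the sphere, and the logarithm of an ultrametric
   truncated below at e on the Berkovich line. Hence the energy of [F] - rho_v at
   the places where rho_v is not the standard measure is at least -delta as soon as
   n is large, while it is nonnegative at the other places. The points of small
   height thus have bounded degree and bounded naive height, and Northcott's
   theorem applies. *)

(** * Absolute values *)

(** Places are given only as absolute values and completions only as fields satisfying a predicate,
    so the link between local degrees and embeddings, on which the product formula rests, is built
    from [K] alone: the local degree is the largest size of a family satisfying a quantitative
    independence inequality. On the analytic side, the equation for g_v says nothing directly about
    the potential of rho_v at a classical point, and does not visibly exclude mass at infinity.
    Regular objects are therefore tested first (logarithms of |z - w|^2 + e^2 on the sphere, points
    of H on the Berkovich line); decreasing limits whose integrals stay bounded below then yield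
    integrability, the absence of mass at infinity and the potential itself. For the lower bound,
    negative type is an inequality between finite sums; it is transferred to rho_v by integrating
    over m sample points of mass 1/m. The diagonal, absent from the energy, costs n terms of size
    |log e| out of n^2: this is why n must be large, and why orbits of bounded size are left to
    Northcott's theorem. *)

Lemma expr_le_affine (R : realType) (r C : R) : 0 <= r ->
  (forall n, r ^+ n <= C * n.+1%:R) -> r <= 1.
Proof.
move=> r0 H; rewrite leNgt; apply/negP => r1.
pose t := r - 1; have t0 : 0 < t by rewrite subr_gt0.
have C1 : 1 <= C by have := H 0%N; rewrite expr0 mulr1.
have bern n : 1 + n%:R * t <= r ^+ n.
  elim: n => [|n IH]; first by rewrite mul0r addr0 expr0.
  have h : t <= t * r ^+ n by rewrite ler_peMr ?(ltW t0)// exprn_ege1// ltW.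
  have -> : r ^+ n.+1 = r ^+ n + t * r ^+ n by rewrite exprS /t; ring.
  by rewrite -natr1; lra.
(* For this [n] one has n^2 t^2 > 3 C n, whereas squaring Bernoulli's inequality gives n^2 t^2 <=
   r^(2n) <= C (2n + 1) <= 3 C n. *)
pose n := (Num.trunc (3 * C / t ^+ 2)).+1.
have n0 : 0 < n%:R :> R by rewrite ltr0n.
have nC : 3 * C < n%:R * t ^+ 2.
  rewrite -ltr_pdivrMr ?exprn_gt0//.
  by have /andP[] := trunc_itv (divr_ge0 (mulr_ge0 (ler0n _ 3) (le_trans ler01 C1)) (exprn_ge0 2 (ltW t0))).
have h1 := bern n; have h2 := H (n * 2)%N.
have h3 : (1 + n%:R * t) ^+ 2 <= r ^+ (n * 2) by rewrite exprM lerXn2r ?nnegrE// ?exprn_ge0// addr_ge0// mulr_ge0 ?ltW.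
have h4 : (n * 2).+1%:R <= 3 * n%:R :> R by rewrite -natrM ler_nat; lia.
have h5 : n%:R ^+ 2 * t ^+ 2 <= 3 * C * n%:R.
  rewrite -exprMn; apply: le_trans (_ : (1 + n%:R * t) ^+ 2 <= _).
    have nt : 0 <= n%:R * t by rewrite mulr_ge0// ltW.
    by rewrite lerXn2r ?nnegrE ?addr_ge0// lerDr.
  apply: (le_trans h3); apply: (le_trans h2); rewrite (mulrC 3) -mulrA ler_wpM2l//; lra.
move: h5; rewrite expr2 -mulrA (mulrC (3 * C)) ler_pM2l//; lra.
Qed.

(** In the binomial expansion of (x + y)^n the coefficients have size at most 1, so N (x + y)^n <=
    (n + 1) m^n with m the maximum; the factor n + 1 disappears on taking n-th roots. A commutative
    ring suffices, which covers seminorms on polynomials. *)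
Lemma ultrametric_of_natr_le1 (R : realType) (A : comNzRingType) (N : A -> R) :
  (forall x, 0 <= N x) -> N 0 = 0 -> N 1 = 1 ->
  (forall x y, N (x * y) = N x * N y) ->
  (forall x y, N (x + y) <= N x + N y) ->
  (forall n, N n%:R <= 1) ->
  forall x y, N (x + y) <= Num.max (N x) (N y).
Proof.
move=> N0 N00 N1 NM ND Nn x y; set m := Num.max _ _.
have NX z n : N (z ^+ n) = N z ^+ n.
  by elim: n => [|n IH]; rewrite ?expr0// !exprS NM IH.
have Nsum I (s : seq I) (F : I -> A) : N (\sum_(i <- s) F i) <= \sum_(i <- s) N (F i).
  elim: s => [|i s IH]; last by rewrite !big_cons (le_trans (ND _ _))// lerD2l.
  by rewrite !big_nil N00.
have m0 : 0 <= m by rewrite le_max N0.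
have bound n : N (x + y) ^+ n <= n.+1%:R * m ^+ n.
  rewrite -NX exprDn; apply: le_trans (Nsum _ _ _) _.
  have -> : n.+1%:R * m ^+ n = \sum_(i < n.+1) m ^+ n by rewrite sumr_const card_ord mulr_natl.
  apply: ler_sum => i _; rewrite -mulr_natr !NM !NX.
  rewrite -[leRHS]mulr1 ler_pM// ?mulr_ge0 ?exprn_ge0//.
  rewrite -[X in m ^+ X](subnK (leq_ord i)) exprD ler_pM// ?exprn_ge0//.
    by rewrite lerXn2r ?nnegrE// le_max lexx.
  by rewrite lerXn2r ?nnegrE// le_max lexx orbT.
have [m_gt0|] := ltP 0 m; last first.
  by move=> mle; have := bound 1%N; rewrite !expr1; have := N0 (x + y); nra.
rewrite -[leRHS]mul1r -ler_pdivrMr//.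
apply: (@expr_le_affine _ _ 1); first by rewrite divr_ge0.
by move=> n; rewrite mul1r expr_div_n ler_pdivrMr ?exprn_gt0.
Qed.

Section AbsoluteValue.
Variables (R : realType) (F : fieldType) (a : F -> R).
Hypothesis aP : absolute_value a.

Lemma av_ge0 x : 0 <= a x. Proof. by case: aP. Qed.
Lemma av_eq0 x : (a x == 0) = (x == 0).
Proof. by case: aP => _ h _ _; apply/eqP/eqP => /h. Qed.
Lemma av0 : a 0 = 0. Proof. by apply/eqP; rewrite av_eq0. Qed.
Lemma av_gt0 x : (0 < a x) = (x != 0).
Proof. by rewrite lt_neqAle av_ge0 andbT eq_sym av_eq0. Qed.
Lemma avM x y : a (x * y) = a x * a y. Proof. by case: aP. Qed.
Lemma avD x y : a (x + y) <= a x + a y. Proof. by case: aP. Qed.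
Lemma av1 : a 1 = 1.
Proof.
by apply: (@mulfI _ (a 1)); rewrite ?av_eq0 ?oner_eq0// -avM !mulr1.
Qed.
Lemma avN x : a (- x) = a x.
Proof.
apply/eqP; rewrite -(@eqrXn2 _ 2) ?av_ge0//; apply/eqP.
by rewrite !expr2 -!avM mulrNN.
Qed.
Lemma avV x : a x^-1 = (a x)^-1.
Proof.
have [->|x0] := eqVneq x 0; first by rewrite invr0 av0 invr0.
by apply: (@mulfI _ (a x)); rewrite ?av_eq0// -avM !divff ?av_eq0// av1.
Qed.
Lemma avX x n : a (x ^+ n) = a x ^+ n.
Proof. by elim: n => [|n IH]; rewrite ?expr0 ?av1// !exprS avM IH. Qed.
Lemma avB x y : a (x - y) <= a x + a y.
Proof. by rewrite -(avN y) avD. Qed.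
Lemma av_distC x y : a (x - y) = a (y - x).
Proof. by rewrite -avN opprB. Qed.
Lemma av_sum I (s : seq I) (P : pred I) (f : I -> F) :
  a (\sum_(i <- s | P i) f i) <= \sum_(i <- s | P i) a (f i).
Proof.
elim/big_ind2: _ => [|x u y w xu yw|//]; first by rewrite av0.
by rewrite (le_trans (avD _ _))// lerD.
Qed.
Lemma av_prod I (s : seq I) (P : pred I) (f : I -> F) :
  a (\prod_(i <- s | P i) f i) = \prod_(i <- s | P i) a (f i).
Proof. by elim/big_rec2: _ => [|i x y _ <-]; rewrite ?av1 ?avM. Qed.
Lemma av_lerB x y : a x - a y <= a (x - y).
Proof. by rewrite lerBlDr -{1}(subrK y x) avD. Qed.

End AbsoluteValue.

(** * Extending the p-adic absolute value to K by a maximal subring *)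

Section MaximalSubring.
Variables (K : fieldType) (p : nat).
Hypothesis pr : prime p.
Hypothesis char0 : forall n : nat, (n%:R == 0 :> K) = (n == 0%N).

Definition ring_part (V : set K) : Prop :=
  [/\ V 1, forall x y, V x -> V y -> V (x - y) & forall x y, V x -> V y -> V (x * y)].

(** This is Chevalley's construction: a subring maximal among those missing 1/p turns out to be a
    valuation ring in which p is not invertible. *)
Lemma maximal_subring_without_invp : exists V : set K,
  [/\ ring_part V, ~ V p%:R^-1 &
    forall W, ring_part W -> V `<=` W -> ~ W p%:R^-1 -> W `<=` V].
Proof.
pose P (V : set K) := V = set0 \/ (ring_part V /\ ~ V p%:R^-1).
have [F FP Ftot|V [PV Vmax]] := @Zorn_bigcup K P.
  have [F0|/existsNP[V0 /not_implyP[FV0 V0n]]] := pselect (forall V, F V -> V = set0).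
    by left; apply/seteqP; split => // x [V /F0 -> ].
  have FP' V x : F V -> V x -> ring_part V /\ ~ V p%:R^-1.
    by move=> /FP[->|//].
  have join V W x y : F V -> F W -> V x -> W y -> exists2 U, F U & U x /\ U y.
    move=> FV FW Vx Wy; have [VW|WV] := Ftot _ _ FV FW.
      by exists W => //; split => //; exact: VW.
    by exists V => //; split => //; exact: WV.
  right; split; [split|].
  - exists V0 => //; have [x V0x] : exists x, V0 x by apply/set0P/eqP.
    by have [[]] := FP' _ _ FV0 V0x.
  - move=> x y [V FV Vx] [W FW Wy]; have [U FU [Ux Uy]] := join _ _ _ _ FV FW Vx Wy.
    by exists U => //; have [[_ h _] _] := FP' _ _ FU Ux; exact: h.
  - move=> x y [V FV Vx] [W FW Wy]; have [U FU [Ux Uy]] := join _ _ _ _ FV FW Vx Wy.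
    by exists U => //; have [[_ _ h] _] := FP' _ _ FU Ux; exact: h.
  - by move=> [V FV Vp]; have [] := FP' _ _ FV Vp.
have ZP : ring_part (range (fun n : int => n%:~R : K)).
  split; first by exists 1.
    by move=> _ _ [m _ <-] [n _ <-]; exists (m - n) => //; rewrite rmorphB.
  by move=> _ _ [m _ <-] [n _ <-]; exists (m * n) => //; rewrite rmorphM.
have p0 : p%:R != 0 :> K by rewrite char0 -lt0n prime_gt0.
have intr0 (n : int) : (n%:~R == 0 :> K) = (n == 0).
  by case: n => n; [exact: char0|rewrite NegzE rmorphN !oppr_eq0; exact: char0].
have Zp : ~ range (fun n : int => n%:~R : K) p%:R^-1.
  move=> [n _ np]; have /eqP : (n * p%:Z - 1)%:~R = 0 :> K.
    by rewrite rmorphB rmorphM /= np mulVf// subrr.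
  rewrite intr0 subr_eq0 => /eqP/(congr1 absz); rewrite abszM !absz_nat => /eqP.
  by rewrite muln_eq1 => /andP[_ /eqP p1]; move: pr; rewrite p1.
have V0 : V !=set0.
  apply/set0P/negP => /eqP V0; apply: (Vmax (range (fun n : int => n%:~R : K))).
    by rewrite V0; split => // h; have := h 1; apply; exists 1.
  by right.
case: PV => [V00|[rV Vp]]; first by move: V0; rewrite V00 => -[].
exists V; split => // W rW VW Wp; apply: contrapT => WV.
by apply: (Vmax W); [split => // | right].
Qed.

Variable V : set K.
Hypothesis rV : ring_part V.
Hypothesis Vp : ~ V p%:R^-1.
Hypothesis Vmax : forall W, ring_part W -> V `<=` W -> ~ W p%:R^-1 -> W `<=` V.
Hypothesis alg : forall z : K, exists2 P : {poly int}, P != 0 & root (map_poly intr P) z.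

Let V1 : V 1. Proof. by case: rV. Qed.
Let VB x y : V x -> V y -> V (x - y). Proof. by case: rV => _ + _; apply. Qed.
Let VM x y : V x -> V y -> V (x * y). Proof. by case: rV => _ _; apply. Qed.
Let V0 : V 0. Proof. by rewrite -(subrr 1); exact: VB. Qed.
Let VN x : V x -> V (- x). Proof. by rewrite -sub0r; exact: VB. Qed.
Let VD x y : V x -> V y -> V (x + y).
Proof. by move=> Vx Vy; rewrite -(opprK y); apply: VB => //; exact: VN. Qed.
Let VX x n : V x -> V (x ^+ n).
Proof. by move=> Vx; elim: n => [|n IH]; rewrite ?expr0// exprS; exact: VM. Qed.
Let Vn n : V n%:R.
Proof. by elim: n => [//|n IH]; rewrite -natr1; exact: VD. Qed.
Let Vsum I (s : seq I) (f : I -> K) : (forall i, V (f i)) -> V (\sum_(i <- s) f i).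
Proof. by move=> h; elim/big_ind: _ => //; exact: VD. Qed.
Let p0 : p%:R != 0 :> K. Proof. by rewrite char0 -lt0n prime_gt0. Qed.

Let gen (x : K) : set K := [set y | exists2 P : {poly K}, (forall i, V P`_i) & y = P.[x]].

(** For x outside V the ring V[x] is strictly larger than V, hence by maximality contains 1/p. *)
Let genP x : ~ V x -> gen x p%:R^-1.
Proof.
move=> Vx; apply: contrapT => gp; apply: Vx.
apply: (Vmax (W := gen x)) => //.
- split.
  + by exists 1; rewrite ?hornerC// => i; rewrite coef1; case: (i == 0%N).
  + move=> _ _ [P VP ->] [Q VQ ->]; exists (P - Q); last by rewrite hornerD hornerN.
    by move=> i; rewrite coefB; exact: VB.
  + move=> _ _ [P VP ->] [Q VQ ->]; exists (P * Q); last by rewrite hornerM.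
    by move=> i; rewrite coefM; apply: Vsum => j; exact: VM.
- by move=> y Vy; exists y%:P; rewrite ?hornerC// => i; rewrite coefC; case: (i == 0%N).
- by exists 'X; rewrite ?hornerX// => i; rewrite coefX; case: (i == 1%N).
Qed.

Let expr_sub (u : K) (m i : nat) : u != 0 -> (i <= m)%N -> u ^+ m * u^-1 ^+ i = u ^+ (m - i).
Proof. by move=> u0 im; rewrite -{1}(subnK im) exprD exprVn mulfK ?expf_neq0. Qed.

(** If u = 1 - pb had no inverse in V, then 1/p would be a polynomial in 1/u over V; multiplying by
    a power of u puts u^m / p in V. But u^m is again 1 modulo pV, so 1/p itself would be in V. *)
Let unit1 b : V b -> V (1 - p%:R * b)^-1.
Proof.
move=> Vb; apply: contrapT => /genP[P VP PE]; pose u := 1 - p%:R * b.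
have u0 : u != 0.
  apply/eqP => u0; apply: Vp; suff -> : p%:R^-1 = b by [].
  by apply: (mulfI p0); rewrite divff//; apply/eqP; rewrite -subr_eq0 -/u u0.
have uX n : exists2 b', V b' & u ^+ n = 1 - p%:R * b'.
  elim: n => [|n [b' Vb' IH]]; first by exists 0; rewrite ?expr0 ?mulr0 ?subr0.
  exists (b + b' - p%:R * b * b'); last by rewrite exprS IH /u; ring.
  by apply: VB; [exact: VD | do 2 apply: VM => //; exact: Vn].
have [b' Vb' bE] := uX (size P).
apply: Vp; rewrite -(subrK b' p%:R^-1); apply: VD => //.
have -> : p%:R^-1 - b' = u ^+ size P * p%:R^-1 by rewrite bE mulrBl mul1r mulrAC divff// mul1r.
rewrite PE horner_coef mulr_sumr; apply: Vsum => i; rewrite mulrCA; apply: VM => //.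
rewrite -/u expr_sub ?(ltnW (ltn_ord i))//; apply: VX.
by apply: VB => //; apply: VM => //; exact: Vn.
Qed.

(** If neither x nor 1/x is in V, then 1/p is a polynomial in x and also a polynomial in 1/x. Each
    of the two relations allows the degree of the longer one to be lowered, which cannot go on
    forever; the induction is on the sum of the sizes. *)
Let valuation x : V x \/ V x^-1.
Proof.
have main n : forall x (P Q : {poly K}), (size P + size Q <= n)%N ->
    (forall i, V P`_i) -> (forall i, V Q`_i) -> p%:R^-1 = P.[x] -> p%:R^-1 = Q.[x^-1] ->
    x != 0 -> False.
  elim: n => [|n IH] {}x P Q.
    rewrite leqn0 addn_eq0 !size_poly_eq0 => /andP[/eqP -> _] _ _ /eqP.
    by rewrite horner0 invr_eq0 (negbTE p0).
  move=> PQn VP VQ PE QE x0.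
  wlog QP : x P Q PQn VP VQ PE QE x0 / (size Q <= size P)%N.
    move=> W; have [QP|/ltnW QP] := leqP (size Q) (size P); first exact: (W x P Q).
    by apply: (W x^-1 Q P) => //; rewrite ?invrK ?invr_eq0// addnC.
  have P_gt0 : (0 < size P)%N.
    rewrite lt0n size_poly_eq0; apply/eqP => P0; move: PE; rewrite P0 horner0 => /eqP.
    by rewrite invr_eq0 (negbTE p0).
  pose m := (size P).-1; have mP : size P = m.+1 by rewrite prednK.
  pose T := \sum_(i < m) Q`_(m - i) * x ^+ i.
  (* The relation for 1/x, multiplied by p x^m, expresses x^m times the unit 1 - p Q_0 through lower
     powers of x; this is substituted for the leading term of P. *)
  have xT : x ^+ m * (1 - p%:R * Q`_0) = p%:R * T.
    have : x ^+ m * p%:R^-1 = T + Q`_0 * x ^+ m.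
      rewrite QE (@horner_coef_wide _ m.+1); last by rewrite -mP.
      rewrite mulr_sumr.
      rewrite (reindex_inj rev_ord_inj) /= big_ord_recr /= subnn mulr1 mulrC; congr (_ + _).
      apply: eq_bigr => i _; rewrite subSS mulrCA; congr (_ * _).
      by rewrite expr_sub ?leq_subr// subKn// ltnW.
    move=> /(congr1 (fun y => p%:R * y)); rewrite mulrCA divff// mulr1 => E.
    by rewrite mulrBr mulr1 {1}E; ring.
  pose u := (1 - p%:R * Q`_0)^-1.
  have u0 : 1 - p%:R * Q`_0 != 0.
    apply/eqP => u0; apply: Vp; suff -> : p%:R^-1 = Q`_0 by [].
    by apply: (mulfI p0); rewrite divff//; apply/eqP; rewrite -subr_eq0 u0.
  have xm : x ^+ m = p%:R * u * T.
    by rewrite mulrAC -xT mulfK.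
  pose c := P`_m * (p%:R * u).
  apply: (IH x (\poly_(i < m) (P`_i + c * Q`_(m - i))) Q) => //.
  - by rewrite -ltnS; apply: leq_trans PQn; rewrite mP addSn ltnS leq_add2r size_poly.
  - move=> i; rewrite coef_poly; case: ifP => // _; apply: VD => //; apply: VM => //.
    by apply: VM => //; apply: VM; [exact: Vn | exact: unit1].
  - rewrite horner_poly PE (@horner_coef_wide _ m.+1) ?mP// big_ord_recr /= xm.
    under [RHS]eq_bigr do rewrite mulrDl.
    rewrite big_split /=; congr (_ + _); rewrite /T mulrA mulr_sumr.
    by apply: eq_bigr => i _; rewrite /c !mulrA.
have [Vx|Vx] := pselect (V x); [by left|right; apply: contrapT => Vx'].
have [P VP PE] := genP Vx; have [Q VQ QE] := genP Vx'.
apply: (main _ x P Q (leqnn _)) => //.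
by apply/eqP => x0; apply: Vx; rewrite x0.
Qed.

Let Vroot y b : (0 < b)%N -> V (y ^+ b) -> V y.
Proof.
case: b => // b _ Vyb; have [//|Vy] := valuation y.
have [->//|y0] := eqVneq y 0.
have -> : y = y ^+ b.+1 * y^-1 ^+ b by rewrite exprS exprVn mulfK ?expf_neq0.
by apply: VM => //; exact: VX.
Qed.

Let VXp (k : nat) : (0 < k)%N -> ~ V (p%:R ^- k).
Proof. by move=> k0; rewrite -exprVn => /(Vroot k0). Qed.

Let Vint (n : int) : V n%:~R.
Proof. by case: n => n; [exact: Vn | rewrite NegzE rmorphN; apply: VN; exact: Vn]. Qed.

Let inv_coprime n : ~~ (p %| n)%N -> V n%:R^-1.
Proof.
move=> pn; have n0 : (0 < n)%N by rewrite lt0n; apply: contraNneq pn => ->.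
have /coprimeP-/(_ n0)[[a b] /= ab] : coprime n p by rewrite coprime_sym prime_coprime.
have abE : (a * n = b * p + 1)%N by lia.
have abK : a%:R * n%:R = 1 - p%:R * - b%:R :> K.
  by rewrite -natrM abE natrD natrM mulrN opprK addrC mulrC.
have -> : n%:R^-1 = a%:R * (1 - p%:R * - b%:R)^-1 :> K.
  rewrite -abK invfM mulrA divff ?mul1r// char0.
  by apply: contra_eq_neq abE => ->; rewrite mul0n addn1.
by apply: VM; [exact: Vn | apply: unit1; apply: VN; exact: Vn].
Qed.

(* The powers of [p] dominate every element, because a nonzero integer in all [p^c V] cannot exist. *)
Let archimedean x : exists c : nat, V (x * p%:R ^+ c).
Proof.
have [->|x0] := eqVneq x 0; first by exists 0%N; rewrite mul0r.
apply: contrapT => /forallNP h.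
have zV c : V (x^-1 * p%:R ^- c).
  by have := valuation (x * p%:R ^+ c); rewrite invfM => -[/h|].
have [P P00 Pz] : exists2 P : {poly int}, P`_0 != 0 & root (map_poly intr P) x^-1.
  have [P] := alg x^-1; elim/poly_ind: P => [|P c IH]; first by rewrite eqxx.
  have [->|c0] := eqVneq c 0; last first.
    by move=> _ Pr; exists (P * 'X + c%:P) => //; rewrite coefD coefMX coefC eqxx add0r.
  rewrite addr0 mulf_eq0 polyX_eq0 orbF => P0.
  rewrite rmorphM /= map_polyX rootM rootX invr_eq0 (negbTE x0) orbF.
  exact: IH.
pose c0 : int := P`_0; rewrite -/c0 in P00.
pose k := logn p (absz c0).
have c0V : V ((absz c0)%:R * p%:R ^- k.+1).
  have Pabs : V ((c0)%:~R * p%:R ^- k.+1).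
    have : (c0)%:~R = - (x^-1 * \sum_(i < (size P).-1) (P`_i.+1)%:~R * x^-1 ^+ i).
      move: Pz; rewrite /root (@horner_coef_wide _ (size P)) ?size_poly// -(prednK (_ : 0 < size P)%N).
        rewrite big_ord_recl expr0 mulr1 coef_map /= addr_eq0 => /eqP ->; congr (- _).
        by rewrite mulr_sumr; apply: eq_bigr => i _; rewrite coef_map /= exprS mulrCA.
      by rewrite lt0n size_poly_eq0; apply: contraNneq P00 => PE; rewrite /c0 PE coef0.
    move=> ->; rewrite mulNr; apply: VN; rewrite mulrAC; apply: VM => //.
    have := zV 0%N; rewrite expr0 invr1 mulr1 => Vz.
    apply: Vsum => i; apply: VM; last exact: VX.
    exact: Vint.
  have : (absz c0)%:R = (c0)%:~R :> K \/ (absz c0)%:R = - (c0)%:~R :> K.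
    by case: (c0) => n; [left | right; rewrite NegzE rmorphN opprK].
  by move=> [->//|->]; rewrite mulNr; exact: VN.
have n0 : (0 < absz c0)%N by rewrite absz_gt0.
have [n pn nE] := pfactor_coprime pr n0.
apply: (@VXp 1%N isT).
have -> : p%:R ^- 1 = n%:R^-1 * ((absz c0)%:R * p%:R ^- k.+1) :> K.
  have nK : n%:R != 0 :> K.
    by rewrite char0; apply: contraTneq n0 => n0; rewrite nE n0.
  rewrite expr1 {1}nE -/k natrM natrX exprS invfM mulrA mulKf// mulrCA divff ?mulr1//.
  by rewrite expf_neq0.
by apply: VM => //; apply: inv_coprime; rewrite -prime_coprime.
Qed.

(** The rational a / b is a lower bound for the valuation of x. Taking suprema of such bounds, as in
    a Dedekind cut, produces a real valuation without constructing a value group. *)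
Let slope x (a : int) (b : nat) := V (x ^+ b * p%:R ^ (- a)).

Let slopeV x a b : ~ slope x a b -> slope x^-1 (- a) b.
Proof.
rewrite /slope; have [//|] := valuation (x ^+ b * p%:R ^ (- a)).
by rewrite invfM exprVn invr_expz.
Qed.

Let slopeM x y a b a' b' : slope x a b -> slope y a' b' ->
  slope (x * y) (a * b'%:Z + a' * b%:Z) (b * b').
Proof.
rewrite /slope => xab yab.
have -> : (x * y) ^+ (b * b') * p%:R ^ (- (a * b'%:Z + a' * b%:Z)) =
    (x ^+ b * p%:R ^ (- a)) ^+ b' * (y ^+ b' * p%:R ^ (- a')) ^+ b.
  rewrite !exprMn exprM [in LHS](mulnC b) (exprM y) -!mulrA; congr (_ * _).
  rewrite mulrCA; congr (_ * _); rewrite !exprnP !exprz_exp -expfzDr//.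
  by congr (_ ^ _); ring.
by apply: VM; exact: VX.
Qed.

Variable R : realType.
Let slopes x := [set r : R | exists a b, [/\ (0 < b)%N, slope x a b & r = a%:~R / b%:R]].
Let w x := sup (slopes x).

Let slopes_ub x c : x != 0 -> V (x^-1 * p%:R ^+ c) -> ubound (slopes x) c%:R.
Proof.
move=> x0 xc _ [a [b [b0 xab ->]]]; rewrite ler_pdivrMr ?ltr0n//.
rewrite -natrM -[_%:R]/((c * b)%N%:~R) ler_int leNgt; apply/negP => cb.
have := slopeM xab (_ : slope x^-1 (- c%:Z) 1).
rewrite /slope expr1 opprK divff// expr1n mul1r => /(_ xc).
rewrite mulr1 mulNr -opprB opprK -PoszM.
have [k kE] : exists k : nat, a - c%:Z * b = k%:Z.
  by exists (absz (a - c%:Z * b)%R); rewrite gez0_abs ?subr_ge0 ?ltW.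
rewrite -opprB kE -invr_expz; apply: VXp.
by rewrite -ltz_nat -kE subr_gt0.
Qed.

Let slopes_sup x : x != 0 -> has_sup (slopes x).
Proof.
move=> x0; split.
  have [c xc] := archimedean x; exists (- c%:R); exists (- c%:Z), 1%N.
  by split => //; [rewrite /slope expr1 opprK | rewrite divr1 rmorphN].
have [c xc] := archimedean x^-1; exists c%:R.
exact: slopes_ub.
Qed.

Let slope_le_w x a b : x != 0 -> (0 < b)%N -> slope x a b -> a%:~R / b%:R <= w x.
Proof.
move=> x0 b0 xab; apply: ub_le_sup; first by case: (slopes_sup x0).
by exists a, b.
Qed.

Let wM_ge x y : x != 0 -> y != 0 -> w x + w y <= w (x * y).
Proof.
move=> x0 y0; rewrite -lerBrDr; apply: ge_sup; first by case: (slopes_sup x0).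
move=> _ [a [b [b0 xab ->]]]; rewrite lerBrDr -lerBrDl.
apply: ge_sup; first by case: (slopes_sup y0).
move=> _ [a' [b' [b'0 yab ->]]]; rewrite lerBrDl.
have -> : a%:~R / b%:R + a'%:~R / b'%:R = (a * b'%:Z + a' * b%:Z)%:~R / (b * b')%N%:R :> R.
  rewrite intrD !intrM natrM -!pmulrn; field.
  by rewrite !pnatr_eq0 -!lt0n b0 b'0.
by apply: slope_le_w; [rewrite mulf_neq0 | rewrite muln_gt0 b0 | exact: slopeM].
Qed.

(** Take a rational q strictly between the two sides. Since -q exceeds w x, it is not a slope of x;
    by [slopeV], q is then a slope of 1/x, against q > w (1/x). *)
Let wV_ge x : x != 0 -> - w x <= w x^-1.
Proof.
move=> x0; rewrite leNgt; apply/negP => /rat_in_itvoo[q]; rewrite in_itv /= => /andP[q1 q2].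
have qE : ratr q = (numq q)%:~R / `|denq q|%N%:R :> R.
  by rewrite /ratr [(absz _)%:R]pmulrn absz_denq.
have d0 : (0 < `|denq q|)%N by rewrite absz_gt0 denq_neq0.
have : ~ slope x (- numq q) `|denq q|%N.
  move=> /(slope_le_w x0 d0); rewrite rmorphN mulNr -qE lerNl; lra.
move=> /slopeV; rewrite opprK => /(slope_le_w (_ : x^-1 != 0) d0).
by rewrite invr_eq0 x0 -qE => /(_ isT); lra.
Qed.

Let wM x y : x != 0 -> y != 0 -> w (x * y) = w x + w y.
Proof.
move=> x0 y0; apply/eqP; rewrite eq_le wM_ge// andbT.
have := @wM_ge (x * y) y^-1; rewrite mulf_neq0// invr_eq0 y0 mulfK// => /(_ isT isT).
by have := wV_ge y0; lra.
Qed.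

Let w_ge0 x : x != 0 -> V x -> 0 <= w x.
Proof.
move=> x0 Vx; have := @slope_le_w x 0 1%N x0 isT; rewrite mul0r; apply.
by rewrite /slope oppr0 expr0z mulr1 expr1.
Qed.

Let w1 : w 1 = 0.
Proof. by have := wM (oner_neq0 K) (oner_neq0 K); rewrite mulr1; lra. Qed.

Let wp : w p%:R = 1.
Proof.
apply/eqP; rewrite eq_le; apply/andP; split.
  by apply: ge_sup; [case: (slopes_sup p0) | apply: (@slopes_ub _ 1%N) => //; rewrite expr1 mulVf].
by have := @slope_le_w p%:R 1 1%N p0 isT; rewrite divr1; apply; rewrite /slope expr1 -invr_expz expr1z divff.
Qed.

Let w_coprime n : ~~ (p %| n)%N -> w n%:R = 0.
Proof.
move=> pn; have n0 : n%:R != 0 :> K by rewrite char0; apply: contraNneq pn => ->.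
have h1 := w_ge0 n0 (Vn n).
have h2 : 0 <= w n%:R^-1 by apply: w_ge0; [rewrite invr_eq0 | exact: inv_coprime].
have := @wM n%:R n%:R^-1; rewrite n0 invr_eq0 n0 divff// w1 => /(_ isT isT); lra.
Qed.

Let v x : R := if x == 0 then 0 else p%:R `^ (- w x).
Let pR : 0 < p%:R :> R. Proof. by rewrite ltr0n prime_gt0. Qed.
Let v_gt0 x : x != 0 -> 0 < v x.
Proof. by move=> x0; rewrite /v (negbTE x0) powR_gt0. Qed.

Let vM x y : v (x * y) = v x * v y.
Proof.
rewrite /v mulf_eq0; have [|x0] /= := eqVneq x 0; first by rewrite mul0r.
have [|y0] /= := eqVneq y 0; first by rewrite mulr0.
by rewrite wM// opprD powRD// (gt_eqF pR) implybT.
Qed.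

Let vD x y : v (x + y) <= v x + v y.
Proof.
have v0 z : 0 <= v z by have [->|/v_gt0/ltW//] := eqVneq z 0; rewrite /v eqxx.
have main x' y' : V (x' / y') -> y' != 0 -> v (x' + y') <= v y'.
  move=> Vxy y'0; have [->|xy0] := eqVneq (x' + y') 0; first by rewrite {1}/v eqxx.
  rewrite /v (negbTE xy0) (negbTE y'0) ler_powR ?ler1n ?prime_gt0// lerN2.
  have E : x' + y' = y' * (x' / y' + 1) by field.
  have E0 : x' / y' + 1 != 0 by apply: contraNneq xy0 => h; rewrite E h mulr0.
  by rewrite E wM// lerDl w_ge0//; exact: VD.
have [->|x0] := eqVneq x 0; first by rewrite add0r lerDr.
have [->|y0] := eqVneq y 0; first by rewrite addr0 lerDl.
have [/main h|h] := valuation (x / y).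
  by rewrite (le_trans (h y0))// lerDr.
rewrite invf_div in h; have := main _ _ h x0; rewrite addrC => H.
by rewrite (le_trans H)// lerDl.
Qed.

Let v_nat n : v n%:R = if n == 0%N then 0 else (p%:R ^+ logn p n)^-1.
Proof.
rewrite /v char0; case: eqVneq => // n0.
have n_gt0 : (0 < n)%N by rewrite lt0n.
have [m pm mE] := pfactor_coprime pr n_gt0.
have pm' : ~~ (p %| m)%N by rewrite -prime_coprime.
have m0 : m%:R != 0 :> K by rewrite char0; apply: contraNneq pm' => ->.
have -> : w n%:R = (logn p n)%:R.
  rewrite {1}mE natrM wM// ?natrX ?expf_neq0// w_coprime// add0r.
  elim: (logn p n) => [|k IH]; first by rewrite expr0 w1.
  by rewrite exprS wM ?expf_neq0// IH wp -natr1 addrC.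
by rewrite powRN powR_mulrn// ltW.
Qed.

Lemma absolute_value_of_maximal_subring : exists2 u : K -> R, absolute_value u &
  forall n, u n%:R = if n == 0%N then 0 else (p%:R ^+ logn p n)^-1.
Proof.
exists v; last exact: v_nat; split; last 2 first.
- exact: vM.
- exact: vD.
- by move=> x; have [->|/v_gt0/ltW//] := eqVneq x 0; rewrite /v eqxx.
- move=> x; split => [vx|->]; last by rewrite /v eqxx.
  by apply/eqP; apply: contraTT (lexx (0 : R)) => /v_gt0; rewrite vx ltxx.
Qed.

End MaximalSubring.

Section PadicPlace.
Variables (R : realType) (K : fieldExtType rat).

Lemma natr_eq0_ext (n : nat) : (n%:R == 0 :> K) = (n == 0%N).
Proof. by rewrite -(rmorph_nat (in_alg K)) fmorph_eq0 pnatr_eq0. Qed.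

Lemma algebraic_over_int (z : K) :
  exists2 P : {poly int}, P != 0 & root (map_poly intr P) z.
Proof.
have /polyOver1P[P PE] := minPolyOver 1%VS z.
have P0 : P != 0.
  apply/eqP => P0; have := monic_minPoly 1%VS z; rewrite PE P0 map_poly0 => /monic_neq0.
  by rewrite eqxx.
have [Q [a a0 QE]] := rat_poly_scale P.
exists Q; first by apply: contra_neq P0 => Q0; rewrite QE Q0 map_poly0 scaler0.
have := root_minPoly 1%VS z; rewrite PE QE map_polyZ rootZ; last first.
  by rewrite fmorph_eq0 invr_eq0 intr_eq0.
rewrite -map_poly_comp; congr (is_true (root _ z)); apply: eq_map_poly => m /=.
exact: (rmorph_int (in_alg K)).
Qed.

(** One place above p is needed for the sequel: its completion serves as the field in which rational
    polynomials split and into which all embeddings of [K] are taken. *)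
Lemma finite_place_exists (p : nat) : prime p ->
  exists2 v : K -> R, absolute_value v & forall q : rat, v (ratr q) = padic_abs R p q.
Proof.
move=> pr; have [V [rV Vp Vmax]] := maximal_subring_without_invp pr natr_eq0_ext.
have [v vP vn] := absolute_value_of_maximal_subring pr natr_eq0_ext rV Vp Vmax algebraic_over_int R.
exists v => // q.
have vint (m : int) : v m%:~R = v `|m|%N%:R.
  by case: m => m //; rewrite NegzE rmorphN /= (avN vP).
rewrite /ratr (avM vP) (avV vP) !vint !vn /padic_abs absz_eq0 numq_eq0 absz_eq0 (negbTE (denq_neq0 q)).
by case: ifP => _; [rewrite mul0r | rewrite invrK mulrC].
Qed.
End PadicPlace.

(** * Weak approximation and local degrees *)

Lemma near_all_seq (I : eqType) (s : seq I) (P : I -> nat -> Prop) :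
  (forall k, k \in s -> \forall n \near \oo, P k n) ->
  \forall n \near \oo, forall k, k \in s -> P k n.
Proof.
elim: s => [|k s IH] H; first by apply: nearW.
have Hk := H k (mem_head _ _).
have Hs : \forall n \near \oo, forall k, k \in s -> P k n.
  by apply: IH => j js; apply: H; rewrite in_cons js orbT.
by apply: filterS2 Hk Hs => n hk hs j; rewrite in_cons => /predU1P[->|/hs].
Qed.

Section PowerLimits.
Variables (R : realType) (F : fieldType) (v : F -> R).
Hypothesis vP : absolute_value v.

Lemma av_exp_small x e : v x < 1 -> 0 < e -> \forall n \near \oo, v x ^+ n < e.
Proof.
move=> vx e0; have : (fun n => v x ^+ n) @ \oo --> 0.
  by apply: cvg_expr; rewrite ger0_norm ?(av_ge0 vP).
move=> /cvgrPdist_lt/(_ _ e0); apply: filterS => n.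
by rewrite sub0r normrN ger0_norm// exprn_ge0// (av_ge0 vP).
Qed.

(** The elements x^n / (1 + x^n) behave as a cutoff: they tend to 0 for the absolute values with v x
    < 1, and to 1 for those with v x > 1. *)
Lemma av_cutoff_small x e : v x < 1 -> 0 < e ->
  \forall n \near \oo, v (x ^+ n / (1 + x ^+ n)) < e.
Proof.
move=> vx e0; have e2 : 0 < e / 2 by rewrite divr_gt0.
have h2 : 0 < 2^-1 :> R by [].
apply: filterS2 (av_exp_small vx e2) (av_exp_small vx h2) => n.
rewrite (avM vP) (avV vP) (avX vP) => h1 h.
have h3 : 1 / 2 <= v (1 + x ^+ n).
  have := av_lerB vP 1 (- x ^+ n); rewrite opprK (avN vP) (avX vP) (av1 vP); lra.
rewrite ltr_pdivrMr; last by apply: lt_le_trans h3.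
apply: lt_le_trans h1 _; have := ler_wpM2l (ltW e0) h3; lra.
Qed.

Lemma av_cutoff_one x e : 1 < v x -> 0 < e ->
  \forall n \near \oo, v (x ^+ n / (1 + x ^+ n) - 1) < e.
Proof.
move=> vx e0; have x0 : x != 0 by rewrite -(av_gt0 vP) (lt_trans _ vx).
have vx1 : v x^-1 < 1 by rewrite (avV vP) invf_lt1// (lt_trans _ vx).
apply: filterS2 (av_cutoff_small vx1 e0) (nbhs_infty_gt 0) => n h n0.
have xn : 1 + x ^+ n != 0.
  rewrite addrC addr_eq0; apply/eqP => E.
  have : v (x ^+ n) = 1 by rewrite E (avN vP) (av1 vP).
  by rewrite (avX vP) => E2; have := vx; rewrite -(expr_gt1 n0 (av_ge0 vP x)) E2 ltxx.
have -> : x ^+ n / (1 + x ^+ n) - 1 = - (x^-1 ^+ n / (1 + x^-1 ^+ n)).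
  have xn0 : x ^+ n != 0 by rewrite expf_neq0.
  rewrite exprVn -{2}(mulfV xn) -mulrBl opprD addrC subrK mulN1r; congr (- _).
  have -> : 1 + (x ^+ n)^-1 = (1 + x ^+ n) / x ^+ n by rewrite mulrDl mul1r divff// addrC.
  by rewrite invf_div mulKf.
by rewrite (avN vP).
Qed.

End PowerLimits.

Section WeakApproximation.
Variables (R : realType) (F : fieldType).
Implicit Types v w : F -> R.

(** Agreement at [q] fixes the normalization, so that different absolute values cannot be powers of
    each other. Starting from v x < w x, a high power of x makes the ratio of the two values smaller
    than v q, and a power of q then brings the value for v just below 1, which leaves the value for
    w above 1. *)
Lemma separate_two v w (q : F) : absolute_value v -> absolute_value w ->
  0 < v q < 1 -> v q = w q -> v <> w -> exists y, v y < 1 /\ 1 < w y.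
Proof.
move=> vP wP /andP[q0 q1] vwq vw.
have [x vwx] : exists x, v x < w x.
  apply: contrapT => /forallNP h.
  have wv x : w x <= v x by rewrite leNgt; apply/negP; exact: h.
  apply: vw; apply/funext => x; apply/eqP; rewrite eq_le wv andbT.
  have [->|x0] := eqVneq x 0; first by rewrite (av0 vP) (av0 wP).
  by have := wv x^-1; rewrite (avV vP) (avV wP) lef_pV2// posrE ?(av_gt0 vP) ?(av_gt0 wP).
have x0 : x != 0 by rewrite -(av_gt0 wP) (le_lt_trans (av_ge0 vP x)).
have vx0 : 0 < v x by rewrite (av_gt0 vP).
have wx0 : 0 < w x by rewrite (av_gt0 wP).
have vxwx : v x / w x < 1 by rewrite ltr_pdivrMr ?mul1r.
have /(_ _ q0)[n _ /(_ n (leqnn n)) nP] : forall e, 0 < e -> \forall n \near \oo, (v x / w x) ^+ n < e.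
  move=> e e0; have : (fun n => (v x / w x) ^+ n) @ \oo --> 0.
    by apply: cvg_expr; rewrite ger0_norm// divr_ge0// ltW.
  move=> /cvgrPdist_lt/(_ _ e0); apply: filterS => k.
  by rewrite sub0r normrN ger0_norm// exprn_ge0// divr_ge0// ltW.
have lq : ln (v q) < 0 by rewrite ln_lt0// q0.
(* The exponent [m] is such that [n * ln (v x) + m * ln (v q)] is at least [ln (v q)] and less than
   0. *)
pose t := n%:R * ln (v x) / - ln (v q).
pose m := Num.floor t + 1.
have tm : t < m%:~R by rewrite /m floorD1_gt.
have mt : m%:~R - 1 <= t by rewrite /m intrD addrK floor_le.
have lnz (b : R) (k : int) : 0 < b -> ln (b ^ k) = k%:~R * ln b.
  move=> b0; case: k => k; first by rewrite -exprnP lnXn// -mulr_natl.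
  by rewrite NegzE -invr_expz -exprnP lnV ?posrE ?exprn_gt0// lnXn// rmorphN /= -mulr_natl mulNr.
have avz (u : F -> R) (uP : absolute_value u) (y : F) (k : int) : u (y ^ k) = u y ^ k.
  by case: k => k; [rewrite -!exprnP (avX uP) | rewrite NegzE -!invr_expz -!exprnP (avV uP) (avX uP)].
have vqm : 0 < v q ^ m by rewrite exprz_gt0.
have vnm : v x ^+ n * v q ^ m < 1.
  rewrite -ltr_ln ?posrE ?mulr_gt0 ?exprn_gt0// ln1 lnM ?posrE ?exprn_gt0// lnXn// lnz//.
  by move: tm; rewrite /t ltr_pdivrMr ?oppr_gt0// mulrN -subr_lt0 opprK mulr_natl.
have vnm1 : v q <= v x ^+ n * v q ^ m.
  rewrite -ler_ln ?posrE ?mulr_gt0 ?exprn_gt0// lnM ?posrE ?exprn_gt0// lnXn// lnz//.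
  by move: mt; rewrite /t ler_pdivlMr ?oppr_gt0// mulrN mulrBl mul1r opprB lerBlDr mulr_natl.
exists (x ^+ n * q ^ m); rewrite (avM vP) (avM wP) (avX vP) (avX wP) (avz v vP) (avz w wP) -vwq; split => //.
have wn0 : 0 < w x ^+ n by rewrite exprn_gt0.
have h : v x ^+ n < v q * w x ^+ n by move: nP; rewrite expr_div_n ltr_pdivrMr.
have : v q < v q * (w x ^+ n * v q ^ m).
  by apply: le_lt_trans vnm1 _; rewrite mulrA ltr_pM2r.
by rewrite ltr_pMr.
Qed.

Variables (I : eqType) (v : I -> F -> R) (q : F) (c : R).
Hypothesis vP : forall i, absolute_value (v i).
Hypothesis vinj : injective v.
Hypothesis c01 : 0 < c < 1.
Hypothesis vq : forall i, v i q = c.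

(** The induction of Artin and Whaples. Let x separate i from s and y separate i from j. If v_j x =
    1 the element x^n y works for large n; otherwise y times the cutoff x^n / (1 + x^n) works,
    whether v_j x is below or above 1. *)
Lemma separate_from_all i (s : seq I) : i \notin s ->
  exists x, 1 < v i x /\ forall j, j \in s -> v j x < 1.
Proof.
elim: s => [|j s IH] /=.
  move=> _; exists q^-1; split => //.
  by rewrite (avV (vP i)) vq invf_gt1; case/andP: c01.
rewrite in_cons negb_or => /andP[ij /IH[x [vx xs]]].
have [y [yj yi]] : exists y, v j y < 1 /\ 1 < v i y.
  apply: (@separate_two _ _ q) => //; rewrite ?vq//.
  by move=> /vinj ji; rewrite ji eqxx in ij.
have ge k z : 0 <= v k z by apply: av_ge0.
have bigk k z : z < 1 / (v k y + 1) -> v k y * z < 1.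
  move=> h; apply: le_lt_trans (_ : v k y * (1 / (v k y + 1)) < 1).
    by rewrite ler_wpM2l// ltW.
  by rewrite mulrA mulr1 ltr_pdivrMr ?mul1r ?ltrDl// ltr_wpDl.
have pk k : 0 < 1 / (v k y + 1) by rewrite divr_gt0// ltr_wpDl.
have [vjx|vjx] := eqVneq (v j x) 1.
  have : \forall n \near \oo, forall k, k \in s -> v k x ^+ n < 1 / (v k y + 1).
    by apply: near_all_seq => k /xs kx; exact: av_exp_small.
  move=> [n _ /(_ n (leqnn n)) nP]; exists (x ^+ n * y); split.
    rewrite (avM (vP _)) (avX (vP _)) (lt_le_trans yi)// ler_peMl//.
    exact: exprn_ege1 (ltW vx).
  move=> k; rewrite in_cons (avM (vP _)) (avX (vP _)) => /predU1P[->|ks].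
    by rewrite vjx expr1n mul1r.
  by rewrite mulrC bigk// nP.
have hi : \forall n \near \oo, v i (x ^+ n / (1 + x ^+ n) - 1) < 1 - (v i y)^-1.
  by apply: av_cutoff_one => //; rewrite subr_gt0 invf_lt1// (lt_trans _ yi).
have hs : \forall n \near \oo, forall k, k \in s -> v k (x ^+ n / (1 + x ^+ n)) < 1 / (v k y + 1).
  by apply: near_all_seq => k /xs kx; exact: av_cutoff_small.
have hj : \forall n \near \oo, v j y * v j (x ^+ n / (1 + x ^+ n)) < 1.
  case: (ltgtP (v j x) 1) vjx => [vjx|vjx|//] _.
    by apply: filterS (av_cutoff_small (vP j) vjx (pk j)) => n; exact: bigk.
  have d0 : 0 < (1 - v j y) / (v j y + 1) by rewrite divr_gt0 ?subr_gt0// ltr_wpDl.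
  apply: filterS (av_cutoff_one (vP j) vjx d0) => n; set e := _ / _ => he.
  have h1 : v j e <= 1 + v j (e - 1).
    by rewrite -(av1 (vP j)) -{1}(subrK 1 e) addrC (avD (vP j)).
  have yj1 : 0 < v j y + 1 by rewrite ltr_wpDl.
  have h2 : (v j y + 1) * v j (e - 1) < 1 - v j y by rewrite mulrC -ltr_pdivlMr.
  have := ge j y; have := ge j (e - 1); have := ler_wpM2l (ge j y) h1; nra.
have [n _ /(_ n (leqnn n))[[/= ni ns] nj]] := filterI (filterI hi hs) hj.
exists (y * (x ^+ n / (1 + x ^+ n))); split.
  set e := _ / _ in ni *; rewrite (avM (vP i)).
  have h1 : 1 - v i (e - 1) <= v i e.
    by rewrite -(av1 (vP i)) (av_distC (vP i)); have := av_lerB (vP i) 1 (1 - e); rewrite subKr.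
  have yi0 : 0 < v i y by rewrite (lt_trans _ yi).
  have h2 : (v i y)^-1 < v i e by lra.
  by rewrite -(mulfV (lt0r_neq0 yi0)) ltr_pM2l.
move=> k; rewrite in_cons (avM (vP k)) => /predU1P[->//|ks].
by rewrite bigk// ns.
Qed.

End WeakApproximation.

Lemma weak_approximation (R : realType) (F : fieldType) (I : finType) (v : I -> F -> R)
  (q : F) (c : R) : (forall i, absolute_value (v i)) -> injective v -> 0 < c < 1 ->
  (forall i, v i q = c) -> forall i e, 0 < e ->
  exists2 y, v i (y - 1) < e & forall j, j != i -> v j y < e.
Proof.
move=> vP vinj c01 vq i e e0.
have ie : i \notin [seq j <- enum I | j != i] by rewrite mem_filter eqxx.
have [x [xi xs]] := separate_from_all vP vinj c01 vq ie.
have hi := av_cutoff_one (vP i) xi e0.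
have hs : \forall n \near \oo, forall j, j \in [seq j <- enum I | j != i] ->
    v j (x ^+ n / (1 + x ^+ n)) < e.
  by apply: near_all_seq => j /xs jx; exact: av_cutoff_small.
have [n _ /(_ n (leqnn n))[/= ni ns]] := filterI hi hs.
exists (x ^+ n / (1 + x ^+ n)) => // j ji; apply: ns.
by rewrite mem_filter ji mem_enum.
Qed.

(** * Algebraic closedness passes to the completion *)

Section Splitting.
Variables (R : realType) (L : valField R).
Implicit Types (W : set L) (P : {poly L}).

Definition poly_closed W := forall P, coefs_in W P -> (1 < size P)%N ->
  exists2 x, W x & root P x.

Section Subfield.
Variable W : set L.
Hypothesis WF : subfield_of W.

Lemma subfield1 : W 1. Proof. by case: WF. Qed.
Lemma subfieldB x y : W x -> W y -> W (x - y).
Proof. by case: WF => _ h Wx Wy; case: (h x y). Qed.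
Lemma subfield_div x y : W x -> W y -> W (x / y).
Proof. by case: WF => _ h Wx Wy; case: (h x y). Qed.
Lemma subfield0 : W 0.
Proof. by rewrite -(subrr 1); apply: subfieldB; exact: subfield1. Qed.
Lemma subfieldN x : W x -> W (- x).
Proof. by rewrite -sub0r; apply: subfieldB; exact: subfield0. Qed.
Lemma subfieldD x y : W x -> W y -> W (x + y).
Proof. by move=> Wx Wy; rewrite -(opprK y); apply: subfieldB => //; exact: subfieldN. Qed.
Lemma subfieldM x y : W x -> W y -> W (x * y).
Proof.
move=> Wx Wy; rewrite -(invrK y); apply: subfield_div => //.
by rewrite -div1r; apply: subfield_div => //; exact: subfield1.
Qed.
Hypothesis Wc : poly_closed W.

Lemma poly_closed_split P : coefs_in W P -> exists2 s : seq L, (forall z, z \in s -> W z) &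
  P = lead_coef P *: \prod_(z <- s) ('X - z%:P).
Proof.
move: {2}(size P) (leqnn (size P)) => n; elim: n P => [|n IH] P.
  rewrite leqn0 size_poly_eq0 => /eqP -> _; exists [::] => //.
  by rewrite lead_coef0 scale0r.
move=> Pn PW; have [P1|P1] := leqP (size P) 1.
  exists [::] => //; rewrite big_nil alg_polyC [in LHS](size1_polyC P1) lead_coefE.
  by case: (size P) P1 => [|[]].
have [x Wx Px] := Wc PW P1.
have [Q PE] := factor_theorem P x Px.
have P0 : P != 0 by rewrite -size_poly_gt0 (leq_trans _ P1).
have Q0 : Q != 0 by apply: contra_neq P0 => Q0; rewrite PE Q0 mul0r.
have szP : size P = (size Q).+1 by rewrite PE size_Mmonic ?monicXsubC// size_XsubC addn2.
have QW : coefs_in W Q.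
  (* Synthetic division from the top degree downwards: each coefficient of the quotient is computed
     inside [W] from the next one. *)
  have rec k : forall i, (size Q <= i + k)%N -> W Q`_i.
    elim: k => [|k IHk] i.
      by rewrite addn0 => /leq_sizeP/(_ i (leqnn _)) ->; exact: subfield0.
    move=> ik; have -> : Q`_i = P`_i.+1 + x * Q`_i.+1.
      by rewrite PE mulrBr coefB coefMX coefMC /= mulrC subrK.
    by apply: subfieldD => //; apply: subfieldM => //; apply: IHk; rewrite addSnnS.
  by move=> i; apply: (rec (size Q)); exact: leq_addl.
have Qn : (size Q <= n)%N by rewrite -ltnS -szP.
have [s sW QE] := IH Q Qn QW.
exists (x :: s); first by move=> z; rewrite in_cons => /predU1P[->//|/sW].
rewrite big_cons {1}PE {1}QE -scalerAl mulrC PE lead_coef_Mmonic ?monicXsubC//.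
Qed.

End Subfield.

Hypothesis ultra : forall x y : L, vabs (x + y) <= Num.max (vabs x) (vabs y).
Let vP := vabsP L.

Lemma ultra_sum I (r : seq I) (Q : pred I) (f : I -> L) (B : R) : 0 <= B ->
  (forall i, Q i -> vabs (f i) <= B) -> vabs (\sum_(i <- r | Q i) f i) <= B.
Proof.
move=> B0 h; elim/big_ind: _ => //; first by rewrite (av0 vP).
by move=> x y xB yB; rewrite (le_trans (ultra x y))// ge_max xB.
Qed.

Let ultraB (x y : L) (B : R) : vabs x <= B -> vabs y <= B -> vabs (x - y) <= B.
Proof. by move=> xB yB; rewrite (le_trans (ultra _ _))// ge_max (avN vP) xB. Qed.

Let expr_sub_bound (x y : L) (B : R) i : 1 <= B -> vabs x <= B -> vabs y <= B ->
  vabs (x ^+ i - y ^+ i) <= vabs (x - y) * B ^+ i.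
Proof.
move=> B1 xB yB; have B0 : 0 <= B by rewrite (le_trans ler01).
elim: i => [|i IH]; first by rewrite subrr (av0 vP) mulr_ge0// (av_ge0 vP).
have -> : x ^+ i.+1 - y ^+ i.+1 = x * (x ^+ i - y ^+ i) + y ^+ i * (x - y) by rewrite !exprS; ring.
rewrite (le_trans (ultra _ _))// ge_max !(avM vP) exprS mulrCA; apply/andP; split.
  by rewrite ler_pM// (av_ge0 vP).
rewrite [leLHS]mulrC [leRHS]mulrC -mulrA ler_wpM2l ?(av_ge0 vP)// (avX vP).
rewrite (@le_trans _ _ (B ^+ i)) ?ler_peMr ?exprn_ge0//.
by rewrite lerXn2r ?nnegrE// (av_ge0 vP).
Qed.

Variable W : set L.
Hypothesis WF : subfield_of W.
Hypothesis Wc : poly_closed W.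
Hypothesis Wdense : vclosure W = setT.
Hypothesis Lc : vcomplete L.

Let approx (P : {poly L}) n (d : R) : P \is monic -> size P = n.+1 -> 0 < d ->
  exists G : {poly L}, [/\ G \is monic, size G = n.+1, coefs_in W G &
    forall i, vabs (G - P)`_i <= d].
Proof.
move=> Pm Pn d0.
have /choice[g gP] (i : nat) : exists y, W y /\ vabs (P`_i - y) < d.
  by have : vclosure W P`_i by [rewrite Wdense]; move=> /(_ _ d0)[y Wy Py]; exists y.
pose G := 'X^n + \poly_(i < n) g i.
have Gc i : G`_i = if (i < n)%N then g i else if i == n then 1 else 0.
  rewrite coefD coefXn coef_poly; case: ltnP => ni; last first.
    by rewrite addr0; case: eqP.
  by rewrite (ltn_eqF ni) add0r.
have szG : size G = n.+1.
  by rewrite size_polyDl size_polyXn// ltnS size_poly.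
have Pn1 : P`_n = 1 by move: Pm; rewrite monicE lead_coefE Pn => /eqP.
exists G; split => //.
- by rewrite monicE lead_coefE szG Gc ltnn eqxx.
- move=> i; rewrite Gc; case: ltnP => _; first by case: (gP i).
  by case: eqP => _; [exact: subfield1 | exact: subfield0].
- move=> i; rewrite coefB Gc; case: ltnP => ni.
    by rewrite (av_distC vP) ltW//; case: (gP i).
  case: eqP => [->|/eqP ni']; first by rewrite Pn1 subrr (av0 vP) ltW.
  rewrite (_ : P`_i = 0) ?subr0 ?(av0 vP) ?ltW//.
  by apply/(leq_sizeP _ n.+1); rewrite ?Pn// ltn_neqAle eq_sym ni'.
Qed.

Let root_bound (G : {poly L}) n (M : R) x : G \is monic -> size G = n.+1 -> 1 <= M ->
  (forall i, vabs G`_i <= M) -> root G x -> vabs x <= M.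
Proof.
move=> Gm Gn M1 GM /rootP; rewrite horner_coef Gn big_ord_recr /=.
have -> : G`_n = 1 by move: Gm; rewrite monicE lead_coefE Gn => /eqP.
rewrite mul1r => /eqP; rewrite addrC addr_eq0 => /eqP xE.
rewrite leNgt; apply/negP => Mx; have x1 : 1 < vabs x by apply: le_lt_trans Mx.
case: n Gn xE => [|n] Gn xE.
  by move: xE; rewrite big_ord0 oppr0 expr0 => /eqP; rewrite oner_eq0.
have x0 : 0 < vabs x ^+ n by rewrite exprn_gt0// (lt_trans _ x1).
have : vabs x ^+ n.+1 <= M * vabs x ^+ n.
  rewrite -(avX vP) xE (avN vP); apply: ultra_sum.
    by rewrite mulr_ge0 ?(ltW x0)// (le_trans ler01).
  move=> i _; rewrite (avM vP) (avX vP) ler_pM ?exprn_ge0 ?(av_ge0 vP)//.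
  by rewrite ler_weXn2l ?(ltW x1)// -ltnS.
by rewrite exprS ler_pM2r// leNgt Mx.
Qed.

(** The value G(x) is the product of the n differences x - y over the roots, so these cannot all
    exceed e. *)
Let near_root (G : {poly L}) n x (e : R) : (0 < n)%N -> G \is monic -> size G = n.+1 -> coefs_in W G ->
  0 < e -> vabs G.[x] <= e ^+ n -> exists2 y, root G y & vabs (x - y) <= e.
Proof.
move=> n0 Gm Gn GW e0; have [s _ GE] := poly_closed_split WF Wc GW.
move: GE; rewrite (monicP Gm) scale1r => GE.
have sn : size s = n by move: Gn; rewrite GE size_prod_XsubC => -[].
rewrite GE horner_prod (av_prod vP) => h.
have [/hasP[y ys yx]|/hasPn hs] := boolP (has (fun y => vabs (x - y) <= e) s).
  by exists y => //; rewrite root_prod_XsubC.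
exfalso; move: h; apply/negP; rewrite -ltNge -sn.
have main (r : seq L) : (forall y, y \in r -> e < vabs (x - y)) ->
    e ^+ size r <= \prod_(y <- r) vabs (x - y).
  elim: r => [|y r IHr] hr; first by rewrite big_nil expr0.
  rewrite big_cons exprS ler_pM ?exprn_ge0 ?(ltW e0)//.
    by rewrite ltW// hr ?mem_head.
  by apply: IHr => z zr; apply: hr; rewrite in_cons zr orbT.
have hs' y : y \in s -> e < vabs (x - y) by move=> /hs; rewrite -ltNge.
under eq_bigr do rewrite hornerXsubC.
have s0 : (0 < size s)%N by rewrite sn.
case: s {GE hs sn} s0 hs' => // y r _ hs'.
rewrite big_cons /= exprS (lt_le_trans (_ : _ < vabs (x - y) * e ^+ size r))//.
  by rewrite ltr_pM2r ?exprn_gt0// hs' ?mem_head.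
rewrite ler_wpM2l ?(av_ge0 vP)// main// => z zr.
by apply: hs'; rewrite in_cons zr orbT.
Qed.

(** Approximate P by monic polynomials G_k over the dense subfield [W]. A root u_k of G_k makes
    G_(k+1) (u_k) tiny, because it is the value of G_(k+1) - G_k there, hence G_(k+1) has a root
    close to u_k. The sequence obtained is Cauchy and its limit is a root of P. *)
Let monic_has_root (P : {poly L}) n : (0 < n)%N -> P \is monic -> size P = n.+1 ->
  exists x, root P x.
Proof.
move=> n0 Pm Pn.
pose M : R := \big[Num.max/1]_(i < n.+1) vabs P`_i.
have M1 : 1 <= M by rewrite /M; elim/big_rec: _ => // i x _ h; rewrite le_max h orbT.
have M0 : 0 < M by rewrite (lt_le_trans ltr01).
have PM i : vabs P`_i <= M.
  have [ni|ni] := ltnP i n.+1; first by rewrite /M (bigD1 (Ordinal ni))//= le_max lexx.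
  by rewrite (leq_sizeP _ _ (_ : size P <= i)%N) ?Pn// (av0 vP) ltW.
pose eps k : R := 2^-1 ^+ k.
have eps0 k : 0 < eps k by rewrite exprn_gt0.
have epsS k : eps k.+1 <= eps k by rewrite /eps exprS ler_piMl ?exprn_ge0//; lra.
have eps1 k : eps k <= 1 by elim: k => [|k IH]; [rewrite /eps expr0 | exact: le_trans (epsS k) IH].
(* All roots have size at most M, so coefficients of size [d k] give values of size at most
   [eps k ^+ n], as [near_root] demands. *)
pose d k := (eps k / M) ^+ n.
have d0 k : 0 < d k by rewrite exprn_gt0// divr_gt0.
have dS k : d k.+1 <= d k.
  by rewrite lerXn2r ?nnegrE ?divr_ge0 ?(ltW (eps0 _)) ?(ltW M0)// ler_wpM2r ?invr_ge0 ?(ltW M0).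
have d1 k : d k <= 1.
  rewrite exprn_ile1 ?divr_ge0 ?(ltW (eps0 _)) ?(ltW M0)//.
  by rewrite ler_pdivrMr// mul1r (le_trans (eps1 k)).
have dM k : d k * M ^+ n = eps k ^+ n by rewrite /d expr_div_n divfK// expf_neq0// gt_eqF.
have /choice[G GP] k := approx Pm Pn (d0 k).
have GM k i : vabs (G k)`_i <= M.
  rewrite -(subrK P`_i (G k)`_i) (le_trans (ultra _ _))// ge_max PM andbT -coefB.
  by case: (GP k) => _ _ _ /(_ i) h; rewrite (le_trans h)// (le_trans (d1 k)).
have diff_small (Q : {poly L}) x k : vabs x <= M -> (size Q <= n)%N ->
    (forall i, vabs Q`_i <= d k) -> vabs Q.[x] <= eps k ^+ n.
  move=> xM Qn Qd; rewrite horner_coef -dM; apply: ultra_sum.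
    by rewrite dM exprn_ge0// ltW.
  move=> i _; rewrite (avM vP) (avX vP) ler_pM ?exprn_ge0 ?(av_ge0 vP)//.
  rewrite (le_trans (_ : _ <= M ^+ i))//.
    by rewrite lerXn2r ?nnegrE ?(av_ge0 vP)// ltW.
  by rewrite ler_weXn2l// ltnW// (leq_trans (ltn_ord i)).
have monicB (A B : {poly L}) : A \is monic -> B \is monic -> size A = n.+1 -> size B = n.+1 ->
    (size (A - B)%R <= n)%N.
  move=> Am Bm An Bn; apply/leq_sizeP => j nj; rewrite coefB.
  move: nj; rewrite leq_eqVlt => /predU1P[<-|nj].
    move: Am Bm; rewrite !monicE !lead_coefE An Bn /= => /eqP -> /eqP ->.
    by rewrite subrr.
  by rewrite !(leq_sizeP _ _ (_ : _ <= j)%N) ?subrr// ?An ?Bn.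
have /choice[f fP] (kx : nat * L) : exists y, root (G kx.1) kx.2 ->
    root (G kx.1.+1) y /\ vabs (kx.2 - y) <= eps kx.1.
  case: kx => k x /=; have [rx|nrx] := boolP (root (G k) x); last by exists x.
  case: (GP k) => Gm Gn GW Gd; case: (GP k.+1) => Gm' Gn' GW' Gd'.
  have [|y ry yx] := @near_root (G k.+1) n x (eps k) n0 Gm' Gn' GW' (eps0 k).
    rewrite -(subr0 (G k.+1).[x]) -(rootP rx) -hornerN -hornerD.
    apply: diff_small; [|exact: monicB|].
      by apply: (root_bound Gm Gn M1 _ rx) => i; exact: GM.
    move=> i; have -> : (G k.+1 - G k)`_i = (G k.+1 - P)`_i - (G k - P)`_i by rewrite !coefB; ring.
    by apply: ultraB => //; exact: le_trans (dS k).
  by exists y.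
have [x0 rx0] : exists x, root (G 0%N) x.
  case: (GP 0%N) => Gm Gn GW _; have [|x _ rx] := Wc GW; first by rewrite Gn ltnS.
  by exists x.
pose u := fix u k := if k is k'.+1 then f (k', u k') else x0.
have ru k : root (G k) (u k) by elim: k => //= k IH; case: (fP (k, u k) IH).
have uS k : vabs (u k - u k.+1) <= eps k by case: (fP (k, u k) (ru k)).
have uM k : vabs (u k) <= M.
  by case: (GP k) => Gm Gn _ _; apply: (root_bound Gm Gn M1 _ (ru k)) => i; exact: GM.
have ucauchy k j : vabs (u k - u (k + j)%N) <= eps k.
  elim: j k => [|j IH] k; first by rewrite addn0 subrr (av0 vP) ltW.
  rewrite addnS -addSn -(subrK (u k.+1) (u k)) -addrA (le_trans (ultra _ _))// ge_max uS /=.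
  exact: le_trans (IH _) (epsS k).
have eps_small e : 0 < e -> exists N, eps N < e.
  move=> e0; have : (fun k => 2^-1 ^+ k : R) @ \oo --> 0 by apply: cvg_expr; rewrite ger0_norm; lra.
  move=> /cvgrPdist_lt/(_ _ e0)[N _ /(_ N (leqnn N))] /=; rewrite sub0r normrN ger0_norm ?exprn_ge0//.
  by exists N.
have [l ul] : exists l, forall e : R, 0 < e -> exists N, forall n, (N <= n)%N -> vabs (u n - l) < e.
  apply: Lc => e /eps_small[N Ne]; exists N => i j Ni Nj; apply: le_lt_trans Ne.
  rewrite -(subrK (u N) (u i)) -addrA (le_trans (ultra _ _))// ge_max.
  by rewrite (av_distC vP) -{1}(subnKC Ni) ucauchy -(subnKC Nj) ucauchy.
have lM : vabs l <= M.
  have [N /(_ N (leqnn N)) h] := ul _ M0; rewrite -(subKr (u N) l); apply: ultraB => //.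
  exact: ltW.
exists l; apply/rootP/eqP; rewrite -(av_eq0 vP) eq_le (av_ge0 vP) andbT.
apply/ler_addgt0Pr => e e0; rewrite add0r.
have [N1 hN1] := eps_small e e0.
have e1 : 0 < e / (M * M ^+ n) by rewrite divr_gt0 ?mulr_gt0 ?exprn_gt0.
have [N2 hN2] := ul _ e1; pose N := maxn N1 N2.
have -> : P.[l] = (P.[l] - P.[u N]) - (G N - P).[u N].
  by rewrite hornerD hornerN (rootP (ru N)) sub0r opprK subrK.
apply: ultraB; last first.
  apply: (@le_trans _ _ (eps N ^+ n)).
    by case: (GP N) => Gm Gn _ Gd; apply: diff_small => //; exact: monicB.
  apply: (@le_trans _ _ (eps N)); first by rewrite -[leRHS]expr1 ler_wiXn2l ?(ltW (eps0 _))//.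
  rewrite (le_trans _ (ltW hN1))// /eps ler_wiXn2l ?leq_maxl//; lra.
rewrite !horner_coef -sumrB; apply: ultra_sum; first exact: ltW.
move=> i _; rewrite -mulrBr (avM vP).
apply: (@le_trans _ _ (M * (vabs (l - u N) * M ^+ n))).
  rewrite ler_pM ?(av_ge0 vP)//; apply: le_trans (expr_sub_bound i M1 lM (uM N)) _.
  by rewrite ler_wpM2l ?(av_ge0 vP)// ler_weXn2l// -ltnS -Pn.
have := hN2 N (leq_maxr _ _); rewrite (av_distC vP) ltr_pdivlMr ?mulr_gt0 ?exprn_gt0// => /ltW.
by apply: le_trans; rewrite le_eqVlt; apply/orP; left; apply/eqP; ring.
Qed.

Lemma dense_poly_closed : poly_closed (setT : set L).
Proof.
move=> P _ P1; have P0 : P != 0 by rewrite -size_poly_gt0 (leq_trans _ P1).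
have lP : (lead_coef P)^-1 != 0 by rewrite invr_eq0 lead_coef_eq0.
have [|||x rx] := @monic_has_root ((lead_coef P)^-1 *: P) (size P).-1.
- by case: (size P) P1 => [|[]].
- by rewrite monicE lead_coefZ mulVf// lead_coef_eq0.
- by rewrite size_scale// prednK// ltnW.
- by exists x => //; rewrite rootZ in rx.
Qed.

End Splitting.

Section Closure.
Variables (R : realType) (L : valField R).
Let vP := vabsP L.

Lemma vclosure_sub (A : set L) x : A x -> vclosure A x.
Proof. by move=> Ax e e0; exists x => //; rewrite subrr (av0 vP). Qed.

Lemma vclosureD (A : set L) : (forall x y, A x -> A y -> A (x + y)) ->
  forall x y, vclosure A x -> vclosure A y -> vclosure A (x + y).
Proof.
move=> AD x y Ax Ay e e0; have e2 : 0 < e / 2 by rewrite divr_gt0.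
have [u Au xu] := Ax _ e2; have [w Aw yw] := Ay _ e2.
exists (u + w); first exact: AD.
have -> : x + y - (u + w) = (x - u) + (y - w) by ring.
by rewrite (le_lt_trans (avD vP _ _))// [e]splitr ltrD.
Qed.

Lemma vclosureM (A : set L) : (forall x y, A x -> A y -> A (x * y)) ->
  forall x y, vclosure A x -> vclosure A y -> vclosure A (x * y).
Proof.
move=> AM x y Ax Ay e e0.
pose M := vabs x + vabs y + 1.
have x0 := av_ge0 vP x; have y0 := av_ge0 vP y.
have M0 : 0 < M by rewrite /M; lra.
pose d := Num.min 1 (e / (2 * M)).
have d0 : 0 < d by rewrite lt_min ltr01 divr_gt0// mulr_gt0.
have [u Au xu] := Ax _ d0; have [w Aw yw] := Ay _ d0.
exists (u * w); first exact: AM.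
have dM : d * M <= e / 2.
  have : d <= e / (2 * M) by rewrite ge_min lexx orbT.
  by rewrite ler_pdivlMr ?mulr_gt0//; lra.
have d1 : d <= 1 by rewrite ge_min lexx.
have -> : x * y - u * w = (x - u) * y + u * (y - w) by ring.
have uM : vabs u <= vabs x + 1.
  by have := av_lerB vP u x; rewrite (av_distC vP); lra.
have h1 : vabs ((x - u) * y) <= d * vabs y by rewrite (avM vP) ler_wpM2r// ltW.
have h2 : vabs (u * (y - w)) <= (vabs x + 1) * d.
  by rewrite (avM vP) ler_pM ?(av_ge0 vP)// ltW.
rewrite (le_lt_trans (avD vP _ _))//; apply: le_lt_trans (lerD h1 h2) _.
by move: dM; rewrite /M; nra.
Qed.

End Closure.

(** * Local degrees, read off from the absolute value on K *)

Section FreeFamilies.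
Variable K : fieldExtType rat.

Lemma ratr_scale (q : rat) (x : K) : ratr q * x = q *: x.
Proof. by rewrite -(fmorph_eq_rat (in_alg K)) /= mulr_algl. Qed.

Lemma rat_free_card (I : finType) (f : I -> K) :
  (forall q : I -> rat, \sum_i q i *: f i = 0 -> forall i, q i = 0) ->
  (#|I| <= \dim {: K})%N.
Proof.
move=> h; pose X := [tuple f (enum_val i) | i < #|I|].
have fX : free X.
  apply/freeP => k kX i.
  have := h (fun j => k (enum_rank j)); rewrite (reindex _ (onW_bij _ (@enum_val_bij I))) /=.
  have -> : \sum_(j < #|I|) k (enum_rank (enum_val j)) *: f (enum_val j) =
      \sum_(i < #|I|) k i *: X`_i.
    apply: eq_bigr => j _; rewrite enum_valK; congr (_ *: _).
    by rewrite -tnth_nth tnth_mktuple.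
  by move=> /(_ kX)/(_ (enum_val i)); rewrite enum_valK.
have : size X = #|I| by rewrite size_tuple.
by move: fX; rewrite /free => /eqP <- <-; rewrite dimvS ?subvf.
Qed.

End FreeFamilies.

Lemma sum_tagged (V : nmodType) (I : finType) (n : I -> nat) (F : {i : I & 'I_(n i)} -> V) :
  \sum_t F t = \sum_i \sum_(j < n i) F (Tagged (fun i => 'I_(n i)) j).
Proof.
rewrite (sig_big_dep _ (fun _ => xpredT) (fun i j => F (Tagged (fun i => 'I_(n i)) j))) /=.
by apply: eq_bigr => -[].
Qed.

Section LocalDegree.
Variables (R : realType) (K : fieldExtType rat) (a : rat -> R).
Hypothesis aP : absolute_value a.

(** Places are sorted by their restriction [a] to the rationals, so that archimedean and p-adic
    places are handled by the same statements. *)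
Definition lies_over (v : K -> R) := absolute_value v /\ forall q, v (ratr q) = a q.

Definition comb n (q : 'I_n -> rat) (e : 'I_n -> K) : K := \sum_j q j *: e j.

Lemma over_scale v q x : lies_over v -> v (q *: x) = a q * v x.
Proof. by move=> [vP vq]; rewrite -ratr_scale (avM vP) vq. Qed.

(** A uniform form of linear independence over Q, strong enough to survive completion: the same
    inequality then holds for coefficients in the closure of Q. It involves only [K] and [v]. *)
Definition independent (v : K -> R) n (e : 'I_n -> K) : Prop :=
  exists2 c : R, 0 < c & forall q i, c * a (q i) <= v (comb q e).

Lemma independent_bound v n (e : 'I_n -> K) : lies_over v -> independent v e ->
  (n <= \dim {: K})%N.
Proof.
move=> [vP _] [c c0 ce]; rewrite -(card_ord n); apply: (@rat_free_card K _ e) => q qe i.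
have := ce q i; rewrite /comb qe (av0 vP) => h; apply/eqP.
rewrite -(av_eq0 aP) eq_le (av_ge0 aP) andbT.
by rewrite -(ler_pM2l c0) mulr0.
Qed.

Lemma local_degree_ex v : lies_over v -> exists n,
  (exists e : 'I_n -> K, independent v e) /\
  forall m (e : 'I_m -> K), independent v e -> (m <= n)%N.
Proof.
move=> vo; pose P n := `[< exists e : 'I_n -> K, independent v e >].
have P0 : exists n, P n.
  by exists 0%N; apply/asboolP; exists (fun=> 0); exists 1 => // q [].
have Pb n : P n -> (n <= \dim {: K})%N by move=> /asboolP[e]; exact: independent_bound.
case: (ex_maxnP P0 Pb) => n /asboolP ne nmax; exists n; split => // m e me.
by apply: nmax; apply/asboolP; exists e.
Qed.

(** This will be [K_v : Q_v] ([degree_over_local_degree]), but it is defined before any completion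
    is chosen, so that different places can be compared inside [K]. *)
Definition local_degree v : nat := get [set n |
  (exists e : 'I_n -> K, independent v e) /\
  forall m (e : 'I_m -> K), independent v e -> (m <= n)%N].

Lemma local_degreeP v : lies_over v ->
  (exists e : 'I_(local_degree v) -> K, independent v e) /\
  forall m (e : 'I_m -> K), independent v e -> (m <= local_degree v)%N.
Proof. by move=> vo; have := getPex (local_degree_ex vo). Qed.

Lemma combB n (q q' : 'I_n -> rat) e : comb q e - comb q' e = comb (fun j => q j - q' j) e.
Proof.
by rewrite /comb -sumrB; apply: eq_bigr => j _; rewrite scalerBl.
Qed.

(** By maximality, adjoining x to the family breaks the inequality for every constant. A violation
    with a small enough constant has a nonzero coefficient b at x, and dividing the combination by b
    shows that x is close to the rational span. *)
Lemma independent_dense v (e : 'I_(local_degree v) -> K) : lies_over v -> independent v e ->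
  forall x eps, 0 < eps -> exists q, v (x - comb q e) < eps.
Proof.
move=> vo [c c0 ce] x eps eps0; have [vP vq] := vo; set n := local_degree v in e ce *.
pose e' (i : 'I_n.+1) := if unlift ord_max i is Some j then e j else x.
have e'x : e' ord_max = x by rewrite /e' unlift_none.
have e'e j : e' (lift ord_max j) = e j by rewrite /e' liftK.
have ne' : ~ independent v e'.
  by move=> /(local_degreeP vo).2; rewrite ltnn.
(* The bound [eps] serves when the violated inequality concerns the coefficient of x; the two other
   bounds serve when it concerns an old coefficient, which is then at most 2 v x / c times that of
   x. *)
pose c' := Num.min eps (Num.min (c / 2) (eps * c / (2 * (v x + 1)))).
have vx0 := av_ge0 vP x.
have vx1 : 0 < v x + 1 by lra.
have c'0 : 0 < c' by rewrite !lt_min eps0 !divr_gt0 ?mulr_gt0.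
have c'e : c' <= eps by rewrite ge_min lexx.
have c'c : c' <= c / 2 by rewrite !ge_min lexx !orbT.
have c'v : c' * (2 * (v x + 1)) <= eps * c.
  by rewrite -ler_pdivlMr ?mulr_gt0// !ge_min lexx !orbT.
have /existsNP[q /existsNP[i /negP]] : ~ forall q i, c' * a (q i) <= v (comb q e').
  by move=> h; apply: ne'; exists c'.
rewrite -ltNge.
pose b := q ord_max; pose q' j := q (lift ord_max j).
have -> : comb q e' = comb q' e + b *: x.
  rewrite /comb (bigD1 ord_max)//= e'x addrC; congr (_ + _).
  rewrite big_mkcond big_ord_recr /= eqxx addr0; apply: eq_bigr => j _.
  have -> : widen_ord (leqnSn n) j = lift ord_max j by apply/val_inj; rewrite /= /bump leqNgt ltn_ord.
  by rewrite eq_sym neq_lift e'e.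
move=> h.
suff [b0 hb] : b != 0 /\ v (comb q' e + b *: x) < eps * a b.
  exists (fun j => - (q' j / b)).
  have -> : x - comb (fun j => - (q' j / b)) e = b^-1 *: (comb q' e + b *: x).
    rewrite scalerDr scalerA mulVf// scale1r addrC; congr (_ + _).
    rewrite /comb scaler_sumr -sumrN; apply: eq_bigr => j _.
    by rewrite scaleNr opprK scalerA mulrC.
  by rewrite over_scale// (avV aP) mulrC ltr_pdivrMr ?(av_gt0 aP).
have ab0 := av_ge0 aP b.
case: (unliftP ord_max i) h => [j ->|->]; rewrite -/b => h.
- rewrite -/(q' j) in h.
  have h1 := ce q' j; have aj0 := av_ge0 aP (q' j).
  have h2 : v (comb q' e) <= v (comb q' e + b *: x) + a b * v x.
    rewrite -over_scale//; have := avB vP (comb q' e + b *: x) (b *: x).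
    by rewrite addrK.
  have h3 : c / 2 * a (q' j) < a b * v x.
    have : c' * a (q' j) <= c / 2 * a (q' j) by rewrite ler_wpM2r.
    lra.
  have b0 : 0 < a b.
    rewrite lt_neqAle ab0 andbT; apply/eqP => E; move: h3; rewrite -E mul0r.
    by apply/negP; rewrite -leNgt mulr_ge0// divr_ge0// ltW.
  rewrite -(av_gt0 aP); split => //; apply: lt_le_trans h _.
  rewrite -(ler_pM2l c0).
  have h4 : c * a (q' j) <= 2 * (a b * v x) by lra.
  have h5 := ler_wpM2l (ltW c'0) h4.
  have h6 : c' * (2 * (v x + 1)) * a b <= eps * c * a b by rewrite ler_wpM2r.
  have h7 : 0 <= c' * a b by rewrite mulr_ge0// ltW.
  by nra.
- have b0 : 0 < a b.
    rewrite lt_neqAle ab0 andbT; apply/eqP => E; move: h; rewrite -E mulr0.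
    by apply/negP; rewrite -leNgt (av_ge0 vP).
  by rewrite -(av_gt0 aP); split => //; apply: lt_le_trans h _; rewrite ler_wpM2r.
Qed.

Section Completion.
Variables (v : K -> R) (L : valField R) (s : {rmorphism K -> L}).
Hypothesis vo : lies_over v.
Hypothesis vs : forall x, vabs (s x) = v x.
Hypothesis Lc : vcomplete L.
Let vP : absolute_value v := vo.1.
Let LP := vabsP L.
Let n := local_degree v.
Let Q0 := @rat_closure R L.
Let K0 := local_field s.

Let s_scale (q : rat) x : s (q *: x) = ratr q * s x.
Proof. by rewrite -ratr_scale rmorphM fmorph_rat. Qed.

Let ratr_abs (q : rat) : vabs (ratr q : L) = a q.
Proof. by rewrite -(fmorph_rat s) vs; case: vo. Qed.

Let ratr_s (q : rat) : (ratr q : L) = s (ratr q). Proof. by rewrite fmorph_rat. Qed.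

Let ratr_sub (p q : rat) : (ratr (p - q) : L) = ratr p - ratr q.
Proof.
have E (t : rat) : (ratr t : K) = in_alg K t by rewrite (fmorph_eq_rat (in_alg K)).
by rewrite !ratr_s !E rmorphB [LHS]rmorphB.
Qed.

Let ratr_div (p q : rat) : (ratr (p / q) : L) = ratr p / ratr q.
Proof.
have E (t : rat) : (ratr t : K) = in_alg K t by rewrite (fmorph_eq_rat (in_alg K)).
by rewrite !ratr_s !E fmorph_div [LHS]fmorph_div.
Qed.

Let Q0D x y : Q0 x -> Q0 y -> Q0 (x + y).
Proof.
apply: vclosureD => _ _ [p _ <-] [q _ <-]; exists (p - - q) => //.
by rewrite ratr_sub -(sub0r q) ratr_sub; have := ratr_sub 0 0; rewrite !subrr => ->; ring.
Qed.

Let Q0M x y : Q0 x -> Q0 y -> Q0 (x * y).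
Proof.
apply: vclosureM => _ _ [p _ <-] [q _ <-]; exists (p / q^-1) => //.
rewrite !ratr_div -(div1r q) ratr_div.
have := ratr_div 1 1; rewrite divff// => h.
have -> : (ratr 1 : L) = 1 by rewrite ratr_s -(fmorph_eq_rat (in_alg K)) !rmorph1.
by rewrite div1r invrK.
Qed.

Let Q0_rat q : Q0 (ratr q). Proof. by apply: vclosure_sub; exists q. Qed.

Section Basis.
Variable e : 'I_n -> K.
Hypothesis ei : independent v e.

(** The coefficients are allowed to be differences of elements of [Q0] because the inequality is
    applied to the difference of two coordinate vectors of the same element. *)
Let closure_bound : exists2 c : R, 0 < c & forall (x : 'I_n -> L) i, (forall j, exists p q, Q0 p /\ Q0 q /\ x j = p - q) ->
  c * vabs (x i) <= vabs (\sum_j x j * s (e j)).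
Proof.
have [c c0 ce] := ei; exists c => // x i xQ.
pose M := \sum_j v (e j).
have M0 : 0 <= M by apply: sumr_ge0 => j _; exact: av_ge0.
apply/ler_addgt0Pr => eps eps0.
pose d := eps / (c + M + 1).
have cM : 0 < c + M + 1 by lra.
have d0 : 0 < d by rewrite divr_gt0.
have d2 : 0 < d / 2 by rewrite divr_gt0.
have /choice[q qP] j : exists q : rat, vabs (x j - ratr q) < d.
  have [y [z [/(_ _ d2)[_ [p _ <-] yp] [/(_ _ d2)[_ [q _ <-] zq] ->]]]] := xQ j.
  exists (p - q); rewrite ratr_sub.
  have -> : y - z - (ratr p - ratr q) = (y - ratr p) - (z - ratr q) by ring.
  by rewrite (le_lt_trans (avB LP _ _))// [d]splitr ltrD.
have h1 : c * vabs (x i) <= c * a (q i) + c * d.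
  rewrite -mulrDr ler_pM2l// -ratr_abs -(subrK (ratr (q i)) (x i)) addrC.
  by rewrite (le_trans (avD LP _ _))// lerD2l ltW.
have h2 : v (comb q e) <= vabs (\sum_j x j * s (e j)) + d * M.
  rewrite -vs rmorph_sum /=.
  have -> : \sum_j s (q j *: e j) =
      \sum_j x j * s (e j) - \sum_j (x j - ratr (q j)) * s (e j).
    by rewrite -sumrB; apply: eq_bigr => j _; rewrite s_scale; ring.
  rewrite (le_trans (avB LP _ _))// lerD2l (le_trans (av_sum LP _ _ _))// mulr_sumr.
  by apply: ler_sum => j _; rewrite (avM LP) vs ler_wpM2r ?(av_ge0 vP)// ltW.
have h3 : d * (c + M + 1) = eps by rewrite /d divfK// gt_eqF.
have := ce q i; lra.
Qed.

(** An element of the closure of K is a limit of rational combinations of the family; the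
    independence inequality makes their coefficients Cauchy, and the limits are its coordinates.
    Uniqueness is the same inequality after passage to the closure. *)
Lemma completion_basis : is_basis Q0 K0 (fun j => s (e j)).
Proof.
have [c c0 ce] := ei.
split; first by move=> i; apply: vclosure_sub; exists (e i).
move=> x Kx.
pose eps k : R := 2^-1 ^+ k.
have eps0 k : 0 < eps k by rewrite exprn_gt0.
have eps_anti k m : (k <= m)%N -> eps m <= eps k.
  by move=> km; rewrite ler_wiXn2l//; lra.
have eps_small r : 0 < r -> exists N, eps N < r.
  move=> r0; have : (fun k => 2^-1 ^+ k : R) @ \oo --> 0 by apply: cvg_expr; rewrite ger0_norm; lra.
  move=> /cvgrPdist_lt/(_ _ r0)[N _ /(_ N (leqnn N))] /=; rewrite sub0r normrN ger0_norm ?exprn_ge0//.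
  by exists N.
have /choice[q qP] k : exists q : 'I_n -> rat, vabs (x - s (comb q e)) < 2 * eps k.
  have [_ [y _ <-] xy] := Kx _ (eps0 k).
  have [q yq] := independent_dense vo ei y (eps0 k); exists q.
  rewrite -(subrK (s y) x) -addrA -rmorphB (le_lt_trans (avD LP _ _))// vs.
  lra.
have qC k m i : c * a (q k i - q m i) <= 2 * (eps k + eps m).
  apply: le_trans (ce (fun j => q k j - q m j) i) _.
  rewrite -combB -vs rmorphB.
  have -> : s (comb (q k) e) - s (comb (q m) e) = (x - s (comb (q m) e)) - (x - s (comb (q k) e)) by ring.
  by rewrite (le_trans (avB LP _ _))//; have := qP k; have := qP m; lra.
have /choice[l lP] (i : 'I_n) : exists l : L, forall r : R, 0 < r ->
    exists N, forall k, (N <= k)%N -> vabs (ratr (q k i) - l) < r.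
  apply: Lc => r r0; have [N Nr] := eps_small _ (divr_gt0 (mulr_gt0 c0 r0) (ltr0n _ 4)).
  exists N => k m Nk Nm; rewrite -ratr_sub ratr_abs -(ltr_pM2l c0).
  apply: le_lt_trans (qC k m i) _; have := eps_anti _ _ Nk; have := eps_anti _ _ Nm; lra.
have Ql i : Q0 (l i).
  move=> r r0; have [N /(_ N (leqnn N)) h] := lP i _ r0.
  by exists (ratr (q N i)); [exists (q N i) | rewrite (av_distC LP)].
have xl : x = \sum_j l j * s (e j).
  apply/eqP; rewrite -subr_eq0 -(av_eq0 LP) eq_le (av_ge0 LP) andbT.
  apply/ler_addgt0Pr => r r0; rewrite add0r.
  pose M := \sum_j v (e j).
  have M0 : 0 <= M by apply: sumr_ge0 => j _; exact: av_ge0.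
  have r1 : 0 < r / (2 * (M + 1)) by rewrite divr_gt0// mulr_gt0//; lra.
  have [N1 hN1] := eps_small _ (divr_gt0 r0 (ltr0n _ 4)).
  have /choice[N2 hN2] (i : 'I_n) : exists N : nat, forall k, (N <= k)%N -> vabs (ratr (q k i) - l i) < r / (2 * (M + 1)).
    exact: lP.
  pose N := maxn N1 (\max_i N2 i).
  have -> : x - \sum_j l j * s (e j) =
      (x - s (comb (q N) e)) + \sum_j (ratr (q N j) - l j) * s (e j).
    rewrite -addrA; congr (_ + _); rewrite rmorph_sum /= -sumrN -sumrN -big_split /=.
    by apply: eq_bigr => j _; rewrite s_scale; ring.
  rewrite (le_trans (avD LP _ _))//.
  have h1 : vabs (x - s (comb (q N) e)) <= r / 2.
    by have := qP N; have := eps_anti _ _ (leq_maxl N1 (\max_i N2 i)); rewrite -/N; lra.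
  have h2 : vabs (\sum_j (ratr (q N j) - l j) * s (e j)) <= r / (2 * (M + 1)) * M.
    rewrite (le_trans (av_sum LP _ _ _))// mulr_sumr; apply: ler_sum => j _.
    rewrite (avM LP) vs ler_wpM2r ?(av_ge0 vP)// ltW// hN2//.
    by rewrite (leq_trans (leq_bigmax j))// leq_maxr.
  have h3 : r / (2 * (M + 1)) * (2 * (M + 1)) = r by rewrite divfK// gt_eqF// mulr_gt0//; lra.
  lra.
exists [ffun j => l j]; split.
  by split => [i|]; [rewrite ffunE | rewrite xl; apply: eq_bigr => j _; rewrite ffunE].
move=> l' [Ql' xl']; apply/ffunP => i; rewrite ffunE.
have [c' c'0 h] := closure_bound.
have := h (fun j => l j - l' j) i (fun j => _) => /(_ _)/wrap[].
  by move=> j; exists (l j), (l' j).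
have -> : \sum_j (l j - l' j) * s (e j) = 0.
  by under eq_bigr do rewrite mulrBl; rewrite sumrB -xl -xl' subrr.
rewrite (av0 LP) pmulr_rle0// => h0; apply/eqP; rewrite -subr_eq0 -(av_eq0 LP) eq_le h0.
exact: (av_ge0 LP).
Qed.

End Basis.

(** The degree is extracted by [get] from the sizes of all bases, so sizes have to be compared: by
    uniqueness of coordinates the two matrices of change of basis multiply to the identity. *)
Let basis_unique m m' (f : 'I_m -> L) (f' : 'I_m' -> L) :
  is_basis Q0 K0 f -> is_basis Q0 K0 f' -> (m <= m')%N.
Proof.
move=> [Kf fB] [Kf' fB'].
have /choice[A AP] i : exists c : {ffun 'I_m' -> L}, (forall j, Q0 (c j)) /\ f i = \sum_(j < m') c j * f' j.
  by have [c [cP _]] := fB' _ (Kf i); exists c.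
have /choice[B BP] j : exists c : {ffun 'I_m -> L}, (forall i, Q0 (c i)) /\ f' j = \sum_(i < m) c i * f i.
  by have [c [cP _]] := fB _ (Kf' j); exists c.
pose MA := \matrix_(i < m, j < m') A i j; pose MB := \matrix_(j < m', i < m) B j i.
have Q0sum (I : finType) (F : I -> L) : (forall i, Q0 (F i)) -> Q0 (\sum_i F i).
  move=> FQ; elim/big_ind: _ => [|x y Qx Qy|i _]; [|exact: Q0D|exact: FQ].
  have <- : ratr (0 : rat) = 0 :> L by have := ratr_sub 0 0; rewrite !subrr.
  exact: Q0_rat.
apply: (@mulmx1_min _ _ _ MA MB); apply/matrixP => i k; rewrite !mxE.
have [c [_ cU]] := fB _ (Kf i).
have c1 : c = [ffun k => \sum_j A i j * B j k].
  apply: cU; split => [k'|]; first by rewrite ffunE; apply: Q0sum => j; apply: Q0M; [case: (AP i)|case: (BP j)].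
  rewrite (AP i).2; under eq_bigr do rewrite (BP _).2 mulr_sumr.
  rewrite exchange_big /=; apply: eq_bigr => k' _; rewrite ffunE mulr_suml.
  by apply: eq_bigr => j _; rewrite mulrA.
have c2 : c = [ffun k => (i == k)%:R].
  apply: cU; split => [k'|].
    have -> : [ffun k => (i == k)%:R] k' = ratr (i == k')%:R :> L.
      by rewrite ffunE ratr_s -(fmorph_eq_rat (in_alg K)) !rmorph_nat.
    exact: Q0_rat.
  rewrite (bigD1 i)//= ffunE eqxx mul1r big1 ?addr0// => k' ki.
  by rewrite ffunE eq_sym (negbTE ki) mul0r.
have := congr1 (fun g : {ffun 'I_m -> L} => g k) c1; rewrite c2 !ffunE => ->.
by apply: eq_bigr => j _; rewrite !mxE.
Qed.

Lemma degree_over_local_degree : degree_over Q0 K0 = local_degree v.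
Proof.
have [[e ei] _] := local_degreeP vo.
have eB := completion_basis ei.
have [f fB] : exists f : 'I_(degree_over Q0 K0) -> L, is_basis Q0 K0 f.
  by apply: (@getPex _ [set m | exists f : 'I_m -> L, is_basis Q0 K0 f]); exists n, (fun j => s (e j)).
by apply/eqP; rewrite eqn_leq (basis_unique fB eB) (basis_unique eB fB).
Qed.

End Completion.

(** For each place i take an independent family and multiply it by an element y_i close to 1 at i
    and close to 0 at the other places. The union of these families is free over Q: at the place
    where the largest coefficient of a relation sits, only its own block counts. *)
Lemma sum_local_degree (I : finType) (w : I -> K -> R) (q0 : rat) : injective w ->
  (forall i, lies_over (w i)) -> 0 < a q0 < 1 ->
  (\sum_i local_degree (w i) <= \dim {: K})%N.
Proof.
move=> winj wo q0P.
have wP i : absolute_value (w i) := (wo i).1.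
have [e_ eP] : exists e : forall i, 'I_(local_degree (w i)) -> K, forall i, independent (w i) (e i).
  have h i : {e : 'I_(local_degree (w i)) -> K | independent (w i) e}.
    by apply: cid; case: (local_degreeP (wo i)).
  by exists (fun i => sval (h i)) => i; exact: svalP (h i).
have /choice[c cP] i : exists c : R, 0 < c /\ forall q j, c * a (q j) <= w i (comb q (e_ i)).
  by have [c c0 ce] := eP i; exists c.
pose T := {i : I & 'I_(local_degree (w i))}.
have -> : (\sum_i local_degree (w i))%N = #|{: T}|.
  by rewrite card_tagged sumnE big_map big_enum; apply: eq_bigr => i _; rewrite card_ord.
pose M : R := 1 + \sum_(i : I) \sum_(t : T) w i (e_ (tag t) (tagged t)).
have M0 i (t : T) : w i (e_ (tag t) (tagged t)) <= M.
  have ge k (t' : T) : 0 <= w k (e_ (tag t') (tagged t')) by apply: av_ge0.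
  apply: (@le_trans _ _ (\sum_(t : T) w i (e_ (tag t) (tagged t)))).
    by rewrite (bigD1 t)//= lerDl sumr_ge0.
  apply: (@le_trans _ _ (\sum_(i : I) \sum_(t : T) w i (e_ (tag t) (tagged t)))).
    by rewrite [leRHS](bigD1 i)//= lerDl sumr_ge0// => k _; exact: sumr_ge0.
  by rewrite /M lerDr.
have M1 : 1 <= M by rewrite /M lerDl sumr_ge0// => i _; apply: sumr_ge0 => t _; exact: av_ge0.
pose cm : R := \big[Num.min/1]_i c i.
have cm0 : 0 < cm by rewrite /cm; elim/big_ind: _ => // [x y x0 y0|i _]; [rewrite lt_min x0 | case: (cP i)].
have cmc i : cm <= c i by rewrite /cm (bigD1 i)//= ge_min lexx.
(* The cross terms add up to at most |T| eps M times the largest coefficient, which stays below [cm]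
   times it; the successor in the denominator covers an empty index type. *)
pose eps := cm / (2 * #|{: T}|.+1%:R * M).
have eps0 : 0 < eps by rewrite divr_gt0// !mulr_gt0// (lt_le_trans ltr01).
have /choice[y yP] i : exists y, w i (y - 1) < eps /\ forall j, j != i -> w j y < eps.
  have [|y] := @weak_approximation _ _ _ w (ratr q0) (a q0) wP winj q0P _ i eps eps0.
    by move=> j; case: (wo j).
  by exists y.
apply: (@rat_free_card K _ (fun t : T => y (tag t) * e_ (tag t) (tagged t))) => q qe.
have [t0|noT] := pickP (fun t : T => true); last by move=> t; have := noT t.
move=> _.
(* The independence inequality is used at the place of an index whose coefficient has largest
   absolute value, where it contradicts the smallness of the error terms. *)
pose tm := [arg max_(t > t0) a (q t)]%O.
have tmP t : a (q t) <= a (q tm) by rewrite /tm; case: arg_maxP => // j _ h; exact: h.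
suff A0 : a (q tm) = 0.
  move=> t; apply/eqP; rewrite -(av_eq0 aP) eq_le (av_ge0 aP) andbT.
  by rewrite -A0.
apply/eqP; rewrite eq_le (av_ge0 aP) andbT leNgt; apply/negP => A0.
pose i0 := tag tm.
have := (cP i0).2 (fun j => q (Tagged _ j)) (tagged tm); rewrite -/i0.
have E (t : T) : Tagged (fun i => 'I_(local_degree (w i))) (tagged t) = t by case: t.
rewrite E.
have -> : comb (fun j => q (Tagged _ j)) (e_ i0) =
    \sum_(t : T) q t *: (((tag t == i0)%:R - y (tag t)) * e_ (tag t) (tagged t)).
  under [RHS]eq_bigr do rewrite mulrBl scalerBr.
  rewrite sumrB qe subr0.
  rewrite sum_tagged (bigD1 i0)//= [X in _ + X]big1 ?addr0; last first.
    by move=> i ii0; rewrite big1// => j _; rewrite (negbTE ii0) mul0r scaler0.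
  by apply: eq_bigr => j _; rewrite eqxx mul1r.
apply/negP; rewrite -ltNge.
apply: (@le_lt_trans _ _ (\sum_(t : T) a (q tm) * (eps * M))).
  rewrite (le_trans (av_sum (wP i0) _ _ _))//; apply: ler_sum => t _.
  rewrite (@over_scale (w i0) _ _ (wo i0)).
  rewrite ler_pM ?(av_ge0 aP) ?(av_ge0 (wP i0))// (avM (wP i0)).
  rewrite ler_pM ?(av_ge0 (wP i0))//.
  have [->|ti] := eqVneq (tag t) i0.
    by rewrite (av_distC (wP i0)) ltW//; case: (yP i0).
  by rewrite sub0r (avN (wP i0)) ltW//; case: (yP (tag t)) => _; apply; rewrite eq_sym.
rewrite sumr_const -mulr_natl mulrCA -[ltRHS]mulrC ltr_pM2l//.
have N0 : 0 < #|{: T}|.+1%:R :> R by rewrite ltr0n.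
have h : eps * (2 * #|{: T}|.+1%:R * M) = cm.
  by rewrite /eps divfK// !mulf_neq0// gt_eqF// (lt_le_trans ltr01).
apply: lt_le_trans (cmc i0); rewrite -h.
have M_gt0 : 0 < M by rewrite (lt_le_trans ltr01).
rewrite mulrCA ltr_pM2l// ltr_pM2r//.
by rewrite -natrM ltr_nat; apply: (@leq_ltn_trans #|{: T}|); [exact: leqnn | lia].
Qed.

End LocalDegree.

(** * Embeddings of K and the characteristic polynomial *)

Section PrimitiveElement.
Variable K : fieldExtType rat.

Lemma ext_separable (x : K) : separable_element 1%VS x.
Proof.
rewrite separable_nz_der; set P := minPoly 1%VS x.
have [n Pn] : exists n, size P = n.+2.
  by rewrite /P size_minPoly /adjoin_degree; eexists.
have Pm : P`_n.+1 = 1.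
  by have := monic_minPoly 1%VS x; rewrite -/P monicE lead_coefE Pn => /eqP.
apply/eqP => /(congr1 (fun p : {poly K} => p`_n)); rewrite coef_deriv Pm coef0 => /eqP.
by rewrite natr_eq0_ext.
Qed.

Definition primitive : K := separable_generator 1%VS {:K}.

Lemma adjoin_primitive : <<1; primitive>>%VS = {:K}%VS.
Proof.
symmetry; apply: eq_adjoin_separable_generator; last exact: sub1v.
by apply/separableP => x _; exact: ext_separable.
Qed.

Lemma primitive_minPoly : exists P : {poly rat},
  [/\ P \is monic, size P = (\dim {: K}).+1, separable_poly P &
    forall Q : {poly rat}, (map_poly (in_alg K) Q).[primitive] = 0 <-> P %| Q].
Proof.
have /polyOver1P[P PE] := minPolyOver 1%VS primitive.
have sz : size P = (\dim {: K}).+1.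
  rewrite -(size_map_poly (in_alg K)) -PE size_minPoly; congr _.+1.
  by rewrite adjoin_degreeE adjoin_primitive dimv1 divn1.
exists P; split => //.
- by rewrite -(map_monic (in_alg K)) -PE monic_minPoly.
- by rewrite -(separable_map (in_alg K)) -PE; exact: ext_separable.
- move=> Q; split => [/rootP|]; last first.
    case/dvdpP => S ->; rewrite rmorphM hornerM /= -PE.
    by have /rootP -> := root_minPoly 1%VS primitive; rewrite mulr0.
  rewrite -(dvdp_map (in_alg K)) -PE => Q0; apply: minPoly_dvdp => //.
  by apply/polyOver1P; exists Q.
Qed.

Lemma primitive_horner (x : K) : exists Q : {poly rat}, x = (map_poly (in_alg K) Q).[primitive].
Proof.
have : x \in <<1; primitive>>%VS by rewrite adjoin_primitive memvf.
by case/Fadjoin_polyP => P /polyOver1P[Q ->] ->; exists Q.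
Qed.

End PrimitiveElement.

Section Embeddings.
Variables (K : fieldExtType rat) (L : fieldType) (r : {rmorphism rat -> L}).
Hypothesis Lsplit : forall P : {poly rat}, exists s : seq L,
  map_poly r P = r (lead_coef P) *: \prod_(z <- s) ('X - z%:P).
Let d := \dim {: K}.
Let t := primitive K.

(** The embeddings correspond to the roots in L of the minimal polynomial of a primitive element,
    which are distinct by separability and d in number. Linear independence is read off from powers
    of the primitive element. *)
Lemma embeddings_exist : exists s : 'I_d -> {rmorphism K -> L},
  (forall c : 'I_d -> L, (forall x, \sum_i c i * s i x = 0) -> forall i, c i = 0) /\
  (forall f : {rmorphism K -> L}, exists i, forall x, f x = s i x).
Proof.
have [P [Pm Pd Psep PQ]] := primitive_minPoly K.
have [z zE] := Lsplit P.
have {}zE : map_poly r P = \prod_(z <- z) ('X - z%:P).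
  by rewrite zE (monicP Pm) rmorph1 scale1r.
have zd : size z = d by move: Pd; rewrite -(size_map_poly r) zE size_prod_XsubC => -[].
have uz : uniq z by rewrite -separable_prod_XsubC -zE separable_map.
have /choice[Q QE] (x : K) := primitive_horner x.
pose f y x := (map_poly r (Q x)).[y].
have fE y (R : {poly rat}) : y \in z -> f y (map_poly (in_alg K) R).[t] = (map_poly r R).[y].
  move=> yz; apply/eqP; rewrite -subr_eq0 -hornerN -hornerD -rmorphB; apply/eqP.
  have /dvdpP[S ->] : P %| (Q (map_poly (in_alg K) R).[t] - R).
    by apply/PQ; rewrite rmorphB hornerD hornerN /= -QE subrr.
  have Py : (map_poly r P).[y] = 0 by apply/rootP; rewrite zE root_prod_XsubC.
  by rewrite rmorphM /= hornerM Py mulr0.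
have fM y : y \in z -> GRing.zmod_morphism (f y) /\ GRing.monoid_morphism (f y).
  move=> yz; split; [|split] => [u v||u v].
  - by rewrite {1}(QE u) {1}(QE v) -hornerN -hornerD -rmorphB fE// rmorphB hornerD hornerN.
  - have -> : 1 = (map_poly (in_alg K) 1).[t] by rewrite rmorph1 hornerC.
    by rewrite fE// rmorph1 hornerC.
  - by rewrite {1}(QE u) {1}(QE v) -hornerM -rmorphM fE// rmorphM hornerM.
have mor y : y \in z -> {g : {rmorphism K -> L} | forall x, g x = f y x}.
  move=> yz; have [fa fm] := fM y yz.
  pose h1 := GRing.isZmodMorphism.Build K L (f y) fa.
  pose h2 := GRing.isMonoidMorphism.Build K L (f y) fm.
  pose g : {rmorphism K -> L} := HB.pack (f y) h1 h2.
  by exists g.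
have zi (i : 'I_d) : z`_i \in z by rewrite mem_nth// zd.
exists (fun i => sval (mor _ (zi i))).
have sE i x : sval (mor _ (zi i)) x = f z`_i x by exact: svalP (mor _ (zi i)) x.
split.
- move=> c cs i.
  have cR (R : {poly L}) : \sum_(j < d) c j * R.[z`_j] = 0.
    have cX k : \sum_(j < d) c j * z`_j ^+ k = 0.
      rewrite -[RHS](cs (t ^+ k)); apply: eq_bigr => j _; rewrite sE; congr (_ * _).
      have -> : t ^+ k = (map_poly (in_alg K) 'X^k).[t] by rewrite map_polyXn hornerXn.
      by rewrite fE// map_polyXn hornerXn.
    under eq_bigr do rewrite horner_coef mulr_sumr.
    rewrite exchange_big big1//= => k _.
    under eq_bigr do rewrite mulrCA.
    by rewrite -mulr_sumr cX mulr0.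
  (* This polynomial vanishes at every root except the i-th, so only [c i] remains in the
     relation. *)
  have := cR (\prod_(w <- rem z`_i z) ('X - w%:P)).
  rewrite (bigD1 i)//= [X in _ + X]big1 ?addr0 => [|j ji]; last first.
    apply/eqP; rewrite mulf_eq0; apply/orP; right; rewrite -[_ == 0]/(root _ _) root_prod_XsubC.
    rewrite mem_rem_uniq// inE /= nth_uniq ?zd// mem_nth ?zd// andbT.
    by apply: contra ji => /eqP h; apply/eqP; exact: val_inj.
  move/eqP; rewrite mulf_eq0 -[_.[_] == 0]/(root _ _) root_prod_XsubC mem_rem_uniq// inE /= eqxx /= orbF.
  by move/eqP.
- move=> g; have gt : g t \in z.
    rewrite -root_prod_XsubC -zE; apply/rootP.
    have gr q : g (in_alg K q) = r q.
      by rewrite -[LHS]/((g \o in_alg K) q) (fmorph_eq_rat (g \o in_alg K)) (fmorph_eq_rat r).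
    have : (map_poly (in_alg K) P).[t] = 0 by apply/PQ.
    move=> /(congr1 g); rewrite rmorph0 -horner_map /= -map_poly_comp => h.
    by rewrite -[RHS]h; congr (_.[_]); apply: eq_map_poly => q; rewrite /= gr.
  have gi : (index (g t) z < d)%N by rewrite -zd index_mem.
  exists (Ordinal gi) => x; rewrite sE /= nth_index//.
  rewrite {1}(QE x) -horner_map /= -map_poly_comp /f; congr (_.[_]); apply: eq_map_poly => q /=.
  by rewrite -[LHS]/((g \o in_alg K) q) (fmorph_eq_rat (g \o in_alg K)) (fmorph_eq_rat r).
Qed.

End Embeddings.

Section NormPoly.
Variable K : fieldExtType rat.
Let d := \dim {: K}.
Let e := vbasis {: K}.

(** The characteristic polynomial of multiplication by x, written in a basis of [K] over Q; unlike
    the minimal polynomial its degree does not depend on x. *)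
Definition norm_poly (x : K) : {poly rat} :=
  char_poly (\matrix_(j < d, k < d) coord e k (x * e`_j)).

Lemma norm_poly_monic x : norm_poly x \is monic. Proof. exact: char_poly_monic. Qed.
Lemma size_norm_poly x : size (norm_poly x) = d.+1. Proof. exact: size_char_poly. Qed.

Variables (L : fieldType) (r : {rmorphism rat -> L}) (s : 'I_d -> {rmorphism K -> L}).
Hypothesis sfree : forall c : 'I_d -> L, (forall x, \sum_i c i * s i x = 0) -> forall i, c i = 0.

Lemma embedding_scale (f : {rmorphism K -> L}) q x : f (q *: x) = r q * f x.
Proof.
rewrite -mulr_algl rmorphM; congr (_ * _).
by rewrite -[LHS]/((f \o in_alg K) q) (fmorph_eq_rat (f \o in_alg K)) (fmorph_eq_rat r).
Qed.

(** The matrix of the s_i (e_k) conjugates multiplication by x into the diagonal matrix of the s_i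
    x; it is invertible because the embeddings are linearly independent. *)
Lemma norm_polyE x : map_poly r (norm_poly x) = \prod_i ('X - (s i x)%:P).
Proof.
rewrite map_char_poly; set A := map_mx r _.
pose V : 'M[L]_d := \matrix_(k, i) s i e`_k.
pose D : 'M[L]_d := diag_mx (\row_i s i x).
have coordE (y : K) : y = \sum_k coord e k y *: e`_k.
  by rewrite -coord_vbasis// memvf.
have AV : A *m V = V *m D.
  apply/matrixP => j i; rewrite mul_mx_diag !mxE.
  under eq_bigr do rewrite !mxE -embedding_scale.
  by rewrite -rmorph_sum -coordE rmorphM mulrC.
have VU : V \in unitmx.
  rewrite -unitmx_tr -row_free_unit -kermx_eq0; apply/eqP/row_matrixP => k.
  rewrite row0; set u := row k _.
  have u0 : u *m V^T = 0 by apply/eqP; rewrite -sub_kermx row_sub.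
  apply/rowP => i; rewrite [RHS]mxE; apply: (sfree (c := fun i => u 0 i)) => y.
  rewrite (coordE y); under eq_bigr do rewrite rmorph_sum mulr_sumr.
  rewrite exchange_big big1//= => j _.
  under eq_bigr do rewrite embedding_scale mulrCA.
  rewrite -mulr_sumr; have /matrixP/(_ 0 j) := u0; rewrite !mxE => u0j.
  by rewrite (eq_bigr (fun i => u 0 i * V^T i j)) ?u0j ?mulr0// => l _; rewrite !mxE.
have cp : char_poly A = char_poly D.
  have VX : \det (map_mx polyC V) != 0.
    by rewrite det_map_mx polyC_eq0 -unitfE -unitmxE.
  apply: (mulIf VX); rewrite /char_poly -det_mulmx [in RHS]mulrC -det_mulmx; congr (\det _).
  rewrite /char_poly_mx mulmxBl mulmxBr -!map_mxM AV.
  by rewrite mul_scalar_mx mul_mx_scalar.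
rewrite cp char_poly_trig ?diag_mx_is_trig//.
by apply: eq_bigr => i _; rewrite !mxE eqxx mulr1n.
Qed.

Lemma norm_poly_root x : (map_poly (in_alg K) (norm_poly x)).[x] = 0.
Proof.
have d0 : (0 < d)%N by rewrite adim_gt0.
pose i := Ordinal d0; apply: (fmorph_inj (s i)); rewrite rmorph0 -horner_map /= -map_poly_comp.
have -> : map_poly (s i \o in_alg K) (norm_poly x) = map_poly r (norm_poly x).
  by apply: eq_map_poly => q /=; rewrite embedding_scale rmorph1 mulr1.
rewrite norm_polyE horner_prod (bigD1 i)//= hornerXsubC subrr mul0r.
by [].
Qed.

Definition norm_rat (x : K) : rat := (-1) ^+ d * (norm_poly x)`_0.

Lemma norm_ratE x : r (norm_rat x) = \prod_i s i x.
Proof.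
rewrite rmorphM rmorphXn rmorphN1 -coef_map norm_polyE -horner_coef0 horner_prod.
under eq_bigr do rewrite hornerXsubC sub0r.
by rewrite prodrN card_ord mulrA -exprMn mulN1r opprK expr1n mul1r.
Qed.

End NormPoly.

Section CoefficientBounds.
Variables (R : realType) (L : fieldType) (v : L -> R).
Hypothesis vP : absolute_value v.

(** Every coefficient below the leading one is a sum of at most 2^n products containing at least one
    root. The induction also carries the bound 2^n valid for all coefficients. *)
Lemma prod_XsubC_coef_small (I : Type) (w : seq I) (z : I -> L) (del : R) : 0 <= del <= 1 ->
  (forall i, v (z i) <= del) -> forall j, (j < size w)%N ->
  v (\prod_(i <- w) ('X - (z i)%:P))`_j <= 2 ^+ size w * del.
Proof.
move=> /andP[d0 d1] zd.
have main : (forall j, v (\prod_(i <- w) ('X - (z i)%:P))`_j <= 2 ^+ size w) /\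
  forall j, (j < size w)%N -> v (\prod_(i <- w) ('X - (z i)%:P))`_j <= 2 ^+ size w * del.
  elim: w => [|i w [IH1 IH2]].
    split => // j; rewrite big_nil coef1 expr0; case: (j == 0%N); rewrite ?(av1 vP)//.
    by rewrite (av0 vP).
  rewrite big_cons /=; set P := \prod_(k <- w) _ in IH1 IH2 *.
  have cE j : (('X - (z i)%:P) * P)`_j = (if j == 0%N then 0 else P`_j.-1) - z i * P`_j.
    by rewrite mulrBl coefB coefXM coefCM.
  have zP j : v (z i * P`_j) <= 2 ^+ size w * del.
    by rewrite (avM vP) mulrC ler_pM ?(av_ge0 vP).
  have p0 : 0 <= 2 ^+ size w :> R by rewrite exprn_ge0.
  split => j; rewrite cE.
    rewrite (le_trans (avB vP _ _))// exprS; have := zP j.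
    have : v (if j == 0%N then 0 else P`_j.-1) <= 2 ^+ size w.
      by case: ifP => _; rewrite ?(av0 vP).
    have : 2 ^+ size w * del <= 2 ^+ size w by rewrite ler_piMr.
    lra.
  move=> jw; rewrite (le_trans (avB vP _ _))// exprS; have := zP j.
  have : v (if j == 0%N then 0 else P`_j.-1) <= 2 ^+ size w * del.
    case: j jw => [|j] jw /=; first by rewrite (av0 vP) mulr_ge0.
    exact: IH2.
  lra.
by case: main.
Qed.

Lemma prod_XsubC_coef_bound (I : Type) (w : seq I) (z : I -> L) j :
  v (\prod_(i <- w) ('X - (z i)%:P))`_j <= 2 ^+ size w * \prod_(i <- w) Num.max 1 (v (z i)).
Proof.
elim: w j => [|i w IH] j.
  by rewrite !big_nil coef1 expr0 mulr1; case: (j == 0%N); rewrite ?(av1 vP) ?(av0 vP).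
rewrite !big_cons /=; set P := \prod_(k <- w) _ in IH *; set M := \prod_(k <- w) _ in IH *.
rewrite mulrBl coefB coefXM coefCM (le_trans (avB vP _ _))// (avM vP).
have M0 : 0 <= 2 ^+ size w * M.
  by rewrite mulr_ge0 ?exprn_ge0// prodr_ge0// => k _; rewrite le_max ler01.
have h1 : v (if j == 0%N then 0 else P`_j.-1) <= Num.max 1 (v (z i)) * (2 ^+ size w * M).
  rewrite -[leLHS]mul1r ler_pM ?(av_ge0 vP) ?le_max ?lexx//.
  by case: ifP => _; rewrite ?(av0 vP).
have h2 : v (z i) * v P`_j <= Num.max 1 (v (z i)) * (2 ^+ size w * M).
  by rewrite ler_pM ?(av_ge0 vP) ?le_max ?lexx ?orbT.
by rewrite exprS; move: h1 h2; lra.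
Qed.

Lemma prod_XsubC_coef_bound_ultra (I : Type) (w : seq I) (z : I -> L) j :
  (forall x y, v (x + y) <= Num.max (v x) (v y)) ->
  v (\prod_(i <- w) ('X - (z i)%:P))`_j <= \prod_(i <- w) Num.max 1 (v (z i)).
Proof.
move=> ultra; elim: w j => [|i w IH] j.
  by rewrite !big_nil coef1; case: (j == 0%N); rewrite ?(av1 vP) ?(av0 vP).
rewrite !big_cons /=; set P := \prod_(k <- w) _ in IH *; set M := \prod_(k <- w) _ in IH *.
rewrite mulrBl coefB coefXM coefCM (le_trans (ultra _ _))// ge_max (avN vP) (avM vP).
have M0 : 0 <= M by rewrite prodr_ge0// => k _; rewrite le_max ler01.
rewrite -[X in (X <= _) && _]mul1r !ler_pM ?(av_ge0 vP) ?le_max ?lexx ?orbT//.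
by case: ifP => _; rewrite ?(av0 vP).
Qed.

End CoefficientBounds.

(** * Places above a fixed absolute value of Q *)

Section LocalSum.
Variables (R : realType) (K : fieldExtType rat) (a : rat -> R).
Hypothesis aP : absolute_value a.
Variable q0 : rat.
Hypothesis q0P : 0 < a q0 < 1.
Variables (L : valField R) (r : {rmorphism rat -> L}).
Hypothesis ra : forall q, vabs (r q) = a q.
Let d := \dim {: K}.
Variable s : 'I_d -> {rmorphism K -> L}.
Hypothesis sfree : forall c : 'I_d -> L, (forall x, \sum_i c i * s i x = 0) -> forall i, c i = 0.
Let LP := vabsP L.

Definition embedding_place (i : 'I_d) : K -> R := fun x => vabs (s i x).

Lemma embedding_place_over i : lies_over a (embedding_place i).
Proof.
split; first split => [x|x|x y|x y].
- exact: (av_ge0 LP).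
- by split => [/eqP|->]; rewrite /embedding_place ?rmorph0 ?(av0 LP)// (av_eq0 LP) fmorph_eq0 => /eqP.
- by rewrite /embedding_place rmorphM (avM LP).
- by rewrite /embedding_place rmorphD (avD LP).
- by move=> q; rewrite /embedding_place fmorph_rat -(fmorph_eq_rat r) ra.
Qed.

Let u := undup [seq embedding_place i | i <- enum 'I_d].

Let u_over w : w \in u -> lies_over a w.
Proof. by rewrite mem_undup => /mapP[i _ ->]; exact: embedding_place_over. Qed.

(** Otherwise v could be separated from the finitely many absolute values coming from embeddings:
    some y has v y > 1 while all its conjugates are tiny. The nonleading coefficients of its
    characteristic polynomial are then tiny too, so that no root can be larger than 1 for v. *)
Lemma place_is_embedding v : lies_over a v -> v \in u.
Proof.
move=> vo; apply/negPn/negP => vu.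
pose n := size (v :: u); pose w (i : 'I_n) := nth v (v :: u) i.
have wo i : lies_over a (w i).
  have := mem_nth v (ltn_ord i : (i < size (v :: u))%N); rewrite in_cons => /predU1P[|].
    by rewrite /w => ->.
  exact: u_over.
have winj : injective w.
  move=> i j /eqP; rewrite nth_uniq//; first by move/eqP/val_inj.
  by rewrite /= vu undup_uniq.
pose i0 : 'I_n := Ordinal (ltn0Sn (size u)).
have i0n : i0 \notin [seq i <- enum 'I_n | i != i0] by rewrite mem_filter eqxx.
have [x [vx xs]] := separate_from_all (fun i => (wo i).1) winj q0P (fun i => (wo i).2 q0) i0n.
have x1 i : embedding_place i x < 1.
  have iu : embedding_place i \in u by rewrite mem_undup map_f ?mem_enum.
  have ju : ((index (embedding_place i) u).+1 < n)%N by rewrite /n /= ltnS index_mem.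
  have := xs (Ordinal ju); rewrite mem_filter mem_enum andbT /w /= nth_index//; apply.
  by [].

have vP := vo.1.
have d0 : (0 < d)%N by rewrite adim_gt0.
(* Chosen so that the d lower coefficients, each of size at most 2^d del, add up to less than 1. *)
pose del : R := (d%:R * 2 ^+ d + 1)^-1.
have D0 : 0 <= d%:R * 2 ^+ d :> R by rewrite mulr_ge0 ?exprn_ge0.
have del0 : 0 < del by rewrite invr_gt0 ltr_wpDl.
have del1 : del <= 1 by rewrite invf_le1 ?ltr_wpDl// lerDr.
have : \forall N \near \oo, forall i, i \in enum 'I_d -> embedding_place i x ^+ N < del.
  by apply: near_all_seq => i _; apply: av_exp_small => //; case: (embedding_place_over i).
move=> /filterI/(_ (nbhs_infty_gt 0))[N _ /(_ N (leqnn N))[/= hN N0]].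
pose y := x ^+ N.
have vy : 1 < v y by rewrite (avX vP) (expr_gt1 N0 (av_ge0 vP _)).
have sy i : vabs (s i y) <= del.
  by rewrite rmorphXn (avX LP) ltW// hN ?mem_enum.
have cj j : (j < d)%N -> a (norm_poly y)`_j <= 2 ^+ d * del.
  move=> jd; rewrite -ra -coef_map (norm_polyE r sfree).
  have := @prod_XsubC_coef_small _ _ _ LP _ (index_enum 'I_d) (fun i => s i y) del.
  rewrite (_ : size (index_enum 'I_d) = d); last by rewrite -[RHS]card_ord cardE enumT.
  by apply => //; rewrite ltW.
have := norm_poly_root r sfree y; rewrite horner_coef size_map_poly size_norm_poly.
rewrite big_ord_recr /= coef_map /=.
have -> : (norm_poly y)`_d = 1.
  by have := norm_poly_monic y; rewrite monicE lead_coefE size_norm_poly => /eqP.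
rewrite scale1r mul1r => /eqP; rewrite addrC addr_eq0 => /eqP yE.
have : v y ^+ d <= d%:R * (2 ^+ d * del) * v y ^+ d.-1.
  rewrite -(avX vP) yE (avN vP) (le_trans (av_sum vP _ _ _))//.
  rewrite -mulrA mulr_natl -[X in _ *+ X](card_ord d) -sumr_const; apply: ler_sum => j _.
  rewrite coef_map /= mulr_algl (over_scale _ _ vo) (avX vP).
  rewrite ler_pM ?(av_ge0 aP) ?exprn_ge0 ?(av_ge0 vP) ?cj//.
  by rewrite ler_weXn2l ?(ltW vy)// -ltnS prednK.
rewrite -{1}(prednK d0) exprS ler_pM2r ?exprn_gt0 ?(lt_trans _ vy)// => h.
have : d%:R * (2 ^+ d * del) < 1.
  by rewrite mulrA /del ltr_pdivrMr ?ltr_wpDl// mul1r ltrDl.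
by move=> h'; have := lt_trans (lt_le_trans vy h) h'; rewrite ltxx.
Qed.

(** If more embeddings than the local degree induced w, some nontrivial combination of them would
    vanish on a maximal independent family, hence on its rational span, hence on all of [K] by
    density; this contradicts their linear independence. *)
Let count_le w : w \in u -> (count_mem w [seq embedding_place i | i <- enum 'I_d] <= local_degree a w)%N.
Proof.
move=> wu; have wo := u_over wu; have wP := wo.1.
have [[e ei] _] := local_degreeP aP wo.
pose I := [seq i <- enum 'I_d | embedding_place i == w].
have -> : count_mem w [seq embedding_place i | i <- enum 'I_d] = size I.
  by rewrite count_map size_filter.
set m := size I; set n := local_degree a w in e ei *.
rewrite leqNgt; apply/negP => nm.
have Iw (i : 'I_m) x : vabs (s (tnth (in_tuple I) i) x) = w x.
  have : tnth (in_tuple I) i \in I by exact: mem_tnth.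
  by rewrite mem_filter => /andP[/eqP <- _].
pose M : 'M[L]_(m, n) := \matrix_(i, j) s (tnth (in_tuple I) i) (e j).
have /rowV0Pn[c cM c0] : kermx M != 0.
  by rewrite -mxrank_eq0 mxrank_ker subn_eq0 -ltnNge (leq_ltn_trans (rank_leq_col M)).
have {}cM : c *m M = 0 by apply/eqP; rewrite -sub_kermx.
have cx x : \sum_i c 0 i * s (tnth (in_tuple I) i) x = 0.
  apply/eqP; rewrite -(av_eq0 LP) eq_le (av_ge0 LP) andbT.
  apply/ler_addgt0Pr => eps eps0; rewrite add0r.
  pose C := \sum_i vabs (c 0 i).
  have C0 : 0 <= C by apply: sumr_ge0 => i _; exact: av_ge0.
  have e1 : 0 < eps / (C + 1) by rewrite divr_gt0//; lra.
  have [q xq] := independent_dense aP wo ei x e1.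
  have -> : \sum_i c 0 i * s (tnth (in_tuple I) i) x =
      \sum_i c 0 i * s (tnth (in_tuple I) i) (x - comb q e).
    rewrite -[LHS]subr0; under [RHS]eq_bigr do rewrite rmorphB mulrBr.
    rewrite sumrB; congr (_ - _); apply/esym.
    under eq_bigr do rewrite rmorph_sum mulr_sumr.
    rewrite exchange_big big1//= => j _.
    under eq_bigr do rewrite (embedding_scale r) mulrCA.
    rewrite -mulr_sumr; have /matrixP/(_ 0 j) := cM; rewrite !mxE => cj.
    by rewrite (eq_bigr (fun i => c 0 i * M i j)) ?cj ?mulr0// => i _; rewrite mxE.
  rewrite (le_trans (av_sum LP _ _ _))//.
  apply: (@le_trans _ _ (C * (eps / (C + 1)))).
    rewrite mulr_suml; apply: ler_sum => i _.
    by rewrite (avM LP) Iw ler_wpM2l ?(av_ge0 LP)// ltW.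
  by rewrite mulrCA ler_piMr ?(ltW eps0)// ler_pdivrMr ?mul1r; lra.
move/eqP: c0; apply; apply/rowP => i; rewrite [RHS]mxE.
pose c' (k : 'I_d) := \sum_(i < m | tnth (in_tuple I) i == k) c 0 i.
have uI : uniq I by rewrite filter_uniq// enum_uniq.
have := @sfree c' _ (tnth (in_tuple I) i).
rewrite /c' (big_pred1 i) => [|k]; last first.
  have /tuple_uniqP tI : uniq (in_tuple I) by [].
  by rewrite (inj_eq tI).
apply => x; rewrite -[RHS](cx x).
rewrite (partition_big (fun i => tnth (in_tuple I) i) predT)//=.
by apply: eq_bigr => k _; rewrite mulr_suml; apply: eq_bigr => j /eqP ->.
Qed.

Let u_sum (V : nmodType) (F : (K -> R) -> V) :
  \sum_i F (embedding_place i) = \sum_(w <- u) F w *+ count_mem w [seq embedding_place i | i <- enum 'I_d].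
Proof.
rewrite (big_undup_iterop_count +%R [seq embedding_place i | i <- enum 'I_d] xpredT F).
by rewrite big_map big_enum.
Qed.

(** The multiplicities add up to d, they are bounded by the local degrees, and the local degrees add
    up to at most d; hence equality holds throughout. *)
Let count_eq w : w \in u ->
  count_mem w [seq embedding_place i | i <- enum 'I_d] = local_degree a w.
Proof.
move=> wu; pose m w := count_mem w [seq embedding_place i | i <- enum 'I_d].
have sm : (\sum_(w <- u) m w = d)%N.
  have := @u_sum nat (fun=> 1%N); rewrite sum1_card card_ord => ->.
  by apply: eq_bigr => x _; rewrite -mulr_natl mulr1 natn.
have sn : (\sum_(w <- u) local_degree a w <= d)%N.
  rewrite (big_nth w) big_mkord; apply: (@sum_local_degree _ _ _ aP _ _ q0) => //.
    by move=> i j /eqP; rewrite nth_uniq ?undup_uniq// => /eqP/val_inj.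
  by move=> i; apply: u_over; exact: mem_nth.
apply/eqP; rewrite eqn_leq count_le// leqNgt; apply/negP => mn.
move: sn; rewrite -sm leqNgt => /negP; apply.
rewrite (bigD1_seq w)//= ?undup_uniq// [ltnRHS](bigD1_seq w)//= ?undup_uniq//.
rewrite -addSn leq_add// big_seq_cond [leqRHS]big_seq_cond; apply: leq_sum => x /andP[xu _].
exact: count_le.
Qed.

Lemma local_degree_sum : exists t : seq (K -> R), [/\ uniq t,
  (forall v, lies_over a v <-> v \in t) &
  forall F : (K -> R) -> R, \sum_(w <- t) (local_degree a w)%:R * F w = \sum_i F (embedding_place i)].
Proof.
exists u; split; first exact: undup_uniq.
  by move=> v; split; [exact: place_is_embedding | exact: u_over].
move=> F; rewrite u_sum big_seq [RHS]big_seq; apply: eq_bigr => w wu.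
by rewrite mulr_natl count_eq.
Qed.

End LocalSum.

(** * Product formula *)

Lemma ln_prod (R : realType) (I : Type) (s : seq I) (F : I -> R) :
  (forall i, 0 < F i) -> ln (\prod_(i <- s) F i) = \sum_(i <- s) ln (F i).
Proof.
move=> F0; elim: s => [|i s IH]; first by rewrite !big_nil ln1.
by rewrite !big_cons lnM ?posrE ?IH// prodr_gt0.
Qed.

Section RationalPlaces.
Variable R : realType.

Lemma ln_padic (p : nat) q : prime p -> q != 0 ->
  ln (padic_abs R p q) = (logn p `|denq q|)%:R * ln p%:R - (logn p `|numq q|)%:R * ln p%:R.
Proof.
move=> pp q0; have p0 : 0 < p%:R :> R by rewrite ltr0n prime_gt0.
rewrite /padic_abs (negPf q0) ln_div ?posrE ?exprn_gt0//.
by rewrite !lnXn// !mulr_natl.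
Qed.

Lemma sum_logn (n B : nat) : (0 < n < B)%N ->
  \sum_(0 <= p < B | prime p) (logn p n)%:R * ln p%:R = ln n%:R :> R.
Proof.
move=> /andP[n0 nB].
have : n = (\prod_(0 <= p < B | predT p) p ^ logn p n)%N.
  rewrite -{1}(partnT n0); case: B nB => // B; rewrite ltnS => nB.
  by rewrite (widen_partn _ nB).
move=> /(congr1 (fun m => ln (m%:R : R))) ->.
rewrite [X in (X%:R)](_ : _ = \prod_(0 <= p < B | prime p) p ^ logn p n)%N; last first.
  rewrite [RHS]big_mkcond; apply: eq_bigr => p _; case: ifPn => // /negPf pp.
  by rewrite lognE pp.
rewrite natr_prod big_mkcond [in RHS]big_mkcond /= [in RHS]ln_prod => [|p]; last first.
  by case: ifP => // pp; rewrite ltr0n expn_gt0 prime_gt0.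
apply: eq_bigr => p _; case: ifP => pp; rewrite ?ln1//.
by rewrite natrX lnXn ?ltr0n ?prime_gt0// mulr_natl.
Qed.

Lemma absz_gt0 (z : int) : z != 0 -> (0 < `|z|)%N.
Proof. by rewrite lt0n absz_eq0. Qed.

Lemma ratr_absE q : `|ratr q : R| = `|numq q|%:R / `|denq q|%:R.
Proof.
by rewrite /ratr normrM normfV -!intr_norm -!abszE -!pmulrn.
Qed.

Lemma sum_ln_padic q B : q != 0 -> (`|numq q| < B)%N -> (`|denq q| < B)%N ->
  \sum_(0 <= p < B | prime p) ln (padic_abs R p q) = - ln `|ratr q|.
Proof.
move=> q0 nB dB; have n0 : (0 < `|numq q|)%N by rewrite absz_gt0 ?numq_eq0.
have d0 : (0 < `|denq q|)%N by rewrite absz_gt0 ?denq_eq0.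
rewrite (eq_bigr (fun p : nat => (logn p `|denq q|)%:R * ln p%:R - (logn p `|numq q|)%:R * ln p%:R : R)); last first.
  by move=> p pp; exact: ln_padic.
rewrite sumrB !sum_logn ?n0 ?d0//.
by rewrite ratr_absE ln_div ?posrE ?ltr0n// opprB.
Qed.

Lemma sum_ln_max_padic q B : (`|denq q| < B)%N ->
  \sum_(0 <= p < B | prime p) ln (Num.max 1 (padic_abs R p q)) = ln `|denq q|%:R.
Proof.
move=> dB; have d0 : (0 < `|denq q|)%N by rewrite absz_gt0 ?denq_eq0.
rewrite -(@sum_logn _ B) ?d0//; apply: eq_bigr => p pp; have p0 := prime_gt0 pp.
have p1 : 1 <= p%:R :> R by rewrite ler1n.
have [->|q0] := eqVneq q 0.
  by rewrite /padic_abs eqxx max_l ?ler01// ln1 logn1 mul0r.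
have n0 : (0 < `|numq q|)%N by rewrite absz_gt0 ?numq_eq0.
have [pn|pn] := boolP (p %| `|numq q|)%N.
  have pd : logn p `|denq q| = 0%N.
    apply/eqP; rewrite -leqn0 leqNgt logn_gt0 mem_primes pp d0 /=.
    have := coprime_num_den q; rewrite /coprime => /eqP g1; apply/negP => pd.
    by have := dvdn_gcd p `|numq q| `|denq q|; rewrite g1 pn pd dvdn1 => /eqP p1'; rewrite p1' in pp.
  rewrite pd mul0r max_l ?ln1// /padic_abs (negPf q0) pd expr0 div1r invf_le1 ?exprn_ege1//.
  by rewrite exprn_gt0// ltr0n.
have pnl : logn p `|numq q| = 0%N.
  by apply/eqP; rewrite -leqn0 leqNgt logn_gt0 mem_primes pp n0 /= (negPf pn).
rewrite max_r; first by rewrite ln_padic// pnl mul0r subr0.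
by rewrite /padic_abs (negPf q0) pnl expr0 divr1 exprn_ege1.
Qed.

Lemma padic_natr_le1 p n : prime p -> padic_abs R p n%:R <= 1.
Proof.
move=> pp; have p0 := prime_gt0 pp.
rewrite /padic_abs; case: eqP => // _.
have -> : denq n%:R = 1 by rewrite pmulrn denq_int.
by rewrite logn1 expr0 div1r invf_le1 ?exprn_ege1 ?exprn_gt0 ?ltr0n ?ler1n.
Qed.

Lemma padic_le1 p q : prime p -> (`|denq q| <= p)%N -> denq q != p -> padic_abs R p q <= 1.
Proof.
move=> pp dp dnp; have p0 := prime_gt0 pp.
rewrite /padic_abs; case: eqP => // _.
have -> : logn p `|denq q| = 0%N.
  apply/eqP; rewrite -leqn0 leqNgt logn_gt0 mem_primes pp /= absz_gt0 ?denq_eq0//=.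
  apply/negP => /dvdn_leq; rewrite absz_gt0 ?denq_eq0// => /(_ isT) pd.
  by move/eqP: dnp; apply; rewrite -absz_denq; congr Posz; apply/eqP; rewrite eqn_leq dp.
by rewrite expr0 div1r invf_le1 ?exprn_ege1 ?exprn_gt0 ?ltr0n ?ler1n.
Qed.

Lemma padic_self p : prime p -> padic_abs R p p%:R = p%:R^-1.
Proof.
move=> pp; have p0 := prime_gt0 pp.
rewrite /padic_abs pnatr_eq0 eqn0Ngt p0 /= (_ : p%:R = p%:Z%:~R :> rat)// denq_int numq_int.
by rewrite logn1 expr0 div1r /= -[X in logn p X]expn1 pfactorK.
Qed.

Lemma padic_other p q : prime p -> prime q -> p <> q -> padic_abs R p q%:R = 1.
Proof.
move=> pp pq npq; have q0 := prime_gt0 pq.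
rewrite /padic_abs pnatr_eq0 eqn0Ngt q0 /= (_ : q%:R = q%:Z%:~R :> rat)// denq_int numq_int.
have -> : logn p `|q%:Z| = 0%N.
  by apply/eqP; rewrite -leqn0 leqNgt logn_gt0 mem_primes pp q0 /= dvdn_prime2//; apply/negP => /eqP.
by rewrite logn1 expr0 divr1.
Qed.

End RationalPlaces.

Lemma finite_rat_bounded (M : nat) : finite_set [set q : rat | (`|denq q| <= M)%N /\ (`|numq q| <= M)%N].
Proof.
pose f (a b : nat) : rat := a%:R / b%:R.
apply: (@sub_finite_set _ _ ([set f x y | x in `I_M.+1 & y in `I_M.+1] `|`
   [set - f x y | x in `I_M.+1 & y in `I_M.+1])); last first.
  by rewrite finite_setU; split; apply: finite_image2; exact: finite_II.
move=> q /= [dM nM].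
have qE : q = (numq q)%:~R / `|denq q|%:R.
  by rewrite -{1}(divq_num_den q) -absz_denq -pmulrn.
have [n0|n0] := leP 0 (numq q); [left|right]; exists `|numq q|%N => //; exists `|denq q|%N => //.
  by rewrite /f {3}qE pmulrn gez0_abs.
by rewrite /f {3}qE pmulrn ltz0_abs// rmorphN mulNr opprK.
Qed.

Section PlaceExtensionality.
Variables (R : realType) (K : fieldExtType rat).

Definition over_prime p (v : finite_place R K) := forall q : rat, v (ratr q) = padic_abs R p q.

Lemma finite_place_ext (v w : finite_place R K) : fin_abs v = fin_abs w -> v = w.
Proof.
by case: v w => [f fP fr] [g gP gr] /= fg; subst g; congr FinitePlace; exact: Prop_irrelevance.
Qed.

Lemma infinite_place_ext (v w : infinite_place R K) : inf_abs v = inf_abs w -> v = w.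
Proof.
by case: v w => [f fP fr] [g gP gr] /= fg; subst g; congr InfinitePlace; exact: Prop_irrelevance.
Qed.

Lemma over_prime_uniq p q v : prime p -> prime q -> over_prime p v -> over_prime q v -> p = q.
Proof.
move=> pp pq vp vq; apply: contrapT => npq.
have := vp p%:R; rewrite vq padic_self// padic_other// => [/eqP|]; last exact/nesym.
by rewrite eq_sym invr_eq1 pnatr_eq1 => /eqP p1; rewrite p1 in pp.
Qed.

Lemma lies_over_absolute a (v : K -> R) : lies_over a v -> absolute_value a.
Proof.
move=> [vP va]; have aE q : a q = v (in_alg K q).
  by rewrite -va -[ratr q]mulr1 ratr_scale.
split => [q|q|q q'|q q']; rewrite ?aE; first exact: av_ge0.
- split => [/eqP|->]; last by rewrite rmorph0 (av0 vP).
  by rewrite (av_eq0 vP) fmorph_eq0 => /eqP.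
- by rewrite rmorphM (avM vP).
- by rewrite rmorphD (avD vP).
Qed.

Lemma over_prime_lies_over p v : over_prime p v -> lies_over (padic_abs R p) v.
Proof. by move=> vp; split => //; exact: fin_absP. Qed.

Lemma fin_place_ultra (v : finite_place R K) x y : v (x + y) <= Num.max (v x) (v y).
Proof.
have vP := fin_absP v; have [p pp vp] := fin_abs_rat v.
apply: ultrametric_of_natr_le1 => [z||//|z z'|z z'|n].
- exact: av_ge0.
- exact: av0.
- exact: av1.
- exact: avM.
- exact: avD.
- by rewrite -ratr_nat vp padic_natr_le1.
Qed.

End PlaceExtensionality.

Section LocalSums.
Variables (R : realType) (K : fieldExtType rat) (a : rat -> R).
Hypothesis aP : absolute_value a.
Variable q0 : rat.
Hypothesis q0P : 0 < a q0 < 1.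
Variables (L : valField R) (r : {rmorphism rat -> L}).
Hypothesis ra : forall q, vabs (r q) = a q.
Hypothesis split : forall P : {poly rat}, exists s : seq L,
  map_poly r P = r (lead_coef P) *: \prod_(z <- s) ('X - z%:P).
Let d := \dim {: K}.

(** Sums over the places above [a] become sums over the embeddings, that is, over the roots of the
    characteristic polynomial. The coefficient bound comes in two forms, with the loss d log 2 in
    general and without loss in the ultrametric case. *)
Lemma local_sums : exists t : seq (K -> R), [/\ uniq t, (forall v, lies_over a v <-> v \in t),
  (forall x, x != 0 -> \sum_(w <- t) (local_degree a w)%:R * ln (w x) = ln (a (norm_rat x))),
  (forall x j, ln (Num.max 1 (a (norm_poly x)`_j)) <=
     d%:R * ln 2 + \sum_(w <- t) (local_degree a w)%:R * ln (Num.max 1 (w x))) &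
  ((forall n, a n%:R <= 1) -> forall x j, ln (Num.max 1 (a (norm_poly x)`_j)) <=
     \sum_(w <- t) (local_degree a w)%:R * ln (Num.max 1 (w x)))].
Proof.
have [s [sfree _]] := embeddings_exist K split.
have [t [ut tP tF]] := local_degree_sum aP q0P ra sfree.
have LP := vabsP L.
have max0 x i : 0 < Num.max 1 (embedding_place s i x) by rewrite lt_max ltr01.
have bound x j (c : R) : 0 <= c -> a (norm_poly x)`_j <= expR c * \prod_i Num.max 1 (embedding_place s i x) ->
    ln (Num.max 1 (a (norm_poly x)`_j)) <= c + \sum_(w <- t) (local_degree a w)%:R * ln (Num.max 1 (w x)).
  move=> c0 h; rewrite (tF (fun w => ln (Num.max 1 (w x)))) -[c in leRHS]expRK -ln_prod//.
  rewrite -lnM ?posrE ?expR_gt0 ?prodr_gt0//.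
  rewrite ler_ln ?posrE ?lt_max ?ltr01 ?mulr_gt0 ?expR_gt0 ?prodr_gt0//.
  rewrite ge_max h andbT; apply: mulr_ege1; first by rewrite -expR0 ler_expR.
  apply: (@big_ind _ (fun y : R => 1 <= y)) => // [y z|i _]; [exact: mulr_ege1 | by rewrite le_max lexx].
have sz : size (index_enum 'I_d) = d by rewrite -[RHS]card_ord cardE enumT.
exists t; split => //.
- move=> x x0; rewrite (tF (fun w => ln (w x))) -ra (norm_ratE r sfree) (av_prod LP) ln_prod//.
  by move=> i; rewrite (av_gt0 LP) fmorph_eq0.
- move=> x j; apply: bound; first by rewrite mulr_ge0// ln_ge0// ler1n.
  rewrite [d%:R * _]mulrC expRM_natr lnK ?posrE// -ra -coef_map (norm_polyE r sfree).
  by rewrite -[X in 2 ^+ X]sz; exact: prod_XsubC_coef_bound.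
- move=> a1 x j; rewrite -[leRHS]add0r; apply: bound => //.
  rewrite expR0 mul1r -ra -coef_map (norm_polyE r sfree).
  apply: prod_XsubC_coef_bound_ultra => //.
  apply: ultrametric_of_natr_le1 => [z||//|z z'|z z'|n].
  + exact: av_ge0.
  + exact: av0.
  + exact: av1.
  + exact: avM.
  + exact: avD.
  + by rewrite -(rmorph_nat r) ra.
Qed.

End LocalSums.

Section NormNonzero.
Variable K : fieldExtType rat.

Let alg_embeddings : exists s : 'I_(\dim {: K}) -> {rmorphism K -> algC},
  forall c : 'I_(\dim {: K}) -> algC, (forall x, \sum_i c i * s i x = 0) -> forall i, c i = 0.
Proof.
have [|s [sfree _]] := @embeddings_exist K algC (ratr : {rmorphism rat -> algC}).
  move=> P; have [w wE] := closed_field_poly_normal (map_poly (ratr : {rmorphism rat -> algC}) P).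
  by exists w; rewrite {1}wE lead_coef_map.
by exists s.
Qed.

Lemma norm_poly_root_K (x : K) : root (map_poly (in_alg K) (norm_poly x)) x.
Proof. by have [s sfree] := alg_embeddings; apply/rootP; exact: (norm_poly_root (ratr : {rmorphism rat -> algC}) sfree). Qed.

Lemma norm_rat_neq0 (x : K) : x != 0 -> norm_rat x != 0.
Proof.
have [s sfree] := alg_embeddings => x0.
rewrite -(fmorph_eq0 (ratr : {rmorphism rat -> algC})) (norm_ratE _ sfree).
by apply/prodf_neq0 => i _; rewrite fmorph_eq0.
Qed.

End NormNonzero.

(** * Sums over the finite places *)

Section FinitePlaceSums.
Variables (R : realType) (K : fieldExtType rat) (C : completions R K).
Let d := \dim {: K}.
Let N := N_fin C.

Let d0 : 0 < d%:R :> R.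
Proof. by rewrite ltr0n adim_gt0. Qed.

Lemma N_fin_ge0 v : 0 <= N_fin C v.
Proof. by rewrite divr_ge0. Qed.

Lemma N_inf_ge0 v : 0 <= N_inf C v.
Proof. by rewrite divr_ge0. Qed.

Lemma rational_split (v : K -> R) (L : valField R) (s : {rmorphism K -> L}) : is_Cv v s ->
  forall P : {poly rat}, exists w : seq L, map_poly (s \o in_alg K) P =
    (s \o in_alg K) (lead_coef P) *: \prod_(z <- w) ('X - z%:P).
Proof.
move=> [_ _ [W [[EW WF _ Wc] _]]] P.
have [|w _ wE] := @poly_closed_split _ _ W WF Wc (map_poly (s \o in_alg K) P).
  move=> i; rewrite coef_map; apply: EW => e e0.
  by exists (s (in_alg K P`_i)); [exists (in_alg K P`_i)|rewrite subrr (av0 (vabsP L))].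
by exists w; rewrite {1}wE lead_coef_map.
Qed.

Lemma lift_finite_places (p : nat) (t : seq (K -> R)) : prime p ->
  (forall w, w \in t -> lies_over (padic_abs R p) w) ->
  exists t' : seq (finite_place R K), map (@fin_abs R K) t' = t.
Proof.
move=> pp; elim: t => [|w t IH] tP; first by exists [::].
have [|t' t'E] := IH; first by move=> u ut; apply: tP; rewrite in_cons ut orbT.
have [wP wo] := tP w (mem_head _ _).
by exists (FinitePlace wP (ex_intro2 _ _ p pp wo) :: t'); rewrite /= t'E.
Qed.

(** The completion at any one place above p receives all embeddings of [K], so a single field
    accounts for all the places above p. *)
Lemma fin_places_over p : prime p -> exists t : seq (finite_place R K),
  [/\ uniq t, forall v, over_prime p v <-> v \in t,
   forall x, x != 0 -> \sum_(v <- t) N v * ln (v x) = d%:R^-1 * ln (padic_abs R p (norm_rat x)) &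
   forall x j, d%:R^-1 * ln (Num.max 1 (padic_abs R p (norm_poly x)`_j))
     <= \sum_(v <- t) N v * ln (Num.max 1 (v x))].
Proof.
move=> pp; have p0 := prime_gt0 pp.
have [f fP fr] := finite_place_exists R K pp.
pose v0 := FinitePlace fP (ex_intro2 _ _ p pp fr).
have v0o : over_prime p v0 by [].
have aP := lies_over_absolute (over_prime_lies_over v0o).
have CP := fin_embP (Cfin C v0); set s := fin_emb _ in CP.
have ra q : vabs ((s \o in_alg K) q) = padic_abs R p q.
  by case: CP => + _ _ => /= ->; rewrite -v0o -[ratr q]mulr1 ratr_scale.
have q0P : 0 < padic_abs R p p%:R < 1.
  by rewrite padic_self// invr_gt0 ltr0n p0 invf_lt1 ?ltr0n// ltr1n prime_gt1.
have [t0 [ut tP tN _ tM]] := local_sums K aP q0P ra (rational_split CP).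
have [t tE] := lift_finite_places pp (fun w wt => (tP w).2 wt).
have tov v : over_prime p v <-> v \in t.
  split => [vo|vt]; last first.
    by have [|_ //] := (tP v).2 _; rewrite -tE map_f.
  have : (v : K -> R) \in t0 by apply/tP; exact: over_prime_lies_over.
  by rewrite -tE => /mapP[w wt vw]; rewrite (finite_place_ext vw).
have NE v : v \in t -> N v = d%:R^-1 * (local_degree (padic_abs R p) v)%:R.
  move=> vt; have vo := over_prime_lies_over ((tov v).2 vt).
  have [sv Lc _] := fin_embP (Cfin C v).
  by rewrite /N /N_fin /Nv (degree_over_local_degree aP vo sv Lc) mulrC.
have sumE F : \sum_(v <- t) N v * F (fin_abs v) =
    d%:R^-1 * \sum_(w <- t0) (local_degree (padic_abs R p) w)%:R * F w.
  rewrite -tE big_map mulr_sumr big_seq [RHS]big_seq; apply: eq_bigr => v vt.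
  by rewrite NE// mulrA.
exists t; split => //.
- by move: ut; rewrite -tE; exact: map_uniq.
- by move=> x x0; rewrite (sumE (fun w => ln (w x))) tN.
- move=> x j; rewrite (sumE (fun w => ln (Num.max 1 (w x)))) ler_wpM2l ?invr_ge0 ?ler0n//.
  by apply: tM => n; exact: padic_natr_le1.
Qed.

(** Sums over the infinitely many finite places are cut off at a bound on the residue
    characteristic; for a given x all terms beyond a suitable bound vanish. *)
Lemma fin_places_below B : exists t : seq (finite_place R K),
  [/\ uniq t, forall p v, prime p -> over_prime p v -> (v \in t) = (p < B)%N,
   forall x, x != 0 -> \sum_(v <- t) N v * ln (v x) =
     d%:R^-1 * \sum_(0 <= p < B | prime p) ln (padic_abs R p (norm_rat x)) &
   forall x j, d%:R^-1 * \sum_(0 <= p < B | prime p) ln (Num.max 1 (padic_abs R p (norm_poly x)`_j))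
     <= \sum_(v <- t) N v * ln (Num.max 1 (v x))].
Proof.
elim: B => [|B [t [ut tP tN tM]]].
  by exists [::]; split => // [x x0|x j]; rewrite big_geq// big_nil mulr0.
have [pB|pB] := boolP (prime B); last first.
  exists t; split => //.
  - move=> p v pp vp; rewrite (tP p)// [RHS]ltnS [RHS]leq_eqVlt.
    by case: eqVneq => //= pB'; case/negP: pB; rewrite -pB'.
  - by move=> x x0; rewrite [in RHS]big_mkcond big_nat_recr//= (negPf pB) addr0 -big_mkcond tN.
  - by move=> x j; rewrite [in leLHS]big_mkcond big_nat_recr//= (negPf pB) addr0 -big_mkcond tM.
have [t' [ut' tP' tN' tM']] := fin_places_over pB.
exists (t ++ t'); split.
- rewrite cat_uniq ut ut' andbT /=; apply/hasPn => v /tP' vB.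
  by rewrite (tP B)// ltnn.
- move=> p v pp vp; rewrite mem_cat (tP p)// [RHS]ltnS [RHS]leq_eqVlt [RHS]orbC; congr orb.
  apply/idP/eqP => [/tP' vB|pB']; first exact: over_prime_uniq pp pB vp vB.
  by apply/tP'; rewrite -pB'.
- by move=> x x0; rewrite big_cat tN// tN'// [in RHS]big_mkcond big_nat_recr//= pB -big_mkcond mulrDr.
- by move=> x j; rewrite big_cat [in leLHS]big_mkcond big_nat_recr//= pB -big_mkcond mulrDr lerD.
Qed.

(** Exceptions are bounded by the residue characteristic rather than counted, which makes
    conjunctions immediate; finiteness of the exceptional set follows since each prime has finitely
    many places above it. *)
Definition almost_all_fin (Q : finite_place R K -> Prop) :=
  exists B, forall p v, prime p -> (B <= p)%N -> over_prime p v -> Q v.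

Lemma almost_all_finI Q Q' : almost_all_fin Q -> almost_all_fin Q' ->
  almost_all_fin (fun v => Q v /\ Q' v).
Proof.
move=> [B h] [B' h']; exists (maxn B B') => p v pp; rewrite geq_max => /andP[b b'] vp.
by split; [exact: h vp|exact: h' vp].
Qed.

Lemma almost_all_finW Q Q' : (forall v, Q v -> Q' v) -> almost_all_fin Q -> almost_all_fin Q'.
Proof. by move=> QQ [B h]; exists B => p v pp Bp vp; apply: QQ; exact: h vp. Qed.

Lemma almost_all_fin_all n (Q : nat -> finite_place R K -> Prop) :
  (forall i, almost_all_fin (Q i)) -> almost_all_fin (fun v => forall i, (i < n)%N -> Q i v).
Proof.
move=> h; elim: n => [|n IH]; first by exists 0%N.
apply: almost_all_finW (almost_all_finI IH (h n)) => v [h1 h2] i.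
by rewrite ltnS leq_eqVlt => /predU1P[->//|]; exact: h1.
Qed.

Lemma almost_all_fin_seq (I : eqType) (s : seq I) (Q : I -> finite_place R K -> Prop) :
  (forall i, i \in s -> almost_all_fin (Q i)) ->
  almost_all_fin (fun v => forall i, i \in s -> Q i v).
Proof.
elim: s => [|i s IH] h; first by exists 0%N.
apply: almost_all_finW (almost_all_finI (h i (mem_head _ _)) (IH _)) => [v [h1 h2] j|j js].
  by rewrite in_cons => /predU1P[->|] //; exact: h2.
by apply: h; rewrite in_cons js orbT.
Qed.

Lemma almost_all_fin_finite Q : almost_all_fin Q -> finite_set [set v | ~ Q v].
Proof.
move=> [B h]; have [t [_ tP _ _]] := fin_places_below B.
apply: (@sub_finite_set _ _ [set` t]); last exact: finite_seq.
move=> v /= nQ; have [p pp vp] := fin_abs_rat v.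
by rewrite (tP p)// ltnNge; apply/negP => Bp; apply: nQ; exact: h vp.
Qed.

Lemma monic_root_le1 (L : fieldType) (v : L -> R) (P : {poly L}) x : absolute_value v ->
  (forall x y, v (x + y) <= Num.max (v x) (v y)) -> v (lead_coef P) = 1 ->
  (forall i, (i < size P)%N -> v P`_i <= 1) -> root P x -> v x <= 1.
Proof.
move=> vP ultra l1 Pi /rootP; rewrite horner_coef.
have sP : (0 < size P)%N.
  by rewrite size_poly_gt0 -lead_coef_eq0 -(av_eq0 vP) l1 oner_eq0.
rewrite -(prednK sP) big_ord_recr /= -/(lead_coef P) => /eqP.
rewrite addrC addr_eq0 => /eqP xE; rewrite leNgt; apply/negP => x1.
have : v x ^+ (size P).-1 <= v x ^+ (size P).-1 / v x.
  rewrite -{1}[_ ^+ _]mul1r -l1 -(avX vP) -(avM vP) xE (avN vP).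
  elim/big_ind: _ => [|y z hy hz|i _].
  - by rewrite (av0 vP) divr_ge0 ?exprn_ge0 ?(av_ge0 vP).
  - by rewrite (le_trans (ultra _ _))// ge_max hy hz.
  - have iP : (i < (size P).-1)%N by [].
    rewrite (avM vP) (avX vP x i); apply: (@le_trans _ _ (v x ^+ i)).
      by rewrite ler_piMl ?exprn_ge0 ?(av_ge0 vP)// Pi// (leq_trans iP)// leq_pred.
    rewrite ler_pdivlMr ?(lt_trans _ x1)// -exprSr (avX vP x (size P).-1) ler_weXn2l// ltW//.
rewrite ler_pdivlMr ?(lt_trans _ x1)// ger_pMr ?exprn_gt0 ?(lt_trans _ x1)//.
by rewrite leNgt x1.
Qed.

(** Above a prime larger than all denominators of its characteristic polynomial, x is a root of a
    monic polynomial with coefficients of size at most 1. *)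
Lemma almost_all_fin_le1 (x : K) : almost_all_fin (fun v => v x <= 1).
Proof.
have d1 : (0 < d)%N by rewrite adim_gt0.
pose M := (\max_(i < d.+1) `|denq (norm_poly x)`_i|)%N.
exists M.+1 => p v pp Mp vp; have vP := fin_absP v.
have vo := over_prime_lies_over vp.
have := @monic_root_le1 K v (map_poly (in_alg K) (norm_poly x)) x vP (@fin_place_ultra _ _ v).
apply.
- rewrite lead_coef_map (monicP (norm_poly_monic x)) rmorph1; exact: av1.
- move=> i; rewrite size_map_poly size_norm_poly => id.
  rewrite coef_map /= (over_scale _ _ vo) (av1 vP) mulr1.
  have iM : (`|denq (norm_poly x)`_i| < p)%N.
    by rewrite (leq_trans _ Mp)// ltnS (leq_bigmax (Ordinal id)).
  apply: padic_le1 => //; first exact: ltnW.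
  by apply/negP => /eqP dE; rewrite dE /= ltnn in iM.
- exact: norm_poly_root_K.
Qed.

Lemma almost_all_fin_eq1 (x : K) : x != 0 -> almost_all_fin (fun v => v x = 1).
Proof.
move=> x0; apply: almost_all_finW (almost_all_finI (almost_all_fin_le1 x) (almost_all_fin_le1 x^-1)).
move=> v [h1 h2]; apply/eqP; rewrite eq_le h1 /=; move: h2.
by rewrite (avV (fin_absP v)) invf_le1// (av_gt0 (fin_absP v)).
Qed.

Lemma fsum_fin_places (F : finite_place R K -> R) : almost_all_fin (fun v => F v = 0) ->
  exists B0, forall B t, (B0 <= B)%N -> uniq t ->
    (forall p v, prime p -> over_prime p v -> (v \in t) = (p < B)%N) ->
    \sum_(v \in setT) F v = \sum_(v <- t) F v.
Proof.
move=> [B0 h]; exists B0 => B t BB ut tP.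
rewrite [RHS]fsbig_seq//; apply/esym/fsbig_widen => // v [_ /= vt].
have [p pp vp] := fin_abs_rat v; apply: (h p) => //.
by rewrite (leq_trans BB)// leqNgt -(tP p v)//; exact/negP.
Qed.

End FinitePlaceSums.

Section InfinitePlaceSums.
Variables (R : realType) (K : fieldExtType rat) (C : completions R K).
Let d := \dim {: K}.
Let N := N_inf C.
Let a (q : rat) : R := `|ratr q|.

Let d0 : 0 < d%:R :> R.
Proof. by rewrite ltr0n adim_gt0. Qed.

Lemma inf_places : exists t : seq (infinite_place R K),
  [/\ uniq t, forall v, v \in t,
   forall x, x != 0 -> \sum_(v <- t) N v * ln (v x) = d%:R^-1 * ln (a (norm_rat x)) &
   forall x j, d%:R^-1 * ln (Num.max 1 (a (norm_poly x)`_j))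
     <= ln 2 + \sum_(v <- t) N v * ln (Num.max 1 (v x))].
Proof.
have aP : absolute_value a.
  split => [q|q|q q'|q q']; first exact: normr_ge0.
  - by split => [/eqP|->]; rewrite /a ?raddf0 ?normr0// normr_eq0 fmorph_eq0 => /eqP.
  - by rewrite /a (rmorphM (ratr : {rmorphism rat -> R})) normrM.
  - by rewrite /a raddfD ler_normD.
pose r : {rmorphism rat -> complexV R} := (real_complex R : {rmorphism R -> R[i]}) \o (ratr : {rmorphism rat -> R}).
have ra q : vabs (r q) = a q.
  by rewrite /= /Normc.normc /= expr0n addr0 sqrtr_sqr.
have split (P : {poly rat}) : exists w : seq (complexV R), map_poly r P =
    r (lead_coef P) *: \prod_(z <- w) ('X - z%:P).
  have [w wE] := closed_field_poly_normal (map_poly r P : {poly R[i]}).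
  by exists w; rewrite {1}wE lead_coef_map.
have q0P : 0 < a 2^-1 < 1.
  by rewrite /a fmorphV rmorph_nat ger0_norm ?invr_gt0 ?invf_lt1 ?ltr1n ?ltr0n// invr_ge0.
have [t0 [ut tP tN tM _]] := local_sums K aP q0P ra split.
have [t tE] : exists t : seq (infinite_place R K), map (@inf_abs R K) t = t0.
  have : forall w, w \in t0 -> lies_over a w by move=> w /tP.
  elim: (t0) => [|w u IH] uP; first by exists [::].
  have [|t' t'E] := IH; first by move=> z zu; apply: uP; rewrite in_cons zu orbT.
  have [wP wo] := uP w (mem_head _ _).
  by exists (InfinitePlace wP wo :: t'); rewrite /= t'E.
have tall v : v \in t.
  have : (v : K -> R) \in t0 by apply/tP; split; [exact: inf_absP|exact: inf_abs_rat].
  by rewrite -tE => /mapP[w wt vw]; rewrite (infinite_place_ext vw).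
have NE v : N v = d%:R^-1 * (local_degree a v)%:R.
  have vo : lies_over a v by split; [exact: inf_absP|exact: inf_abs_rat].
  have [sv Lc _] := inf_embP (Cinf C v).
  by rewrite /N /N_inf /Nv (@degree_over_local_degree _ _ _ aP _ (complexV R) _ vo sv Lc) mulrC.
have sumE F : \sum_(v <- t) N v * F (inf_abs v) =
    d%:R^-1 * \sum_(w <- t0) (local_degree a w)%:R * F w.
  rewrite -tE big_map mulr_sumr; apply: eq_bigr => v _.
  by rewrite NE// mulrA.
exists t; split => //.
- by move: ut; rewrite -tE; exact: map_uniq.
- by move=> x x0; rewrite (sumE (fun w => ln (w x))) tN.
- move=> x j; rewrite (sumE (fun w => ln (Num.max 1 (w x)))).
  by rewrite -(ler_pM2l d0) mulrDr !mulrA divff ?gt_eqF// !mul1r tM.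
Qed.

Lemma fsum_inf_places t (F : infinite_place R K -> R) : uniq t -> (forall v, v \in t) ->
  \sum_(v \in setT) F v = \sum_(v <- t) F v.
Proof.
by move=> ut tP; rewrite [RHS]fsbig_seq//; apply/esym/fsbig_widen => // v [_ /=]; rewrite tP.
Qed.

(** Grouping the places above each place of Q turns both sums into those for the norm of x, a
    nonzero rational, for which the formula is its prime factorization. *)
Theorem product_formula (x : K) : x != 0 ->
  \sum_(v \in setT) N_inf C v * ln (v x) + \sum_(v \in setT) N_fin C v * ln (v x) = 0.
Proof.
move=> x0; have [ti [uti tiP tiN _]] := inf_places.
rewrite (fsum_inf_places _ uti tiP) tiN//.
have [|B0 hB] := @fsum_fin_places _ K (fun v => N_fin C v * ln (v x)).
  have [B h] := @almost_all_fin_eq1 R K x x0; exists B => p v pp Bp vp.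
  by rewrite (h p v)// ln1 mulr0.
set q := norm_rat x.
have q0 : q != 0.
  exact: norm_rat_neq0.
pose B := maxn B0 (maxn `|numq q| `|denq q|).+1.
have [t [ut tP tN _]] := fin_places_below C B.
rewrite (hB B t)// ?leq_maxl// tN// (@sum_ln_padic R q B)//.
- by rewrite mulrN subrr.
- by rewrite /B leq_max ltnS leq_maxl orbT.
- by rewrite /B leq_max ltnS leq_maxr orbT.
Qed.

(** The height is bounded through all finite partial sums, so no finiteness of support enters. The
    finite places control the denominators of the coefficients, and the infinite places control
    their absolute values. *)
Lemma height_coef_bound (x : K) (b : R) :
  (forall t u, uniq t -> uniq u -> \sum_(v <- t) N_inf C v * ln (Num.max 1 (v x)) +
     \sum_(v <- u) N_fin C v * ln (Num.max 1 (v x)) <= b) ->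
  forall j, `|denq (norm_poly x)`_j|%:R <= expR (d%:R * b) /\
    `|ratr (norm_poly x)`_j| <= expR (d%:R * (ln 2 + b)).
Proof.
move=> h j; set q := (norm_poly x)`_j.
have dd : 0 < `|denq q|%:R :> R by rewrite ltr0n absz_gt0 ?denq_eq0.
split.
  have [t [ut tP _ tM]] := fin_places_below C `|denq q|.+1.
  rewrite -[leLHS]lnK ?posrE// ler_expR -ler_pdivrMl//.
  rewrite -(@sum_ln_max_padic R q `|denq q|.+1)// (le_trans (tM x j))//.
  by have := h [::] t isT ut; rewrite big_nil add0r.
have [t [ut tP _ tM]] := inf_places.
rewrite (@le_trans _ _ (Num.max 1 (a q)))//; first by rewrite le_max lexx orbT.
rewrite -[leLHS]lnK ?posrE ?lt_max ?ltr01// ler_expR -ler_pdivrMl//.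
rewrite (le_trans (tM x j))// lerD2l.
by have := h t [::] ut isT; rewrite big_nil addr0.
Qed.

End InfinitePlaceSums.

Lemma finite_roots (F : fieldType) (P : {poly F}) : P != 0 -> finite_set [set x | root P x].
Proof.
move=> P0; apply: contrapT => /(@infinite_set_fset _ _ (size P))[A AP sA].
have := max_poly_roots P0 (rs := enum_fset A); rewrite fset_uniq ltnNge sA => /(_ _ isT) h.
by suff : false by []; apply: h; apply/allP => x xA; exact: AP.
Qed.

Lemma finite_poly (F : nzRingType) n (S : set F) : finite_set S ->
  finite_set [set P : {poly F} | (size P <= n)%N /\ forall i, (i < n)%N -> S P`_i].
Proof.
move=> /finite_fsetP[A SA].
pose f (g : {ffun 'I_n -> A}) : {poly F} := \poly_(i < n) (if insub i is Some j then val (g j) else 0).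
apply: (@sub_finite_set _ _ (range f)); last exact: finite_image.
move=> P /= [sP hP].
have hA (i : 'I_n) : P`_i \in A by have := hP i (ltn_ord i); rewrite SA.
exists [ffun i => [` hA i]%fset] => //; apply/polyP => i; rewrite coef_poly.
case: ltnP => ni; first by rewrite insubT ffunE.
by rewrite nth_default// (leq_trans sP).
Qed.

(** The characteristic polynomial of x then has rational coefficients of bounded numerator and
    denominator, which leaves finitely many monic polynomials of degree d, and x is a root of one of
    them. *)
Theorem northcott_K (R : realType) (K : fieldExtType rat) (C : completions R K) (b : R) :
  finite_set [set x : K | forall t u, uniq t -> uniq u ->
    \sum_(v <- t) N_inf C v * ln (Num.max 1 (v x)) +
    \sum_(v <- u) N_fin C v * ln (Num.max 1 (v x)) <= b].
Proof.
set d := \dim {: K}.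
pose M1 : R := expR (d%:R * b); pose M2 : R := expR (d%:R * (ln 2 + b)).
(* [M1] bounds the denominators and [M1 * M2], denominator times absolute value, bounds the
   numerators. *)
have [M MP] : exists M : nat, M1 <= M%:R /\ M1 * M2 <= M%:R.
  exists (Num.truncn (Num.max M1 (M1 * M2))).+1.
  by have := truncnS_gt (Num.max M1 (M1 * M2)); rewrite gt_max => /andP[/ltW ? /ltW ?].
have fS := finite_rat_bounded M.
have fP := finite_poly d.+1 fS.
apply: (@sub_finite_set _ _ (\bigcup_(P in [set P : {poly rat} | P \is monic] `&`
   [set P : {poly rat} | (size P <= d.+1)%N /\ forall i, (i < d.+1)%N ->
     [set q : rat | (`|denq q| <= M)%N /\ (`|numq q| <= M)%N] P`_i])
   [set x : K | root (map_poly (in_alg K) P) x])); last first.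
  apply: bigcup_finite; first by apply: sub_finite_set fP => P [].
  by move=> P [/monic_neq0 P0 _]; apply: finite_roots; rewrite map_poly_eq0.
move=> x /= hx; have hc := height_coef_bound hx.
exists (norm_poly x); last first.
  exact: norm_poly_root_K.
split; first exact: norm_poly_monic.
split => [|i _]; first by rewrite size_norm_poly.
have [h1 h2] := hc i; split; rewrite -(@ler_nat R).
  exact: le_trans h1 MP.1.
move: h2; rewrite ratr_absE ler_pdivrMr ?ltr0n ?absz_gt0 ?denq_eq0// => h2.
rewrite (le_trans h2)// (le_trans _ MP.2)// mulrC.
by rewrite ler_wpM2r// expR_ge0.
Qed.

(** * Galois orbits *)

Section PartialEmbeddings.
Variables (K : fieldType) (F : closedFieldType) (iota : {rmorphism K -> F}).
Hypothesis alg : forall x : F, algebraicOver iota x.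

(* Homomorphisms over [K] between subrings of [F] are encoded by their graphs, so that Zorn's lemma applies to inclusion. *)
Definition partial_embedding (G : set (F * F)) : Prop :=
  [/\ forall k, G (iota k, iota k), forall u v, G u -> G v -> G (u - v),
      forall u v, G u -> G v -> G (u * v) & forall y, G (0, y) -> y = 0].

Section Graph.
Variable G : set (F * F).
Hypothesis GP : partial_embedding G.

Lemma partial_embedding1 : G 1.
Proof. by have [h _ _ _] := GP; have := h 1; rewrite rmorph1. Qed.
Lemma partial_embedding0 : G 0.
Proof. by have [h _ _ _] := GP; have := h 0; rewrite rmorph0. Qed.
Lemma partial_embeddingD u v : G u -> G v -> G (u + v).
Proof.
have [_ hB _ _] := GP; move=> Gu Gv; rewrite -[v]opprK; apply: (hB) => //.
by rewrite -sub0r; apply: (hB) => //; exact: partial_embedding0.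
Qed.
Lemma partial_embedding_fun x y y' : G (x, y) -> G (x, y') -> y = y'.
Proof.
have [_ hB _ h0] := GP; move=> h h'.
have E : (x, y) - (x, y') = (0, y - y') by rewrite [LHS]surjective_pairing /= subrr.
by have := hB _ _ h h'; rewrite E => /h0/eqP; rewrite subr_eq0 => /eqP.
Qed.

Let dg (k : K) : F * F := (iota k, iota k).

(** An algebraic equation of a with nonzero constant term p_0, written q(a) a + p_0 = 0, gives the
    inverse as -q(a) / p_0. Computing in the product ring [F * F] produces the inverse and its image
    at the same time. *)
Lemma partial_embedding_inv a b : G (a, b) -> a != 0 -> exists c, G (a^-1, c).
Proof.
move=> Gab a0; have [Gk hB hM _] := GP.
have [p p0 pa] := alg a.
wlog p00 : p p0 pa / p`_0 != 0.
  move=> wh; elim: {p}(size p) {-2}p (leqnn (size p)) p0 pa => [|n IH] p.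
    by rewrite leqn0 size_poly_eq0 => /eqP -> /eqP.
  move=> sp p0 pa; have [p00|] := eqVneq p`_0 0; last exact: wh.
  have pE : p = drop_poly 1 p * 'X.
    by apply/polyP => -[|i]; rewrite coefMX ?p00//= coef_drop_poly addn1.
  have dp0 : drop_poly 1 p != 0 by apply: contraNneq p0 => dp; rewrite pE dp mul0r.
  apply: (IH (drop_poly 1 p)) => //.
    by rewrite size_drop_poly leq_subLR add1n.
  by move: pa; rewrite {1}pE rmorphM /= map_polyX rootM rootX (negPf a0) orbF.
pose q := drop_poly 1 p.
have pE : p = q * 'X + (p`_0)%:P.
  apply/polyP => -[|i]; rewrite coefD coefMX coefC /= ?add0r//.
  by rewrite coef_drop_poly addn1 addr0.
pose e : F * F := \sum_(i < size q) dg q`_i * (a, b) ^+ i.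
have GX i : G ((a, b) ^+ i).
  by elim: i => [|i IH]; rewrite ?expr0 ?exprS; [exact: partial_embedding1|exact: hM].
have Ge : G e.
  apply: (big_ind G) => [||i _]; [exact: partial_embedding0|exact: partial_embeddingD|].
  exact: (hM _ _ (Gk _) (GX i)).
have e1 : e.1 = (map_poly iota q).[a].
  rewrite horner_coef size_map_poly /e (raddf_sum (fst : {additive F * F -> F})).
  by apply: eq_bigr => i _; rewrite coef_map /= (rmorphXn (fst : {rmorphism F * F -> F})).
exists (- (e * dg (p`_0)^-1)).2.
have -> : (a^-1, (- (e * dg (p`_0)^-1)).2) = - (e * dg (p`_0)^-1).
  rewrite [RHS]surjective_pairing; congr pair => /=; rewrite e1.
  have := rootP pa; rewrite {1}pE rmorphD rmorphM /= map_polyX map_polyC hornerD hornerM hornerX hornerC.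
  move/eqP; rewrite addr_eq0 => /eqP qa; rewrite fmorphV.
  apply: (mulIf a0); rewrite mulVf// mulNr mulrAC qa mulNr divff ?fmorph_eq0// opprK.
  by [].
rewrite -sub0r; apply: hB; first exact: partial_embedding0.
exact: (hM _ _ Ge (Gk _)).
Qed.

(** Division is carried out by hand because the ring of coefficients [F * F] has zero divisors and
    the remainder must keep its coefficients in the graph. *)
Lemma partial_embedding_rem (P Q : {poly F * F}) : P \is monic ->
  (forall i, G P`_i) -> (forall i, G Q`_i) ->
  exists S T : {poly F * F}, [/\ Q = S * P + T, (size T < size P)%N & forall i, G T`_i].
Proof.
move=> Pm GPi; have [_ hB hM _] := GP.
have P0 : (0 < size P)%N by rewrite size_poly_gt0 monic_neq0.
elim: {Q}(size Q) {-2}Q (leqnn (size Q)) => [|n IH] Q.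
  rewrite leqn0 size_poly_eq0 => /eqP -> GQ; exists 0, 0.
  by rewrite mul0r addr0 size_poly0.
move=> sQ GQ; have [sQP|sPQ] := ltnP (size Q) (size P).
  by exists 0, Q; rewrite mul0r add0r.
pose c := lead_coef Q; pose m := (size Q - size P)%N.
pose Q' := Q - c *: ('X^m * P).
have coefE i : (c *: ('X^m * P))`_i = c * (if (i < m)%N then 0 else P`_(i - m)).
  by rewrite coefZ coefXnM.
have GQ' i : G Q'`_i.
  rewrite coefB coefE; apply: hB => //; apply: hM; first by rewrite /c lead_coefE.
  by case: ifP => _ //; exact: partial_embedding0.
have sQ' : (size Q' <= n)%N.
  have Q0 : (0 < size Q)%N by rewrite (leq_trans P0).
  rewrite -ltnS (leq_trans _ sQ)// -(prednK Q0) ltnS; apply/leq_sizeP => j.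
  rewrite leq_eqVlt => /predU1P[<-|Qj].
    rewrite coefB coefE ifN; last by rewrite -leqNgt /m; lia.
    have -> : ((size Q).-1 - m = (size P).-1)%N.
      by rewrite /m; lia.
    by rewrite -/(lead_coef P) (monicP Pm) mulr1 /c lead_coefE subrr.
  rewrite coefB coefE nth_default; last by rewrite -(prednK Q0).
  rewrite ifN; last by rewrite -leqNgt /m; lia.
  have jm : (size P <= j - m)%N.
    by rewrite -[X in (X <= _)%N](subKn sPQ) leq_sub2r// -(prednK Q0).
  by rewrite (nth_default _ jm) mulr0 subrr.
have [S [T [Q'E sT GT]]] := IH _ sQ' GQ'.
exists (S + c *: 'X^m), T; split => //.
by rewrite mulrDl -addrAC -Q'E /Q' -scalerAl subrK.
Qed.

Let P1 (P : {poly F * F}) : {poly F} := map_poly (fst : {rmorphism F * F -> F}) P.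
Let P2 (P : {poly F * F}) : {poly F} := map_poly (snd : {rmorphism F * F -> F}) P.

(** The new graph consists of the pairs (Q_1 (z), Q_2 (w)) for Q over G. If Q_1 (z) = 0, the
    remainder of Q modulo P has zero first part by minimality of P, hence zero second part, so Q_2
    (w) = 0: the extension is well defined. *)
Lemma partial_embedding_extend P z w : P \is monic -> (forall i, G P`_i) ->
  root (P1 P) z -> root (P2 P) w ->
  (forall T : {poly F * F}, (forall i, G T`_i) -> (size T < size P)%N -> root (P1 T) z -> P1 T = 0) ->
  exists G', [/\ partial_embedding G', G `<=` G' & G' (z, w)].
Proof.
move=> Pm GPi Pz Pw Pmin; have [Gk hB hM h0] := GP.
exists [set u | exists2 Q : {poly (F * F)%type}, (forall i, G Q`_i) & u = ((P1 Q).[z], (P2 Q).[w])].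
have GC u : G u -> exists2 Q : {poly (F * F)%type}, (forall i, G Q`_i) & u = ((P1 Q).[z], (P2 Q).[w]).
  move=> Gu; exists u%:P; last by rewrite /P1 /P2 !map_polyC !hornerC -surjective_pairing.
  by move=> i; rewrite coefC; case: ifP => _ //; exact: partial_embedding0.
split; [split|by move=> u /GC|].
- by move=> k; exact/GC/Gk.
- move=> _ _ [Q GQ ->] [Q' GQ' ->]; exists (Q - Q').
    by move=> i; rewrite coefB; exact: hB.
  by rewrite /P1 /P2 !rmorphB !hornerD !hornerN.
- move=> _ _ [Q GQ ->] [Q' GQ' ->]; exists (Q * Q').
    move=> i; rewrite coefM; apply: (big_ind G) => [||j _]; last exact: hM.
      exact: partial_embedding0.
    exact: partial_embeddingD.
  by rewrite /P1 /P2 !rmorphM !hornerM.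
- move=> y [Q GQ [Qz ->]]; have [S [T [QE sT GT]]] := partial_embedding_rem Pm GPi GQ.
  have T1 : P1 T = 0.
    apply: Pmin => //; apply/rootP; have := Qz.
    by rewrite QE /P1 rmorphD rmorphM hornerD hornerM -/(P1 P) (rootP Pz) mulr0 add0r => <-.
  have T2 : P2 T = 0.
    apply/polyP => i; rewrite coef_map coef0; apply: h0.
    have : (P1 T)`_i = 0 by rewrite T1 coef0.
    by rewrite coef_map /= => <-; rewrite -surjective_pairing.
  rewrite QE /P2 rmorphD rmorphM hornerD hornerM (rootP Pw) mulr0 add0r.
  by transitivity (P2 T).[w] => //; rewrite T2 horner0.
- exists 'X; last by rewrite /P1 /P2 !map_polyX !hornerX.
  move=> i; rewrite coefX; case: (i == 1%N); [exact: partial_embedding1|exact: partial_embedding0].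
Qed.

(** A relation for z of least degree; its leading coefficient can be made 1 because the domain of G
    contains inverses ([partial_embedding_inv]). *)
Lemma partial_embedding_minimal z : exists P : {poly F * F}, [/\ P \is monic, forall i, G P`_i,
  root (P1 P) z & forall T : {poly F * F}, (forall i, G T`_i) -> (size T < size P)%N -> root (P1 T) z -> P1 T = 0].
Proof.
have [Gk hB hM h0] := GP.
pose good n := `[< exists P : {poly F * F}, [/\ P \is monic, forall i, G P`_i,
  root (P1 P) z & size P = n] >].
have good_of (T : {poly F * F}) : (forall i, G T`_i) -> root (P1 T) z -> P1 T != 0 ->
    exists2 n, good n & (n <= size T)%N.
  move=> GT Tz T10; have l0 : (lead_coef (P1 T)) != 0 by rewrite lead_coef_eq0.
  have sT : (0 < size (P1 T))%N by rewrite size_poly_gt0.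
  set n := size (P1 T) in sT *.
  have Tl : G (lead_coef (P1 T), (T`_n.-1).2).
    by have := GT n.-1; rewrite [T`_(_)]surjective_pairing lead_coefE coef_map.
  have [c Gc] := partial_embedding_inv Tl l0.
  pose u : F * F := ((lead_coef (P1 T))^-1, c).
  have u1 : u * T`_n.-1 = 1.
    have h1 : (u * T`_n.-1).1 = 1.
      by rewrite /= -[(T`_n.-1).1](coef_map (fst : {rmorphism F * F -> F})) -/(P1 T) -lead_coefE mulVf.
    rewrite [LHS]surjective_pairing h1; congr pair.
    apply: (@partial_embedding_fun 1); last exact: partial_embedding1.
    by rewrite -{1}h1 -surjective_pairing; apply: hM.
  pose P : {poly F * F} := \poly_(i < n) (u * T`_i).
  have sP : size P = n.
    by apply: size_poly_eq; rewrite u1 oner_eq0.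
  have P1E : P1 P = (lead_coef (P1 T))^-1 *: P1 T.
    apply/polyP => i; rewrite coef_map coef_poly coefZ; case: ltnP => ni /=.
      by rewrite coef_map.
    by rewrite nth_default ?mulr0.
  exists n; last exact: size_poly.
  apply/asboolP; exists P; split => //.
  - by apply/monicP; rewrite lead_coefE sP coef_poly prednK// leqnn u1.
  - by move=> i; rewrite coef_poly; case: ifP => _; [exact: hM|exact: partial_embedding0].
  - by rewrite P1E rootZ ?invr_eq0.
have ex : exists n, good n.
  have [p p0 pz] := alg z.
  pose dgr : {poly F * F} := \poly_(i < size p) dg p`_i.
  have dE : P1 dgr = map_poly iota p.
    apply/polyP => i; rewrite !coef_map coef_poly; case: ltnP => //= ni.
    by rewrite nth_default// rmorph0.
  have [|||n gn _] := good_of dgr.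
  - by move=> i; rewrite coef_poly; case: ifP => _; [exact: Gk|exact: partial_embedding0].
  - by rewrite dE.
  - by rewrite dE map_poly_eq0.
  by exists n.
case: (ex_minnP ex) => m /asboolP[P [Pm GPi Pz sP]] Pmin.
exists P; split => // T GT TP Tz; apply/eqP/negPn/negP => T10.
have [n gn nT] := good_of T GT Tz T10.
have := Pmin n gn; rewrite -sP => Pn.
by move: (leq_ltn_trans (leq_trans Pn nT) TP); rewrite ltnn.
Qed.

End Graph.

Lemma maximal_partial_embedding G : partial_embedding G -> exists f : {rmorphism F -> F},
  forall x y, G (x, y) -> f x = y.
Proof.
move=> GP; pose P (H : set (F * F)) := H = set0 \/ (partial_embedding H /\ G `<=` H).
have [C CP Ctot|M [MP Mmax]] := @Zorn_bigcup (F * F)%type P.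
  have [C0|/existsNP[H0 /not_implyP[CH0 H0n]]] := pselect (forall V, C V -> V = set0).
    by left; apply/seteqP; split => // x [V /C0 -> ].
  have CP' V x : C V -> V x -> partial_embedding V /\ G `<=` V.
    by move=> /CP[->|//].
  have join V W x y : C V -> C W -> V x -> W y -> exists2 U, C U & U x /\ U y.
    move=> CV CW Vx Wy; have [VW|WV] := Ctot _ _ CV CW.
      by exists W => //; split => //; exact: VW.
    by exists V => //; split => //; exact: WV.
  have [x0 H0x] : exists x, H0 x by apply/set0P/eqP.
  have [[Hk _ _ _] GH0] := CP' _ _ CH0 H0x.
  right; split; [split|].
  - by move=> k; exists H0.
  - move=> x y [V CV Vx] [W CW Wy]; have [U CU [Ux Uy]] := join _ _ _ _ CV CW Vx Wy.
    by exists U => //; have [[_ h _ _] _] := CP' _ _ CU Ux; exact: h.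
  - move=> x y [V CV Vx] [W CW Wy]; have [U CU [Ux Uy]] := join _ _ _ _ CV CW Vx Wy.
    by exists U => //; have [[_ _ h _] _] := CP' _ _ CU Ux; exact: h.
  - by move=> y [V CV Vp]; have [[_ _ _ h] _] := CP' _ _ CV Vp; exact: h.
  - by move=> x /GH0 ?; exists H0.
have M0 : M !=set0.
  apply/set0P/negP => /eqP M0; apply: (Mmax G); last by right; split.
  rewrite M0; split => // h; have [Gk _ _ _] := GP; exact: (h _ (Gk 0)).
case: MP => [M00|[MP GM]]; first by move: M0; rewrite M00 => -[].
have total z : exists w, M (z, w).
  have [Q [Qm MQ Qz Qmin]] := partial_embedding_minimal MP z.
  have [w Qw] : exists w, root (map_poly (snd : {rmorphism F * F -> F}) Q) w.
    apply/closed_rootP; rewrite size_map_poly_id0; last by rewrite (monicP Qm) oner_eq0.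
    apply/negP => /size_poly1P[c c0 QE].
    have c1 : c = 1 by have := monicP Qm; rewrite QE lead_coefC.
    by move: Qz; rewrite QE c1 map_polyC /= rootC oner_eq0.
  have [M' [M'P MM' M'zw]] := partial_embedding_extend MP Qm MQ Qz Qw Qmin.
  exists w; apply: contrapT => nM; apply: (Mmax M').
    by split => // h; exact/nM/h.
  by right; split => //; apply: subset_trans MM'.
have [f fP] := choice total.
have [Mk MB MM _] := MP.
have fB : {morph f : x y / x - y}.
  by move=> x y; apply: (partial_embedding_fun MP (fP _)); exact: (MB _ _ (fP x) (fP y)).
have fM : monoid_morphism f.
  split; first by apply: (partial_embedding_fun MP (fP _)); exact: partial_embedding1.
  by move=> x y; apply: (partial_embedding_fun MP (fP _)); exact: (MM _ _ (fP x) (fP y)).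
pose h1 := GRing.isZmodMorphism.Build F F f fB.
pose h2 := GRing.isMonoidMorphism.Build F F f fM.
pose g : {rmorphism F -> F} := HB.pack f h1 h2.
by exists g => x y /GM Mxy; apply: (partial_embedding_fun MP (fP _)).
Qed.

(** An endomorphism over [K] maps the finite set of roots of a polynomial over [K] injectively into
    itself, hence onto itself. *)
Lemma algebraic_endo_bijective (f : {rmorphism F -> F}) : (forall k, f (iota k) = iota k) -> bijective f.
Proof.
move=> fk; have finj : injective f by exact: fmorph_inj.
have surj y : exists x, f x = y.
  have [p p0 py] := alg y.
  have [w wE] := closed_field_poly_normal (map_poly iota p).
  have rootE x : root (map_poly iota p) x = (x \in undup w).
    by rewrite wE rootZ ?lead_coef_eq0 ?map_poly_eq0// root_prod_XsubC mem_undup.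
  have sub : {subset [seq f x | x <- undup w] <= undup w}.
    move=> _ /mapP[x xw ->]; rewrite -rootE; move: xw; rewrite -rootE => xw.
    have -> : map_poly iota p = map_poly f (map_poly iota p).
      by rewrite -map_poly_comp; apply: eq_map_poly => k /=; rewrite fk.
    by rewrite fmorph_root.
  have uf : uniq [seq f x | x <- undup w] by rewrite map_inj_uniq ?undup_uniq.
  have [_ h] := uniq_min_size uf sub (eq_leq (esym (size_map _ _))).
  move: py; rewrite rootE -h => /mapP[x _ ->]; by exists x.
have [g gP] := choice surj.
by exists g => x //; apply: finj.
Qed.

(** Any root y of the minimal polynomial of x is the image of x under an automorphism over [K], so y
    = x and the polynomial is a power of X - x. In characteristic 0 an exponent above 1 would make
    the derivative a shorter relation. *)
Lemma fixed_in_base (charK : forall n, (n%:R == 0 :> F) = (n == 0%N)) (x : F) :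
  (forall f : {rmorphism F -> F}, bijective f -> (forall k, f (iota k) = iota k) -> f x = x) -> exists k, x = iota k.
Proof.
move=> fx; pose G0 := range (fun k : K => (iota k, iota k)).
have G0P : partial_embedding G0.
  split.
  - by move=> k; exists k.
  - by move=> _ _ [k _ <-] [l _ <-]; exists (k - l) => //; rewrite rmorphB.
  - by move=> _ _ [k _ <-] [l _ <-]; exists (k * l) => //; rewrite rmorphM.
  - by move=> y [k _ [k0 <-]].
have [P [Pm GPi Px Pmin]] := partial_embedding_minimal G0P x.
have P12 (Q : {poly F * F}) : (forall i, G0 Q`_i) ->
    map_poly (snd : {rmorphism F * F -> F}) Q = map_poly (fst : {rmorphism F * F -> F}) Q.
  move=> GQ; apply/polyP => i; rewrite !coef_map; have [k _ kE] := GQ i.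
  by rewrite -kE.
pose p := map_poly (fst : {rmorphism F * F -> F}) P.
have pm : p \is monic by exact: monic_map.
have sp : size p = size P.
  by rewrite size_map_poly_id0// (monicP Pm) oner_eq0.
have root_x y : root p y -> y = x.
  move=> py; have [|G1 [G1P _ G1xy]] := @partial_embedding_extend _ G0P P x y Pm GPi Px _ Pmin.
    by rewrite P12.
  have [f fP] := maximal_partial_embedding G1P.
  rewrite -(fP _ _ G1xy).
  have fk k : f (iota k) = iota k by apply: fP; case: G1P.
  apply: fx => //.
  exact: algebraic_endo_bijective fk.
have [w wE] := closed_field_poly_normal p.
have allx : all (pred1 x) w.
  apply/allP => y yw /=; apply/eqP/root_x.
  by rewrite wE rootZ ?lead_coef_eq0 ?monic_neq0// root_prod_XsubC.
have pE : p = ('X - x%:P) ^+ size w.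
  rewrite wE (monicP pm) scale1r; elim: (w) allx => [|y u IH] /=; first by rewrite big_nil.
  by move=> /andP[/eqP -> /IH uE]; rewrite big_cons uE exprS.
have sw : (size w).+1 = size p by rewrite pE size_exp_XsubC.
have w0 : (0 < size w)%N.
  rewrite lt0n; apply/eqP => w0; move: Px; rewrite -/p pE w0 expr0 rootC.
  by rewrite oner_eq0.
have [w1|w1] := leqP (size w) 1.
  have {w0 w1}w1 : size w = 1%N by apply/eqP; rewrite eqn_leq w1.
  have [k _ kE] := GPi 0%N; exists (- k); rewrite rmorphN.
  have : p`_0 = iota k by rewrite coef_map -kE.
  by rewrite pE w1 expr1 coefB coefX coefC sub0r => /= <-; rewrite opprK.
have GD i : G0 P^`()`_i.
  rewrite coef_deriv; have Gn n : G0 (P`_i.+1 *+ n).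
    elim: n => [|n IH]; first exact: (partial_embedding0 G0P).
    by rewrite mulrS; apply: (partial_embeddingD G0P).
  exact: Gn.
have := Pmin _ GD (lt_size_deriv (monic_neq0 Pm)).
have dE : map_poly (fst : {rmorphism F * F -> F}) P^`() = p^`().
  by rewrite /p deriv_map.
rewrite dE pE deriv_exp derivB derivX derivC subr0 mul1r.
rewrite -(prednK w0) /= => /(_ _)/eqP.
case: (size w) w1 => [|[|n]]// _ /(_ _).
have -> : root (('X - x%:P) ^+ n.+1 *+ n.+2) x.
  by rewrite -mulr_natl rootM root_exp_XsubC orbC eqxx.
move=> /(_ isT); rewrite -scaler_nat scaler_eq0 charK /= expf_eq0 polyXsubC_eq0.
by rewrite andbF.
Qed.

End PartialEmbeddings.

Lemma sum_uniq_sub (R : realType) (I : eqType) (t u : seq I) (f : I -> R) : uniq t -> uniq u ->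
  {subset t <= u} -> (forall i, 0 <= f i) -> \sum_(i <- t) f i <= \sum_(i <- u) f i.
Proof.
move=> ut uu tu f0.
have tp : perm_eq t [seq i <- u | i \in t].
  apply: uniq_perm => //; first exact: filter_uniq.
  by move=> i; rewrite mem_filter; case: (boolP (i \in t)) => //= /tu ->.
rewrite (perm_big _ tp) big_filter big_mkcond; apply: ler_sum => i _.
by case: ifP.
Qed.

Lemma fin_completion_ultra (R : realType) (K : fieldExtType rat) (v : finite_place R K)
  (C : fin_completion v) (x y : C) : vabs (x + y) <= Num.max (vabs x) (vabs y).
Proof.
have CP := vabsP C; have [sv _ _] := fin_embP C.
apply: ultrametric_of_natr_le1 => [z||//|z z'|z z'|n].
- exact: av_ge0.
- exact: av0.
- exact: av1.
- exact: avM.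
- exact: avD.
- have [p pp vp] := fin_abs_rat v.
  by rewrite -(rmorph_nat (fin_emb C)) sv -ratr_nat vp padic_natr_le1.
Qed.

Section Orbits.
Variables (K : fieldExtType rat) (Kbar : closedFieldType) (iota : {rmorphism K -> Kbar}).
Hypothesis alg : forall x : Kbar, algebraicOver iota x.
Local Notation G := (galois_group iota).

Lemma galois_orbit_finite (a : option Kbar) : finite_set [set omap f a | f in G].
Proof.
case: a => [x|]; last by apply: (@sub_finite_set _ _ [set None]) => // _ [f _ <-].
have [p p0 px] := alg x.
apply: (@sub_finite_set _ _ [set Some y | y in [set y | root (map_poly iota p) y]]).
  move=> _ [f [_ fk] <-] /=; exists (f x) => //=.
  have -> : map_poly iota p = map_poly f (map_poly iota p).
    by rewrite -map_poly_comp; apply: eq_map_poly => k /=; rewrite fk.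
  by rewrite fmorph_root.
by apply: finite_image; apply: finite_roots; rewrite map_poly_eq0.
Qed.

Lemma galois_orbitP (a b : option Kbar) : (b \in galois_orbit iota a) <-> exists2 f, G f & omap f a = b.
Proof. by rewrite in_fset_set ?inE; [| exact: galois_orbit_finite]; split. Qed.

Definition conjugates (x : Kbar) : seq Kbar := pmap id (galois_orbit iota (Some x)).

Lemma galois_orbitE x : galois_orbit iota (Some x) = map Some (conjugates x) :> seq _.
Proof.
rewrite /conjugates; have : forall b, b \in (galois_orbit iota (Some x) : seq _) -> exists y, b = Some y.
  by move=> b /galois_orbitP[f _ <-]; exists (f x).
elim: (galois_orbit _ _ : seq _) => //= b s IH h.
have [y ->] := h b (mem_head _ _); rewrite /= -IH// => c cs.
by apply: h; rewrite in_cons cs orbT.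
Qed.

Lemma conjugates_uniq x : uniq (conjugates x).
Proof. by rewrite -(map_inj_uniq (@Some_inj _)) -galois_orbitE fset_uniq. Qed.

Lemma mem_conjugates x y : (y \in conjugates x) <-> exists2 f : {rmorphism Kbar -> Kbar}, G f & f x = y.
Proof.
have SI : injective (@Some Kbar) by move=> ? ? [].
rewrite -(mem_map SI) -galois_orbitE galois_orbitP; split => -[f Gf].
  by move=> [<-]; exists f.
by move=> <-; exists f.
Qed.

Lemma mem_conjugates_self x : x \in conjugates x.
Proof. by apply/mem_conjugates; exists idfun => //; split => //; exists id. Qed.

Lemma size_conjugates_gt0 x : (0 < size (conjugates x))%N.
Proof. by have := mem_conjugates_self x; case: (conjugates x). Qed.

Lemma conjugates_perm x f : G f -> perm_eq (map f (conjugates x)) (conjugates x).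
Proof.
move=> Gf; have uf : uniq (map f (conjugates x)).
  by rewrite map_inj_uniq ?conjugates_uniq//; exact: fmorph_inj.
have sub : {subset map f (conjugates x) <= conjugates x}.
  move=> _ /mapP[y /mem_conjugates[g Gg <-] ->]; apply/mem_conjugates.
  exists (f \o g) => //; split; first by apply: bij_comp; [case: Gf|case: Gg].
  by move=> k /=; rewrite Gg.2 Gf.2.
have [_ h] := uniq_min_size uf sub (eq_leq (esym (size_map _ _))).
by apply: uniq_perm => //; exact: conjugates_uniq.
Qed.

Let char0 n : (n%:R == 0 :> Kbar) = (n == 0%N).
Proof. by rewrite -(rmorph_nat iota) fmorph_eq0 natr_eq0_ext. Qed.

Lemma galois_fixed z : (forall f : {rmorphism Kbar -> Kbar}, G f -> f z = z) -> exists k, z = iota k.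
Proof. by move=> h; apply: (fixed_in_base alg char0) => f f1 f2; apply: h. Qed.

Lemma conjugates_poly x : exists Q : {poly K}, map_poly iota Q = \prod_(y <- conjugates x) ('X - y%:P).
Proof.
set P := \prod_(y <- _) _.
have h i : exists k, P`_i = iota k.
  apply: galois_fixed => f Gf; rewrite -coef_map.
  suff -> : map_poly f P = P by [].
  rewrite /P rmorph_prod -[RHS](perm_big _ (conjugates_perm x Gf)) big_map.
  by apply: eq_bigr => y _; rewrite rmorphB /= map_polyX map_polyC.
have [c cP] := choice h.
exists (\poly_(i < size P) c i); apply/polyP => i; rewrite coef_map coef_poly.
case: ifPn => [_|]; first by rewrite cP.
rewrite -leqNgt => Pi; rewrite [RHS]nth_default//; exact: rmorph0.
Qed.

(** Running over ordered pairs, this is up to sign the discriminant of the orbit, and it is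
    invariant under the Galois group. *)
Definition disc x := \prod_(y <- conjugates x) \prod_(z <- conjugates x | z != y) (y - z).

Lemma disc_in_base x : exists2 k, k != 0 & disc x = iota k.
Proof.
have D0 : disc x != 0.
  rewrite /disc prodf_seq_neq0; apply/allP => y _ /=.
  rewrite prodf_seq_neq0; apply/allP => z _; apply/implyP => zy.
  by rewrite subr_eq0 eq_sym.
have [k kE] : exists k, disc x = iota k.
  apply: galois_fixed => f Gf; rewrite /disc rmorph_prod.
  rewrite -[RHS](perm_big _ (conjugates_perm x Gf)) big_map; apply: eq_bigr => y _.
  rewrite rmorph_prod -[RHS](perm_big _ (conjugates_perm x Gf)) big_map; apply: eq_big => [z|z _].
    by rewrite (inj_eq (fmorph_inj f)).
  by rewrite rmorphB.
by exists k => //; rewrite -(fmorph_eq0 iota) -kE.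
Qed.

End Orbits.

(** * Product formula and Northcott's theorem for Galois orbits *)

Section AdelicOrbits.
Variables (R : realType) (K : fieldExtType rat) (C : completions R K).
Variables (Kbar : closedFieldType) (iota : {rmorphism K -> Kbar}).
Hypothesis alg : forall x : Kbar, algebraicOver iota x.
Variable tau : embeddings C iota.

Definition abs_inf v (z : Kbar) : R := vabs (tau_inf tau v z : complexV R).
Definition abs_fin v (z : Kbar) : R := vabs (tau_fin tau v z).

Lemma abs_infP v : absolute_value (abs_inf v).
Proof.
have LP := vabsP (complexV R); split => [x|x|x y|x y]; first exact: (av_ge0 LP).
- by split => [/eqP|->]; rewrite /abs_inf ?rmorph0 ?(av0 LP)// (av_eq0 LP) fmorph_eq0 => /eqP.
- by rewrite /abs_inf rmorphM (avM LP).
- by rewrite /abs_inf rmorphD (avD LP).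
Qed.

Lemma abs_finP v : absolute_value (abs_fin v).
Proof.
have LP := vabsP (Cfin C v); split => [x|x|x y|x y]; first exact: (av_ge0 LP).
- by split => [/eqP|->]; rewrite /abs_fin ?rmorph0 ?(av0 LP)// (av_eq0 LP) fmorph_eq0 => /eqP.
- by rewrite /abs_fin rmorphM (avM LP).
- by rewrite /abs_fin rmorphD (avD LP).
Qed.

Lemma abs_fin_ultra v x y : abs_fin v (x + y) <= Num.max (abs_fin v x) (abs_fin v y).
Proof. by rewrite /abs_fin rmorphD fin_completion_ultra. Qed.

Lemma abs_inf_iota v k : abs_inf v (iota k) = v k.
Proof. by rewrite /abs_inf tau_infK; have [h _ _] := inf_embP (Cinf C v). Qed.

Lemma abs_fin_iota v k : abs_fin v (iota k) = v k.
Proof. by rewrite /abs_fin tau_finK; have [h _ _] := fin_embP (Cfin C v). Qed.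

Lemma almost_all_fin_abs_le1 z : almost_all_fin (fun v => abs_fin v z <= 1).
Proof.
have [p p0 pz] := alg z.
have h i : almost_all_fin (fun v : finite_place R K => p`_i = 0 \/ v p`_i = 1).
  have [->|pi0] := eqVneq p`_i 0; first by exists 0%N; left.
  by have [B hB] := @almost_all_fin_eq1 R K _ pi0; exists B => q v pq Bq vq; right; exact: hB vq.
have [B hB] := almost_all_fin_all (size p) h; exists B => q v pq Bq vq.
have {}hB := hB q v pq Bq vq.
apply: (monic_root_le1 (P := map_poly iota p)) pz.
- exact: abs_finP.
- exact: abs_fin_ultra.
- rewrite lead_coef_map abs_fin_iota lead_coefE; have [||//] := hB (size p).-1.
    by rewrite prednK// size_poly_gt0.
  by move/eqP; rewrite -lead_coefE lead_coef_eq0 (negPf p0).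
- move=> i; rewrite size_map_poly coef_map abs_fin_iota => ip.
  by have [->|->//] := hB i ip; rewrite (av0 (fin_absP v)) ler01.
Qed.

Lemma almost_all_fin_abs_eq1 z : z != 0 -> almost_all_fin (fun v => abs_fin v z = 1).
Proof.
move=> z0; have [B hB] := almost_all_fin_abs_le1 z; have [B' hB'] := almost_all_fin_abs_le1 z^-1.
exists (maxn B B') => p v pp; rewrite geq_max => /andP[b b'] vp; apply/eqP.
have := hB' p v pp b' vp; rewrite (avV (abs_finP v)) invf_le1 ?(av_gt0 (abs_finP v))// => h.
by rewrite eq_le h (hB p v).
Qed.

(** The product of the differences is a nonzero element of [K], to which the product formula
    applies. *)
Lemma sum_ln_disc x : 
  \sum_(v \in setT) N_inf C v * (\sum_(y <- conjugates iota x) \sum_(z <- conjugates iota x | z != y) ln (abs_inf v (y - z)))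
  + \sum_(v \in setT) N_fin C v * (\sum_(y <- conjugates iota x) \sum_(z <- conjugates iota x | z != y) ln (abs_fin v (y - z))) = 0.
Proof.
have [k k0 kE] := disc_in_base alg x.
have lnE (a : Kbar -> R) : absolute_value a -> ln (a (disc iota x)) =
    \sum_(y <- conjugates iota x) \sum_(z <- conjugates iota x | z != y) ln (a (y - z)).
  move=> aP; rewrite /disc (av_prod aP).
  have P0 y : 0 < a (\prod_(z <- conjugates iota x | z != y) (y - z)).
    rewrite (av_gt0 aP) prodf_seq_neq0; apply/allP => z _; apply/implyP => zy.
    by rewrite subr_eq0 eq_sym.
  rewrite ln_prod//; apply: eq_bigr => y _.
  rewrite (av_prod aP) big_mkcond ln_prod.
    by rewrite [RHS]big_mkcond; apply: eq_bigr => z _; case: ifP => // _; rewrite ln1.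
  by move=> z; case: ifPn => // zy; rewrite (av_gt0 aP) subr_eq0 eq_sym.
rewrite -[RHS](product_formula C k0); congr (_ + _); apply: eq_fsbigr => v _.
  by rewrite -lnE ?kE ?abs_inf_iota//; exact: abs_infP.
by rewrite -lnE ?kE ?abs_fin_iota//; exact: abs_finP.
Qed.

(** The polynomial of the orbit has coefficients in [K] whose size at each place is controlled by
    the product of the max (1, |y|); finiteness over [K] leaves finitely many such polynomials. *)
Lemma northcott (n : nat) (b : R) : finite_set [set x : Kbar | (size (conjugates iota x) <= n)%N /\
  forall t u, uniq t -> uniq u ->
    \sum_(v <- t) N_inf C v * (\sum_(y <- conjugates iota x) ln (Num.max 1 (abs_inf v y))) +
    \sum_(v <- u) N_fin C v * (\sum_(y <- conjugates iota x) ln (Num.max 1 (abs_fin v y))) <= b].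
Proof.
have [ti [uti tiP _ _]] := inf_places C.
(* Accounts for the factor 2^n lost at each infinite place in bounding coefficients by roots. *)
pose c : R := \sum_(v <- ti) N_inf C v * (n%:R * ln 2).
have fP := finite_poly n.+1 (northcott_K C (b + c)).
apply: (@sub_finite_set _ _ (\bigcup_(P in [set P : {poly K} | P != 0] `&`
   [set P : {poly K} | (size P <= n.+1)%N /\ forall i, (i < n.+1)%N -> [set x : K | forall t u, uniq t -> uniq u ->
    \sum_(v <- t) N_inf C v * ln (Num.max 1 (v x)) +
    \sum_(v <- u) N_fin C v * ln (Num.max 1 (v x)) <= b + c] P`_i])
   [set x : Kbar | root (map_poly iota P) x])); last first.
  apply: bigcup_finite; first by apply: sub_finite_set fP => P [].
  by move=> P [P0 _]; apply: finite_roots; rewrite map_poly_eq0.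
move=> x /= [xn hx]; have [Q QE] := conjugates_poly alg x.
have Q0 : Q != 0 by rewrite -(map_poly_eq0 iota) QE monic_neq0// monic_prod_XsubC.
exists Q; last by rewrite /= QE root_prod_XsubC; exact: mem_conjugates_self.
split => //; split.
  by rewrite -(size_map_poly iota) QE size_prod_XsubC.
move=> i _ t u ut uu.
have ln_max_prod (a : Kbar -> R) : \sum_(y <- conjugates iota x) ln (Num.max 1 (a y)) =
    ln (\prod_(y <- conjugates iota x) Num.max 1 (a y)).
  by rewrite ln_prod// => y; rewrite lt_max ltr01.
have p0 (a : Kbar -> R) : 1 <= \prod_(y <- conjugates iota x) Num.max 1 (a y).
  apply: (@big_ind _ (fun y : R => 1 <= y)) => // [y z|y _]; [exact: mulr_ege1 | by rewrite le_max lexx].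
have hi (v : infinite_place R K) : ln (Num.max 1 (v Q`_i)) <= n%:R * ln 2 + \sum_(y <- conjugates iota x) ln (Num.max 1 (abs_inf v y)).
  have := @prod_XsubC_coef_bound _ _ _ (abs_infP v) _ (conjugates iota x) id i.
  rewrite -QE coef_map abs_inf_iota => h.
  have e2 : 1 <= 2 ^+ n :> R by rewrite exprn_ege1 ?ler1n.
  rewrite ln_max_prod mulr_natl -lnXn// -lnM ?posrE ?exprn_gt0 ?(lt_le_trans ltr01)//.
  rewrite ler_ln ?posrE ?lt_max ?ltr01 ?mulr_gt0 ?exprn_gt0 ?(lt_le_trans ltr01 (p0 _))//.
  rewrite ge_max mulr_ege1//= (le_trans h)// ler_wpM2r ?(le_trans ler01)//.
  - by rewrite ler_weXn2l ?ler1n.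
  - by rewrite ler1n.
have hf (v : finite_place R K) : ln (Num.max 1 (v Q`_i)) <= \sum_(y <- conjugates iota x) ln (Num.max 1 (abs_fin v y)).
  have := @prod_XsubC_coef_bound_ultra _ _ _ (abs_finP v) _ (conjugates iota x) id i (@abs_fin_ultra v).
  rewrite -QE coef_map abs_fin_iota => h.
  rewrite ln_max_prod ler_ln ?posrE ?lt_max ?ltr01 ?(lt_le_trans ltr01 (p0 _))//.
  by rewrite ge_max p0.
rewrite (@le_trans _ _ (\sum_(v <- t) N_inf C v * (n%:R * ln 2 + \sum_(y <- conjugates iota x) ln (Num.max 1 (abs_inf v y))) +
  \sum_(v <- u) N_fin C v * (\sum_(y <- conjugates iota x) ln (Num.max 1 (abs_fin v y)))))//.
  by apply: lerD; apply: ler_sum => v _; apply: ler_wpM2l; rewrite ?N_inf_ge0 ?N_fin_ge0 ?hi ?hf.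
under eq_bigr do rewrite mulrDr.
rewrite big_split /= -addrA addrC lerD ?hx//.
apply: sum_uniq_sub => // v.
by rewrite mulr_ge0 ?N_inf_ge0 ?mulr_ge0 ?ln_ge0 ?ler1n.
Qed.

Lemma log_plus_powR (x N : R) : 0 <= x -> 0 <= N -> log_plus (x `^ N) = N * ln (Num.max 1 x).
Proof.
move=> x0 N0; rewrite /log_plus; have [x1|x1] := leP x 1.
  rewrite ln1 mulr0 max_l ?ln1//.
  by have := ge0_ler_powR N0 x0 ler01 x1; rewrite powR1.
rewrite max_r ?ln_powR//.
by have := ge0_ler_powR N0 ler01 x0 (ltW x1); rewrite powR1.
Qed.

End AdelicOrbits.

(** * Energies of conditionally negative kernels *)

Section RealIntegrable.
Context d (X : measurableType d) (R : realType).
Variable mu : {finite_measure set X -> \bar R}.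
Implicit Types f g : X -> R.

Lemma integrableRD f g : mu.-integrable setT (EFin \o f) ->
  mu.-integrable setT (EFin \o g) ->
  mu.-integrable setT (EFin \o (fun x => f x + g x)).
Proof.
move=> fi gi; rewrite (_ : _ \o _ = ((EFin \o f) \+ (EFin \o g))%E); last exact/funext.
exact: integrableD.
Qed.

Lemma integrableRB f g : mu.-integrable setT (EFin \o f) ->
  mu.-integrable setT (EFin \o g) ->
  mu.-integrable setT (EFin \o (fun x => f x - g x)).
Proof.
move=> fi gi; rewrite (_ : _ \o _ = ((EFin \o f) \- (EFin \o g))%E); last exact/funext.
exact: integrableB.
Qed.

Lemma integrableRZ (c : R) f : mu.-integrable setT (EFin \o f) ->
  mu.-integrable setT (EFin \o (fun x => c * f x)).
Proof.
move=> fi; rewrite (_ : _ \o _ = (fun x => c%:E * (EFin \o f) x)%E); last exact/funext.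
exact: integrableZl.
Qed.

Lemma integrableR_cst (c : R) : mu.-integrable setT (EFin \o (fun=> c)).
Proof. exact: finite_measure_integrable_cst. Qed.

Lemma integrableR_sum I (s : seq I) (f : I -> X -> R) :
  (forall i, mu.-integrable setT (EFin \o f i)) ->
  mu.-integrable setT (EFin \o (fun x => \sum_(i <- s) f i x)).
Proof.
move=> fi; elim: s => [|i s IH].
  by under eq_fun do rewrite big_nil; exact: integrableR_cst.
by under eq_fun do rewrite big_cons; exact: integrableRD.
Qed.

Lemma Rintegral_sum I (s : seq I) (f : I -> X -> R) :
  (forall i, mu.-integrable setT (EFin \o f i)) ->
  \int[mu]_x (\sum_(i <- s) f i x) = \sum_(i <- s) \int[mu]_x f i x.
Proof.
move=> fi; elim: s => [|i s IH].
  by under eq_fun do rewrite big_nil; rewrite big_nil Rintegral_cst// mul0r.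
under eq_fun do rewrite big_cons; rewrite big_cons RintegralD ?IH//.
exact: integrableR_sum.
Qed.

Lemma integrableR_le f g : measurable_fun setT f -> (forall x, `|f x| <= g x) ->
  mu.-integrable setT (EFin \o g) -> mu.-integrable setT (EFin \o f).
Proof.
move=> mf fg; apply: le_integrable => //; first exact/measurable_EFinP.
by move=> x _ /=; rewrite lee_fin (le_trans (fg x))// ler_norm.
Qed.

Lemma measurableR f : mu.-integrable setT (EFin \o f) -> measurable_fun setT f.
Proof. by move=> /measurable_int/measurable_EFinP. Qed.

End RealIntegrable.

Section MonotoneIntegral.
Context d (X : measurableType d) (R : realType).
Variable mu : {finite_measure set X -> \bar R}.

Lemma EFin_RintegralE (f : X -> R) : mu.-integrable setT (EFin \o f) ->
  (\int[mu]_x (f x)%:E)%E = (\int[mu]_x f x)%:E.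
Proof. by move=> fi; rewrite /Rintegral fineK//; exact: integrable_fin_num. Qed.

(* Pointwise limits are only required where the sequence stays bounded below;
   the bound on the integrals makes this almost everywhere. *)
Lemma decreasing_integral_limit (u : nat -> X -> R) (f : X -> R) (c : R) :
  (forall n, mu.-integrable setT (EFin \o u n)) ->
  measurable_fun setT f ->
  (forall x n m, (n <= m)%N -> u m x <= u n x) ->
  (forall n, c <= \int[mu]_x u n x) ->
  (forall x, (exists M, forall n, M <= u n x) -> u n x @[n --> \oo] --> f x) ->
  [/\ {ae mu, forall x, exists M, forall n, M <= u n x},
      mu.-integrable setT (EFin \o f) &
      (\int[mu]_x u n x) @[n --> \oo] --> \int[mu]_x f x].
Proof.
move=> ui mf umono uc uf.
(* The differences are nonnegative and increasing, so monotone convergence applies; the lower bound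
   [c] makes their limit integrable, hence finite almost everywhere. *)
pose v n x := u 0%N x - u n x.
have vi n : mu.-integrable setT (EFin \o v n).
  rewrite (_ : EFin \o v n = ((EFin \o u 0%N) \- (EFin \o u n))%E); last exact/funext.
  exact: integrableB.
have v0 n x : 0 <= v n x by rewrite subr_ge0 umono.
have vmono x : {homo (fun n => (v n x)%:E) : n m / (n <= m)%N >-> (n <= m)%E}.
  by move=> n m nm; rewrite lee_fin lerB// umono.
have vint n : \int[mu]_x v n x = \int[mu]_x u 0%N x - \int[mu]_x u n x.
  by rewrite /v RintegralB.
have mv n : measurable_fun setT (EFin \o v n) by apply: measurable_int (vi n).
pose w x := limn (fun n => (v n x)%:E).
have w0 x : (0 <= w x)%E.
  apply: lime_ge; last by apply: nearW => n; rewrite lee_fin.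
  exact: ereal_nondecreasing_is_cvgn.
have cw : (\int[mu]_x (v n x)%:E)%E @[n --> \oo] --> (\int[mu]_x w x)%E.
  apply: (@cvg_monotone_convergence _ _ _ mu setT measurableT (fun n x => (v n x)%:E)) => //.
  by move=> n x _; rewrite lee_fin.
have mw : measurable_fun setT w.
  apply: (@emeasurable_fun_cvg _ _ _ _ (fun n x => (v n x)%:E)) => //.
  by move=> x _; apply: ereal_nondecreasing_is_cvgn.
have wle : (\int[mu]_x w x <= (\int[mu]_x u 0%N x - c)%:E)%E.
  rewrite -(cvg_lim _ cw)//; apply: lime_le; first by apply/cvg_ex; eexists; exact: cw.
  apply: nearW => n; rewrite EFin_RintegralE// vint lee_fin lerB//.
have wi : mu.-integrable setT w.
  apply/integrableP; split => //.
  under eq_integral do rewrite gee0_abs//.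
  by apply: le_lt_trans wle _; rewrite ltry.
have key x : w x \is a fin_num -> (exists M, forall n, M <= u n x) /\ w x = (u 0%N x - f x)%:E.
  move=> wx.
  have vw n : v n x <= fine (w x).
    rewrite -lee_fin fineK//; apply: lime_ge; first exact: ereal_nondecreasing_is_cvgn.
    by near=> m; apply: vmono; near: m; exact: nbhs_infty_ge.
  have M : exists M, forall n, M <= u n x.
    by exists (u 0%N x - fine (w x)) => n; have := vw n; rewrite /v; lra.
  split=> //; apply/cvg_lim => //; apply: cvg_EFin; first exact: nearW.
  by apply: cvgB; [exact: cvg_cst | exact: uf].
have aw : {ae mu, forall x, w x \is a fin_num}.
  by apply: filterS (integrable_ae measurableT wi) => x; apply.
have ufi : mu.-integrable setT (EFin \o (fun x => u 0%N x - f x)).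
  apply/integrableP; split.
    apply/measurable_EFinP; apply: measurable_funB => //.
    by apply/measurable_EFinP; exact: measurable_int (ui 0%N).
  case/integrableP: wi => _; congr (_ < _)%E; apply: ae_eq_integral => //.
  - exact: measurableT_comp.
  - apply: measurableT_comp => //; apply/measurable_EFinP; apply: measurable_funB => //.
    by apply/measurable_EFinP; exact: measurable_int (ui 0%N).
  - by apply: filterS aw => x /key[_ ->].
have fi : mu.-integrable setT (EFin \o f).
  rewrite (_ : EFin \o f = ((EFin \o u 0%N) \- (EFin \o (fun x => u 0%N x - f x)%R))%E).
    exact: integrableB.
  by apply/funext => x /=; rewrite -EFinB; congr EFin; lra.
split => //.
  by apply: filterS aw => x /key[].
have wE : (\int[mu]_x w x)%E = (\int[mu]_x u 0%N x - \int[mu]_x f x)%:E.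
  rewrite -RintegralB// -EFin_RintegralE//; apply: ae_eq_integral => //.
  - by apply: measurable_int ufi.
  - by apply: filterS aw => x /key[_ ->].
have : (\int[mu]_x v n x) @[n --> \oo] --> \int[mu]_x u 0%N x - \int[mu]_x f x.
  apply: (@fine_cvg _ _ _ _ (fun n => (\int[mu]_x v n x)%:E)).
  by move: cw; rewrite wE; under eq_fun do rewrite EFin_RintegralE//.
move=> cv.
have -> : (fun n => \int[mu]_x u n x) = (fun n => \int[mu]_x u 0%N x - \int[mu]_x v n x).
  by apply/funext => n; rewrite vint opprB addrC subrK.
rewrite -[X in _ --> X](subKr (\int[mu]_x u 0%N x)).
by apply: cvgB => //; exact: cvg_cst.
Unshelve. all: by end_near. Qed.

End MonotoneIntegral.

Section Empirical.
Context d (X : measurableType d) (R : realType).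
Variable s : seq X.

Lemma ge0_integral_empirical (f : X -> \bar R) : measurable_fun setT f ->
  (forall x, (0 <= f x)%E) ->
  (\int[empirical R s]_x f x = (size s)%:R^-1%:E * \sum_(x <- s) f x)%E.
Proof.
move=> mf f0; rewrite /empirical ge0_integral_mscale//=.
congr (_ * _)%E; rewrite ge0_integral_measure_sum//.
rewrite (big_nth point) big_mkord; apply: eq_bigr => i _.
by rewrite integral_dirac// diracT mul1e.
Qed.

Lemma integrable_empirical (f : X -> R) : measurable_fun setT f ->
  (empirical R s).-integrable setT (EFin \o f).
Proof.
move=> mf; apply/integrableP; split; first exact/measurable_EFinP.
rewrite ge0_integral_empirical//=; last by do 2 apply: measurableT_comp => //.
by rewrite sumEFin -EFinM ltry.
Qed.

Lemma Rintegral_empirical (f : X -> R) : measurable_fun setT f ->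
  \int[empirical R s]_x f x = (size s)%:R^-1 * \sum_(x <- s) f x.
Proof.
move=> mf; have fi := integrable_empirical mf.
rewrite /Rintegral integralE !ge0_integral_empirical//.
- rewrite (eq_bigr (fun x => (Num.max (f x) 0)%:E)); last by move=> x _; rewrite funeposE EFin_max.
  rewrite [X in (_ - _ * X)%E](eq_bigr (fun x => (Num.max (- f x) 0)%:E)); last first.
    by move=> x _; rewrite funenegE EFin_max.
  rewrite !sumEFin -!EFinM -EFinB /= -mulrBr -sumrB; congr (_ * _); apply: eq_bigr => x _.
  by rewrite /Num.max; case: ltP => ?; case: ltP => ?; lra.
- by apply: measurable_funeneg; exact/measurable_EFinP.
- by apply: measurable_funepos; exact/measurable_EFinP.
Qed.

End Empirical.

(** * Expansion of the energy of [F] - rho *)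

Section Energy.
Context d (X : measurableType d) (R : realType).
Variable rho : probability X R.
Variables (k : X * X -> R) (l : X -> R) (c0 B : R).
Hypothesis mk : measurable_fun setT k.
Hypothesis ksym : forall x y, k (x, y) = k (y, x).
Hypothesis l0 : forall x, 0 <= l x.
Hypothesis c00 : 0 <= c0.
Hypothesis li : rho.-integrable setT (EFin \o l).
Hypothesis kl : forall x y, k (x, y) <= l x + l y + c0.
Hypothesis ki : forall x, rho.-integrable setT (EFin \o (fun y => k (x, y))).
Let p x := \int[rho]_y k (x, y).
Hypothesis pl : forall x, `|p x - l x| <= B.

Let mkx x : measurable_fun setT (fun y => k (x, y)).
Proof. exact: measurableT_comp (measurable_pair1 x). Qed.

Let mky y : measurable_fun setT (fun x => k (x, y)).
Proof. exact: measurableT_comp (measurable_pair2 y). Qed.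

(** If k <= u with u >= 0 then |k| <= 2u - k. The kernel being bounded above by integrable
    functions, its absolute integral is controlled by the potential alone. *)
Let abs_le x : \int[rho]_y `|k (x, y)| <= 2 * (l x + c0 + \int[rho]_y l y) - p x.
Proof.
have cI : rho.-integrable setT (EFin \o (fun=> l x + c0)) by exact: integrableR_cst.
have H : rho.-integrable setT (EFin \o (fun y => (l x + c0) + l y)) by exact: integrableRD.
have H2 : rho.-integrable setT (EFin \o (fun y => 2 * ((l x + c0) + l y))) by exact: integrableRZ.
have -> : 2 * (l x + c0 + \int[rho]_y l y) - p x =
    \int[rho]_y (2 * ((l x + c0) + l y) - k (x, y)).
  rewrite RintegralB// RintegralZl// RintegralD// Rintegral_cst//; congr (2 * (_ + _) - _).
  by rewrite /= [X in fine X]probability_setT mulr1.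
apply: le_Rintegral => //.
- exact: integrable_norm.
- exact: integrableRB.
- move=> y _ /=; have ? := kl x y; have ? := l0 x; have ? := l0 y; have ? := c00; case: ger0P => ?; lra.
Qed.

Let abs_fin x : (\int[rho]_y `|(k (x, y))%:E| = (\int[rho]_y `|k (x, y)|)%:E)%E.
Proof. by rewrite -EFin_RintegralE//; exact: integrable_norm. Qed.

Let mkE : measurable_fun setT (EFin \o k).
Proof. exact/measurable_EFinP. Qed.

Let abs_l x : \int[rho]_y `|k (x, y)| <= l x + (2 * (c0 + \int[rho]_y l y) + B).
Proof. by have := abs_le x; have := pl x; rewrite ler_norml => /andP[]; lra. Qed.

Let labs : rho.-integrable setT (EFin \o (fun x => l x + (2 * (c0 + \int[rho]_y l y) + B))).
Proof. by apply: integrableRD => //; exact: integrableR_cst. Qed.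

Let prod_int (m1 m2 : {finite_measure set X -> \bar R}) :
  (forall x, m2.-integrable setT (EFin \o (fun y => k (x, y)))) ->
  (m1 \x m2)%E.-integrable setT (EFin \o k) ->
  \int[(m1 \x m2)%E]_q k q = \int[m1]_x \int[m2]_y k (x, y).
Proof.
move=> k2 ik; rewrite /Rintegral -integral12_prod_meas1//.
congr fine; apply: eq_integral => x _.
by rewrite /fubini_F EFin_RintegralE.
Qed.

Let irr : (rho \x rho)%E.-integrable setT (EFin \o k).
Proof.
apply/integrable12ltyP => //=; under eq_integral do rewrite abs_fin.
have /integrableP[_] := labs; apply: le_lt_trans; apply: ge0_le_integral => //.
- by move=> x _; rewrite lee_fin; exact: Rintegral_ge0.
- under eq_fun do rewrite -abs_fin.
  apply: (@measurable_fun_fubini_tonelli_F _ _ _ _ _ rho (fun q => `|(k q)%:E|)%E) => //.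
  exact: measurableT_comp.
- by apply: measurableT_comp => //; apply: measurable_int labs.
- by move=> x _; rewrite /= lee_fin (le_trans (abs_l x))// ler_norm.
Qed.

Let pi : rho.-integrable setT (EFin \o p).
Proof.
have := integrable_fubini_F irr; rewrite /fubini_F.
by under eq_fun do rewrite EFin_RintegralE//.
Qed.

Lemma potential_integrable : rho.-integrable setT (EFin \o p).
Proof. exact: pi. Qed.

Variable s : seq X.

Let ier : (empirical R s \x rho)%E.-integrable setT (EFin \o k).
Proof.
apply/integrable12ltyP => //=; under eq_integral do rewrite abs_fin.
rewrite ge0_integral_empirical.
- by rewrite sumEFin -EFinM ltry.
- under eq_fun do rewrite -abs_fin.
  apply: (@measurable_fun_fubini_tonelli_F _ _ _ _ _ rho (fun q => `|(k q)%:E|)%E) => //.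
  exact: measurableT_comp.
- by move=> x; rewrite lee_fin; exact: Rintegral_ge0.
Qed.

Let ire : (rho \x empirical R s)%E.-integrable setT (EFin \o k).
Proof.
apply/integrable21ltyP => //=; under eq_integral do under eq_integral do rewrite ksym.
under eq_integral do rewrite abs_fin.
rewrite ge0_integral_empirical.
- by rewrite sumEFin -EFinM ltry.
- under eq_fun do rewrite -abs_fin.
  apply: (@measurable_fun_fubini_tonelli_F _ _ _ _ _ rho (fun q => `|(k q)%:E|)%E) => //.
  exact: measurableT_comp.
- by move=> x; rewrite lee_fin; exact: Rintegral_ge0.
Qed.

Let iee : (empirical R s \x empirical R s)%E.-integrable setT (EFin \o k).
Proof.
have H x : (\int[empirical R s]_y `|(k (x, y))%:E| = ((size s)%:R^-1 * \sum_(y <- s) `|k (x, y)|)%:E)%E.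
  rewrite ge0_integral_empirical//; first by rewrite EFinM -sumEFin.
  by apply: measurableT_comp => //; exact/measurable_EFinP.
apply/integrable12ltyP => //=; under eq_integral do rewrite H.
rewrite ge0_integral_empirical.
- by rewrite sumEFin -EFinM ltry.
- apply/measurable_EFinP; apply: measurable_funM => //; apply: measurable_sum => y.
  exact: measurableT_comp.
- by move=> x; rewrite lee_fin mulr_ge0 ?invr_ge0 ?ler0n// sumr_ge0.
Qed.

(** With the logarithm of 0 taken to be 0, the kernels in question vanish outside the domain [D],
    which can then be dropped; Fubini's theorem does the rest. *)
Lemma energyE (D : set (X * X)) : (forall q, ~ D q -> k q = 0) ->
  let mu := SignedMeasure (empirical R s) rho in
  energy D k mu mu =
  - ((size s)%:R ^- 2 * (\sum_(x <- s) \sum_(y <- s) k (x, y))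
     - 2 * (size s)%:R^-1 * (\sum_(x <- s) p x) + \int[rho]_x p x).
Proof.
move=> kD mu; rewrite /energy /=.
have D0 : k \_ D = k.
  apply/funext => q; rewrite patchE; case: ifPn => // /negP qD.
  by rewrite kD// => h; apply: qD; rewrite inE.
have RD (m : {measure set (X * X) -> \bar R}) : \int[m]_(q in D) k q = \int[m]_q k q.
  by rewrite Rintegral_mkcond D0.
rewrite !RD.
have mp : measurable_fun setT p by apply: measurableR pi.
rewrite !prod_int//; last by move=> x; exact: integrable_empirical.
  rewrite Rintegral_empirical//; last first.
    under eq_fun do rewrite Rintegral_empirical//.
    by apply: measurable_funM => //; exact: measurable_sum.
  rewrite Rintegral_empirical//.
  have Ee x : \int[empirical R s]_y k (x, y) = (size s)%:R^-1 * \sum_(y <- s) k (x, y).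
    by rewrite Rintegral_empirical.
  rewrite (eq_bigr _ (fun x _ => Ee x)) -mulr_sumr.
  have -> : \int[rho]_x \int[empirical R s]_y k (x, y) = (size s)%:R^-1 * \sum_(y <- s) p y.
    under eq_Rintegral do rewrite Rintegral_empirical//.
    rewrite RintegralZl//; last first.
      by apply: integrableR_sum => y; under eq_fun do rewrite ksym.
    rewrite Rintegral_sum; last by move=> y; under eq_fun do rewrite ksym.
    by congr (_ * _); apply: eq_bigr => y _; apply: eq_Rintegral => x _; rewrite ksym.
  by rewrite /p -exprVn; ring.
by move=> x; exact: integrable_empirical.
Qed.

End Energy.

(** * Negative type, from finite sums to measures *)

Section ConditionallyNegative.
Context d (X : measurableType d) (R : realType).
Variable rho : probability X R.
Variable k : X -> X -> R.
Hypothesis ksym : forall x y, k x y = k y x.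

Definition quad (nu : seq (R * X)) : R :=
  \sum_(a <- nu) \sum_(b <- nu) a.1 * b.1 * k a.2 b.2.

Hypothesis cnd : forall nu, \sum_(a <- nu) a.1 = 0 -> quad nu <= 0.
Hypothesis ki : forall x, rho.-integrable setT (EFin \o k x).
Let p x := \int[rho]_y k x y.
Hypothesis pi : rho.-integrable setT (EFin \o p).
Hypothesis di : rho.-integrable setT (EFin \o (fun x => k x x)).
Let I := \int[rho]_x p x.
Let D := \int[rho]_x k x x.

Let quad_cons c x nu : quad ((c, x) :: nu) =
  quad nu + 2 * c * (\sum_(a <- nu) a.1 * k a.2 x) + c ^+ 2 * k x x.
Proof.
rewrite /quad big_cons big_cons /=.
under [X in _ + X]eq_bigr do rewrite big_cons /=.
rewrite big_split /= !mulr_sumr.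
rewrite (eq_bigr (fun b => c * (b.1 * k b.2 x))); last by move=> b _; rewrite ksym mulrA.
rewrite [X in _ + (X + _)](eq_bigr (fun b => c * (b.1 * k b.2 x))); last by move=> b _; ring.
rewrite -!mulr_sumr; ring.
Qed.

(* The inequality obtained by sampling [j] of the atoms of mass [1/m] from [rho]. *)
Let sampled (m j : nat) (nu : seq (R * X)) : \sum_(a <- nu) a.1 = - (j%:R / m%:R) ->
  quad nu + 2 * (j%:R / m%:R) * (\sum_(a <- nu) a.1 * p a.2)
  + j%:R * (j%:R - 1) / m%:R ^+ 2 * I + j%:R / m%:R ^+ 2 * D <= 0.
Proof.
elim: j nu => [|j IH] nu numass.
  rewrite !mul0r !(mulr0, mul0r) !addr0; apply: cnd.
  by rewrite numass mul0r oppr0.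
pose c : R := m%:R^-1.
have sI : rho.-integrable setT (EFin \o (fun w => \sum_(a <- nu) a.1 * k a.2 w)).
  by apply: integrableR_sum => a; exact: integrableRZ.
pose K := quad nu + 2 * (j%:R * c) * (\sum_(a <- nu) a.1 * p a.2)
  + j%:R * (j%:R - 1) * c ^+ 2 * I + j%:R * c ^+ 2 * D.
pose F w := K + (2 * c * (\sum_(a <- nu) a.1 * k a.2 w) +
  (c ^+ 2 * k w w + 2 * (j%:R * c) * c * p w)).
have F0 w : F w <= 0.
  have := IH ((c, w) :: nu); rewrite big_cons /= numass => /(_ _)/wrap[].
    by rewrite /c -natr1; ring.
  rewrite quad_cons big_cons /=; apply: le_trans.
  by rewrite /F /K -exprVn -/c le_eqVlt; apply/orP; left; apply/eqP; ring.
have i1 := integrableRZ (2 * c) sI.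
have i2 := integrableRZ (c ^+ 2) di.
have i3 := integrableRZ (2 * (j%:R * c) * c) pi.
have i4 := integrableRD i2 i3.
have i5 := integrableRD i1 i4.
have kI := @integrableR_cst _ _ _ rho K.
have : \int[rho]_w F w <= 0.
  rewrite -[leRHS](_ : \int[rho]_w (fun=> 0) w = 0); last by rewrite Rintegral_cst// mul0r.
  apply: le_Rintegral => //; first exact: integrableRD.
  exact: integrableR_cst.
rewrite /F RintegralD// Rintegral_cst// [X in fine X]probability_setT mulr1.
rewrite RintegralD// RintegralD// !RintegralZl// -/I -/D.
rewrite Rintegral_sum; last by move=> a; exact: integrableRZ.
rewrite (eq_bigr (fun a => a.1 * p a.2)); last by move=> a _; rewrite RintegralZl.
apply: le_trans; rewrite /K -!exprVn -/c -natr1 le_eqVlt; apply/orP; left; apply/eqP; ring.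
Qed.

(** Take m sample points of mass 1/m against the empirical measure. The average of the quadratic
    form differs from the desired one by the diagonal error (D - I) / m, which disappears as m
    grows. *)
Lemma cnd_empirical (s : seq X) : (0 < size s)%N ->
  (size s)%:R ^- 2 * (\sum_(x <- s) \sum_(y <- s) k x y)
    - 2 * (size s)%:R^-1 * (\sum_(x <- s) p x) + I <= 0.
Proof.
move=> s0; set A := (X in X <= 0); rewrite leNgt; apply/negP => A0.
pose n : R := (size s)%:R^-1.
pose nu := [seq (- n, x) | x <- s].
have step (m : nat) : (0 < m)%N -> A <= (I - D) / m%:R.
  move=> m0; have mN0 : m%:R != 0 :> R by rewrite pnatr_eq0 -lt0n.
  have := @sampled m m nu; rewrite big_map /= big_const_seq count_predT iter_addr_0.
  move=> /(_ _)/wrap[].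
    by rewrite divff// mulNrn -[n *+ _]mulr_natr /n mulVf// pnatr_eq0 -lt0n.
  have -> : quad nu = n ^+ 2 * (\sum_(x <- s) \sum_(y <- s) k x y).
    rewrite /quad big_map mulr_sumr; apply: eq_bigr => x _.
    by rewrite big_map mulr_sumr; apply: eq_bigr => y _ /=; ring.
  have -> : \sum_(a <- nu) a.1 * p a.2 = - (n * \sum_(x <- s) p x).
    by rewrite big_map mulr_sumr -sumrN; apply: eq_bigr => x _ /=; ring.
  have -> : m%:R * (m%:R - 1) / m%:R ^+ 2 = 1 - m%:R^-1 :> R by field.
  have -> : m%:R / m%:R ^+ 2 = m%:R^-1 :> R by field.
  by rewrite divff// /A -exprVn -/n; lra.
have [|m0] := leP (I - D) 0.
  by move=> ID; have := step 1%N isT; rewrite divr1; lra.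
have /andP[m1 m2] := trunc_itv (divr_ge0 (ltW m0) (ltW A0)).
have := step (Num.trunc ((I - D) / A)).+1 isT.
by rewrite ler_pdivlMr ?ltr0n// leNgt mulrC -ltr_pdivrMr// m2.
Qed.

End ConditionallyNegative.

Section EnergyLowerBound.
Context d (X : measurableType d) (R : realType).
Variable rho : probability X R.
Variables (k : X * X -> R) (ke : R -> X -> X -> R) (P : set X) (oo : X).
Let p x := \int[rho]_y k (x, y).
Let pe e x := \int[rho]_y ke e x y.
Hypothesis pint : rho.-integrable setT (EFin \o p).
Hypothesis moo : measurable [set oo].
Hypothesis rhooo : rho [set oo] = 0%E.
Hypothesis ksym : forall e x y, 0 < e <= 1 -> ke e x y = ke e y x.
Hypothesis cnd : forall e (nu : seq (R * X)), 0 < e <= 1 ->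
  \sum_(a <- nu) a.1 = 0 -> quad (ke e) nu <= 0.
Hypothesis kei : forall e x, 0 < e <= 1 -> rho.-integrable setT (EFin \o ke e x).
Hypothesis pei : forall e, 0 < e <= 1 -> rho.-integrable setT (EFin \o pe e).
Hypothesis dei : forall e, 0 < e <= 1 -> rho.-integrable setT (EFin \o (fun x => ke e x x)).
Hypothesis ppe : forall e x, 0 < e <= 1 -> x <> oo -> p x <= pe e x.
Hypothesis kke : forall e x y, 0 < e <= 1 -> P x -> P y -> x <> y -> k (x, y) <= ke e x y.
Hypothesis kxx : forall x, P x -> k (x, x) = 0.
Hypothesis kexx : forall e, 0 < e <= 1 -> exists M, forall x, P x -> - M <= ke e x x.
Hypothesis unif : forall eta, 0 < eta -> exists2 e, 0 < e <= 1 &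
  forall x, P x -> pe e x <= p x + eta.

Let ntegral_ppe e : 0 < e <= 1 -> \int[rho]_x p x <= \int[rho]_x pe e x.
Proof.
move=> e01; rewrite -lee_fin -!EFin_RintegralE//; last exact: pei.
rewrite (negligible_integral moo)// [leRHS](negligible_integral moo)//; last exact: pei.
apply: le_integral.
- exact: measurableD.
- by apply: integrableS pint => //; exact: measurableD.
- by apply: integrableS (pei e01) => //; exact: measurableD.
- by move=> x; rewrite inE => -[_ /= xoo]; rewrite lee_fin ppe.
Qed.

(** The regular kernel dominates the singular one off the diagonal, so the inequality of negative
    type can be transferred. The loss is M for each of the n diagonal terms, that is M / n after
    normalization, and the uniform difference of the two potentials. *)
Lemma empirical_energy_lower_bound (del : R) : 0 < del -> exists N : nat,
  forall s : seq X, uniq s -> {in s, forall x, P x} -> (N <= size s)%N ->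
  (size s)%:R ^- 2 * (\sum_(x <- s) \sum_(y <- s) k (x, y))
     - 2 * (size s)%:R^-1 * (\sum_(x <- s) p x) + \int[rho]_x p x <= del.
Proof.
(* The potentials enter with a factor 2, so they lose [del / 2]; the number of points is then taken
   so large that the diagonal loses no more than the other half. *)
move=> d0; have [e e01 eu] := @unif (del / 4) (divr_gt0 d0 (ltr0n _ 4)).
have [M0 M0P] := kexx e01.
pose M := Num.max 0 M0.
have M_ge0 : 0 <= M by rewrite le_max lexx.
have MP x : P x -> - M <= ke e x x.
  by move=> /M0P; apply: le_trans; rewrite lerN2 le_max lexx orbT.
exists (Num.trunc (2 * M / del)).+1 => s us sP sN.
have s0 : (0 < size s)%N by apply: leq_trans sN.
have := cnd_empirical (fun x y => @ksym e x y e01) (fun nu => cnd e01) (fun x => @kei e x e01) (pei e01) (dei e01) s0.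
have := ntegral_ppe e01.
set S := \sum_(x <- s) \sum_(y <- s) k (x, y); set I := \int[rho]_x p x; set Ie := \int[rho]_x pe e x.
set n := (size s)%:R; set Se := \sum_(x <- s) \sum_(y <- s) ke e x y; set Pe := \sum_(x <- s) \int[rho]_y _.
set Ps := \sum_(x <- s) p x.
have lsum (f g : X -> R) : {in s, forall x, f x <= g x} ->
    \sum_(x <- s) f x <= \sum_(x <- s) g x.
  by move=> fg; rewrite big_seq [leRHS]big_seq; apply: ler_sum.
have n0 : 0 < n by rewrite ltr0n.
have PP : Pe <= Ps + n * (del / 4).
  have -> : n * (del / 4) = \sum_(x <- s) (del / 4).
    by rewrite big_const_seq count_predT iter_addr_0 mulr_natl.
  by rewrite /Ps -big_split; apply: lsum => x /sP /eu.
have SS : S <= Se + n * M.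
  have -> : n * M = \sum_(x <- s) \sum_(y <- s) (if x == y then M else 0).
    rewrite big_seq (eq_bigr (fun=> M)) -?big_seq.
      by rewrite big_const_seq count_predT iter_addr_0 mulr_natl.
    move=> x xs; rewrite (bigD1_seq x)//= eqxx big1 ?addr0//.
    by move=> y yx; rewrite eq_sym (negbTE yx).
  rewrite /Se -big_split; apply: (lsum _ _) => x xs.
  rewrite -big_split; apply: lsum => y ys /=.
  case: eqVneq => [<-|/eqP xy]; last by rewrite addr0; apply: kke => //; exact: sP.
  by rewrite kxx; [have := MP x (sP _ xs); lra|exact: sP].
have nM : M / n <= del / 2.
  have : 2 * M / del < n.
    have /andP[_ h] := trunc_itv (divr_ge0 (mulr_ge0 (ler0n _ 2) M_ge0) (ltW d0)).
    by apply: lt_le_trans h _; rewrite ler_nat.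
  rewrite ltr_pdivrMr// => h; rewrite ler_pdivrMr//; lra.
move=> II H.
have n2 : 0 <= n ^- 2 by rewrite invr_ge0 exprn_ge0// ltW.
have nI : 0 <= n^-1 by rewrite invr_ge0 ltW.
have h1 := ler_wpM2l n2 SS.
have h2 := ler_wpM2l nI PP.
have e1 : n ^- 2 * (Se + n * M) = n ^- 2 * Se + M / n by field; rewrite gt_eqF.
have e2 : n^-1 * (Ps + n * (del / 4)) = n^-1 * Ps + del / 4 by field; rewrite gt_eqF.
rewrite e1 in h1; rewrite e2 in h2.
move: H; rewrite -!mulrA; lra.
Qed.

End EnergyLowerBound.

(** * The Berkovich line *)

Section GaussNorm.
Variables (R : realType) (A : comNzRingType) (N : A -> R).
Hypothesis N0 : forall x, 0 <= N x.
Hypothesis Nz : N 0 = 0.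
Hypothesis NM : forall x y, N (x * y) = N x * N y.
Hypothesis NU : forall x y, N (x + y) <= Num.max (N x) (N y).
Hypothesis NN : forall x, N (- x) = N x.
Variable t : R.
Hypothesis t0 : 0 <= t.

(** The Gauss norm of radius [t], over an arbitrary ultrametric multiplicative seminorm: the
    coefficients will be polynomials measured by a point of the Berkovich line. *)
Definition gauss (P : {poly A}) : R := \big[Num.max/0]_(i < size P) (N P`_i * t ^+ i).

Lemma gauss_le (P : {poly A}) B : 0 <= B -> (forall i, N P`_i * t ^+ i <= B) -> gauss P <= B.
Proof. by move=> B0 h; apply/bigmax_leP; split. Qed.

Lemma gauss_ge0 P : 0 <= gauss P.
Proof. exact: bigmax_ge_id. Qed.

Lemma gauss_ge (P : {poly A}) i : N P`_i * t ^+ i <= gauss P.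
Proof.
have [iP|Pi] := ltnP i (size P); last by rewrite nth_default// Nz mul0r gauss_ge0.
exact: (le_bigmax _ (fun i : 'I_(size P) => N P`_i * t ^+ i) (Ordinal iP)).
Qed.

Lemma gauss_attained (P : {poly A}) : 0 < gauss P -> exists2 i, N P`_i * t ^+ i = gauss P &
  forall j, (j < i)%N -> N P`_j * t ^+ j < gauss P.
Proof.
move=> P0; have ex : exists i, N P`_i * t ^+ i == gauss P.
  apply: contrapT => /forallNP h; suff : gauss P < gauss P by rewrite ltxx.
  rewrite {1}/gauss; apply/bigmax_ltP; split => // i _.
  by rewrite lt_neqAle gauss_ge andbT; apply/negP; exact: h.
case: (ex_minnP ex) => i /eqP iE imin; exists i => // j ji.
rewrite lt_neqAle gauss_ge andbT; apply/negP => /imin.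
by rewrite leqNgt ji.
Qed.

Lemma gaussD P Q : gauss (P + Q) <= Num.max (gauss P) (gauss Q).
Proof.
apply: gauss_le => [|i]; first by rewrite le_max gauss_ge0.
rewrite coefD (@le_trans _ _ (Num.max (N P`_i) (N Q`_i) * t ^+ i))//.
  by rewrite ler_wpM2r// exprn_ge0.
by case: (leP (N P`_i) (N Q`_i)) => _; rewrite le_max gauss_ge ?orbT.
Qed.

Lemma Nsum_le (I : Type) (r : seq I) (S : pred I) (F : I -> A) (B : R) : 0 <= B ->
  (forall i, S i -> N (F i) <= B) -> N (\sum_(i <- r | S i) F i) <= B.
Proof.
move=> B0 h; elim/big_ind: _ => [||//]; first by rewrite Nz.
by move=> x y hx hy; rewrite (le_trans (NU x y))// ge_max hx hy.
Qed.

Lemma Nsum_lt (I : Type) (r : seq I) (S : pred I) (F : I -> A) (B : R) : 0 < B ->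
  (forall i, S i -> N (F i) < B) -> N (\sum_(i <- r | S i) F i) < B.
Proof.
move=> B0 h; elim/big_ind: _ => [||//]; first by rewrite Nz.
by move=> x y hx hy; rewrite (le_lt_trans (NU x y))// gt_max hx hy.
Qed.

Lemma Nadd_dominant x y : N y < N x -> N (x + y) = N x.
Proof.
move=> yx; apply/eqP; rewrite eq_le; apply/andP; split.
  by rewrite (le_trans (NU x y))// ge_max lexx ltW.
have := NU (x + y) (- y); rewrite addrK NN le_max => /orP[//|xy].
by have := lt_le_trans yx xy; rewrite ltxx.
Qed.

(** Gauss's lemma. If i and j are the first indices at which the maxima of P and Q are attained, the
    term P_i Q_j strictly dominates the coefficient of index i + j of the product. *)
Lemma gaussM P Q : gauss (P * Q) = gauss P * gauss Q.
Proof.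
apply/eqP; rewrite eq_le; apply/andP; split.
  apply: gauss_le => [|n]; first by rewrite mulr_ge0 ?gauss_ge0.
  have [t00|tn] := eqVneq (t ^+ n) 0; first by rewrite t00 mulr0 mulr_ge0 ?gauss_ge0.
  have tn0 : 0 < t ^+ n by rewrite lt_neqAle eq_sym tn exprn_ge0.
  rewrite -ler_pdivlMr// coefM; apply: Nsum_le => [|i _].
    by rewrite divr_ge0 ?mulr_ge0 ?gauss_ge0 ?exprn_ge0.
  rewrite ler_pdivlMr// NM; have ni : (n = i + (n - i))%N by rewrite subnKC// -ltnS.
  by rewrite [X in t ^+ X]ni exprD mulrACA ler_pM ?gauss_ge ?mulr_ge0 ?exprn_ge0.
have [P0|P0] := leP (gauss P) 0.
  by rewrite (le_trans _ (gauss_ge0 _))// mulr_le0_ge0 ?gauss_ge0.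
have [Q0|Q0] := leP (gauss Q) 0.
  by rewrite (le_trans _ (gauss_ge0 _))// mulr_ge0_le0 ?gauss_ge0.
have [i iE imin] := gauss_attained P0; have [j jE jmin] := gauss_attained Q0.
have tij : 0 < t ^+ (i + j).
  rewrite lt_neqAle exprn_ge0// andbT eq_sym exprD mulf_eq0 negb_or.
  by apply/andP; split; apply/eqP => tz; move: P0 Q0; rewrite -iE -jE tz mulr0 ltxx.
suff E : N (P * Q)`_(i + j) = N P`_i * N Q`_j.
  by rewrite (le_trans _ (gauss_ge _ (i + j)))// E exprD mulrACA iE jE.
have ij : (i < (i + j).+1)%N by rewrite ltnS leq_addr.
rewrite coefM (bigD1 (Ordinal ij))//= addKn -NM; apply: Nadd_dominant.
have PQ0 : 0 < N (P`_i * Q`_j).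
  rewrite NM lt_neqAle mulr_ge0 ?N0// andbT eq_sym mulf_eq0 negb_or.
  by apply/andP; split; apply/eqP => tz; move: P0 Q0; rewrite -iE -jE tz mul0r ltxx.
apply: Nsum_lt => // -[k kij'] /= ki; have kij : (k <= i + j)%N by [].
have {ki}ki : k != i by apply: contraNneq ki => ki; apply/eqP/val_inj.
rewrite -(ltr_pM2r tij) !NM exprD [ltRHS]mulrACA iE jE.
have -> : t ^+ i * t ^+ j = t ^+ k * t ^+ (i + j - k) by rewrite -!exprD subnKC.
rewrite mulrACA; have [ki'|ik] := ltnP k i.
  rewrite (@le_lt_trans _ _ (N P`_k * t ^+ k * gauss Q))//.
    by rewrite ler_wpM2l ?gauss_ge// mulr_ge0 ?exprn_ge0.
  by rewrite ltr_pM2r// imin.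
have ik' : (i < k)%N by rewrite ltn_neqAle eq_sym ki.
rewrite (@le_lt_trans _ _ (gauss P * (N Q`_(i + j - k) * t ^+ (i + j - k))))//.
  by rewrite ler_wpM2r ?gauss_ge// mulr_ge0 ?exprn_ge0.
by rewrite ltr_pM2l// jmin// ltn_subLR ?ltn_add2r.
Qed.

Lemma gaussC c : gauss c%:P = N c.
Proof.
apply/eqP; rewrite eq_le; apply/andP; split; last first.
  by have := gauss_ge c%:P 0; rewrite coefC /= expr0 mulr1.
apply: gauss_le => // i; rewrite coefC; case: eqP => [->|_]; last by rewrite Nz mul0r.
by rewrite expr0 mulr1.
Qed.

End GaussNorm.

(** * Order, joins and diameters on the Berkovich line *)

Section BerkovichOrder.
Variables (R : realType) (L : valField R).
Hypothesis ultra : forall x y : L, vabs (x + y) <= Num.max (vabs x) (vabs y).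
Hypothesis Lclosed : poly_closed [set: L].
Let LP := vabsP L.
Local Notation berk := (berk_A1 L).
Implicit Types S T U : berk.

Lemma berk_ext (S T : berk) : (forall P, S P = T P) -> S = T.
Proof.
case: S T => [f f0 fD fM fC] [g g0 gD gM gC] /= /funext fg; subst g.
by congr BerkA1; exact: Prop_irrelevance.
Qed.

Definition dist (S : berk) (z : L) : R := S ('X - z%:P).

Lemma berk0 (S : berk) : S 0 = 0.
Proof. by have := snormC S 0; rewrite (av0 LP). Qed.
Lemma berk1 (S : berk) : S 1 = 1.
Proof. by have := snormC S 1; rewrite (av1 LP). Qed.
Lemma berkN (S : berk) P : S (- P) = S P.
Proof. by rewrite -mulN1r -[X in S (X * _)]polyCN snormM snormC (avN LP) (av1 LP) mul1r. Qed.

Lemma berkU (S : berk) P Q : S (P + Q) <= Num.max (S P) (S Q).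
Proof.
apply: ultrametric_of_natr_le1 => [z||//|z z'|z z'|n].
- exact: snorm_ge0.
- exact: berk0.
- exact: berk1.
- exact: snormM.
- exact: snormD.
- rewrite -polyC_natr snormC.
  elim: n => [|n IH]; first by rewrite (av0 LP).
  by rewrite -natr1 (le_trans (ultra _ _))// ge_max IH (av1 LP) lexx.
Qed.

Lemma berk_prod (S : berk) (I : Type) (s : seq I) (F : I -> {poly L}) :
  S (\prod_(i <- s) F i) = \prod_(i <- s) S (F i).
Proof. by elim: s => [|i s IH]; rewrite ?big_nil ?berk1// !big_cons snormM IH. Qed.

Lemma L_split (P : {poly L}) : exists s : seq L, P = lead_coef P *: \prod_(z <- s) ('X - z%:P).
Proof.
have [//|//|s _ sE] := @poly_closed_split _ L setT _ Lclosed P.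
by exists s.
Qed.

Lemma berk_dist_prod S (c : L) (s : seq L) :
  S (c *: \prod_(z <- s) ('X - z%:P)) = vabs c * \prod_(z <- s) dist S z.
Proof. by rewrite -mul_polyC snormM snormC berk_prod. Qed.

(** Polynomials over L split, so a point is determined by its values on the X - z. Everything that
    follows is expressed through the functions [dist S]. *)
Lemma berk_leP (S T : berk) : berk_le S T <-> forall z, dist S z <= dist T z.
Proof.
split => [h z|h P]; first exact: h.
have [s ->] := L_split P; rewrite !berk_dist_prod ler_wpM2l ?(av_ge0 LP)//.
by apply: ler_prod => z _; rewrite snorm_ge0 h.
Qed.

Lemma berk_le_anti (S T : berk) : berk_le S T -> berk_le T S -> S = T.
Proof. by move=> ST TS; apply: berk_ext => P; apply/eqP; rewrite eq_le ST TS. Qed.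

Lemma dist_inj (S T : berk) : dist S =1 dist T -> S = T.
Proof. by move=> h; apply: berk_le_anti; apply/berk_leP => z; rewrite h. Qed.

Lemma dist_ge0 S z : 0 <= dist S z. Proof. exact: snorm_ge0. Qed.

Lemma dist_ultra S z w : dist S z <= Num.max (dist S w) (vabs (z - w)).
Proof.
rewrite /dist (_ : 'X - z%:P = ('X - w%:P) + (w - z)%:P); last first.
  by rewrite polyCB addrA subrK.
by rewrite (le_trans (berkU _ _ _))// snormC (av_distC LP).
Qed.

Lemma abs_le_dist S z w : vabs (z - w) <= Num.max (dist S z) (dist S w).
Proof.
rewrite -(snormC S) /dist (_ : (z - w)%:P = ('X - w%:P) - ('X - z%:P)); last first.
  by rewrite polyCB; ring.
by rewrite (le_trans (berkU _ _ _))// berkN maxC.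
Qed.

Lemma dist_point z w : dist (berk_point z) w = vabs (z - w).
Proof. by rewrite /dist /= hornerXsubC. Qed.

(** This is P(X + Y) as a polynomial in Y whose coefficients are polynomials in X. Measuring these
    by S and applying the Gauss norm of radius r in Y enlarges S multiplicatively, which is how
    [raise] is built. *)
Definition taylor (P : {poly L}) : {poly {poly L}} := P^:P \Po ('X + ('X)%:P).

Lemma taylorM P Q : taylor (P * Q) = taylor P * taylor Q.
Proof. by rewrite /taylor rmorphM comp_polyM. Qed.
Lemma taylorD P Q : taylor (P + Q) = taylor P + taylor Q.
Proof. by rewrite /taylor rmorphD comp_polyD. Qed.
Lemma taylorC c : taylor c%:P = c%:P%:P.
Proof. by rewrite /taylor map_polyC comp_polyC. Qed.
Lemma taylorX z : taylor ('X - z%:P) = 'X + ('X - z%:P)%:P.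
Proof. by rewrite taylorD -polyCN taylorC /taylor map_polyX comp_polyX polyCD -addrA polyCN. Qed.

Section Raise.
Variables (S : berk) (r : R).
Let t := Num.max r 0.
Let t0 : 0 <= t. Proof. by rewrite le_max lexx orbT. Qed.
Let f P := gauss S t (taylor P).

Let f_ge0 P : 0 <= f P. Proof. exact: gauss_ge0. Qed.
Let fD P Q : f (P + Q) <= f P + f Q.
Proof.
rewrite /f taylorD (le_trans (gaussD (berk0 S) (berkU S) t0 _ _))// ge_max.
by rewrite lerDl lerDr !f_ge0.
Qed.
Let fM P Q : f (P * Q) = f P * f Q.
Proof.
rewrite /f taylorM; apply: gaussM => //.
- exact: snorm_ge0.
- exact: berk0.
- exact: snormM.
- exact: berkU.
- exact: berkN.
Qed.
Let fC c : f c%:P = vabs c.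
Proof. by rewrite /f taylorC gaussC ?snormC ?(av0 LP)// => P; exact: snorm_ge0. Qed.

(* The point obtained from [S] by enlarging every disc of radius below [r] to radius [r]. *)
Definition raise : berk := BerkA1 f_ge0 fD fM fC.

Lemma dist_raise z : dist raise z = Num.max (dist S z) r.
Proof.
suff -> : dist raise z = Num.max (dist S z) t by rewrite /t maxA max_l// le_max dist_ge0.
rewrite /dist /= /f taylorX; apply/eqP; rewrite eq_le; apply/andP; split.
  apply: gauss_le => [|i]; first by rewrite le_max t0 orbT.
  rewrite coefD coefX coefC; case: i => [|[|i]] /=.
  - by rewrite add0r expr0 mulr1 le_max lexx.
  - by rewrite addr0 berk1 mul1r expr1 le_max lexx orbT.
  - by rewrite addr0 berk0 mul0r le_max t0 orbT.
have ge := @gauss_ge _ _ S (berk0 S) t ('X + ('X - z%:P)%:P).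
rewrite ge_max; apply/andP; split.
  by have := ge 0%N; rewrite coefD coefX coefC add0r expr0 mulr1.
by have := ge 1%N; rewrite coefD coefX coefC addr0 berk1 mul1r expr1.
Qed.

End Raise.

(** The radius of the smallest discs meeting both points, in closed form; [berk_supE] identifies it
    with [berk_sup], and on classical points it is the distance. *)
Definition J (S T : berk) : R := inf [set Num.max (dist S z) (dist T z) | z in setT].

Let J_has_inf S T : has_inf [set Num.max (dist S z) (dist T z) | z in setT].
Proof.
split; first by exists (Num.max (dist S 0) (dist T 0)), 0.
by exists 0 => _ [z _ <-]; rewrite le_max dist_ge0.
Qed.

Lemma J_le S T z : J S T <= Num.max (dist S z) (dist T z).
Proof. by apply: ge_inf; [case: (J_has_inf S T)|exists z]. Qed.

Lemma J_ge S T c : (forall z, c <= Num.max (dist S z) (dist T z)) -> c <= J S T.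
Proof.
move=> h; apply: lb_le_inf; first by case: (J_has_inf S T).
by move=> _ [z _ <-].
Qed.

Lemma J_lt S T c : J S T < c -> exists z, dist S z < c /\ dist T z < c.
Proof.
move=> h; apply: contrapT => /forallNP nz; move: h; rewrite ltNge => /negP; apply.
apply: J_ge => z; rewrite leNgt gt_max; apply/negP => /andP[? ?]; exact: (nz z).
Qed.

Lemma J_ge0 S T : 0 <= J S T.
Proof. by apply: J_ge => z; rewrite le_max dist_ge0. Qed.

Lemma JC S T : J S T = J T S.
Proof. by apply/eqP; rewrite eq_le; apply/andP; split; apply: J_ge => z; rewrite maxC J_le. Qed.

Lemma diamE S : diam S = J S S.
Proof. by rewrite /diam /J; congr inf; apply: eq_imagel => z _; rewrite maxxx. Qed.

Lemma diam_le S z : diam S <= dist S z.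
Proof. by rewrite diamE (le_trans (J_le _ _ z))// maxxx. Qed.

Lemma diam_ge S c : (forall z, c <= dist S z) -> c <= diam S.
Proof. by move=> h; rewrite diamE; apply: J_ge => z; rewrite maxxx. Qed.

Lemma diam_ge0 S : 0 <= diam S. Proof. by rewrite diamE J_ge0. Qed.

Lemma diam_le_J S T : diam S <= J S T.
Proof. by apply: J_ge => z; rewrite le_max diam_le. Qed.

Lemma le_diam S T : berk_le S T -> diam S <= diam T.
Proof. by move=> /berk_leP h; apply: diam_ge => z; rewrite (le_trans (diam_le S z)). Qed.

(** Some z is nearly within J of both points, so beyond the radius J the functions [dist S] and
    [dist T] agree. Hence the join is obtained by enlarging S alone up to J, as [joinE] makes
    precise. *)
Lemma max_distE S T z : Num.max (dist S z) (dist T z) = Num.max (dist S z) (J S T).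
Proof.
apply/eqP; rewrite eq_le !ge_max !le_max lexx /=; apply/andP; split; last first.
  by rewrite -le_max J_le.
rewrite -le_max leNgt; apply/negP; rewrite gt_max => /andP[Sz Jz].
have [w [Sw Tw]] := J_lt Jz.
have := dist_ultra T z w; rewrite le_max leNgt Tw /= => h.
by have := le_trans h (abs_le_dist S z w); rewrite leNgt gt_max Sz Sw.
Qed.

Lemma raise_id S r : r <= diam S -> raise S r = S.
Proof. by move=> rS; apply: dist_inj => z; rewrite dist_raise max_l// (le_trans rS)// diam_le. Qed.

Lemma le_raise S r : berk_le S (raise S r).
Proof. by apply/berk_leP => z; rewrite dist_raise le_max lexx. Qed.

Lemma raise_le S r r' : r <= r' -> berk_le (raise S r) (raise S r').
Proof.
move=> rr; apply/berk_leP => z; rewrite !dist_raise ge_max !le_max lexx /=.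
by rewrite rr orbT.
Qed.

Lemma diam_raise S r : diam (raise S r) = Num.max (diam S) r.
Proof.
apply/eqP; rewrite eq_le; apply/andP; split; last first.
  by apply: diam_ge => z; rewrite dist_raise ge_max !le_max diam_le lexx orbT.
rewrite leNgt; apply/negP; rewrite gt_max => /andP[h1 h2].
have [z [Sz _]] : exists z, dist S z < diam (raise S r) /\ dist S z < diam (raise S r).
  by apply: J_lt; rewrite -diamE.
have := diam_le (raise S r) z; rewrite dist_raise leNgt gt_max Sz.
by rewrite h2.
Qed.

(** The points above S form a ray parametrized by the diameter; this is the tree structure of the
    line. *)
Lemma above_raise S T : berk_le S T -> T = raise S (diam T).
Proof.
move=> /berk_leP ST; apply: dist_inj => z; rewrite dist_raise.
have := max_distE S T z; rewrite max_r// => ->; congr Num.max.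
apply/eqP; rewrite eq_le; apply/andP; split; last first.
  by apply: J_ge => w; rewrite le_max diam_le orbT.
by apply: diam_ge => w; rewrite (le_trans (J_le _ _ w))// max_r.
Qed.

Lemma joinE S T : berk_join S T = raise S (J S T).
Proof.
set M := raise S (J S T).
have dM z : dist M z = Num.max (dist S z) (dist T z) by rewrite dist_raise -max_distE.
have MP : [/\ berk_le S M, berk_le T M & forall N : berk, berk_le S N -> berk_le T N -> berk_le M N].
  split => [||N /berk_leP SN /berk_leP TN]; apply/berk_leP => z; rewrite dM ?le_max ?lexx ?orbT//.
  by rewrite ge_max SN TN.
rewrite /berk_join; set E := [set _ | _].
have : E (get E) by apply: getPex; exists M.
move=> [h1 h2 h3]; apply: berk_le_anti; first by apply: h3; case: MP.
by case: MP => _ _; apply.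
Qed.

Lemma berk_supE S T : berk_sup S T = J S T.
Proof. by rewrite /berk_sup joinE diam_raise max_r// diam_le_J. Qed.

Lemma dist_join S T z : dist (berk_join S T) z = Num.max (dist S z) (dist T z).
Proof. by rewrite joinE dist_raise -max_distE. Qed.

Lemma joinC S T : berk_join S T = berk_join T S.
Proof. by apply: dist_inj => z; rewrite !dist_join maxC. Qed.

Lemma le_joinl S T : berk_le S (berk_join S T).
Proof. by apply/berk_leP => z; rewrite dist_join le_max lexx. Qed.

Lemma le_joinr S T : berk_le T (berk_join S T).
Proof. by rewrite joinC; exact: le_joinl. Qed.

Lemma join_le S T (N : berk) : berk_le S N -> berk_le T N -> berk_le (berk_join S T) N.
Proof. by move=> /berk_leP h /berk_leP h'; apply/berk_leP => z; rewrite dist_join ge_max h h'. Qed.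

Lemma J_ultra S T U : J S U <= Num.max (J S T) (J T U).
Proof.
wlog TU : S U / J S T <= J T U.
  move=> wh; have [h|] := boolP (J S T <= J T U); first exact: wh.
  rewrite -ltNge => /ltW h; rewrite maxC (JC S U) (JC T U) (JC S T); apply: wh.
  by rewrite (JC U T) (JC T S).
rewrite (max_r TU) leNgt; apply/negP => h.
have h2 : J S T < J S U by exact: le_lt_trans h.
have [z [Tz Uz]] := J_lt h; have [w [Sw Tw]] := J_lt h2.
have Uw : dist U w < J S U.
  rewrite (le_lt_trans (dist_ultra U w z))// gt_max Uz /=.
  by rewrite (le_lt_trans (abs_le_dist T w z))// gt_max Tw Tz.
by have := J_le S U w; rewrite leNgt gt_max Sw Uw.
Qed.

Lemma J_raise S T r : J (raise S r) T = Num.max (J S T) r.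
Proof.
apply/eqP; rewrite eq_le; apply/andP; split; last first.
  rewrite ge_max; apply/andP; split; apply: J_ge => z; rewrite dist_raise.
    by rewrite (le_trans (J_le _ _ z))// ge_max !le_max !lexx ?orbT.
  by rewrite !le_max lexx orbT.
rewrite leNgt; apply/negP; rewrite gt_max => /andP[h1 h2].
have [z [Sz Tz]] := J_lt h1.
by have := J_le (raise S r) T z; rewrite dist_raise leNgt !gt_max Sz Tz h2.
Qed.

Lemma J_point z w : J (berk_point z) (berk_point w) = vabs (z - w).
Proof.
apply/eqP; rewrite eq_le; apply/andP; split.
  rewrite (le_trans (J_le _ _ z))// !dist_point subrr (av0 LP) ge_max (av_ge0 LP).
  by rewrite (av_distC LP) lexx.
apply: J_ge => u; rewrite !dist_point -[z - w](subrKA u).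
by rewrite (le_trans (ultra _ _))// (av_distC LP u w).
Qed.

Lemma diam_point (z : L) : diam (berk_point z) = 0.
Proof. by rewrite diamE J_point subrr (av0 LP). Qed.

Definition canon : berk := raise (berk_point 0) 1.

Lemma dist_canon z : dist canon z = Num.max 1 (vabs z).
Proof. by rewrite dist_raise dist_point sub0r (avN LP) maxC. Qed.

Lemma berk_canE : berk_can L = canon.
Proof.
have key P : canon P = sup [set vabs P.[z] | z in [set z : L | vabs z <= 1]].
  have [s PE] := L_split P; set c := lead_coef P in PE.
  have cE : canon P = vabs c * \prod_(z <- s) Num.max 1 (vabs z).
    rewrite PE berk_dist_prod; congr (_ * _); apply: eq_bigr => z _; exact: dist_canon.
  have vE w : vabs P.[w] = vabs c * \prod_(z <- s) vabs (w - z).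
    rewrite PE hornerZ horner_prod (avM LP) (av_prod LP); congr (_ * _).
    by apply: eq_bigr => z _; rewrite hornerXsubC.
  have le w : vabs w <= 1 -> vabs P.[w] <= canon P.
    move=> w1; rewrite vE cE ler_wpM2l ?(av_ge0 LP)//; apply: ler_prod => z _.
    by rewrite (av_ge0 LP)/= (le_trans (ultra _ _))// (avN LP) ge_max !le_max w1 lexx orbT.
  (* A root of [prod (X - z) - 1], over the [z] in the unit ball, avoids their residue classes. *)
  have [w w1 wP] : exists2 w : L, vabs w <= 1 & vabs P.[w] = canon P.
    pose u := [seq z <- s | vabs z <= 1].
    have [w w1 wu] : exists2 w : L, vabs w <= 1 & forall z, z \in u -> vabs (w - z) = 1.
      have [u0|un] := eqVneq u [::].
        by exists 0; rewrite ?(av0 LP)// => z; rewrite u0.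
      pose Q : {poly L} := \prod_(z <- u) ('X - z%:P).
      have sQ : size Q = (size u).+1 by rewrite size_prod_XsubC.
      have u0 : (0 < size u)%N by rewrite lt0n size_eq0.
      have sQ1 : size (Q - 1) = (size u).+1.
        by rewrite size_polyDl// size_polyN size_poly1 sQ ltnS.
      have [//||w _ /rootP] := Lclosed (P := Q - 1).
        by rewrite sQ1 ltnS.
      rewrite hornerD hornerN hornerC => /eqP; rewrite subr_eq0 => /eqP Qw.
      have Qw' : \prod_(z <- u) vabs (w - z) = 1.
        have := congr1 (@vabs R L) Qw; rewrite horner_prod (av_prod LP) (av1 LP) => h; rewrite -[RHS]h.
        by apply: eq_bigr => z _; rewrite hornerXsubC.
      have w1 : vabs w <= 1.
        rewrite leNgt; apply/negP => w1.
        have wz z : z \in u -> vabs (w - z) = vabs w.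
          rewrite mem_filter => /andP[z1 _].
          by apply: (Nadd_dominant ultra (avN LP)); rewrite (avN LP) (le_lt_trans z1).
        move: Qw'; rewrite big_seq (eq_bigr (fun=> vabs w)) => [|z /wz //].
        rewrite -big_seq big_const_seq count_predT iter_mulr_1 => /eqP.
        by rewrite gt_eqF// exprn_egt1// -lt0n.
      exists w => // z zu; apply/eqP; rewrite eq_le; apply/andP; split.
        move: zu; rewrite mem_filter => /andP[z1 _].
        by rewrite (le_trans (ultra _ _))// (avN LP) ge_max w1 z1.
      rewrite -Qw' (big_rem z)//= ler_piMr ?(av_ge0 LP)//.
      suff /andP[] : 0 <= \prod_(y <- rem z u) vabs (w - y) <= 1 by [].
      rewrite big_seq; apply: (big_ind (fun x : R => 0 <= x <= 1)) => [|x y /andP[x0 x1] /andP[y0 y1]|y yu].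
      - by rewrite ler01 lexx.
      - by rewrite mulr_ge0// mulr_ile1.
      rewrite (av_ge0 LP)/=.
      have : y \in u by apply: mem_rem yu.
      rewrite mem_filter => /andP[y1 _].
      by rewrite (le_trans (ultra _ _))// (avN LP) ge_max w1 y1.
    exists w => //; rewrite vE cE; congr (_ * _).
    rewrite big_seq [RHS]big_seq; apply: eq_bigr => z zs.
    have [z1|z1] := leP (vabs z) 1.
      by rewrite wu// mem_filter z1.
    rewrite (av_distC LP).
    by apply: (Nadd_dominant ultra (avN LP)); rewrite (avN LP) (le_lt_trans w1).
  apply/eqP; rewrite eq_le; apply/andP; split.
    rewrite -wP; apply: ub_le_sup; last by exists w.
    by exists (canon P) => _ [z z1 <-]; exact: le.
  apply: ge_sup; first by exists (vabs P.[w]), w.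
  by move=> _ [z z1 <-]; exact: le.
rewrite /berk_can; set E := [set _ | _].
have : E (get E) by apply: getPex; exists canon.
by move=> h; apply: berk_ext => P; rewrite h key.
Qed.

Lemma J_canon S : J S canon = Num.max 1 (dist S 0).
Proof.
apply/eqP; rewrite eq_le; apply/andP; split.
  by rewrite (le_trans (J_le _ _ 0))// dist_canon (av0 LP) (max_l ler01) maxC.
apply: J_ge => z; rewrite dist_canon ge_max !le_max lexx orbT /=.
have := dist_ultra S 0 z; rewrite sub0r (avN LP) le_max => /orP[->//|->].
by rewrite !orbT.
Qed.

Lemma diam_canon : diam canon = 1.
Proof. by rewrite diam_raise diam_point max_r. Qed.

Hypothesis Lcomplete : vcomplete L.

(** If the diameter is 0, centers of shrinking discs form a Cauchy sequence; its limit, which exists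
    by completeness, is a classical point equal to S. *)
Lemma berk_H_diam S : berk_H S <-> 0 < diam S.
Proof.
split => [SH|d0 z Sz]; last by move: d0; rewrite Sz diam_point ltxx.
rewrite lt_neqAle diam_ge0 andbT; apply/eqP => d0.
have ex (n : nat) : exists z, dist S z < n.+1%:R^-1.
  have [|z [h _]] := @J_lt S S n.+1%:R^-1; last by exists z.
  by rewrite -diamE -d0 invr_gt0.
have [z zP] := choice ex.
have small (e : R) : 0 < e -> exists N, forall n, (N <= n)%N -> dist S (z n) < e.
  move=> e0; exists (Num.truncn e^-1) => n Nn; rewrite (lt_trans (zP n))//.
  rewrite invf_plt ?posrE// (lt_le_trans (truncnS_gt _))// ler_nat ltnS//.
have [e e0|w wP] := Lcomplete (u := z).
  have [N NP] := small e e0; exists N => m n Nm Nn.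
  by rewrite (le_lt_trans (abs_le_dist S _ _))// gt_max !NP.
have Sw : dist S w = 0.
  apply/eqP; rewrite eq_le dist_ge0 andbT; apply/ler_addgt0Pr => e e0; rewrite add0r.
  have [N NP] := small e e0; have [M MP] := wP e e0.
  rewrite (le_trans (dist_ultra S w (z (maxn N M))))// ge_max !ltW//.
    by rewrite (av_distC LP) MP// leq_maxr.
  by rewrite NP// leq_maxl.
apply: (SH w); apply: dist_inj => u; rewrite dist_point; apply/eqP; rewrite eq_le; apply/andP; split.
  by have := dist_ultra S u w; rewrite Sw max_r ?(av_ge0 LP)// (av_distC LP).
by have := abs_le_dist S w u; rewrite Sw max_r ?dist_ge0.
Qed.

End BerkovichOrder.

Section MaxLimits.
Context {T : Type} (R : realType) (F : set_system T).
Hypothesis FF : Filter F.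

Lemma cvg_maxR (f g : T -> R) a b : f @ F --> a -> g @ F --> b ->
  (fun x => Num.max (f x) (g x)) @ F --> Num.max a b.
Proof.
move=> fa gb; rewrite maxr_absE; under eq_fun do rewrite maxr_absE.
apply: cvgM; last exact: cvg_cst.
by apply: cvgD; [exact: cvgD|apply: cvg_norm; exact: cvgB].
Qed.

Lemma cvg_minR (f g : T -> R) a b : f @ F --> a -> g @ F --> b ->
  (fun x => Num.min (f x) (g x)) @ F --> Num.min a b.
Proof.
move=> fa gb; rewrite minr_absE; under eq_fun do rewrite minr_absE.
apply: cvgM; last exact: cvg_cst.
by apply: cvgB; [exact: cvgD|apply: cvg_norm; exact: cvgB].
Qed.

Lemma cvg_bigmaxR (I : Type) (s : seq I) (f : I -> T -> R) (l : I -> R) :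
  (forall i, f i @ F --> l i) ->
  (fun x => \big[Num.max/0]_(i <- s) f i x) @ F --> \big[Num.max/0]_(i <- s) l i.
Proof.
move=> h; elim: s => [|i s IH].
  by rewrite big_nil; under eq_fun do rewrite big_nil; exact: cvg_cst.
by rewrite big_cons; under eq_fun do rewrite big_cons; exact: cvg_maxR.
Qed.

Lemma cvg_exprR (f : T -> R) (a : R) n : f @ F --> a -> (fun x => f x ^+ n) @ F --> a ^+ n.
Proof.
move=> fa; elim: n => [|n IH]; first by under eq_fun do rewrite expr0; exact: cvg_cst.
by rewrite exprS; under eq_fun do rewrite exprS; exact: cvgM.
Qed.

End MaxLimits.

Lemma near_ltR (R : realType) (t c : R) : t < c -> \forall s \near t, s < c.
Proof.
move=> tc; have : open_nbhs t [set s | s < c] by split => //; exact: open_lt.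
by move/open_nbhs_nbhs.
Qed.

Lemma near_gtR (R : realType) (t c : R) : c < t -> \forall s \near t, c < s.
Proof.
move=> tc; have : open_nbhs t [set s | c < s] by split => //; exact: open_gt.
by move/open_nbhs_nbhs.
Qed.

(** * Paths on the Berkovich line and an explicit formula for the pairing *)

Section BerkovichTopology.
Variables (R : realType) (L : valField R).
Hypothesis ultra : forall x y : L, vabs (x + y) <= Num.max (vabs x) (vabs y).
Hypothesis Lclosed : poly_closed [set: L].
Let LP := vabsP L.
Local Notation berk := (berk_A1 L).
Local Notation P1 := (berk_P1 L).
Implicit Types S T U : berk.
Local Notation raise := (raise ultra).
Local Notation canon := (canon ultra).

Lemma berk_eval_continuous (P : {poly L}) : continuous (fun S : berk => S P).
Proof.
move=> S; have h1 : (fun S : berk => snorm S : {ptws {poly L} -> R}) @ S --> (snorm S : {ptws {poly L} -> R}).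
  exact: initial_continuous.
have h2 : continuous (fun g : {ptws {poly L} -> R} => g P) by exact: proj_continuous.
exact: (continuous_comp h1 (h2 _)).
Qed.

Lemma berk_cvg (F : set_system berk) (S : berk) : Filter F ->
  (forall P, (fun x : berk => x P) @ F --> S P) -> F --> S.
Proof.
move=> FF h A [_ [[B oB <-] BS BA]]; apply: filterS BA _ => /=.
suff : (fun x : berk => snorm x : {ptws {poly L} -> R}) @ F --> (snorm S : {ptws {poly L} -> R}).
  by move/(_ B); apply; exact: open_nbhs_nbhs.
apply/cvg_sup => P C [_ [[D oD <-] DS DC]]; apply: filterS DC _ => /=.
by apply: (h P D); exact: open_nbhs_nbhs.
Qed.

Lemma raise_cvg (T : Type) (F : set_system T) (Y : T -> berk) (e : T -> R) S e0 : Filter F ->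
  Y @ F --> S -> e @ F --> e0 -> (fun t => raise (Y t) (e t)) @ F --> raise S e0.
Proof.
move=> FF YS ee; apply: berk_cvg => P /=; rewrite /gauss.
apply: cvg_bigmaxR => i; apply: cvgM.
  exact: (cvg_comp _ _ YS (@berk_eval_continuous _ S)).
by apply: cvg_exprR; apply: cvg_maxR => //; exact: cvg_cst.
Qed.

Lemma berk_disc_closed z r : closed [set x : berk | dist x z <= r].
Proof.
have -> : [set x : berk | dist x z <= r] = (fun x : berk => x ('X - z%:P)) @^-1` [set y | y <= r] by [].
by apply: closed_comp; [move=> *; exact: berk_eval_continuous|exact: closed_le].
Qed.

Lemma berk_disc_bound z r P : exists M, forall x : berk, dist x z <= r -> x P <= M.
Proof.
have [s PE] := L_split Lclosed P.
exists (vabs (lead_coef P) * \prod_(w <- s) Num.max r (vabs (w - z))) => x xr.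
rewrite {1}PE berk_dist_prod ler_wpM2l ?(av_ge0 LP)//; apply: ler_prod => w _.
rewrite dist_ge0 (le_trans (dist_ultra ultra x w z))// ge_max !le_max xr lexx.
by rewrite orbT.
Qed.

(** On a disc every polynomial is bounded. Along an ultrafilter its values thus converge, and the
    limits form again a multiplicative seminorm. *)
Lemma berk_disc_compact z r : compact [set x : berk | dist x z <= r].
Proof.
rewrite compact_ultra => F FU FA.
have ex P : exists l : R, (fun x : berk => x P) @ F --> l.
  have [M MP] := berk_disc_bound z r P.
  have F0M : F ((fun x : berk => x P) @^-1` `[0, M]).
    by apply: filterS FA => x /= xr; rewrite in_itv /= (snorm_ge0 x P) MP.
  have [l [_ lP]] := @segment_compact R 0 M ((fun x : berk => x P) @ F) _ F0M.
  exists l => B lB; have [//|FB] := in_ultra_setVsetC ((fun x : berk => x P) @^-1` B) FU.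
  by have [y [yB By]] := lP (~` B) B FB lB.
have [f fP] := choice ex.
have f0 P : 0 <= f P.
  by apply: (ler_cvg_to (cvg_cst 0) (fP P)); apply: nearW => x; exact: snorm_ge0.
have fD P Q : f (P + Q) <= f P + f Q.
  apply: (ler_cvg_to (fP (P + Q)) (cvgD (fP P) (fP Q))).
  by apply: nearW => x; exact: snormD.
have fM P Q : f (P * Q) = f P * f Q.
  have h : (fun x : berk => x (P * Q)) @ F --> f P * f Q.
    rewrite (_ : (fun x : berk => x (P * Q)) = (fun x : berk => x P * x Q)); first exact: cvgM (fP P) (fP Q).
    by apply/funext => x; exact: snormM.
  by apply/eqP; rewrite eq_le (ler_cvg_to (fP (P * Q)) h) ?(ler_cvg_to h (fP (P * Q)))//; exact: nearW.
have fC c : f c%:P = vabs c.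
  have h : (fun x : berk => x c%:P) @ F --> vabs c.
    rewrite (_ : (fun x : berk => x c%:P) = (fun=> vabs c)); first exact: cvg_cst.
    by apply/funext => x; exact: snormC.
  by apply/eqP; rewrite eq_le (ler_cvg_to (fP c%:P) h) ?(ler_cvg_to h (fP c%:P))//; exact: nearW.
have FS : F --> BerkA1 f0 fD fM fC by apply: berk_cvg => P; exact: fP.
exists (BerkA1 f0 fD fM fC); split => //.
exact: (closed_cvg (u_ := id) _ (@berk_disc_closed z r) FA _ FS).
Qed.

Lemma near_infty z r : nbhs (None : P1) ((Some @` [set x : berk | r < dist x z]) `|` [set None]).
Proof.
exists [set x : berk | dist x z <= r].
  by split; [exact: berk_disc_compact|exact: berk_disc_closed].
move=> p [[x /= xr <-]|->]; [left|by right].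
by exists x => //=; rewrite ltNge; exact/negP.
Qed.

Lemma nbhs_infty A : nbhs (None : P1) A -> exists r, forall x : berk, r < dist x 0 -> A (Some x).
Proof.
move=> [C [cC _] CA].
have : compact ((fun x : berk => dist x 0) @` C).
  by apply: continuous_compact => //; apply: continuous_subspaceT; exact: berk_eval_continuous.
move=> /compact_bounded[M [_ MP]]; exists (M + 1) => x xM; apply: CA; left; exists x => //= Cx.
have := MP (M + 1); rewrite ltrDl ltr01 => /(_ isT (dist x 0)) /(_ (ex_intro2 _ _ x Cx erefl)).
by rewrite /= ger0_norm ?dist_ge0// leNgt xM.
Qed.

Definition odisc z r : set P1 := Some @` [set x : berk | dist x z < r].
Definition zeta z r : berk := raise (berk_point z) r.

Lemma dist_zeta z r w : dist (zeta z r) w = Num.max (vabs (z - w)) r.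
Proof. by rewrite dist_raise dist_point. Qed.

Lemma odisc_open z r : open (odisc z r).
Proof.
apply: one_point_compactification_open_some.
have -> : [set x : berk | dist x z < r] = (fun x : berk => x ('X - z%:P)) @^-1` [set y | y < r] by [].
by apply: open_comp; [move=> *; exact: berk_eval_continuous|exact: open_lt].
Qed.

(** The boundary of an open disc is the single point [zeta z r]; this is what prevents paths from
    leaving a disc anywhere else. *)
Lemma odisc_zeta_closed z r : 0 <= r -> closed (odisc z r `|` [set Some (zeta z r)]).
Proof.
move=> r0; rewrite -[X in closed X]setCK; apply: open_closedC; rewrite openE => p pD.
case: p pD => [x|_]; last first.
  apply: filterS (near_infty z r) => q [[y /= yr <-]|->].
    move=> [[w /= wr [wy]]|[yz]]; first by move: yr; rewrite -wy ltNge (ltW wr).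
    by move: yr; rewrite yz dist_zeta subrr (av0 LP) max_r// ltxx.
  by move=> [[]|].
move=> /not_orP[xD xz]; have rx : r <= dist x z.
  by rewrite leNgt; apply/negP => h; apply: xD; exists x.
have some_nbhs (B : set berk) : nbhs x B -> (forall y, B y -> ~ (odisc z r `|` [set Some (zeta z r)]) (Some y)) ->
    (~` (odisc z r `|` [set Some (zeta z r)]))° (Some x).
  move=> xB BD; have := @one_point_compactification_some_nbhs _ x B xB; apply: filterS.
  by move=> q [y By <-]; exact: BD.
have [rx'|rx'] := ltP r (dist x z).
  apply: (some_nbhs [set y : berk | r < dist y z]).
    exact: (@berk_eval_continuous ('X - z%:P) x _ (near_gtR rx')).
  move=> y /= yr [[w /= wr [wy]]|[yz]]; first by move: yr; rewrite -wy ltNge (ltW wr).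
  by move: yr; rewrite yz dist_zeta subrr (av0 LP) max_r// ltxx.
have {rx rx'}xr : dist x z = r by apply/eqP; rewrite eq_le rx rx'.
have [w wP] : exists w, dist x w <> Num.max (vabs (z - w)) r.
  apply: contrapT => /forallNP h; apply: xz; congr Some; apply: (dist_inj Lclosed) => w.
  by rewrite dist_zeta; apply: contrapT.
have xw : dist x w < Num.max (vabs (z - w)) r.
  rewrite lt_neqAle; apply/andP; split; first exact/eqP.
  by rewrite maxC -xr (av_distC LP) dist_ultra.
have zw : vabs (z - w) <= r.
  rewrite leNgt; apply/negP => rz; have := abs_le_dist ultra x z w.
  by rewrite leNgt gt_max xr rz /=; move: xw; rewrite max_l ?(ltW rz)// => ->.
rewrite max_r// in xw.
have zwr : vabs (z - w) = r.
  apply/eqP; rewrite eq_le zw /= leNgt; apply/negP => h.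
  by have := dist_ultra ultra x z w; rewrite leNgt gt_max xr xw h.
apply: (some_nbhs [set y : berk | dist y w < r]).
  exact: (@berk_eval_continuous ('X - w%:P) x _ (near_ltR xw)).
move=> y /= yr [[u /= ur [uy]]|[yz]].
  have := abs_le_dist ultra y z w; rewrite zwr leNgt gt_max yr andbT -uy.
  by move=> /negP; apply.
by move: yr; rewrite yz dist_zeta zwr maxxx ltxx.
Qed.

Lemma path_crosses (g : R -> P1) a b z r : 0 <= r -> {within `[a, b], continuous g} ->
  (exists2 s, a <= s <= b & odisc z r (g s)) -> (exists2 s, a <= s <= b & ~ odisc z r (g s)) ->
  exists2 s, a <= s <= b & g s = Some (zeta z r).
Proof.
move=> r0 cg [s sab sD] [s' sab' sD']; apply: contrapT => nz.
have cA := connected_continuous_connected (@segment_connected R a b) cg.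
have E : (g @` `[a, b]) `&` odisc z r = g @` `[a, b].
  apply: cA.
  - by exists (g s); split => //; exists s => //=; rewrite in_itv.
  - by exists (odisc z r) => //; exact: odisc_open.
  - exists (odisc z r `|` [set Some (zeta z r)]); first exact: odisc_zeta_closed.
    apply/seteqP; split => q [qA qD]; split => //; first by left.
    case: qD => // qz; case: nz; by have [t tab tq] := qA; exists t; rewrite ?tq.
apply: sD'; have : (g @` `[a, b]) (g s') by exists s' => //=; rewrite in_itv.
by rewrite -E => -[].
Qed.

(** A path with both ends on one side of a disc which visits the other side crosses the unique
    boundary point once before and once after the visit; this is impossible for an injective
    path. *)
Lemma injective_path_crosses (g : R -> P1) t z r : 0 <= r -> {within `[0, 1], continuous g} ->
  {in `[0, 1] &, injective g} -> 0 <= t <= 1 -> g t <> Some (zeta z r) ->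
  (odisc z r (g 0) /\ odisc z r (g 1) /\ ~ odisc z r (g t)) \/
  (~ odisc z r (g 0) /\ ~ odisc z r (g 1) /\ odisc z r (g t)) -> False.
Proof.
move=> r0 cg ginj /andP[t0 t1] gt h.
have c1 : {within `[0, t], continuous g}.
  by apply: continuous_subspaceW cg => x /=; rewrite !in_itv /= => /andP[-> h']; exact: le_trans t1.
have c2 : {within `[t, 1], continuous g}.
  by apply: continuous_subspaceW cg => x /=; rewrite !in_itv /= => /andP[h' ->]; rewrite (le_trans t0).
have [s1 /andP[s10 s1t] g1] : exists2 s, 0 <= s <= t & g s = Some (zeta z r).
  case: h => -[h0 [h1 ht]]; apply: path_crosses => //.
  - by exists 0; rewrite ?lexx.
  - by exists t; rewrite ?lexx ?t0.
  - by exists t; rewrite ?lexx ?t0.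
  - by exists 0; rewrite ?lexx.
have [s2 /andP[s2t s21] g2] : exists2 s, t <= s <= 1 & g s = Some (zeta z r).
  case: h => -[h0 [h1 ht]]; apply: path_crosses => //.
  - by exists 1; rewrite ?lexx ?t1.
  - by exists t; rewrite ?lexx ?t1.
  - by exists t; rewrite ?lexx ?t1.
  - by exists 1; rewrite ?lexx ?t1.
have s12 : s1 = s2.
  apply: ginj; rewrite ?g1 ?g2// in_itv /=.
    by rewrite s10 (le_trans s1t).
  by rewrite s21 (le_trans t0).
apply: gt; have -> : t = s1 by apply/eqP; rewrite eq_le s1t s12 s2t.
by [].
Qed.

Definition above U (x : P1) : Prop := if x is Some s then berk_le s U else False.

Lemma le_of_J S U : J U S <= diam U -> berk_le S U.
Proof.
move=> h; have E : raise U (J U S) = U by apply: (raise_id ultra Lclosed).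
by rewrite -[X in berk_le _ X]E -(joinE ultra Lclosed); exact: le_joinr.
Qed.

(** If U is below neither end nor above it, take a disc around U of radius slightly more than its
    diameter: it contains U and neither end, against [injective_path_crosses]. *)
Lemma segment_above (x y : P1) U : berk_segment x y (Some U) -> above U x \/ above U y.
Proof.
move=> [[_ <-]|[g [cg ginj g0 g1 [t + gt]]]]; first by left.
rewrite /= in_itv /= => t01; apply: contrapT => /not_orP[nx ny].
(* Infinity belongs to no disc, so any value above [diam U] is suitable there. *)
pose rd (p : P1) := if p is Some s then J U s else diam U + 1.
have rdU p : ~ above U p -> diam U < rd p.
  case: p => [S|] /= nS; last by rewrite ltrDl.
  by rewrite ltNge; apply/negP => /le_of_J.
pose r := Num.min (rd x) (rd y).
have Ur : diam U < r by rewrite lt_min !rdU.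
have [z [Uz _]] : exists z, dist U z < r /\ dist U z < r by apply: J_lt; rewrite -diamE.
have out p : r <= rd p -> ~ odisc z r p.
  case: p => [S|]; last by move=> _ [].
  move=> rS [W /= Sz [SE]]; rewrite SE in Sz; have := le_trans rS (J_le U S z).
  by rewrite leNgt gt_max Uz Sz.
apply: (@injective_path_crosses g t z r) => //.
    exact: ltW (le_lt_trans (diam_ge0 U) Ur).
  rewrite gt => -[UE]; move: Uz; rewrite UE dist_zeta subrr (av0 LP).
  by rewrite gt_max ltxx andbF.
right; rewrite g0 g1 gt; split; first by apply: out; rewrite ge_min lexx.
split; first by apply: out; rewrite ge_min lexx orbT.
by exists U.
Qed.

(** A point not below the join lies outside some disc containing both ends, whose radius is between
    the diameter of the join and that of the point. *)
Lemma segment_below S T p : berk_segment (Some S) (Some T) p ->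
  exists2 U, p = Some U & berk_le U (raise S (J S T)).
Proof.
set V := raise _ _; have VE : V = berk_join S T by rewrite /V -(joinE ultra Lclosed).
have SV : berk_le S V by rewrite VE; exact: le_joinl.
have TV : berk_le T V by rewrite VE; exact: le_joinr.
move=> seg; case: (seg) => [[_ ->]|[g [cg ginj g0 g1 [t + gt]]]]; first by exists S.
rewrite /= in_itv /= => t01.
apply: contrapT => h.
have [r [Vr pr pD]] : exists r, [/\ diam V < r, (forall z, p <> Some (zeta z r)) &
    (forall z, ~ odisc z r p)].
  case: p h seg gt => [U|] h seg gt; last first.
    by exists (diam V + 1); split => [|//|z []//]; rewrite ltrDl.
  have UV : diam V < diam U.
    rewrite ltNge; apply/negP => UV; apply: h; exists U => //.
    have comp (W : berk) : berk_le W U -> berk_le W V -> berk_le U V.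
      move=> WU WV; rewrite (above_raise ultra Lclosed WU) (above_raise ultra Lclosed WV).
      exact: (raise_le ultra Lclosed).
    by case: (segment_above seg) => /= WU; exact: comp WU _.
  exists ((diam V + diam U) / 2); split.
  - by rewrite midf_lt.
  - move=> z [UE]; have := congr1 (@diam R L) UE; rewrite (diam_raise ultra) (diam_point ultra).
    rewrite max_r => [E|]; first by have := midf_lt UV => -[_]; rewrite -E ltxx.
    by rewrite divr_ge0// addr_ge0// diam_ge0.
  - move=> z [W /= Wz [WU]]; have := diam_le U z; rewrite -WU leNgt => /negP; apply.
    by rewrite WU in Wz *; rewrite (lt_le_trans Wz)// ltW// (midf_lt UV).2.
have [z [Vz _]] : exists z, dist V z < r /\ dist V z < r by apply: J_lt; rewrite -diamE.
apply: (@injective_path_crosses g t z r) => //; rewrite ?gt//.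
  exact: ltW (le_lt_trans (diam_ge0 V) Vr).
left; rewrite g0 g1; split; first by exists S => //=; rewrite (le_lt_trans _ Vz)//; apply: SV.
by split => //; exists T => //=; rewrite (le_lt_trans _ Vz)//; apply: TV.
Qed.

Lemma segment_sym (x y p : P1) : berk_segment x y p -> berk_segment y x p.
Proof.
move=> [[-> ->]|[g [cg ginj g0 g1 [t t01 gt]]]]; first by left.
right; exists (fun t => g (1 - t)); split.
- apply/subspace_continuousP => s s01; move/subspace_continuousP : cg => cg.
  have s01' : `[0, 1]%classic (1 - s) by move: s01; rewrite /= !in_itv /=; lra.
  apply: cvg_comp (cg _ s01') => B; rewrite /within /= => sB.
  have c1 : (fun t : R => 1 - t) @ s --> 1 - s by apply: cvgB; [exact: cvg_cst|exact: cvg_id].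
  have c2 : \forall u \near s, `[0, 1]%classic (1 - u) -> B (1 - u) by exact: (c1 _ sB).
  change (\forall u \near s, `[0, 1]%classic u -> B (1 - u)).
  apply: filterS c2 => u /= uB u01; apply: uB.
  by move: u01; rewrite !in_itv /=; lra.
- move=> s s' hs hs' /ginj E; have : 1 - s = 1 - s'.
    by apply: E; move: hs hs'; rewrite !in_itv /=; lra.
  by lra.
- by rewrite subr0.
- by rewrite subrr.
- by exists (1 - t); [move: t01; rewrite /= !in_itv /=; lra|rewrite subKr].
Qed.

(** The path enlarges S with t / (1 - t) added to its diameter, which sweeps the whole ray as t runs
    through the unit interval. *)
Lemma segment_infty S r : diam S <= r -> berk_segment (Some S) None (Some (raise S r)).
Proof.
move=> Sr; right; exists (fun t : R => if t < 1 then Some (raise S (diam S + t / (1 - t))) else None).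
have D0 := diam_ge0 S.
split.
- apply: continuous_subspaceT => t; have [t1|t1|->] := ltgtP t 1.
  + have : (fun t => Some (raise S (diam S + t / (1 - t))) : P1) @ t --> (Some (raise S (diam S + t / (1 - t))) : P1).
      apply: (@cvg_comp _ _ _ _ (Some : berk -> P1) _ (nbhs (raise S (diam S + t / (1 - t))))); last first.
        exact: one_point_compactification_some_continuous.
      apply: raise_cvg; first exact: cvg_cst.
      apply: cvgD; first exact: cvg_cst.
      apply: cvgM; first exact: cvg_id.
      apply: cvgV; first by rewrite subr_eq0 gt_eqF.
      by apply: cvgB; [exact: cvg_cst|exact: cvg_id].
    rewrite /continuous_at t1; apply: cvg_trans; apply: near_eq_cvg; near=> s; rewrite ifT//.
    by near: s; exact: near_ltR.
  + have : (fun=> None : P1) @ t --> (None : P1) by exact: cvg_cst.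
    rewrite /continuous_at ltNge (ltW t1) /=; apply: cvg_trans; apply: near_eq_cvg; near=> s; rewrite ltNge ifN// negbK ltW//.
    by near: s; exact: near_gtR.
  + rewrite /continuous_at ltxx => A nA; have A0 := nbhs_singleton nA.
    have [M MA] := nbhs_infty nA.
    pose N := Num.max M 0 + 1; have N1 : 1 <= N by rewrite lerDr le_max lexx orbT.
    have MN : M < N by rewrite ltr_pwDr// le_max lexx.
    change (\forall s \near (1 : R), A (if s < 1 then Some (raise S (diam S + s / (1 - s))) else None)).
    near=> s; case: ifPn => // s1; apply: MA; rewrite dist_raise lt_max; apply/orP; right.
    rewrite (lt_le_trans MN)// (@le_trans _ _ (s / (1 - s)))//; last by rewrite lerDr.
    have sN : N / (N + 1) <= s by near: s; apply: filterS (near_gtR (c := N / (N + 1)) _) => [s /ltW//|]; rewrite ltr_pdivrMr; lra.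
    rewrite ler_pdivlMr ?subr_gt0//; move: sN; rewrite ler_pdivrMr; lra.
- have lt1 (t : R) : 0 <= t <= 1 -> t < 1 -> 0 <= t / (1 - t).
    by move=> /andP[t0 _] t1; rewrite divr_ge0// subr_ge0 ltW.
  move=> s t; rewrite !in_itv /= => s01 t01; case: ifPn => s1; case: ifPn => t1 //.
    move=> /(congr1 (fun q : P1 => if q is Some u then diam u else 0)); rewrite !(diam_raise ultra) !max_r ?lerDl ?lt1// => /addrI E.
    have s10 : 1 - s != 0 by rewrite subr_eq0 gt_eqF.
    have t10 : 1 - t != 0 by rewrite subr_eq0 gt_eqF.
    move/eqP: E; rewrite eqr_div// => /eqP; lra.
  by move=> _; move: s01 t01 s1 t1; rewrite -!leNgt; lra.
- by rewrite ltr01 subr0 mul0r addr0 (raise_id ultra Lclosed).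
- by rewrite ltxx.
- have k0 : 0 <= r - diam S by rewrite subr_ge0.
  have k1 : 0 < 1 + (r - diam S) by lra.
  exists ((r - diam S) / (1 + (r - diam S))).
    rewrite /= in_itv /= divr_ge0 ?(ltW k1)//= ler_pdivrMr// mul1r; lra.
  rewrite ifT; last by rewrite ltr_pdivrMr// mul1r; lra.
  congr (Some (raise S _)).
  have -> : 1 - (r - diam S) / (1 + (r - diam S)) = (1 + (r - diam S))^-1.
    by rewrite -{1}(divff (lt0r_neq0 k1)) -mulrBl addrK mul1r.
  by rewrite invrK divfK ?lt0r_neq0// addrC subrK.
Unshelve. all: by end_near. Qed.

Lemma segment_raise S T r : diam S <= r -> r <= J S T ->
  berk_segment (Some S) (Some T) (Some (raise S r)).
Proof.
move=> Sr rJ; set h := J S T in rJ *.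
have [ST|ST] := pselect (S = T).
  left; rewrite -ST; split => //; congr Some; apply: (raise_id ultra Lclosed).
  by rewrite diamE {2}ST.
have Sh : diam S <= h by exact: diam_le_J.
have Th : diam T <= h by rewrite /h JC; exact: diam_le_J.
pose D := (h - diam S) + (h - diam T).
have D0 : 0 < D.
  rewrite lt_neqAle addr_ge0 ?subr_ge0// andbT; apply/eqP => D0; apply: ST.
  have E1 : diam S = h by move: D0 Sh Th; rewrite /D; lra.
  have E2 : diam T = h by move: D0 Sh Th; rewrite /D; lra.
  apply: berk_le_anti; apply: le_of_J; last by rewrite E1.
  by rewrite JC E2.
pose ga (s : R) := raise S (Num.min (diam S + s) h).
pose gb (s : R) := raise T (Num.min (2 * h - diam S - s) h).
have jE : raise S h = raise T h by rewrite /h -(joinE ultra Lclosed) JC -(joinE ultra Lclosed) joinC.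
pose g (s : R) := if s <= h - diam S then ga s else gb s.
(* Below the common join, the rising branch and the falling branch are comparable, and the path is
   the smaller of the two at each time. Continuity then needs no gluing. *)
have gE s P : g s P = Num.min (ga s P) (gb s P).
  have le1 : berk_le (ga s) (raise S h) by apply: (raise_le ultra Lclosed); rewrite ge_min lexx orbT.
  have le2 : berk_le (gb s) (raise T h) by apply: (raise_le ultra Lclosed); rewrite ge_min lexx orbT.
  rewrite /g; case: ifPn => [sh|].
    rewrite min_l// (le_trans (le1 P))// jE /gb min_r//; lra.
  rewrite -ltNge => sh; rewrite min_r// (le_trans (le2 P))// -jE /ga min_r//; lra.
have cg : continuous g.
  move=> s; apply: berk_cvg => P; rewrite gE.
  suff : (fun x => g x P) @ s --> Num.min (ga s P) (gb s P) by [].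
  rewrite (_ : (fun x : R => g x P) = (fun x => Num.min (ga x P) (gb x P))); last by apply/funext => x; exact: gE.
  apply: cvg_minR.
    have ca : ga @ s --> ga s.
      apply: raise_cvg; first exact: cvg_cst.
      by apply: cvg_minR; [apply: cvgD; [exact: cvg_cst|exact: cvg_id]|exact: cvg_cst].
    exact: (cvg_comp _ _ ca (@berk_eval_continuous P (ga s))).
  have cb : gb @ s --> gb s.
    apply: raise_cvg; first exact: cvg_cst.
    by apply: cvg_minR; [apply: cvgB; [exact: cvg_cst|exact: cvg_id]|exact: cvg_cst].
  exact: (cvg_comp _ _ cb (@berk_eval_continuous P (gb s))).
have dga s : 0 <= s -> s <= h - diam S -> diam (ga s) = diam S + s.
  move=> s0 sh; rewrite (diam_raise ultra) min_l; last by lra.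
  by rewrite max_r// lerDl.
have dgb s : h - diam S <= s -> s <= D -> diam (gb s) = 2 * h - diam S - s.
  move=> s0 sD; rewrite (diam_raise ultra) min_l; last by lra.
  by rewrite max_r//; move: sD; rewrite /D; lra.
have cross s s' : 0 <= s -> s <= h - diam S -> h - diam S < s' -> s' <= D -> ga s = gb s' -> False.
  move=> s0 sh sh' sD E; have d1 := dga s s0 sh; have d2 := dgb s' (ltW sh') sD.
  have SE : berk_le S (ga s) by exact: le_raise.
  have TE : berk_le T (ga s) by rewrite E; exact: le_raise.
  have := le_diam Lclosed (join_le ultra Lclosed SE TE).
  rewrite (joinE ultra Lclosed) (diam_raise ultra) -/h max_r// E d2; lra.
right; exists (fun t => Some (g (t * D))); split.
- apply: continuous_subspaceT => t.
  apply: (@cvg_comp _ _ _ (fun t => g (t * D)) (Some : berk -> P1) _ (nbhs (g (t * D)))); last first.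
    exact: one_point_compactification_some_continuous.
  have cm : (fun u : R => u * D) @ t --> t * D by apply: cvgM; [exact: cvg_id|exact: cvg_cst].
  exact: (cvg_comp _ _ cm (cg (t * D))).
- move=> s t; rewrite !in_itv /= => /andP[s0 s1] /andP[t0 t1] [E].
  have sD : 0 <= s * D <= D by rewrite mulr_ge0 ?(ltW D0)//= ler_piMl ?(ltW D0).
  have tD : 0 <= t * D <= D by rewrite mulr_ge0 ?(ltW D0)//= ler_piMl ?(ltW D0).
  move: sD tD => /andP[sD0 sD] /andP[tD0 tD].
  apply: (mulIf (lt0r_neq0 D0)); move: E; rewrite /g; case: ifPn => h1; case: ifPn => h2 E.
  + by have := congr1 (@diam R L) E; rewrite !dga// => /addrI.
  + by exfalso; rewrite -ltNge in h2; exact: (cross _ _ sD0 h1 h2 tD).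
  + by exfalso; rewrite -ltNge in h1; exact: (cross _ _ tD0 h2 h1 sD).
  + rewrite -!ltNge in h1 h2; have := congr1 (@diam R L) E; rewrite !dgb ?(ltW h1) ?(ltW h2)//; lra.
- rewrite mul0r /g subr_ge0 Sh /ga addr0 min_l// (raise_id ultra Lclosed)//.
- rewrite mul1r; have gbD : gb D = T.
    rewrite /gb (raise_id ultra Lclosed)// ge_min; apply/orP; left; rewrite /D; lra.
  rewrite /g; case: ifPn => DS; last by rewrite gbD.
  have ThE : diam T = h by move: DS Th; rewrite /D; lra.
  have DE : D = h - diam S by rewrite /D ThE subrr addr0.
  have m : Num.min (diam S + D) h = h by rewrite min_r// DE addrC subrK.
  by congr Some; rewrite /ga m jE (raise_id ultra Lclosed)// ThE.
- have t0 : 0 <= (r - diam S) / D <= 1.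
    rewrite divr_ge0 ?subr_ge0 ?(ltW D0)//= ler_pdivrMr// mul1r /D; lra.
  exists ((r - diam S) / D); first by rewrite /= in_itv.
  rewrite divfK ?lt0r_neq0// /g ifT; last by lra.
  by congr (Some (raise S _)); rewrite min_l; lra.
Qed.

Lemma segment_two_points S T U : berk_le S U -> diam U <= J S T ->
  berk_segment (Some S) (Some T) (Some U).
Proof.
move=> SU UJ; rewrite (above_raise ultra Lclosed SU); apply: segment_raise => //.
exact: le_diam.
Qed.

Lemma median_of_three S T c (U : berk) : berk_le S U -> berk_le T U ->
  diam U = J S T -> J S T <= J S c -> J S T <= J T c ->
  [/\ berk_segment (Some S) (Some T) (Some U), berk_segment (Some S) (Some c) (Some U)
    & berk_segment (Some T) (Some c) (Some U)].
Proof.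
move=> SU TU dU h1 h2; split; apply: segment_two_points => //; rewrite dU//.
Qed.

(** A point on the three segments is above two of the three vertices, hence above their join; being
    also below the three pairwise joins, it is the greatest point with this property. *)
Lemma median_unique S T c (p p' : P1) :
  (berk_segment (Some S) (Some T) `&` berk_segment (Some S) (Some c) `&` berk_segment (Some T) (Some c)) p ->
  (berk_segment (Some S) (Some T) `&` berk_segment (Some S) (Some c) `&` berk_segment (Some T) (Some c)) p' ->
  p = p'.
Proof.
have key q : (berk_segment (Some S) (Some T) `&` berk_segment (Some S) (Some c) `&` berk_segment (Some T) (Some c)) q ->
    exists2 V, q = Some V & forall W, berk_le W (raise S (J S T)) -> berk_le W (raise S (J S c)) ->
     berk_le W (raise T (J T c)) -> berk_le W V.
  move=> [[h1 h2] h3]; have [V qV V1] := segment_below h1; exists V => // W W1 W2 W3.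
  rewrite qV in h1 h2 h3.
  have a1 := segment_above h1; have a2 := segment_above h2; have a3 := segment_above h3.
  have two A B : berk_le W (raise A (J A B)) -> berk_le A V -> berk_le B V -> berk_le W V.
    move=> WAB AV BV P; rewrite (le_trans (WAB P))//.
    by rewrite -(joinE ultra Lclosed); apply: (join_le ultra Lclosed).
  case: a1 => /= a1; case: a2 => /= a2; case: a3 => /= a3; try by [exact: two W1 a2 a1|exact: two W1 a1 a3|exact: two W1 a3 a1|
    exact: two W2 a1 a2|exact: two W2 a1 a3|exact: two W2 a2 a1|exact: two W2 a2 a3|exact: two W3 a1 a2|
    exact: two W3 a1 a3|exact: two W3 a3 a2| exact: two W3 a2 a3].
move=> hp hp'; have [V pV VP] := key p hp; have [V' pV' VP'] := key p' hp'.
rewrite pV pV'; congr Some; apply: berk_le_anti.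
  case: hp => -[h1 h2] h3; rewrite pV in h1 h2 h3.
  have [? [<-] ?] := segment_below h1; have [? [<-] ?] := segment_below h2; have [? [<-] ?] := segment_below h3.
  exact: VP'.
case: hp' => -[h1 h2] h3; rewrite pV' in h1 h2 h3.
have [? [<-] ?] := segment_below h1; have [? [<-] ?] := segment_below h2; have [? [<-] ?] := segment_below h3.
exact: VP.
Qed.

Definition ln_dist0 S : R := ln (Num.max 1 (dist S 0)).

Hypothesis Lcomplete : vcomplete L.

Lemma berk_medianE S T U : 
  [/\ berk_segment (Some S) (Some T) (Some U), berk_segment (Some S) (Some canon) (Some U)
    & berk_segment (Some T) (Some canon) (Some U)] ->
  berk_median (Some S) (Some T) = Some U.
Proof.
move=> [h1 h2 h3]; rewrite /berk_median (berk_canE ultra Lclosed); set E := _ `&` _.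
have EU : E (Some U) by [].
by apply: (@median_unique S T canon) => //; apply: (getPex (ex_intro _ _ EU)).
Qed.

Lemma berk_distE U : berk_dist U (berk_can L) = 2 * ln (J U canon) - ln (diam U).
Proof.
by rewrite /berk_dist (berk_canE ultra Lclosed) (berk_supE ultra Lclosed) (diam_canon ultra) ln1 subr0.
Qed.

Lemma pairing_of_median x y U : berk_median x y = Some U -> 0 < diam U ->
  berk_pairing x y = (2 * ln (J U canon) - ln (diam U))%:E.
Proof.
move=> mU dU; rewrite /berk_pairing mU asboolT ?berk_distE//.
exact/(berk_H_diam ultra Lclosed Lcomplete).
Qed.

(** Of the three numbers J attached to S, T and the canonical point, the two largest are equal. The
    median is the join of the pair with the smallest one, and the formula is checked in the three
    cases. *)
Lemma berk_pairingE S T : berk_H S ->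
  berk_pairing (Some S) (Some T) = (ln_dist0 S + ln_dist0 T - ln (J S T))%:E.
Proof.
move=> /(berk_H_diam ultra Lclosed Lcomplete) dS.
rewrite /ln_dist0 -!(J_canon ultra).
have Jp : 0 < J S T by rewrite (lt_le_trans dS)// diam_le_J.
have SC : 0 < J S canon by rewrite (lt_le_trans dS)// diam_le_J.
have TC : 0 < J T canon by rewrite (J_canon ultra) lt_max ltr01.
have u1 := J_ultra ultra S T canon; have u2 := J_ultra ultra T S canon; have u3 := J_ultra ultra S canon T.
rewrite (JC T S) in u2; rewrite (JC canon T) in u3.
pose a := J S T; pose b := J S canon; pose e := J T canon.
have [abe|] := boolP ((a <= b) && (a <= e)).
  have {abe}[ab ae] := andP abe.
  have be : b = e.
    apply/eqP; rewrite eq_le; apply/andP; split.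
      by rewrite (le_trans u1)// ge_max ae lexx.
    by rewrite (le_trans u2)// ge_max ab lexx.
  pose U := raise S a.
  have dU : diam U = a by rewrite (diam_raise ultra) max_r// diam_le_J.
  have UJ : U = berk_join S T by rewrite (joinE ultra Lclosed).
  rewrite (pairing_of_median (U := U)) ?dU//.
    by rewrite (J_raise ultra) -/b max_l// -/e -be mulr_natl mulr2n.
  apply: berk_medianE; apply: median_of_three => //; rewrite UJ; [exact: le_joinl|exact: le_joinr].
have [bae _|] := boolP ((b <= a) && (b <= e)).
  have {bae}[ba be] := andP bae.
  have ae : a = e.
    apply/eqP; rewrite eq_le; apply/andP; split.
      by rewrite (le_trans u3)// ge_max be lexx.
    by rewrite (le_trans u2)// ge_max ba lexx.
  pose U := raise S b.
  have dU : diam U = b by rewrite (diam_raise ultra) max_r// diam_le_J.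
  have UJ : U = berk_join S canon by rewrite (joinE ultra Lclosed).
  rewrite (pairing_of_median (U := U)) ?dU//.
    by rewrite (J_raise ultra) -/b maxxx -/e -ae -/a; congr EFin; lra.
  have SU : berk_le S U by rewrite UJ; exact: le_joinl.
  have CU : berk_le canon U by rewrite UJ; exact: le_joinr.
  have be' : J S canon <= J canon T by rewrite (JC canon).
  have [h1 h2 h3] := @median_of_three S canon T U SU CU dU ba be'.
  by apply: berk_medianE; split => //; exact: segment_sym.
move=> n2 n1.
have eab : e <= a /\ e <= b.
  move: n1 n2; rewrite !negb_and -!ltNge; case/orP => h1; case/orP => h2; split; lra.
have [ea eb] := eab.
have ab : a = b.
  apply/eqP; rewrite eq_le; apply/andP; split.
    by rewrite (le_trans u3)// ge_max eb lexx.
  by rewrite (le_trans u1)// ge_max ea lexx.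
pose U := raise T e.
have dU : diam U = e by rewrite (diam_raise ultra) max_r// diam_le_J.
have UJ : U = berk_join T canon by rewrite (joinE ultra Lclosed).
rewrite (pairing_of_median (U := U)) ?dU//.
  by rewrite (J_raise ultra) -/e maxxx -/b -ab -/a; congr EFin; lra.
have TU : berk_le T U by rewrite UJ; exact: le_joinl.
have CU : berk_le canon U by rewrite UJ; exact: le_joinr.
have ea' : J T canon <= J T S by rewrite (JC T S).
have eb' : J T canon <= J canon S by rewrite (JC canon).
have [h1 h2 h3] := @median_of_three T canon S U TU CU dU ea' eb'.
by apply: berk_medianE; split => //; exact: segment_sym.
Qed.

(** The median of S, infinity and the canonical point is the join of S with the canonical point. *)
Lemma berk_pairing_infty S : berk_H S -> berk_pairing (Some S) None = (ln_dist0 S)%:E.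
Proof.
move=> /(berk_H_diam ultra Lclosed Lcomplete) dS; rewrite /ln_dist0 -(J_canon ultra).
pose U := raise S (J S canon).
have dU : diam U = J S canon by rewrite (diam_raise ultra) max_r// diam_le_J.
have UJ : U = berk_join S canon by rewrite (joinE ultra Lclosed).
have SU : berk_le S U by rewrite UJ; exact: le_joinl.
have CU : berk_le canon U by rewrite UJ; exact: le_joinr.
have SC : 0 < J S canon by rewrite (lt_le_trans dS)// diam_le_J.
suff mU : berk_median (Some S) None = Some U.
  rewrite (pairing_of_median mU) ?dU// (J_raise ultra) maxxx; congr EFin; lra.
rewrite /berk_median (berk_canE ultra Lclosed); set E := _ `&` _.
have EU : E (Some U).
  split; [split|].
  - by apply: segment_infty; exact: diam_le_J.
  - by apply: segment_two_points => //; rewrite dU.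
  - apply: segment_sym; rewrite (above_raise ultra Lclosed CU); apply: segment_infty.
    exact: le_diam.
have [] : E (get E) by apply: getPex; exists (Some U).
move: (get E) => p [h1 h2] h3; have [V pV VU] := segment_below h2; rewrite pV in h1 h2 h3 *.
have a1 := segment_above h1; have a3 := segment_above h3.
congr Some; apply: berk_le_anti => //.
rewrite UJ; apply: (join_le ultra Lclosed); first by case: a1.
by case: a3.
Qed.

End BerkovichTopology.

(** * The Riemann sphere *)

Section BorelCompactification.
Variables (R : realType) (X : ptopologicalType).
Local Notation opc := (one_point_compactification X).

Lemma open_borel (Y : ptopologicalType) (A : set Y) : open A -> measurable (A : set (borel Y)).
Proof. by move=> oA; exact: sub_sigma_algebra. Qed.

Lemma measurable_infty : measurable ([set None] : set (borel opc)).
Proof.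
rewrite -[X in measurable X]setCK; apply: measurableC.
have -> : ~` [set None] = Some @` [set: X] :> set (borel opc).
  by apply/seteqP; split => [[x|]//= _|_ [x _ <-]//]; exists x.
by apply: open_borel; apply: one_point_compactification_open_some; exact: openT.
Qed.

Lemma measurable_lift (h : X -> R) (c : R) : continuous h ->
  measurable_fun setT (fun p : borel opc => if p is Some s then h s else c).
Proof.
move=> ch; apply: (measurability (@RGenOInfty.G R)); first exact: RGenOInfty.measurableE.
move=> _ [_ [x ->] <-]; rewrite setTI.
have mo : measurable (Some @` (h @^-1` `]x, +oo[) : set (borel opc)).
  apply: open_borel; apply: one_point_compactification_open_some.
  by apply: open_comp => //; rewrite set_itv_o_infty; exact: open_gt.
have [xc|xc] := ltP x c.
  have -> : (fun p : borel opc => if p is Some s then h s else c) @^-1` `]x, +oo[ =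
      Some @` (h @^-1` `]x, +oo[) `|` [set None].
    apply/seteqP; split => [[s|]|p [[s hs <-]|->]] //=; first by left; exists s.
      by right.
    by rewrite in_itv /= xc.
  by apply: measurableU => //; exact: measurable_infty.
suff -> : (fun p : borel opc => if p is Some s then h s else c) @^-1` `]x, +oo[ =
    Some @` (h @^-1` `]x, +oo[) by [].
apply/seteqP; split => [[s|]|p [s hs <-]] //=; first by exists s.
by rewrite in_itv /= andbT ltNge xc.
Qed.

End BorelCompactification.

Section SphereTopology.
Variable R : realType.
Local Notation C := (R[i])^o.
Local Notation S := (riemann_sphere R).
Local Notation bS := (borel S).
Local Notation normc := (@Normc.normc R).
Local Notation Re := (@complex.Re R).
Local Notation Im := (@complex.Im R).
Local Open Scope complex_scope.

Definition nsq (z : R[i]) : R := Re z ^+ 2 + Im z ^+ 2.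

Lemma nsq_ge0 z : 0 <= nsq z.
Proof. by rewrite addr_ge0// sqr_ge0. Qed.

Lemma normcE z : normc z = Num.sqrt (nsq z).
Proof. by case: z. Qed.

Lemma normc_sqr z : normc z ^+ 2 = nsq z.
Proof. by rewrite normcE sqr_sqrtr// nsq_ge0. Qed.

Lemma normc_ge0 z : 0 <= normc z.
Proof. by rewrite normcE sqrtr_ge0. Qed.

Lemma normc_ge_Re z : `|Re z| <= normc z.
Proof. by rewrite normcE -sqrtr_sqr ler_wsqrtr// lerDl sqr_ge0. Qed.

Lemma normc_ge_Im z : `|Im z| <= normc z.
Proof. by rewrite normcE -sqrtr_sqr ler_wsqrtr// lerDr sqr_ge0. Qed.

Lemma normc_le (z : R[i]) : normc z <= `|Re z| + `|Im z|.
Proof.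
rewrite normcE -[leRHS]ger0_norm ?addr_ge0// -sqrtr_sqr ler_wsqrtr// /nsq -[Re z ^+ 2]real_normK ?num_real//.
rewrite -[Im z ^+ 2]real_normK ?num_real// sqrrD lerD2r lerDl mulrn_wge0// mulr_ge0//.
Qed.

Lemma Re_B (z w : R[i]) : Re (z - w) = Re z - Re w. Proof. by case: z w => ? ? []. Qed.
Lemma Im_B (z w : R[i]) : Im (z - w) = Im z - Im w. Proof. by case: z w => ? ? []. Qed.
Lemma Re_D (z w : R[i]) : Re (z + w) = Re z + Re w. Proof. by case: z w => ? ? []. Qed.
Lemma Im_D (z w : R[i]) : Im (z + w) = Im z + Im w. Proof. by case: z w => ? ? []. Qed.

Lemma normcN z : normc (- z) = normc z.
Proof. by case: z => a b; rewrite /= !sqrrN. Qed.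

Lemma normc_distC z w : normc (z - w) = normc (w - z).
Proof. by rewrite -normcN opprB. Qed.

Lemma near_normc (z : C) (e : R) : 0 < e -> \forall w \near z, normc (z - w) < e.
Proof.
move=> e0; apply/nbhs_ballP; exists e%:C; first by rewrite /= ltcE /= eqxx.
move=> w; rewrite -ball_normE /ball_ /= ltcE => /andP[_].
by rewrite normc_def -normcE.
Qed.

Lemma nbhs_normc (z : C) A : nbhs z A -> exists2 e : R, 0 < e & forall w, normc (z - w) < e -> A w.
Proof.
move=> /nbhs_ballP[[e e'] /=]; rewrite ltcE /= => /andP[/eqP -> e0] eA; exists e => // w zw.
by apply: eA; rewrite -ball_normE /ball_ /= ltcE normc_def -normcE /= zw !eqxx.
Qed.

Lemma continuous_Re : continuous (Re : C -> R).
Proof.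
move=> z; apply/(@cvgrPdist_lt R R C (nbhs z) (nbhs_filter z)) => e e0; apply: filterS (near_normc z e0) => w.
by apply: le_lt_trans; rewrite -Re_B normc_ge_Re.
Qed.

Lemma continuous_Im : continuous (Im : C -> R).
Proof.
move=> z; apply/(@cvgrPdist_lt R R C (nbhs z) (nbhs_filter z)) => e e0; apply: filterS (near_normc z e0) => w.
by apply: le_lt_trans; rewrite -Im_B normc_ge_Im.
Qed.

Lemma continuous_normc : continuous (normc : C -> R).
Proof.
have -> : normc = Num.sqrt \o nsq by apply/funext => z; rewrite normcE.
move=> z; apply: (@continuous_comp C R R nsq Num.sqrt); last exact: sqrt_continuous.
by apply: (@cvgD R R C _ (nbhs_filter z)); apply: (@cvg_exprR _ _ _ (nbhs_filter z)); [exact: continuous_Re|exact: continuous_Im].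
Qed.

Lemma cvg_complex (T : Type) (F : set_system T) (f : T -> C) (z : C) : Filter F ->
  Re \o f @ F --> Re z -> Im \o f @ F --> Im z -> f @ F --> z.
Proof.
move=> FF h1 h2 A /nbhs_normc[e e0 eA].
have e2 : 0 < e / 2 by rewrite divr_gt0.
move/cvgrPdist_lt: h1 => /(_ _ e2) h1; move/cvgrPdist_lt: h2 => /(_ _ e2) h2.
apply: (filterS _ (filterI h1 h2)) => t /= [t1 t2]; apply: eA.
apply: le_lt_trans (normc_le _) _; rewrite Re_B Im_B; lra.
Qed.

Lemma continuous_chart : continuous (fun p : R * R => (p.1 +i* p.2) : C).
Proof. by move=> p; apply: cvg_complex => /=; [exact: cvg_fst|exact: cvg_snd]. Qed.

Lemma continuous_chart0 : continuous (@chart0 R : R * R -> S).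
Proof.
move=> p; apply: (@continuous_comp _ C S (fun p => p.1 +i* p.2) Some).
  exact: continuous_chart.
exact: one_point_compactification_some_continuous.
Qed.

Lemma normc_disc_compact r : compact [set w : C | normc w <= r].
Proof.
apply: (@subclosed_compact _ _ ((fun p : R * R => (p.1 +i* p.2) : C) @` (`[- r, r] `*` `[- r, r]))).
- by apply: (@closed_comp C R normc [set x | x <= r]) => [? _|]; [exact: continuous_normc|exact: closed_le].
- apply: continuous_compact; last by apply: compact_setX; exact: segment_compact.
  by apply: continuous_subspaceT; exact: continuous_chart.
move=> z /= zr; exists (Re z, Im z); last by case: z zr.
by split; rewrite /= in_itv /= -ler_norml (le_trans _ zr)// ?normc_ge_Re ?normc_ge_Im.
Qed.

Lemma sphere_near_infty r : nbhs (None : S) ((Some @` [set w : R[i] | r < normc w]) `|` [set None]).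
Proof.
exists [set w : C | normc w <= r].
  split; first exact: normc_disc_compact.
  by apply: (@closed_comp C R normc [set x | x <= r]) => [? _|]; [exact: continuous_normc|exact: closed_le].
move=> p [[x /= xr <-]|->]; [left|by right].
by exists x => //=; rewrite ltNge; exact/negP.
Qed.

Lemma sphere_nbhs_infty A : nbhs (None : S) A -> exists r, forall w : R[i], r < normc w -> A (Some w).
Proof.
move=> [K [cK _] KA].
have : compact ((normc : C -> R) @` K).
  by apply: continuous_compact => //; apply: continuous_subspaceT; exact: continuous_normc.
move=> /compact_bounded[M [_ MP]]; exists (M + 1) => x xM; apply: KA; left; exists x => //= Kx.
have := MP (M + 1); rewrite ltrDl ltr01 => /(_ isT (normc x)) /(_ (ex_intro2 _ _ x Kx erefl)).
by rewrite /= ger0_norm ?normc_ge0// leNgt xM.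
Qed.

Lemma sphere_nbhs_some (z : R[i]) A : nbhs (Some z : S) A ->
  exists2 e : R, 0 < e & forall w, normc (z - w) < e -> A (Some w).
Proof. by move=> /(@nbhs_normc z (fun w => A (Some w))). Qed.

(** Uniform continuity with respect to translations of the affine plane. Compactness of the sphere
    is used, as a bounded translation moves points near infinity to points near infinity. *)
Lemma sphere_uniform (g : S -> R) (eta : R) : continuous g -> 0 < eta ->
  exists2 r : R, 0 < r & forall z h : R[i], normc h < r -> `|g (Some (z + h)) - g (Some z)| < eta.
Proof.
move=> gc eta0; have eta2 : 0 < eta / 2 by rewrite divr_gt0.
pose Q (r : R) (x : S) : Prop := if x is Some z then
  forall h : R[i], normc h < r -> `|g (Some (z + h)) - g (Some z)| < eta else True.
have cov : near_covering [set: S] by apply/compact_near_coveringP; exact: one_point_compactification_compact.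
have := cov R (0^'+) Q _; case.
- move=> x _; have := gc x; move/cvgrPdist_lt => /(_ _ eta2).
  case: x => [z|] nA.
    have [e e0 eA] := sphere_nbhs_some nA.
    have e2 : 0 < e / 2 by rewrite divr_gt0.
    exists (Some @` [set w | normc (z - w) < e / 2], [set r | r < e / 2]).
      split => /=; last exact: nbhs_right_lt.
      by apply: one_point_compactification_some_nbhs; exact: near_normc.
    move=> [_ r] [[w /= zw <-] /= re] h hr.
    have := eA w (lt_trans zw _); rewrite ltr_pdivrMr// ltr_pMr// ltr1n => /(_ isT).
    have : normc (z - (w + h)) < e.
      rewrite opprD addrA; apply: le_lt_trans (le_normcD _ _) _.
      by rewrite normcN [e]splitr ltrD// (lt_trans hr).
    by move=> /eA /=; rewrite !ltr_distlC => /andP[? ?] /andP[? ?]; apply/andP; split; lra.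
  have [r rP] := sphere_nbhs_infty nA.
  exists ((Some @` [set w : R[i] | r + 1 < normc w]) `|` [set None], [set r | r < 1]).
    by split => /=; [exact: sphere_near_infty|exact: nbhs_right_lt].
  move=> [q d] [/= [[w wr <-]|->] d1] //= h hd.
  have := rP w (lt_trans _ wr); rewrite ltrDl ltr01 => /(_ isT).
  have : r < normc (w + h).
    have : normc w <= normc (w + h) + normc h.
      by rewrite -{1}[w](addrK h) (le_trans (le_normcD _ _))// normcN.
    by move: wr hd d1 => /=; lra.
  by move=> /rP /=; rewrite !ltr_distlC => /andP[? ?] /andP[? ?]; apply/andP; split; lra.
- move=> d /= d0 dP; exists (d / 2); first by rewrite divr_gt0.
  move=> z h hr; have := dP (d / 2) _ _ (Some z) I h hr; apply; last by rewrite divr_gt0.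
  by rewrite /ball_ /= sub0r normrN gtr0_norm ?divr_gt0// ltr_pdivrMr// ltr_pMr// ltr1n.
Qed.

Lemma sphere_bounded (g : S -> R) : continuous g -> exists M, forall x, `|g x| <= M.
Proof.
move=> gc; have : compact (range g).
  by apply: continuous_compact; [exact: continuous_subspaceT|exact: one_point_compactification_compact].
move=> /compact_bounded[M [_ MP]]; exists (M + 1) => x.
by apply: (MP (M + 1)); rewrite ?ltrDl//; exists x.
Qed.

Lemma open_measurable_prod (U : set (R * R)) : open U -> measurable U.
Proof.
move=> oU.
have -> : U = \bigcup_(q in [set q : (rat * rat) * (rat * rat) |
    (`]ratr q.1.1, ratr q.1.2[%classic `*` `]ratr q.2.1, ratr q.2.2[) `<=` U])
    (`]ratr q.1.1, ratr q.1.2[%classic `*` `]ratr q.2.1, ratr q.2.2[ : set (R * R)).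
  apply/seteqP; split => [[x y] Uxy|p [q qU qp]]; last exact: qU.
  have : nbhs (x, y) U by apply: open_nbhs_nbhs.
  move=> /nbhs_ballP[e e0 eU].
  have rt (t : R) : exists q : rat * rat, [/\ t - e < ratr q.1, ratr q.1 < t, t < ratr q.2 & ratr q.2 < t + e].
    have [|a] := @rat_in_itvoo R (t - e) t; first by rewrite ltrBlDr ltrDl.
    have [|b] := @rat_in_itvoo R t (t + e); first by rewrite ltrDl.
    by rewrite !in_itv /= => /andP[? ?] /andP[? ?]; exists (a, b).
  have [a [a1 a2 a3 a4]] := rt x; have [b [b1 b2 b3 b4]] := rt y.
  exists (a, b); last by split; rewrite /= in_itv /= ?a2 ?a3 ?b2 ?b3.
  move=> [u v] [] /=; rewrite !in_itv /= => /andP[? ?] /andP[? ?]; apply: eU.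
  by split; rewrite /ball /= ltr_distlC; apply/andP; split; lra.
rewrite bigcup_mkcond; apply: countable_bigcupT_measurable => [|q]; first exact: countableP.
by case: ifP => _ //; exact: measurableX.
Qed.

Lemma continuous_measurable_prod (f : R * R -> R) : continuous f -> measurable_fun setT f.
Proof.
move=> fc; apply: (measurability (@RGenOInfty.G R)); first exact: RGenOInfty.measurableE.
move=> _ [_ [x ->] <-]; rewrite setTI; apply: open_measurable_prod.
by apply: open_comp => //; rewrite set_itv_o_infty; exact: open_gt.
Qed.

End SphereTopology.

Section AffineSubstitution.
Variable R : realType.
Local Notation leb := (@lebesgue_measure R).

Lemma Rintegral_affine (h : R -> R) (c d a b : R) : 0 < c -> a <= b -> continuous h ->
  \int[leb]_(x in `[c * a + d, c * b + d]) h x = c * \int[leb]_(x in `[a, b]) h (c * x + d).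
Proof.
move=> c0 ab hc; pose F (x : R) : R := c * x + d.
have dF (x : R) : is_derive x (1 : R) F c.
  have := is_deriveD (is_deriveZ c (is_derive_id x (1 : R))) (is_derive_cst d x (1 : R)).
  by rewrite addr0 /GRing.scale /= mulr1.
have F1 : derive1 F = cst c by apply/funext => x; rewrite derive1E derive_val.
have Fc : continuous F by move=> x; apply: differentiable_continuous; apply/derivable1_diffP.
have hFc : continuous (h \o F) by move=> x; apply: continuous_comp; [exact: Fc|exact: hc].
rewrite /Rintegral (@integration_by_substitution_increasing R F h a b)//.
- rewrite -[c]/(fine c%:E) -fineM//; last first.
    by apply: integrable_fin_num => //; apply: continuous_compact_integrable; [exact: segment_compact|exact: continuous_subspaceT].
  rewrite -integralZl//; last first.
    by apply: continuous_compact_integrable; [exact: segment_compact|exact: continuous_subspaceT].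
  by congr fine; apply: eq_integral => x _; rewrite -EFinM F1 mulrC.
- by move=> x y _ _ xy; rewrite /F ltrD2r ltr_pM2l.
- by rewrite F1 => x _; exact: cst_continuous.
- by rewrite F1; exact: is_cvg_cst.
- by rewrite F1; exact: is_cvg_cst.
- split => [x _| |]; first by [].
    by apply: cvg_at_right_filter; exact: Fc.
  by apply: cvg_at_left_filter; exact: Fc.
- exact: continuous_subspaceT.
Qed.

End AffineSubstitution.

(** * Potential of the unit circle *)

Section CirclePotential.
Variable R : realType.
Local Notation leb := (@lebesgue_measure R).
Local Notation bS := (borel (riemann_sphere R)).

Let g (a b t : R) := 1 + (a ^+ 2 + b ^+ 2) - 2 * (a * cos t + b * sin t).

Let cos_sin_le (a b t : R) : (a * cos t + b * sin t) ^+ 2 <= a ^+ 2 + b ^+ 2.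
Proof.
have := cos2Dsin2 t; set c := cos t; set s := sin t => cs.
have -> : a ^+ 2 + b ^+ 2 = (a ^+ 2 + b ^+ 2) * (c ^+ 2 + s ^+ 2) by rewrite cs mulr1.
rewrite -subr_ge0 (_ : _ - _ = (a * s - b * c) ^+ 2) ?sqr_ge0//; ring.
Qed.

Let g_bounds a b t q : 0 <= q -> a ^+ 2 + b ^+ 2 = q ^+ 2 -> (1 - q) ^+ 2 <= g a b t <= (1 + q) ^+ 2.
Proof.
move=> q0 abq; have := cos_sin_le a b t; rewrite /g abq => h.
have /andP[h1 h2] : - q <= a * cos t + b * sin t <= q.
  by rewrite -ler_norml -(ler_pXn2r (n := 2))// ?nnegrE// real_normK ?num_real.
apply/andP; split; nra.
Qed.

Let g_gt0 a b t : a ^+ 2 + b ^+ 2 < 1 -> 0 < g a b t.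
Proof.
move=> ab1; have ab0 : 0 <= a ^+ 2 + b ^+ 2 by rewrite addr_ge0 ?sqr_ge0.
have /andP[h _] := @g_bounds a b t (Num.sqrt (a ^+ 2 + b ^+ 2)) (sqrtr_ge0 _) (esym (sqr_sqrtr ab0)).
apply: lt_le_trans h; rewrite exprn_gt0// subr_gt0 -[ltRHS]sqrtr1 ltr_sqrt//.
Qed.

Let g_cont a b : continuous (g a b).
Proof.
move=> t; apply: cvgB; first exact: cvg_cst.
apply: cvgM; first exact: cvg_cst.
by apply: cvgD; apply: cvgM; try exact: cvg_cst; [exact: continuous_cos|exact: continuous_sin].
Qed.

Let ln_g_cont a b : a ^+ 2 + b ^+ 2 < 1 -> continuous (fun t => ln (g a b t)).
Proof. by move=> ab1 t; apply: continuous_comp; [exact: g_cont|apply: continuous_ln; exact: g_gt0]. Qed.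

Let J a b := \int[leb]_(t in `[0, 2 * pi]) ln (g a b t).

Let cint (h : R -> R) u v : continuous h -> leb.-integrable `[u, v] (EFin \o h).
Proof. by move=> hc; apply: continuous_compact_integrable; [exact: segment_compact|exact: continuous_subspaceT]. Qed.

(* |1 - tau e^(-it)|^2 |1 + tau e^(-it)|^2 = |1 - tau^2 e^(-2it)|^2 *)
Let J_doubling a b : a ^+ 2 + b ^+ 2 < 1 -> J (a ^+ 2 - b ^+ 2) (2 * (a * b)) = 2 * J a b.
Proof.
move=> ab1.
have sq : (a ^+ 2 - b ^+ 2) ^+ 2 + (2 * (a * b)) ^+ 2 = (a ^+ 2 + b ^+ 2) ^+ 2 by ring.
have ab1' : (a ^+ 2 - b ^+ 2) ^+ 2 + (2 * (a * b)) ^+ 2 < 1.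
  by rewrite sq expr_lt1// addr_ge0 ?sqr_ge0.
have pi0 := @pi_ge0 R.
have c1 := ln_g_cont ab1; have c2 := ln_g_cont ab1'.
have cp : continuous (fun t : R => ln (g a b (1 * t + pi))).

  move=> t; apply: (@continuous_comp R R R (fun t => 1 * t + pi) (fun t : R => ln (g a b t))); last exact: c1.
  by apply: cvgD; [apply: cvgM; [exact: cvg_cst|exact: cvg_id]|exact: cvg_cst].
have h1 : J a b = \int[leb]_(t in `[0, pi]) ln (g a b t) + \int[leb]_(t in `[0, pi]) ln (g a b (1 * t + pi)).
  have := @Rintegral_affine R _ 1 pi 0 pi ltr01 pi0 c1; rewrite !mul1r add0r => <-.
  have := @Rintegral_itvB R (fun t => ln (g a b t)) (BLeft 0) (BRight (2 * pi)) pi (cint _ _ c1).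
  rewrite !bnd_simp pi0 ler_peMl// ?ler1n// => /(_ isT isT) h.
  rewrite /J -[LHS](subrK (\int[leb]_(t in `[0, pi]) ln (g a b t))) h addrC; congr (_ + _).
  by rewrite mulr_natl mulr2n Rintegral_itv_obnd_cbnd//; apply: integrableS (cint pi (pi + pi) c1) => //; exact: subset_itv_oc_cc.
have := @Rintegral_affine R _ 2 0 0 pi (ltr0n _ 2) pi0 c2; rewrite mulr0 !addr0 /J => ->.
congr (_ * _); rewrite -/(J a b) h1 -RintegralD//; [|exact: cint|exact: cint].
apply: eq_Rintegral => t _; rewrite -lnM ?posrE ?g_gt0//; congr ln.
rewrite addr0 mul1r /g cosDpi sinDpi [2 * t]mulr_natl mulr2n cosD sinD.
have := cos2Dsin2 t; set c := cos t; set s := sin t => cs.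
apply/eqP; rewrite -subr_eq0; apply/eqP; transitivity (2 * (a ^+ 2 + b ^+ 2) * (c ^+ 2 + s ^+ 2 - 1)); first ring.
by rewrite cs subrr mulr0.
Qed.

Let J_bound a b q : 0 <= q -> q < 1 -> a ^+ 2 + b ^+ 2 <= q ^+ 2 ->
  `|J a b| <= (ln 4 - 2 * ln (1 - q)) * (2 * pi).
Proof.
move=> q0 q1 abq; set C := ln 4 - 2 * ln (1 - q).
have ab1 : a ^+ 2 + b ^+ 2 < 1 by apply: le_lt_trans abq _; rewrite expr_lt1.
have c1 := ln_g_cont ab1.
have pi0 : 0 <= 2 * pi :> R by rewrite mulr_ge0 ?pi_ge0.
have cs (c : R) : \int[leb]_(t in `[0, 2 * pi]) c = c * (2 * pi).
  by rewrite Rintegral_cst//= lebesgue_measure_itv /= lte_fin mulr_gt0 ?pi_gt0//= subr0.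
have bd t : - C <= ln (g a b t) <= C.
  have ab0 : 0 <= a ^+ 2 + b ^+ 2 by rewrite addr_ge0 ?sqr_ge0.
  set p := Num.sqrt (a ^+ 2 + b ^+ 2).
  have p0 : 0 <= p by exact: sqrtr_ge0.
  have pE : a ^+ 2 + b ^+ 2 = p ^+ 2 by rewrite sqr_sqrtr.
  have pq : p <= q by rewrite -(ler_pXn2r (n := 2)) ?nnegrE// -pE.
  have /andP[h1 h2] := @g_bounds a b t p p0 pE.
  have l1 : ln (1 - q) <= 0 by apply: ln_le0; rewrite gerBl.
  have l4 : 0 <= ln 4 :> R by rewrite ln_ge0// ler1n.
  have := g_gt0 t ab1 => g0; apply/andP; split.
    have hq : (1 - q) ^+ 2 <= g a b t by apply: le_trans h1; nra.
    have : ln ((1 - q) ^+ 2) <= ln (g a b t) by rewrite ler_ln ?posrE// exprn_gt0// subr_gt0.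
    by rewrite lnXn ?subr_gt0// -mulr_natl /C; move: l4; lra.
  have : ln (g a b t) <= ln 4.
    by rewrite ler_ln ?posrE//; apply: le_trans h2 _; nra.
  by rewrite /C; move: l1; lra.
rewrite ler_norml -mulNr -!cs; apply/andP; split; apply: le_Rintegral => //; try exact: cint.
- by apply: cint; exact: cst_continuous.
- by move=> t _; have /andP[] := bd t.
- by apply: cint; exact: cst_continuous.
- by move=> t _; have /andP[] := bd t.
Qed.

(** Squaring the parameter doubles the integral, while on a disc of radius q < 1 the integral is
    bounded. Iterating n times bounds it by a constant over 2^n, so it vanishes; harmonic functions
    are avoided. *)
Lemma jensen_circle a b : a ^+ 2 + b ^+ 2 < 1 ->
  \int[leb]_(t in `[0, 2 * pi]) ln (1 + (a ^+ 2 + b ^+ 2) - 2 * (a * cos t + b * sin t)) = 0.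
Proof.
move=> ab1; rewrite -/(J a b).
have ab0 : 0 <= a ^+ 2 + b ^+ 2 by rewrite addr_ge0 ?sqr_ge0.
set q := Num.sqrt (a ^+ 2 + b ^+ 2).
have q0 : 0 <= q by exact: sqrtr_ge0.
have q1 : q < 1 by rewrite -[ltRHS]sqrtr1 ltr_sqrt.
pose C := (ln 4 - 2 * ln (1 - q)) * (2 * pi).
suff key n a' b' : a' ^+ 2 + b' ^+ 2 <= q ^+ 2 -> `|J a' b'| * 2 ^+ n <= C.
  apply/normr0_eq0/eqP; rewrite eq_le normr_ge0 andbT leNgt; apply/negP => j0.
  have [n nP] : exists n, C / `|J a b| < n%:R by exists (Num.trunc (C / `|J a b|)).+1; exact: truncnS_gt.
  have := key n a b; rewrite sqr_sqrtr// => /(_ (lexx _)); rewrite leNgt => /negP; apply.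
  rewrite ltr_pdivrMr// mulrC in nP; apply: lt_trans nP _.
  by rewrite ltr_pM2l// -natrX ltr_nat ltn_expl.
elim: n a' b' => [|n IH] a' b' abq; first by rewrite expr0 mulr1 J_bound.
have ab1' : a' ^+ 2 + b' ^+ 2 < 1 by apply: le_lt_trans abq _; rewrite expr_lt1.
have -> : `|J a' b'| * 2 ^+ n.+1 = `|J (a' ^+ 2 - b' ^+ 2) (2 * (a' * b'))| * 2 ^+ n.
  by rewrite (J_doubling ab1') normrM (ger0_norm (ler0n R 2)) [2 ^+ n.+1]exprS mulrA [_ * 2]mulrC.
apply: IH.
have -> : (a' ^+ 2 - b' ^+ 2) ^+ 2 + (2 * (a' * b')) ^+ 2 = (a' ^+ 2 + b' ^+ 2) ^+ 2 by ring.
apply: le_trans abq; rewrite -[leRHS]mulr1 expr2 ler_wpM2l ?addr_ge0 ?sqr_ge0//; exact: ltW.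
Qed.

Lemma circle_average (f : bS -> R) (h : R -> R) (M : R) : measurable_fun setT f ->
  (forall t, f (circle_map t) = h t) -> continuous h -> (forall t, `|h t| <= M) ->
  \int[circle_measure R]_w f w = (2 * pi)^-1 * \int[leb]_(t in `[0, 2 * pi]) h t.
Proof.
move=> mf fh hc hM; have pi2 : 0 < 2 * pi :> R by rewrite mulr_gt0// pi_gt0.
have mh : measurable_fun setT h by exact: continuous_measurable_fun.
pose P := uniform_prob pi2.
have ih : P.-integrable setT (EFin \o h).
  by apply: (@integrableR_le _ _ R (uniform_prob pi2) h (fun=> M)) => //; exact: integrableR_cst.
have e1 : \int[circle_measure R]_w f w = \int[P]_t h t.
  rewrite /Rintegral integral_distribution//=.
  - by congr fine; apply: eq_integral => t _ /=; rewrite fh.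
  - exact/measurable_EFinP.
  by rewrite (_ : _ \o _ = EFin \o h)//; apply/funext => t /=; rewrite fh.
have iM : P.-integrable setT (EFin \o (fun=> M)) by exact: integrableR_cst.
have ilb (k : R -> R) : continuous k -> leb.-integrable `[0, 2 * pi] (EFin \o k) by exact: cint.
have hM0 t : 0 <= h t + M by have := hM t; rewrite ler_norml => /andP[]; lra.
have : \int[P]_t (h t + M) = (2 * pi)^-1 * \int[leb]_(t in `[0, 2 * pi]) (h t + M).
  rewrite [LHS]/Rintegral (integral_uniform pi2) ?subr0.
  - rewrite fineM//; apply: integrable_fin_num => //; apply: ilb => t.
    by apply: cvgD; [exact: hc|exact: cvg_cst].
  - by apply/measurable_EFinP/measurable_funD.
  - by move=> t; rewrite lee_fin.
rewrite RintegralD// Rintegral_cst// [X in fine X]probability_setT mulr1.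
rewrite RintegralD//; [|exact: ilb|by apply: ilb; exact: cst_continuous].
have mV (u : R) : (2 * pi)^-1 * (u + M * (2 * pi)) = (2 * pi)^-1 * u + M.
  by rewrite mulrDr mulrCA mulVf ?gt_eqF// mulr1.
rewrite Rintegral_cst//= lebesgue_measure_itv /= lte_fin pi2 /= subr0 mV.
by rewrite e1 => /addIr.
Qed.

(** Infinity gets the value 0 by convention, a measurable extension; the measures concerned turn out
    to give it no mass. *)
Definition pi0 (p : bS) : R[i] := if p is Some z then z else 0.

Definition smooth_kernel (e : R) (x y : bS) : R := 2^-1 * ln (nsq (pi0 x - pi0 y) + e ^+ 2).

Definition sphere_ln_dist (x : bS) : R := if x is Some z then 2^-1 * ln (Num.max 1 (nsq z)) else 0.

Lemma measurable_lift2 (h : R[i]^o -> R) (c : R) : continuous h ->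
  measurable_fun setT (fun p : bS => if p is Some s then h s else c).
Proof. exact: measurable_lift. Qed.

Lemma measurable_pi0_Re : measurable_fun setT (fun p : bS => complex.Re (pi0 p)).
Proof.
have := @measurable_lift2 (@complex.Re R) 0 (@continuous_Re R).
by congr measurable_fun; apply/funext => -[].
Qed.

Lemma measurable_pi0_Im : measurable_fun setT (fun p : bS => complex.Im (pi0 p)).
Proof.
have := @measurable_lift2 (@complex.Im R) 0 (@continuous_Im R).
by congr measurable_fun; apply/funext => -[].
Qed.

Lemma measurable_nsq_dist : measurable_fun setT (fun q : bS * bS => nsq (pi0 q.1 - pi0 q.2)).
Proof.
have m1 (f : bS -> R) : measurable_fun setT f -> measurable_fun setT (fun q : bS * bS => f q.1 - f q.2).
  by move=> mf; apply: measurable_funB; apply: measurableT_comp mf _.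
rewrite (_ : (fun q : bS * bS => _) = (fun q => (complex.Re (pi0 q.1) - complex.Re (pi0 q.2)) ^+ 2 +
    (complex.Im (pi0 q.1) - complex.Im (pi0 q.2)) ^+ 2)); last by apply/funext => q; rewrite /nsq Re_B Im_B.
apply: measurable_funD; apply: measurable_funX; apply: (m1 (fun p => _ (pi0 p))).
- exact: measurable_pi0_Re.
- exact: measurable_pi0_Im.
Qed.

Lemma measurable_smooth_kernel e : measurable_fun setT (fun q : bS * bS => smooth_kernel e q.1 q.2).
Proof.
apply: measurable_funM; first exact: measurable_cst.
apply: measurableT_comp; first exact: measurable_ln.
by apply: measurable_funD; [exact: measurable_nsq_dist|exact: measurable_cst].
Qed.

Lemma measurable_smooth_kernel1 e x : measurable_fun setT (smooth_kernel e x).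
Proof. exact: (measurableT_comp (measurable_smooth_kernel e) (pair1_measurable x)). Qed.

(** On the circle, |z - w|^2 + e^2 is k |1 - tau|^2 for some tau of constant modulus below 1, so by
    Jensen's formula the potential is exactly (1/2) log k. It then remains to see that k is between
    m and m (1 + 2e) with m = max (1, |z|^2). *)
Lemma smooth_circle_potential (z : R[i]) (e : R) : 0 < e <= 1 ->
  sphere_ln_dist (Some z) <= \int[circle_measure R]_w smooth_kernel e (Some z) w <= sphere_ln_dist (Some z) + e.
Proof.
case: z => x y /andP[e0 e1]; set s := x ^+ 2 + y ^+ 2.
have s0 : 0 <= s by rewrite addr_ge0 ?sqr_ge0.
have e20 : 0 < e ^+ 2 by rewrite exprn_gt0.
pose A := 1 + s + e ^+ 2; pose D := A ^+ 2 - 4 * s.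
have A2 : 4 * s < A ^+ 2.
  have : 0 <= (1 - s) ^+ 2 by exact: sqr_ge0.
  rewrite /A; nra.
have D0 : 0 <= D by rewrite subr_ge0 ltW.
(* The larger root of k^2 - A k + s = 0, so that k + s / k = A and |z / k| < 1. *)
pose k := (A + Num.sqrt D) / 2.
have kA : A / 2 <= k by rewrite ler_pM2r// lerDl sqrtr_ge0.
have A0 : 0 < A by rewrite /A; lra.
have k0 : 0 < k by apply: lt_le_trans kA; rewrite divr_gt0.
have kE : k ^+ 2 + s = A * k.
  have gen (u v w : R) : v ^+ 2 = u ^+ 2 - 4 * w -> ((u + v) / 2) ^+ 2 + w = u * ((u + v) / 2).
    move=> h; have -> : w = (u ^+ 2 - v ^+ 2) / 4 by lra.
    by field.
  exact/gen/sqr_sqrtr.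
have k2s : s < k ^+ 2 by nra.
have kprod : (k - 1) * (k - s) = e ^+ 2 * k by rewrite /A in kE; nra.
have ksum : 1 + s < 2 * k by move: kA; rewrite /A ler_pdivrMr//; lra.
have k1 : 1 < k by rewrite ltNge; apply/negP => h; nra.
have ks : s < k by rewrite ltNge; apply/negP => h; nra.
set m := Num.max 1 s.
have m1 : 1 <= m by rewrite le_max lexx.
have mk : m <= k by rewrite ge_max !ltW.
have km2 : (k - m) ^+ 2 <= e ^+ 2 * k.
  have mE : (m = 1 /\ s <= 1) \/ (m = s /\ 1 <= s).
    by rewrite /m; case: (leP 1 s) => h; [right|left]; split => //; exact: ltW.
  rewrite -kprod expr2; case: mE => -[-> h]; [apply: ler_wpM2l|apply: ler_wpM2r]; lra.
have km : k <= m * (1 + 2 * e).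
  rewrite leNgt; apply/negP => h; set u := k - m.
  have h1 : 2 * e * m < u by rewrite /u; lra.
  have h2 : u ^+ 2 <= e ^+ 2 * (m + u) by rewrite [m + u]addrC /u subrK.
  have em : 0 < e * m by rewrite mulr_gt0//; lra.
  have h3 : e ^+ 2 <= e * m by rewrite expr2 ler_pM2l//; lra.
  have h4 : e ^+ 2 * m <= (e * m) ^+ 2 by rewrite exprMn ler_pM2l// expr2 ler_peMl; lra.
  have h5 : e ^+ 2 * u <= e * m * u by apply: ler_wpM2r => //; lra.
  nra.
pose h t := ln (1 + ((x / k) ^+ 2 + (y / k) ^+ 2) - 2 * (x / k * cos t + y / k * sin t)).
have ab1 : (x / k) ^+ 2 + (y / k) ^+ 2 < 1.
  have k20 : 0 < k ^+ 2 by exact: exprn_gt0.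
  by rewrite (expr_div_n x) (expr_div_n y) -mulrDl ltr_pdivrMr ?mul1r.
have hc : continuous h by exact: ln_g_cont ab1.
have fE t : smooth_kernel e (Some (x +i* y)%C) (circle_map t) = 2^-1 * ln k + 2^-1 * h t.
  rewrite /smooth_kernel /h -mulrDr -lnM ?posrE//; last exact: g_gt0.
  congr (2^-1 * ln _); rewrite /nsq /=.
  have := cos2Dsin2 t; set c := cos t; set sn := sin t => cs.
  have -> : k * (1 + ((x / k) ^+ 2 + (y / k) ^+ 2) - 2 * (x / k * c + y / k * sn)) =
      (k ^+ 2 + s) / k - 2 * (x * c + y * sn) by rewrite /s; field; rewrite gt_eqF.
  by rewrite kE mulfK ?gt_eqF// /A /s -{1}cs; ring.
have hb t : `|h t| <= `|ln ((1 - Num.sqrt ((x / k) ^+ 2 + (y / k) ^+ 2)) ^+ 2)| + ln 4.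
  have ab0 : 0 <= (x / k) ^+ 2 + (y / k) ^+ 2 by rewrite addr_ge0 ?sqr_ge0.
  have /andP[h1 h2] := @g_bounds _ _ t _ (sqrtr_ge0 _) (esym (sqr_sqrtr ab0)).
  set q := Num.sqrt _ in h1 h2 *.
  have q1 : q < 1 by rewrite -[ltRHS]sqrtr1 ltr_sqrt.
  have q0 : 0 <= q by exact: sqrtr_ge0.
  have q2 : 0 < (1 - q) ^+ 2 by rewrite exprn_gt0// subr_gt0.
  have g0 := g_gt0 t ab1.
  have l1 : ln ((1 - q) ^+ 2) <= h t by rewrite /h ler_ln.
  have l2 : h t <= ln 4 by rewrite /h ler_ln ?posrE//; apply: le_trans h2 _; nra.
  have l4 : 0 <= ln 4 :> R by rewrite ln_ge0// ler1n.
  rewrite ler_norml; have := ler_norm (- ln ((1 - q) ^+ 2)); rewrite normrN.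
  have := normr_ge0 (ln ((1 - q) ^+ 2)); move: l1 l2 l4 => ? ? ? ? ?; apply/andP; split; lra.
rewrite (@circle_average _ _ (`|2^-1 * ln k| + 2^-1 * (`|ln ((1 - Num.sqrt ((x / k) ^+ 2 + (y / k) ^+ 2)) ^+ 2)| + ln 4)) (measurable_smooth_kernel1 e _) fE); last 2 first.
- by move=> t; apply: cvgD; [exact: cvg_cst|apply: cvgM; [exact: cvg_cst|exact: hc]].
- by move=> t; rewrite (le_trans (ler_normD _ _))// lerD2l normrM ger0_norm ?invr_ge0// ler_pM2l ?invr_gt0.
have pi2 : 0 < 2 * pi :> R by rewrite mulr_gt0// pi_gt0.
rewrite RintegralD//; [|by apply: cint; exact: cst_continuous|].
  have ih : leb.-integrable `[0, 2 * pi] (EFin \o h) by exact: cint.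
  rewrite [X in _ + X]RintegralZl//.
  rewrite (jensen_circle ab1) mulr0 addr0 Rintegral_cst//= lebesgue_measure_itv /= lte_fin pi2 /= subr0.
  rewrite mulrCA mulVf ?gt_eqF// mulr1 /nsq /= -/s -/m.
  have l1 : ln m <= ln k by rewrite ler_ln ?posrE; lra.
  have m0 : 0 < m by exact: lt_le_trans m1.
  have e21 : 0 < 1 + 2 * e by rewrite addr_gt0// mulr_gt0.
  have l2 : ln k <= ln m + ln (1 + 2 * e) by rewrite -lnM ?posrE// ler_ln ?posrE// mulr_gt0.
  have l3 : ln (1 + 2 * e) <= 2 * e by apply: le_ln1Dx; lra.
  by apply/andP; split; move: l1 l2 l3; lra.
by apply: cint => t; apply: cvgM; [exact: cvg_cst|exact: hc].
Qed.

End CirclePotential.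

(** * Averages against the Fubini-Study form *)

Section PlaneIntegrals.
Variable R : realType.
Local Notation leb := (@lebesgue_measure R).
Local Notation leb2 := (leb \x leb)%E.

Let affine_continuous (c d : R) : continuous (fun x : R => c * x + d).
Proof. by move=> x; apply: cvgD; [apply: cvgM; [exact: cvg_cst|exact: cvg_id]|exact: cvg_cst]. Qed.

Lemma ge0_integral_affine (h : R -> R) (c d : R) : 0 < c -> continuous h -> (forall x, 0 <= h x) ->
  (\int[leb]_x (h x)%:E = c%:E * \int[leb]_x (h (c * x + d))%:E)%E.
Proof.
move=> c0 hc h0; pose F (x : R) : R := c * x + d.
have dF (x : R) : is_derive x (1 : R) F c.
  have := is_deriveD (is_deriveZ c (is_derive_id x (1 : R))) (is_derive_cst d x (1 : R)).
  by rewrite addr0 /GRing.scale /= mulr1.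
have F1 : derive1 F = cst c by apply/funext => x; rewrite derive1E derive_val.
have hFc : continuous (h \o F) by move=> x; apply: continuous_comp; [exact: affine_continuous|exact: hc].
rewrite (@increasing_ge0_integration_by_substitutionT R F h)//.
- rewrite -ge0_integralZl//; [|by apply/measurable_EFinP; exact: continuous_measurable_fun|by move=> x _; rewrite lee_fin|by rewrite lee_fin ltW].
  by apply: eq_integral => x _; rewrite -EFinM F1 mulrC.
- by move=> x y xy; rewrite /F ltrD2r ltr_pM2l.
- by rewrite F1 => x; exact: cst_continuous.
- by rewrite F1; exact: is_cvg_cst.
- by rewrite F1; exact: is_cvg_cst.
- apply/cvgrNyPle => A; apply: filterS (nbhs_ninfty_le (num_real ((A - d) / c))) => x h'.
  by rewrite /F -lerBrDr mulrC -ler_pdivlMr.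
- apply/cvgryPge => A; apply: filterS (nbhs_pinfty_ge (num_real ((A - d) / c))) => x h'.
  by rewrite /F -lerBlDr mulrC -ler_pdivrMr.
Qed.

Let pair_cont (G : R * R -> R) (u v : R * R -> R) : continuous G -> continuous u -> continuous v ->
  continuous (fun p : R * R => G (u p, v p)).
Proof.
move=> Gc uc vc p; apply: (@continuous_comp _ _ R (fun p : R * R => (u p, v p)) G); last exact: Gc.
exact: (cvg_pair (uc p) (vc p)).
Qed.

Let aff1 (c d : R) : continuous (fun p : R * R => c * p.1 + d).
Proof. by move=> p; apply: (@continuous_comp _ R R fst (fun x => c * x + d)); [exact: cvg_fst|exact: affine_continuous]. Qed.

Let aff2 (c d : R) : continuous (fun p : R * R => c * p.2 + d).
Proof. by move=> p; apply: (@continuous_comp _ R R snd (fun x => c * x + d)); [exact: cvg_snd|exact: affine_continuous]. Qed.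

Lemma continuous_plane_affine (G : R * R -> R) (c a d b : R) : continuous G ->
  continuous (fun p : R * R => G (c * p.1 + a, d * p.2 + b)).
Proof. by move=> Gc; exact: pair_cont. Qed.

Lemma tonelli_plane1 (G : R * R -> R) : continuous G -> (forall p, 0 <= G p) ->
  (\int[leb2]_p (G p)%:E = \int[leb]_x \int[leb]_y (G (x, y))%:E)%E /\
  measurable_fun setT (fun x => \int[leb]_y (G (x, y))%:E)%E.
Proof.
move=> Gc G0; have mG : measurable_fun setT (EFin \o G).
  by apply/measurable_EFinP; exact: continuous_measurable_prod.
split; first by apply: (@fubini_tonelli1 _ _ _ _ R leb leb (EFin \o G)) => // p; rewrite lee_fin.
by apply: (@measurable_fun_fubini_tonelli_F _ _ _ _ R leb (EFin \o G)) => // p; rewrite lee_fin.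
Qed.

Lemma tonelli_plane2 (G : R * R -> R) : continuous G -> (forall p, 0 <= G p) ->
  (\int[leb2]_p (G p)%:E = \int[leb]_y \int[leb]_x (G (x, y))%:E)%E /\
  measurable_fun setT (fun y => \int[leb]_x (G (x, y))%:E)%E.
Proof.
move=> Gc G0; have mG : measurable_fun setT (EFin \o G).
  by apply/measurable_EFinP; exact: continuous_measurable_prod.
split; first by apply: (@fubini_tonelli2 _ _ _ _ R leb leb (EFin \o G)) => // p; rewrite lee_fin.
by apply: (@measurable_fun_fubini_tonelli_G _ _ _ _ R leb (EFin \o G)) => // p; rewrite lee_fin.
Qed.

Lemma ge0_integral_plane_affine (G : R * R -> R) (c a b : R) : 0 < c -> continuous G -> (forall p, 0 <= G p) ->
  (\int[leb2]_p (G p)%:E = (c ^+ 2)%:E * \int[leb2]_p (G (c * p.1 + a, c * p.2 + b)%R)%:E)%E.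
Proof.
move=> c0 Gc G0.
have c0E : (0 <= c%:E)%E by rewrite lee_fin ltW.
have sl1 (H : R * R -> R) x : continuous H -> continuous (fun y => H (x, y)).
  by move=> Hc y; exact: (cvg_comp _ _ (cvg_pair (@cvg_cst _ x _ _ _) (@cvg_id _ _)) (Hc (x, y))).
have sl2 (H : R * R -> R) y : continuous H -> continuous (fun x => H (x, y)).
  by move=> Hc x; exact: (cvg_comp _ _ (cvg_pair (@cvg_id _ _) (@cvg_cst _ y _ _ _)) (Hc (x, y))).
pose G1 (p : R * R) := G (p.1, c * p.2 + b).
have G1c : continuous G1 by apply: pair_cont => // p; exact: cvg_fst.
pose G2 (p : R * R) := G (c * p.1 + a, c * p.2 + b).
have G2c : continuous G2 by exact: pair_cont.
have G10 p : 0 <= G1 p by exact: G0.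
have G20 p : 0 <= G2 p by exact: G0.
have [-> _] := tonelli_plane1 Gc G0; have [I1 m1] := tonelli_plane1 G1c G10.
have [I1' _] := tonelli_plane2 G1c G10; have [I2 m2] := tonelli_plane2 G2c G20.
transitivity (c%:E * \int[leb2]_p (G1 p)%:E)%E.
  rewrite I1 -ge0_integralZl//; last by move=> x _; apply: integral_ge0 => y _; rewrite lee_fin.
  apply: eq_integral => x _.
  by rewrite (@ge0_integral_affine (fun y => G (x, y)) c b)//; exact: sl1.
rewrite (expr2 c) EFinM -muleA; congr (_ * _)%E.
rewrite I1' I2 -ge0_integralZl//; last by move=> y _; apply: integral_ge0 => x _; rewrite lee_fin.
apply: eq_integral => y _.
by rewrite (@ge0_integral_affine (fun x => G1 (x, y)) c a)//; exact: sl2.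
Qed.

(** The density of dd^c of (1/2) log (|z - w|^2 + e^2) with w = a + ib: the Fubini-Study form
    centered at w and at scale e. *)
Definition fubini_study (a b e : R) (p : R * R) : R :=
  e ^+ 2 / (pi * ((p.1 - a) ^+ 2 + (p.2 - b) ^+ 2 + e ^+ 2) ^+ 2).
Local Notation FS := (fubini_study 0 0 1).

Let den_gt0 a b e (p : R * R) : 0 < e -> 0 < (p.1 - a) ^+ 2 + (p.2 - b) ^+ 2 + e ^+ 2.
Proof. by move=> e0; rewrite ltr_wpDl ?exprn_gt0// addr_ge0// sqr_ge0. Qed.

Lemma fubini_study_ge0 a b e p : 0 <= fubini_study a b e p.
Proof. by rewrite /fubini_study mulr_ge0 ?sqr_ge0// invr_ge0 mulr_ge0 ?pi_ge0// sqr_ge0. Qed.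

Lemma fubini_study_continuous a b e : 0 < e -> continuous (fubini_study a b e).
Proof.
move=> e0 p; apply: cvgM; first exact: cvg_cst.
apply: cvgV; first by rewrite mulf_neq0 ?gt_eqF ?pi_gt0 ?exprn_gt0 ?den_gt0.
apply: cvgM; first exact: cvg_cst.
apply: cvg_exprR; apply: cvgD; last exact: cvg_cst.
by apply: cvgD; apply: cvg_exprR; apply: cvgB; try exact: cvg_cst; [exact: cvg_fst|exact: cvg_snd].
Qed.

Lemma fubini_study_affine a b e p : 0 < e ->
  e ^+ 2 * fubini_study a b e (e * p.1 + a, e * p.2 + b) = FS p.
Proof.
move=> e0; rewrite /fubini_study /= !addrK !subr0 !exprMn expr1n.
have h : 0 < p.1 ^+ 2 + p.2 ^+ 2 + 1 by rewrite ltr_wpDl// addr_ge0// sqr_ge0.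
have -> : e ^+ 2 * p.1 ^+ 2 + e ^+ 2 * p.2 ^+ 2 + e ^+ 2 = e ^+ 2 * (p.1 ^+ 2 + p.2 ^+ 2 + 1) by ring.
set D := _ + 1; 
have ee : e != 0 by rewrite gt_eqF.
have -> : pi * (e ^+ 2 * D) ^+ 2 = (e ^+ 2 * e ^+ 2) * (pi * D ^+ 2) by ring.
by rewrite invfM !mulrA mulfV ?mulf_neq0 ?expf_neq0.
Qed.

Let oneDsqr_integral : (\int[leb]_x ((oneDsqr x)^-1)%:E = pi%:E)%E.
Proof.
rewrite ge0_symfun_integralT.
- by rewrite -set_itvcy integral0y_oneDsqr -EFinM mulrC divfK.
- by move=> x; rewrite invr_ge0 addr_ge0// sqr_ge0.
- exact: continuous_oneDsqrV.
- by move=> x; rewrite /= /oneDsqr sqrrN.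
Qed.

Lemma fubini_study_integrable : leb2.-integrable setT (EFin \o FS).
Proof.
have mF : measurable_fun setT FS by apply: continuous_measurable_prod; exact: fubini_study_continuous.
(* A product majorant: (1 + x^2) (1 + y^2) <= (1 + x^2 + y^2)^2 and pi >= 1. *)
pose H (p : R * R) := (oneDsqr p.1)^-1 * (oneDsqr p.2)^-1.
have Hc : continuous H.
  move=> p; apply: cvgM; apply: (@continuous_comp _ R R _ (fun x => (oneDsqr x)^-1)).
  - exact: cvg_fst.
  - exact: continuous_oneDsqrV.
  - exact: cvg_snd.
  - exact: continuous_oneDsqrV.
have H0 x : 0 <= (@oneDsqr R x)^-1 by rewrite invr_ge0 addr_ge0// sqr_ge0.
have mH : measurable_fun setT (EFin \o H).
  by apply/measurable_EFinP; exact: continuous_measurable_prod.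
have m1 : measurable_fun setT (fun x : R => ((oneDsqr x)^-1)%:E).
  by apply/measurable_EFinP; apply: continuous_measurable_fun; exact: continuous_oneDsqrV.
have iH : leb2.-integrable setT (EFin \o H).
  apply/integrableP; split => //.
  under eq_integral do rewrite /= ger0_norm ?mulr_ge0//.
  have [I1 _] := tonelli_plane1 Hc (fun p => mulr_ge0 (H0 p.1) (H0 p.2)).
  rewrite [X in (X < _)%E](_ : _ = \int[leb]_x \int[leb]_y (H (x, y))%:E)%E//.
  rewrite [X in (X < _)%E](_ : _ = \int[leb]_x (pi%:E * ((oneDsqr x)^-1)%:E))%E; last first.
    apply: eq_integral => x _; rewrite /H /=; under eq_integral do rewrite EFinM.
    by rewrite ge0_integralZl// ?oneDsqr_integral 1?muleC// ?lee_fin// => y _; rewrite lee_fin.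
  rewrite ge0_integralZl//; first [by rewrite oneDsqr_integral -EFinM ltry|by move=> x _; rewrite lee_fin|
    by rewrite lee_fin pi_ge0].
apply: le_integrable iH => //; first exact/measurable_EFinP.
move=> [x y] _; rewrite /= !lee_fin !ger0_norm ?fubini_study_ge0 ?mulr_ge0//.
rewrite /fubini_study /H /= !subr0 expr1n div1r -invfM.
have p1 : 1 <= pi :> R by apply: le_trans (pi_ge2 R); rewrite ler1n.
have x0 : 0 <= x ^+ 2 by exact: sqr_ge0.
have y0 : 0 <= y ^+ 2 by exact: sqr_ge0.
have d0 : 0 < oneDsqr x * oneDsqr y by rewrite mulr_gt0// /oneDsqr; lra.
rewrite lef_pV2 ?posrE//; last by rewrite mulr_gt0 ?pi_gt0// exprn_gt0//; lra.
have : oneDsqr x * oneDsqr y <= (x ^+ 2 + y ^+ 2 + 1) ^+ 2 by rewrite /oneDsqr; nra.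
by move=> h; apply: le_trans h _; rewrite ler_peMl// sqr_ge0.
Qed.

(** The total mass is carried as a symbol; it multiplies g in the formula for the potential of
    rho. *)
Definition fs_mass := \int[leb2]_p FS p.

Lemma fs_mass_ge0 : 0 <= fs_mass.
Proof. by apply: Rintegral_ge0 => p _; exact: fubini_study_ge0. Qed.

Section Bounded.
Variables (f : R * R -> R) (M : R).
Hypothesis fc : continuous f.
Hypothesis fM : forall p, `|f p| <= M.

Lemma bounded_fs_integrable : leb2.-integrable setT (EFin \o (fun p => f p * FS p)).
Proof.
have mF : measurable_fun setT FS by apply: continuous_measurable_prod; exact: fubini_study_continuous.
have iMF : leb2.-integrable setT (EFin \o (fun p => M * FS p)).
  by have := integrableZl measurableT M fubini_study_integrable.
apply: le_integrable iMF => //.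
  by apply/measurable_EFinP; apply: measurable_funM => //; exact: continuous_measurable_prod.
move=> p _; rewrite /= lee_fin !normrM ler_wpM2r// (le_trans (fM p))//.
by rewrite ler_norm.
Qed.

End Bounded.

(** The substitution is established for nonnegative functions and applied to f + M and to the
    constant M. *)
Lemma fs_change_of_variables (f : R * R -> R) M (a b e : R) : continuous f -> (forall p, `|f p| <= M) -> 0 < e ->
  leb2.-integrable setT (EFin \o (fun p => f p * fubini_study a b e p)) /\
  \int[leb2]_p (f p * fubini_study a b e p) = \int[leb2]_p (f (e * p.1 + a, e * p.2 + b) * FS p).
Proof.
move=> fc fM e0; pose FS' := fubini_study a b e.
have M0 : 0 <= M by apply: le_trans (fM 0).
have F'c : continuous FS' by exact: fubini_study_continuous.
have e2E : (0 <= (e ^+ 2)%:E)%E by rewrite lee_fin sqr_ge0.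
have Fc : continuous FS by exact: fubini_study_continuous.
have key (h : R * R -> R) : continuous h -> (forall p, 0 <= h p) ->
    (\int[leb2]_p (h p * FS' p)%:E = \int[leb2]_p (h (e * p.1 + a, e * p.2 + b)%R * FS p)%:E)%E.
  move=> hc h0; rewrite (@ge0_integral_plane_affine (fun p => h p * FS' p) e a b)//.
  - rewrite -ge0_integralZl//; last 2 first.
    + apply/measurable_EFinP; apply: continuous_measurable_prod.
      apply: (@pair_cont (fun p => h p * FS' p)) => //.
      by move=> p; apply: cvgM; [exact: hc|exact: F'c].
    + by move=> p _; rewrite lee_fin mulr_ge0// fubini_study_ge0.
    apply: eq_integral => p _; rewrite -EFinM mulrCA; congr (_ * _)%:E.
    exact: fubini_study_affine.
  - by move=> p; apply: cvgM; [exact: hc|exact: F'c].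
  - by move=> p; rewrite mulr_ge0// fubini_study_ge0.
pose T (p : R * R) := f (e * p.1 + a, e * p.2 + b).
have Tc : continuous T by exact: pair_cont.
have iF' : leb2.-integrable setT (EFin \o FS').
  apply/integrableP; split; first by apply/measurable_EFinP; exact: continuous_measurable_prod.
  have c1 : continuous (fun _ : R * R => 1 : R) by move=> p; exact: cvg_cst.
  have h : (\int[leb2]_p (FS' p)%:E = \int[leb2]_p (FS p)%:E)%E.
    transitivity (\int[leb2]_p (1 * FS' p)%:E)%E; first by under [RHS]eq_integral do rewrite mul1r.
    by rewrite (key _ c1 (fun=> ler01)); under eq_integral do rewrite mul1r.
  under eq_integral do rewrite /= ger0_norm ?fubini_study_ge0//.
  have /integrableP[_] := fubini_study_integrable.
  move=> ltF; rewrite [X in (X < _)%E](_ : _ = \int[leb2]_p `|(EFin \o FS) p|)%E//.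
  transitivity (\int[leb2]_p (FS p)%:E)%E; first exact: h.
  by apply: eq_integral => p _; rewrite /= ger0_norm ?fubini_study_ge0.
have iMF' : leb2.-integrable setT (EFin \o (fun p => M * FS' p)).
  by have := integrableZl measurableT M iF'.
have iff : leb2.-integrable setT (EFin \o (fun p => f p * FS' p)).
  apply: le_integrable iMF' => //.
    by apply/measurable_EFinP; apply: continuous_measurable_prod => p; apply: cvgM; [exact: fc|exact: F'c].
  by move=> p _; rewrite /= lee_fin !normrM ler_wpM2r// (le_trans (fM p))// ler_norm.
split=> //.
have iT : leb2.-integrable setT (EFin \o (fun p => T p * FS p)).
  by apply: (@bounded_fs_integrable T M) => // p; exact: fM.
have iMF : leb2.-integrable setT (EFin \o (fun p => M * FS p)).
  by have := integrableZl measurableT M fubini_study_integrable.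
have k1 : \int[leb2]_p (M * FS' p) = \int[leb2]_p (M * FS p).
  by congr fine; apply: (key (fun=> M)) => // p; exact: cvg_cst.
have : \int[leb2]_p (f p * FS' p + M * FS' p) = \int[leb2]_p (T p * FS p + M * FS p).
  rewrite /Rintegral; congr fine; under eq_integral do rewrite -mulrDl.
  under [in RHS]eq_integral do rewrite -mulrDl; apply: (key (fun p => f p + M)).
    by move=> p; apply: cvgD; [exact: fc|exact: cvg_cst].
  by move=> p; have := fM p; rewrite ler_norml => /andP[]; lra.
by rewrite !RintegralD// k1 => /addIr.
Qed.

Lemma fs_tail eta : 0 < eta -> exists n : nat,
  \int[leb2]_p (if p.1 ^+ 2 + p.2 ^+ 2 <= n%:R ^+ 2 then 0 else FS p) < eta.
Proof.
move=> eta0; pose u (n : nat) (p : R * R) : \bar R := (if p.1 ^+ 2 + p.2 ^+ 2 <= n%:R ^+ 2 then 0 else FS p)%:E.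
have mF : measurable_fun setT FS by apply: continuous_measurable_prod; exact: fubini_study_continuous.
have mu n : measurable_fun setT (u n).
  apply/measurable_EFinP; apply: measurable_fun_ifT => //.
  apply: measurable_fun_ler; last exact: measurable_cst.
  apply: continuous_measurable_prod => p.
  by apply: cvgD; apply: cvg_exprR; [exact: cvg_fst|exact: cvg_snd].
have := @dominated_cvg _ _ R leb2 setT measurableT u (cst 0%E) (EFin \o FS) mu.
move=> /(_ _ _ fubini_study_integrable) h.
have {h} : (\int[leb2]_x u n x)%E @[n --> \oo] --> (\int[leb2]_x (cst 0 x))%E.
  apply: h => //.
    move=> p _; have [N NP] : exists N : nat, p.1 ^+ 2 + p.2 ^+ 2 <= N%:R.
      by exists (Num.trunc (p.1 ^+ 2 + p.2 ^+ 2)).+1; apply/ltW/truncnS_gt.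
    apply: cvg_near_cst; exists N.+1 => // n /= Nn; rewrite /u ifT//.
    apply: le_trans NP _; rewrite -natrX ler_nat (leq_trans (ltnW Nn))//.
    by rewrite -{1}[n]expn1 leq_pexp2l// (leq_trans _ Nn).
  move=> n p _; rewrite /u /= lee_fin; case: ifP => _; first by rewrite normr0 fubini_study_ge0.
  by rewrite ger0_norm ?fubini_study_ge0.
rewrite integral0 => /fine_cvgP[_ /cvgrPdist_lt/(_ _ eta0)[n _ /(_ n (leqnn n))]].
rewrite /= sub0r normrN => h; exists n; exact: le_lt_trans (ler_norm _) h.
Qed.

(** As e tends to 0 the form concentrates at its center. Uniformity in the center comes from
    splitting the plane: on a disc of radius n the variation of g is small by [sphere_uniform], and
    outside it the mass is small. *)
Lemma fs_average_uniform (g : riemann_sphere R -> R) eta : continuous g -> 0 < eta ->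
  exists2 e0 : R, 0 < e0 <= 1 & forall e a b, 0 < e <= e0 ->
    `|\int[leb2]_p (g (chart0 (e * p.1 + a, e * p.2 + b)) * FS p) - fs_mass * g (chart0 (a, b))| <= eta.
Proof.
move=> gc eta0; have [M0 M0P] := sphere_bounded gc; pose M := Num.max 0 M0.
have M_ge0 : 0 <= M by rewrite le_max lexx.
have MP x : `|g x| <= M by rewrite (le_trans (M0P x))// le_max lexx orbT.
have k0 := fs_mass_ge0.
(* The inner part contributes at most [d * fs_mass] and the outer part at most 2 M t, each of which
   is at most [eta / 2]. *)
pose d := eta / (2 * (fs_mass + 1)).
have d0 : 0 < d by rewrite divr_gt0// mulr_gt0//; lra.
have [r r0 rP] := sphere_uniform gc d0.
pose t := eta / (2 * (2 * M + 1)).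
have t0 : 0 < t by rewrite divr_gt0// mulr_gt0//; lra.
have [n nP] := fs_tail t0.
exists (Num.min 1 (r / (n%:R + 1))).
  by rewrite lt_min ltr01 divr_gt0 ?ltr_wpDl//= ge_min lexx.
move=> e a b /andP[e0]; rewrite le_min ler_pdivlMr ?ltr_wpDl// => /andP[_ er].
have cc : continuous (fun p : R * R => g (chart0 p)).
  by move=> p; apply: continuous_comp; [exact: continuous_chart0|exact: gc].
pose T (p : R * R) := g (chart0 (e * p.1 + a, e * p.2 + b)).
have Tc : continuous T by exact: (@pair_cont (fun p => g (chart0 p))).
pose c0 := g (chart0 (a, b)).
have iT : leb2.-integrable setT (EFin \o (fun p => T p * FS p)).
  by apply: (@bounded_fs_integrable T M) => // p; exact: MP.
have ic (c : R) : leb2.-integrable setT (EFin \o (fun p => c * FS p)).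
  by have := integrableZl measurableT c fubini_study_integrable.
have -> : fs_mass * c0 = \int[leb2]_p (c0 * FS p) by rewrite RintegralZl 1?mulrC//; exact: fubini_study_integrable.
rewrite -RintegralB//.
pose tl (p : R * R) : R := if p.1 ^+ 2 + p.2 ^+ 2 <= n%:R ^+ 2 then 0 else FS p.
have mF : measurable_fun setT FS by apply: continuous_measurable_prod; exact: fubini_study_continuous.
have itl : leb2.-integrable setT (EFin \o tl).
  apply: le_integrable fubini_study_integrable => //.
    apply/measurable_EFinP; apply: measurable_fun_ifT => //.
    apply: measurable_fun_ler; last exact: measurable_cst.
    apply: continuous_measurable_prod => p.
    by apply: cvgD; apply: cvg_exprR; [exact: cvg_fst|exact: cvg_snd].
  move=> p _; rewrite /= lee_fin /tl; case: ifP => _ //; first by rewrite normr0.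
have itl2 : leb2.-integrable setT (EFin \o (fun p => (2 * M) * tl p)).
  by have := integrableZl measurableT (2 * M) itl.
have iD : leb2.-integrable setT (EFin \o (fun p => T p * FS p - c0 * FS p)).
  by have := integrableB measurableT iT (ic c0).
have := le_normr_Rintegral measurableT iD; move/le_trans; apply.
apply: (@le_trans _ _ (\int[leb2]_p (d * FS p + 2 * M * tl p))).
  apply: le_Rintegral => //.
  - by have := integrable_norm iD.
  - by have := integrableD measurableT (ic d) itl2.
  move=> p _; rewrite -mulrBl normrM (ger0_norm (fubini_study_ge0 _ _ _ _)) /tl.
  case: ifP => [pn|_]; last first.
    have h1 := MP (chart0 (e * p.1 + a, e * p.2 + b)); have h2 := MP (chart0 (a, b)).
    have h3 : `|T p - c0| <= 2 * M by rewrite (le_trans (ler_normB _ _))//; move: h1 h2; rewrite -/(T p) -/c0; lra.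
    by rewrite (le_trans (ler_wpM2r (fubini_study_ge0 _ _ _ _) h3))// lerDr mulr_ge0 ?fubini_study_ge0// ltW.
  rewrite mulr0 addr0 ler_wpM2r ?fubini_study_ge0//; apply: ltW.
  have := rP (a +i* b)%C ((e * (p.1 : R)) +i* (e * (p.2 : R)))%C.
  rewrite /T /c0 /chart0 /= [e * p.1 + a]addrC [e * p.2 + b]addrC; apply.
  rewrite !exprMn -mulrDr sqrtrM ?sqr_ge0// sqrtr_sqr gtr0_norm//; apply: lt_le_trans er.
  rewrite ltr_pM2l// ltr_pwDr// -(ger0_norm (ler0n R n)) -sqrtr_sqr ler_wsqrtr//.
rewrite RintegralD// RintegralZl//; last exact: fubini_study_integrable.
rewrite -/fs_mass RintegralZl//.
have h1 : d * fs_mass <= eta / 2.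
  by rewrite /d mulrAC ler_pdivrMr ?mulr_gt0//; [nra|lra].
have h2 : 2 * M * \int[leb2]_p tl p <= eta / 2.
  have : 2 * M * \int[leb2]_p tl p <= 2 * M * t by rewrite ler_wpM2l ?mulr_ge0// ltW.
  move/le_trans; apply; rewrite /t mulrA ler_pdivrMr ?mulr_gt0//; [nra|lra].
by rewrite [leRHS]splitr lerD.
Qed.

End PlaneIntegrals.

(** * Smooth test functions on the sphere *)

Section SmoothExpressions.
Variable R : realType.

(** A syntax closed under formal differentiation. Smoothness requires all iterated partial
    derivatives, which are obtained at once by interpreting derived expressions; the Laplacian
    becomes a rational identity. *)
Inductive rexpr :=
  | RC of R | RX of bool | RA of rexpr & rexpr | RM of rexpr & rexpr | RV of rexpr | RL of rexpr.

Fixpoint ev (e : rexpr) (p : R * R) : R :=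
  match e with
  | RC c => c
  | RX b => if b then p.1 else p.2
  | RA a b => ev a p + ev b p
  | RM a b => ev a p * ev b p
  | RV a => (ev a p)^-1
  | RL a => ln (ev a p)
  end.

Fixpoint well_defined (e : rexpr) : Prop :=
  match e with
  | RC _ | RX _ => True
  | RA a b | RM a b => well_defined a /\ well_defined b
  | RV a => well_defined a /\ forall p, ev a p != 0
  | RL a => well_defined a /\ forall p, 0 < ev a p
  end.

Fixpoint der (b : bool) (e : rexpr) : rexpr :=
  match e with
  | RC _ => RC 0
  | RX b' => RC (b == b')%:R
  | RA u v => RA (der b u) (der b v)
  | RM u v => RA (RM (der b u) v) (RM u (der b v))
  | RV u => RM (RM (RC (-1)) (RM (RV u) (RV u))) (der b u)
  | RL u => RM (RV u) (der b u)
  end.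

Lemma well_defined_der b e : well_defined e -> well_defined (der b e).
Proof.
elim: e => //= [u IHu v IHv|u IHu v IHv|u IHu|u IHu].
- by move=> [/IHu ? /IHv ?].
- by move=> [wu wv]; split; split => //; [exact: IHu|exact: IHv].
- by move=> [wu u0]; split; [|exact: IHu].
- by move=> [wu u0]; split; [split => // p; rewrite gt_eqF|exact: IHu].
Qed.

Lemma ev_continuous e : well_defined e -> continuous (ev e).
Proof.
elim: e => [c|b|u IHu v IHv|u IHu v IHv|u IHu|u IHu] /= h p.
- exact: cvg_cst.
- by case: b; [exact: cvg_fst|exact: cvg_snd].
- by case: h => hu hv; apply: cvgD; [exact: IHu|exact: IHv].
- by case: h => hu hv; apply: cvgM; [exact: IHu|exact: IHv].
- by case: h => hu hv; apply: cvgV; [exact: hv|exact: IHu].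
- case: h => hu hv; apply: (@continuous_comp _ R R (ev u) (@ln R)); first exact: IHu.
  exact: continuous_ln.
Qed.

Local Notation dir b := ((if b then (1, 0) else (0, 1)) : R * R).

Lemma is_derive_line (f : R * R -> R) (p v : R * R) (d : R) :
  is_derive (0 : R) (1 : R) (fun t : R => f (t *: v + p)) d -> is_derive p v f d.
Proof.
have e : (fun h : R => h^-1 *: (((fun t : R => f (t *: v + p)) \o shift 0) (h *: 1) - f (0 *: v + p))) =
    (fun h => h^-1 *: ((f \o shift p) (h *: v) - f p)).
  by apply/funext => h; rewrite /= addr0 scale0r add0r /GRing.scale /= mulr1.
by case; rewrite /derivable /derive e => h1 h2; constructor.
Qed.

Lemma ev_is_derive e b p : well_defined e -> is_derive p (dir b) (ev e) (ev (der b e) p).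
Proof.
move=> we; apply: is_derive_line.
have p0 : 0 *: dir b + p = p by rewrite scale0r add0r.
elim: e we => [c|b'|u IHu v IHv|u IHu v IHv|u IHu|u IHu] /= h.
- exact: is_derive_cst.
- have := is_deriveD (is_deriveZ ((b == b')%:R : R) (is_derive_id (0 : R) (1 : R)))
    (is_derive_cst (if b' then p.1 else p.2) (0 : R) (1 : R)).
  rewrite addr0 /GRing.scale /= mulr1; congr (is_derive _ _ _ _); apply/funext => t.
  transitivity ((b == b')%:R * t + (if b' then p.1 else p.2)) => //.
  by clear p0; case: b; case: b'; rewrite /= /GRing.scale /= ?mulr1 ?mul1r ?mulr0 ?mul0r.
- by case: h => hu hv; apply: is_deriveD; [exact: IHu|exact: IHv].
- case: h => hu hv; have := is_deriveM (IHu hu) (IHv hv).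
  by rewrite p0 /GRing.scale /= addrC [X in X + _]mulrC.
- case: h => hu hv; have := is_deriveV _ (IHu hu); rewrite p0 => /(_ (hv p)).
  by rewrite /GRing.scale /= mulN1r -expr2 exprVn.
- case: h => hu hv.
  have hl : is_derive ((fun t : R => ev u (t *: dir b + p)) 0) 1 (@ln R) (ev u p)^-1.
    by rewrite p0; exact: is_derive1_ln.
  exact: (is_derive1_comp hl (IHu hu)).
Qed.

Lemma partials_ev s e : well_defined e ->
  partials s (ev e) = ev (foldr der e s) /\ well_defined (foldr der e s).
Proof.
move=> we; elim: s => [|b s [IH1 IH2]] //=; split; last exact: well_defined_der.
rewrite IH1; apply/funext => p; rewrite /partial.
by have := ev_is_derive b p IH2 => h; exact: derive_val.
Qed.

Lemma smooth_ev e : well_defined e -> smooth (ev e).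
Proof.
move=> we s; have [-> ws] := partials_ev s we; split; first exact: ev_continuous.
by move=> b p; have := ev_is_derive b p ws => h; exact: ex_derive.
Qed.

End SmoothExpressions.

Section TestFunctions.
Variable R : realType.
Local Notation S := (riemann_sphere R).
Local Notation leb2 := (@lebesgue_measure R \x @lebesgue_measure R)%E.

(** The regularized logarithm has a pole at infinity; subtracting (1/2) log (|z|^2 + 1) removes it,
    and the difference extends smoothly by 0. *)
Definition test_function (a b e : R) (x : S) : R :=
  if x is Some z then 2^-1 * (ln ((complex.Re z - a) ^+ 2 + (complex.Im z - b) ^+ 2 + e ^+ 2) - ln (nsq z + 1)) else 0.

Let sq (u : rexpr R) := RM u u.
Let half_ln_ratio (u v : rexpr R) := RM (RC 2^-1) (RA (RL u) (RM (RC (-1)) (RL v))).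

Let num0 (a b e : R) := RA (RA (sq (RA (RX R true) (RC (- a)))) (sq (RA (RX R false) (RC (- b))))) (RC (e ^+ 2)).
Let den0 := RA (RA (sq (RX R true)) (sq (RX R false))) (RC 1).

(* in the coordinate zeta = 1/z, |z - w|^2 becomes |1 - w zeta|^2 / |zeta|^2 *)
Let numoo (a b e : R) := RA (RA (sq (RA (RC 1) (RA (RM (RC (- a)) (RX R true)) (RM (RC b) (RX R false)))))
  (sq (RA (RM (RC a) (RX R false)) (RM (RC b) (RX R true))))) (RM (RC (e ^+ 2)) (RA (sq (RX R true)) (sq (RX R false)))).

Let wd_half u v : well_defined u -> well_defined v -> (forall p, 0 < ev u p) -> (forall p, 0 < ev v p) ->
  well_defined (half_ln_ratio u v).
Proof. by move=> *; do !split. Qed.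

Let den0_gt0 p : 0 < ev den0 p.
Proof. by rewrite /= -!expr2 ltr_wpDl// addr_ge0// sqr_ge0. Qed.

Let num0_gt0 a b e p : 0 < e -> 0 < ev (num0 a b e) p.
Proof. by move=> e0; rewrite /= -!expr2 ltr_wpDl ?exprn_gt0// addr_ge0// sqr_ge0. Qed.

Let numoo_gt0 a b e p : 0 < e -> 0 < ev (numoo a b e) p.
Proof.
move=> e0; rewrite /= -!expr2.
have [N0|N0] := eqVneq (p.1 ^+ 2 + p.2 ^+ 2) 0.
  have s1 := sqr_ge0 p.1; have s2 := sqr_ge0 p.2.
  have x0 : p.1 = 0 by apply/eqP; rewrite -sqrf_eq0 eq_le s1 andbT; move: N0 s1 s2; lra.
  have y0 : p.2 = 0 by apply/eqP; rewrite -sqrf_eq0 eq_le s2 andbT; move: N0 s1 s2; lra.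
  by rewrite x0 y0 !mulr0 !addr0 expr1n expr0n /= !addr0 mulr0 addr0.
have N1 : 0 < p.1 ^+ 2 + p.2 ^+ 2 by rewrite lt_neqAle eq_sym N0 addr_ge0 ?sqr_ge0.
by rewrite ltr_wpDl ?addr_ge0 ?sqr_ge0// mulr_gt0// exprn_gt0.
Qed.

Let test_chart0 a b e : test_function a b e \o @chart0 R = ev (half_ln_ratio (num0 a b e) den0).
Proof. by apply/funext => -[x y]; rewrite /= /nsq /= -!expr2 mulN1r. Qed.

Let test_chartoo a b e : 0 < e -> test_function a b e \o @chartoo R = ev (half_ln_ratio (numoo a b e) den0).
Proof.
move=> e0; apply/funext => -[x y] /=; rewrite /chartoo -!expr2.
case: eqP => [[-> ->]|xy0] /=.
  by rewrite !mulr0 !addr0 expr1n expr0n /= !addr0 mulr0 addr0 add0r ln1 mulr0 addr0 mulr0.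
have N0 : 0 < x ^+ 2 + y ^+ 2.
  rewrite lt_neqAle addr_ge0 ?sqr_ge0// andbT eq_sym paddr_eq0 ?sqr_ge0// !sqrf_eq0.
  by apply/negP => /andP[/eqP x0 /eqP y0]; apply: xy0; rewrite x0 y0.
set N := x ^+ 2 + y ^+ 2 in N0 *.
have A0 := numoo_gt0 a b (x, y) e0; rewrite /= -!expr2 -/N in A0.
have NN : N != 0 by rewrite gt_eqF.
congr (_ * _); rewrite mulN1r /nsq /=.
have -> : (x / N - a) ^+ 2 + (- (y / N) - b) ^+ 2 + e ^+ 2 =
    ((1 + (- a * x + b * y)) ^+ 2 + (a * y + b * x) ^+ 2 + e ^+ 2 * N) / N by rewrite /N; field.
have -> : (x / N) ^+ 2 + (- (y / N)) ^+ 2 + 1 = (N + 1) / N by rewrite /N; field.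
have N1 : 0 < N + 1 by rewrite addr_gt0.
by rewrite !ln_div ?posrE// opprB addrA subrK.
Qed.

Lemma test_function_smooth a b e : 0 < e -> smooth_sphere (test_function a b e).
Proof.
move=> e0; split.
  by rewrite test_chart0; apply: smooth_ev; apply: wd_half => // q; exact: num0_gt0.
by rewrite test_chartoo//; apply: smooth_ev; apply: wd_half => // q; exact: numoo_gt0.
Qed.

Lemma test_function_laplace a b e p : 0 < e ->
  (2 * pi)^-1 * laplace (test_function a b e \o @chart0 R) p = fubini_study a b e p - fubini_study 0 0 1 p.
Proof.
move=> e0; rewrite test_chart0 /laplace.
have we : well_defined (half_ln_ratio (num0 a b e) den0).
  by apply: wd_half => // q; exact: num0_gt0.
have [-> _] := partials_ev [:: true; true] we; have [-> _] := partials_ev [:: false; false] we.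
have h1 := num0_gt0 a b p e0; have h2 := den0_gt0 p.
rewrite /fubini_study; move: h1 h2; case: p => x y /=.
have pp : (pi : R) != 0 by rewrite gt_eqF// pi_gt0.
move: (pi : R) pp => c pp h1 h2; field.
by apply/and3P; split => //; rewrite !expr2 gt_eqF.
Qed.

End TestFunctions.

(** * Positive kernels and the logarithm *)

Section PositiveKernels.
Context d (X : measurableType d) (R : realType).
Implicit Types (nu : seq (R * X)) (K b : X -> X -> R).

Definition psd K := forall nu, 0 <= quad K nu.

Lemma psd_const1 : psd (fun _ _ => 1).
Proof.
move=> nu; rewrite (_ : quad _ nu = (\sum_(a <- nu) a.1) ^+ 2) ?sqr_ge0//.
rewrite /quad expr2 mulr_suml; apply: eq_bigr => a _; rewrite mulr_sumr; apply: eq_bigr => b _.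
by rewrite mulr1.
Qed.

Lemma psd_rank1M (f : X -> R) K : psd K -> psd (fun x y => f x * f y * K x y).
Proof.
move=> pK nu; rewrite (_ : quad _ nu = quad K [seq (a.1 * f a.2, a.2) | a <- nu])//.
rewrite /quad big_map; apply: eq_bigr => a _; rewrite big_map; apply: eq_bigr => b _ /=; ring.
Qed.

Lemma quadD K K' nu : quad (fun x y => K x y + K' x y) nu = quad K nu + quad K' nu.
Proof.
rewrite /quad -big_split; apply: eq_bigr => a _; rewrite -big_split; apply: eq_bigr => b _.
by rewrite mulrDr.
Qed.

Lemma quadZ (c : R) K nu : quad (fun x y => c * K x y) nu = c * quad K nu.
Proof.
rewrite /quad mulr_sumr; apply: eq_bigr => a _; rewrite mulr_sumr; apply: eq_bigr => b _.
by rewrite mulrCA.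
Qed.

Lemma cvg_bigsum (I : Type) (s : seq I) (f : nat -> I -> R) (l : I -> R) :
  (forall i, f n i @[n --> \oo] --> l i) -> \sum_(i <- s) f n i @[n --> \oo] --> \sum_(i <- s) l i.
Proof.
move=> fl; elim: s => [|i s IH]; first by rewrite big_nil; under eq_fun do rewrite big_nil; exact: cvg_cst.
by rewrite big_cons; under eq_fun do rewrite big_cons; apply: cvgD.
Qed.

Lemma quad_cvg (u : nat -> X -> X -> R) K nu : (forall x y, u n x y @[n --> \oo] --> K x y) ->
  quad (u n) nu @[n --> \oo] --> quad K nu.
Proof.
move=> h; rewrite /quad; apply: cvg_bigsum => a; apply: cvg_bigsum => b.
by apply: cvgM; [exact: cvg_cst|exact: h].
Qed.

Lemma quad_sum_zero (f : X -> R) nu : \sum_(a <- nu) a.1 = 0 -> quad (fun x y => f x + f y) nu = 0.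
Proof.
move=> s0; rewrite quadD /quad [X in _ + X]exchange_big /= -[RHS]addr0.
congr (_ + _); apply: big1_seq => a _.
  rewrite (eq_bigr (fun c => a.1 * f a.2 * c.1)); first by rewrite -mulr_sumr s0 mulr0.
  by move=> b _; rewrite mulrAC.
rewrite (eq_bigr (fun c => a.1 * f a.2 * c.1)); first by rewrite -mulr_sumr s0 mulr0.
by move=> c _; ring.
Qed.

Definition log_series (M : nat) (x : R) : R := \sum_(m < M) (m.+1)%:R^-1 * x ^+ m.+1.

(** The difference vanishes at 0 and has derivative x^M / (1 - x); the mean value theorem concludes
    on either side of 0. *)
Lemma log_series_bound (M : nat) (b : R) : `|b| < 1 ->
  `|- ln (1 - b) - log_series M b| <= (1 - `|b|)^-1 * `|b| ^+ M.
Proof.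
move=> b1; pose F (x : R) : R := - ln (1 - x) - log_series M x.
have dS (x : R) : is_derive x (1 : R) (log_series M) (\sum_(m < M) x ^+ m).
  elim: M @F => [|m IH].
    rewrite big_ord0 (_ : log_series 0 = cst 0); first exact: is_derive_cst.
    by apply/funext => y; rewrite /log_series big_ord0.
  have h := is_deriveD IH (is_deriveZ (m.+1%:R^-1 : R) (is_deriveX m.+1 (is_derive_id x (1 : R)))).
  rewrite big_ord_recr /=; move: h; rewrite /GRing.scale /= mulr1 mulrA mulVf ?pnatr_eq0// mul1r.
  congr (is_derive _ _ _ _); apply/funext => y.
  by rewrite /log_series big_ord_recr /= -[RHS]/(_ + _ * _); congr (_ + _ * _); rewrite exprfctE.
have dF (x : R) : x < 1 -> is_derive x (1 : R) F (x ^+ M / (1 - x)).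
  move=> x1; have x10 : 0 < 1 - x by rewrite subr_gt0.
  have hl : is_derive (((cst 1 : R -> R) - id) x) (1 : R) (@ln R) (1 - x)^-1 by exact: is_derive1_ln.
  have := is_deriveB (is_deriveN (is_derive1_comp hl
    (is_deriveB (is_derive_cst (1 : R) x (1 : R)) (is_derive_id x (1 : R))))) (dS x).
  have -> : - ((1 - x)^-1 * (0 - 1)) - \sum_(m < M) x ^+ m = x ^+ M / (1 - x).
    apply: (mulIf (lt0r_neq0 x10)); rewrite divfK ?gt_eqF// mulrBl sub0r mulrN1 opprK mulVf ?gt_eqF//.
    by have := subrX1 x M => h; rewrite mulrC -[1 - x]opprB mulNr -h opprK addrC subrK.
  by [].
have F0 : F 0 = 0.
  rewrite /F subr0 ln1 oppr0 sub0r /log_series big1 ?oppr0// => m _.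
  by rewrite expr0n /= mulr0.
have r1 : 0 < 1 - `|b| by rewrite subr_gt0.
have bd (c : R) : `|c| <= `|b| -> `|c ^+ M / (1 - c) * b| <= (1 - `|b|)^-1 * `|b| ^+ M.
  move=> cb; have c1 : c <= `|b| by apply: le_trans (ler_norm _) cb.
  have c10 : 0 < 1 - c by rewrite subr_gt0 (le_lt_trans c1).
  rewrite !normrM normrX normfV (gtr0_norm c10) -[leRHS]mulr1 ler_pM ?mulr_ge0 ?invr_ge0 ?exprn_ge0//; first exact: ltW.
    rewrite [leRHS]mulrC ler_pM ?invr_ge0 ?exprn_ge0//; first exact: ltW.
      by rewrite lerXn2r ?nnegrE.
    by rewrite lef_pV2 ?posrE// lerB.
  exact: ltW.
have Fc (u v : R) : v < 1 -> {within `[u, v], continuous F}.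
  move=> v1; apply: derivable_within_continuous => x; rewrite in_itv /= => /andP[_ xv].
  by have := dF x (le_lt_trans xv v1) => h; exact: ex_derive.
rewrite -/(F b); move: (b1); rewrite ltr_norml => /andP[b1' b1''].
have [->|b0] := eqVneq b 0.
  by rewrite F0 normr0 subr0 invr1 mul1r exprn_ge0.
have [bp|bn] := ltP 0 b.
  have [|c] := @MVT R F (fun x => x ^+ M / (1 - x)) 0 b bp _ (Fc 0 b b1'').
    by move=> c; rewrite in_itv /= => /andP[_ cb]; apply: dF; exact: lt_trans cb b1''.
  rewrite in_itv /= => /andP[c0 cb]; rewrite F0 !subr0 => ->; apply: bd.
  by rewrite !ger0_norm ltW.
have bn' : b < 0 by rewrite lt_neqAle b0.
have [|c] := @MVT R F (fun x => x ^+ M / (1 - x)) b 0 bn' _ (Fc b 0 ltr01).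
  by move=> c; rewrite in_itv /= => /andP[_ cb]; apply: dF; exact: lt_trans cb ltr01.
rewrite in_itv /= => /andP[c0 cb]; rewrite F0 !sub0r => h.
rewrite -normrN h mulrN normrN; apply: bd.
by rewrite !ltr0_norm// lerN2 ltW.
Qed.

(** The series of -log (1 - b) has nonnegative coefficients, and powers of b are positive because
    multiplication by b preserves positivity; this hypothesis, clear for finite sums of rank one
    kernels, stands in for the Schur product theorem. *)
Lemma psd_log b : (forall x y, `|b x y| < 1) -> (forall K, psd K -> psd (fun x y => b x y * K x y)) ->
  psd (fun x y => - ln (1 - b x y)).
Proof.
move=> b1 pb nu.
have pX m : psd (fun x y => b x y ^+ m).
  elim: m => [|m IH]; first by move=> nu'; exact: psd_const1.
  rewrite (_ : (fun x y => b x y ^+ m.+1) = fun x y => b x y * b x y ^+ m); first exact: pb.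
  by apply/funext => x; apply/funext => y; rewrite exprS.
have pS M : 0 <= quad (fun x y => log_series M (b x y)) nu.
  elim: M => [|M IH].
    by rewrite /quad big1// => a _; rewrite big1// => a' _; rewrite /log_series big_ord0 mulr0.
  rewrite (_ : quad _ nu = quad (fun x y => log_series M (b x y) + (M.+1)%:R^-1 * b x y ^+ M.+1) nu); last first.
    by congr quad; apply/funext => x; apply/funext => y; rewrite /log_series big_ord_recr.
  by rewrite quadD quadZ addr_ge0// mulr_ge0 ?invr_ge0// pX.
have cv : quad (fun x y => log_series M (b x y)) nu @[M --> \oo] --> quad (fun x y => - ln (1 - b x y)) nu.
  apply: quad_cvg => x y; set t := b x y.
  apply/cvgrPdist_lt => e e0.
  have := @cvg_geometric R (1 - `|t|)^-1 `|t|; rewrite normr_id => /(_ (b1 x y)) /cvgrPdist_lt/(_ _ e0).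
  apply: filterS => M; rewrite sub0r normrN; apply: le_lt_trans.
  apply: le_trans (log_series_bound M (b1 x y)) _; exact: ler_norm.
by apply: ler_cvg_to (cvg_cst 0) cv _; exact: nearW.
Qed.

End PositiveKernels.

Section SmoothKernelNegative.
Variable R : realType.
Local Notation bS := (borel (riemann_sphere R)).

(* |z - w|^2 + e^2 = u_z u_w (1 - b) where b is the Gram kernel of the stereographic lift *)
Lemma smooth_kernel_cnd e (nu : seq (R * bS)) : 0 < e -> \sum_(a <- nu) a.1 = 0 -> quad (smooth_kernel e) nu <= 0.
Proof.
move=> e0 s0.
pose s (x : bS) := nsq (pi0 x).
have s_ge0 x : 0 <= s x by exact: nsq_ge0.
pose u (x : bS) := e ^+ 2 + s x.
have e20 : 0 < e ^+ 2 by rewrite exprn_gt0.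
have u0 x : 0 < u x by rewrite ltr_wpDr.
pose X1 (x : bS) := complex.Re (pi0 x); pose X2 (x : bS) := complex.Im (pi0 x).
pose b (x y : bS) := (s x * s y + 2 * e ^+ 2 * (X1 x * X1 y + X2 x * X2 y)) / (u x * u y).
have sE x : s x = X1 x ^+ 2 + X2 x ^+ 2 by [].
have dE x y : nsq (pi0 x - pi0 y) = s x + s y - 2 * (X1 x * X1 y + X2 x * X2 y).
  by rewrite /nsq Re_B Im_B -/(X1 _) -/(X1 _) -/(X2 _) -/(X2 _) !sE; ring.
have bE x y : nsq (pi0 x - pi0 y) + e ^+ 2 = u x * u y / e ^+ 2 * (1 - b x y).
  have ux := u0 x; have uy := u0 y.
  have e_neq0 : e != 0 by rewrite gt_eqF.
  rewrite dE /b; move: ux uy; rewrite /u; move: (s x) (s y) => v w ux uy.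
  by field; rewrite e_neq0 !gt_eqF.
have b_lt1 x y : `|b x y| < 1.
  have ux := u0 x; have uy := u0 y.
  rewrite ltr_norml /b ltr_pdivrMr ?mulr_gt0// mul1r ltr_pdivlMr ?mulr_gt0// mulN1r.
  have h1 : 0 <= nsq (pi0 x - pi0 y) by exact: nsq_ge0.
  have h2 : 0 <= (X1 x + X1 y) ^+ 2 + (X2 x + X2 y) ^+ 2 by rewrite addr_ge0 ?sqr_ge0.
  have h3 : 0 <= e ^+ 2 * (s x + s y + 2 * (X1 x * X1 y + X2 x * X2 y)).
    rewrite (_ : s x + s y + _ = (X1 x + X1 y) ^+ 2 + (X2 x + X2 y) ^+ 2); first exact: mulr_ge0 (ltW e20) h2.
    by rewrite (sE x) (sE y); ring.
  have h4 : 0 <= e ^+ 2 * (s x + s y - 2 * (X1 x * X1 y + X2 x * X2 y)).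
    by have := mulr_ge0 (ltW e20) h1; rewrite dE.
  have h5 := mulr_gt0 e20 e20; have h6 := mulr_ge0 (s_ge0 x) (s_ge0 y).
  by rewrite /u; apply/andP; split; move: h3 h4 h5 h6; lra.
have pb K : psd K -> psd (fun x y => b x y * K x y).
  move=> pK nu'.
  have [q q2] : exists q : R, q ^+ 2 = 2 * e ^+ 2.
    by exists (Num.sqrt (2 * e ^+ 2)); rewrite sqr_sqrtr// mulr_ge0// ltW.
  pose w1 x := s x / u x; pose w2 x := q * X1 x / u x; pose w3 x := q * X2 x / u x.
  rewrite (_ : quad _ nu' = quad (fun x y => w1 x * w1 y * K x y + (w2 x * w2 y * K x y + w3 x * w3 y * K x y)) nu').
    by rewrite !quadD !addr_ge0//; exact: psd_rank1M.
  congr quad; apply/funext => x; apply/funext => y.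
  rewrite -!mulrDl; congr (_ * _); rewrite /b /w1 /w2 /w3 -q2.
  move: (u x) (u y) (u0 x) (u0 y) => v w v0 w0.
  by field; rewrite !gt_eqF.
have pl := psd_log b_lt1 pb nu.
(* The kernel is split into f(x) + f(y), which disappears on families of total mass 0, and minus one
   half of the positive kernel -log (1 - b). *)
rewrite (_ : quad _ nu = quad (fun x y => (2^-1 * (ln (u x) - ln e) + 2^-1 * (ln (u y) - ln e)) + (- 2^-1) * (- ln (1 - b x y))) nu).
  rewrite quadD quad_sum_zero// add0r quadZ mulNr oppr_le0 mulr_ge0 ?invr_ge0//.
congr quad; apply/funext => x; apply/funext => y.
rewrite /smooth_kernel bE mulrNN -mulrDr -mulrDr; congr (_ * _).
have b1 : 0 < 1 - b x y by have := b_lt1 x y; rewrite ltr_norml => /andP[_]; lra.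
rewrite lnM ?posrE ?divr_gt0 ?mulr_gt0// ln_div ?posrE ?mulr_gt0// lnM ?posrE// lnXn// mulr2n; ring.
Qed.

End SmoothKernelNegative.

(** * Potential and energy on the Riemann sphere *)

Section SpherePotential.
Variable R : realType.
Local Notation S := (riemann_sphere R).
Local Notation bS := (borel S).
Local Notation leb2 := (@lebesgue_measure R \x @lebesgue_measure R)%E.
Local Notation FS := (fubini_study 0 0 1).
Local Notation lambda := (circle_measure R).
Local Notation sk := (@smooth_kernel R).
Local Notation ld := (@sphere_ln_dist R).

Let q : bS -> R := sk 1 (Some 0).

Let qE w : q w = 2^-1 * ln (nsq (pi0 w) + 1).
Proof. by rewrite /q /smooth_kernel sub0r /nsq expr1n; case: (pi0 w) => a b /=; rewrite !sqrrN. Qed.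

Let q_ge0 w : 0 <= q w.
Proof. by rewrite qE mulr_ge0 ?invr_ge0// ln_ge0// lerDr nsq_ge0. Qed.

Let mq : measurable_fun setT q. Proof. exact: measurable_smooth_kernel1. Qed.

Let nsqB (z w : R[i]) : nsq (z - w) <= 2 * nsq z + 2 * nsq w.
Proof.
rewrite -subr_ge0 (_ : _ - _ = nsq (z + w)) ?nsq_ge0//.
by rewrite /nsq !(Re_B, Im_B, Re_D, Im_D); ring.
Qed.

Let sk_bound e (x w : bS) : 0 < e <= 1 -> `|sk e x w| <= q w + (`|ln e| + 2^-1 * ln (2 * nsq (pi0 x) + 3)).
Proof.
move=> /andP[e0 e1]; set s := nsq (pi0 x); set t := nsq (pi0 w).
have s0 : 0 <= s by exact: nsq_ge0.
have t0 : 0 <= t by exact: nsq_ge0.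
have d0 := nsq_ge0 (pi0 x - pi0 w); have d1 := nsqB (pi0 x) (pi0 w).
have e2 : 0 < e ^+ 2 by rewrite exprn_gt0.
have e21 : e ^+ 2 <= 1 by rewrite expr_le1// ltW.
have D0 : 0 < nsq (pi0 x - pi0 w) + e ^+ 2 by rewrite ltr_wpDl.
have l3 : 0 <= ln (2 * s + 3) by rewrite ln_ge0//; lra.
have up : sk e x w <= q w + 2^-1 * ln (2 * s + 3).
  rewrite qE -/t -mulrDr ler_pM2l ?invr_gt0// -lnM ?posrE; [|lra|lra].
  rewrite ler_ln ?posrE//; last by rewrite mulr_gt0//; lra.
  by rewrite -/s -/t in d1; have := mulr_ge0 s0 t0; lra.
have lo : ln e <= sk e x w.
  have -> : ln e = 2^-1 * ln (e ^+ 2) by rewrite lnXn// mulr2n; field.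
  by rewrite ler_pM2l ?invr_gt0// ler_ln ?posrE// lerDr.
have := q_ge0 w; have := ler_norm (ln e); have := ler_norm (- ln e); rewrite normrN.
have := normr_ge0 (ln e).
by rewrite ler_norml; move: up lo l3 => ? ? ? ? ? ? ?; apply/andP; split; lra.
Qed.

Let mtest a b e : measurable_fun setT (test_function a b e : bS -> R).
Proof.
pose z : bS := Some (a +i* b)%C.
have mf : measurable_fun setT (fun x : bS => if x is Some _ then (1 : R) else 0).
  by apply: (@measurable_lift2 R (fun=> 1) 0); exact: cst_continuous.
rewrite (_ : test_function a b e = fun x : bS => (sk e z x - q x) * (if x is Some _ then 1 else 0)).
  by apply: measurable_funM => //; apply: measurable_funB => //; exact: measurable_smooth_kernel1.
apply/funext => -[w|] /=; rewrite ?mulr0// mulr1 qE /smooth_kernel /= -mulrBr; congr (_ * (ln _ - _)).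
by rewrite /nsq Re_B Im_B /= -[X in X + _ + _]sqrrN opprB -[X in _ + X + _]sqrrN opprB.
Qed.

Let test_sk z e w : test_function (complex.Re z) (complex.Im z) e (Some w) = sk e (Some z) (Some w) - q (Some w).
Proof.
rewrite qE /smooth_kernel /= -mulrBr; congr (_ * (ln _ - _)).
by rewrite /nsq Re_B Im_B /= -[X in X + _ + _]sqrrN opprB -[X in _ + X + _]sqrrN opprB.
Qed.

Section Finite.
Variable mu : probability bS R.
Hypothesis mu_infty : mu [set None] = 0%E.
Hypothesis qi : mu.-integrable setT (EFin \o q).

Lemma ae_finite : {ae mu, forall y : bS, y <> None}.
Proof.
exists [set None]; split => //; first exact: measurable_infty.
by move=> y /= /contrapT ->.
Qed.

Lemma smooth_kernel_integrable e x : 0 < e <= 1 -> mu.-integrable setT (EFin \o sk e x).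
Proof.
move=> e01; apply: (@integrableR_le _ _ R mu _ _ (measurable_smooth_kernel1 e x) (fun w => @sk_bound e x w e01)).
by apply: integrableRD => //; exact: integrableR_cst.
Qed.

Lemma Rintegral_ae (f h : bS -> R) : measurable_fun setT f -> measurable_fun setT h ->
  (forall w, f (Some w) = h (Some w)) -> \int[mu]_w f w = \int[mu]_w h w.
Proof.
move=> mf mh fh; rewrite /Rintegral; congr fine; apply: ae_eq_integral => //; try exact/measurable_EFinP.
have [N [mN N0 NP]] := ae_finite; exists N; split => // y /= h'; apply: NP => /= y1; apply: h' => _.
by case: y y1 => [w|]// _; rewrite fh.
Qed.

Lemma Rintegral_test z e : 0 < e <= 1 ->
  \int[mu]_w test_function (complex.Re z) (complex.Im z) e w = \int[mu]_w sk e (Some z) w - \int[mu]_w q w.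
Proof.
move=> e01; rewrite -RintegralB//; last exact: smooth_kernel_integrable.
apply: Rintegral_ae; [exact: mtest| |by move=> w; exact: test_sk].
by apply: measurable_funB => //; exact: measurable_smooth_kernel1.
Qed.

End Finite.

Let lambda_infty : lambda [set None] = 0%E.
Proof.
rewrite /circle_measure /distribution /pushforward (_ : _ @^-1` _ = set0) ?measure0//.
by apply/seteqP; split.
Qed.

Let lambda_integrable (f : bS -> R) M : measurable_fun setT f -> (forall t, `|f (circle_map t)| <= M) ->
  lambda.-integrable setT (EFin \o f).
Proof.
move=> mf fM; have pi2 : 0 < 2 * pi :> R by rewrite mulr_gt0// pi_gt0.
apply/integrableP; split; first exact/measurable_EFinP.
rewrite ge0_integral_distribution//; last by do 2 apply: measurableT_comp => //.
apply: (@le_lt_trans _ _ (\int[uniform_prob pi2]_x M%:E)%E).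
  apply: ge0_le_integral => //.
  - by move=> t _ /=; rewrite lee_fin.
  - by apply: measurableT_comp; [do 2 apply: measurableT_comp => //|exact: measurable_funP].
  - by move=> t _; rewrite /= lee_fin.
have M0 : 0 <= M by exact: le_trans (fM 0).
rewrite integral_cst// -ge0_fin_numE ?mule_ge0 ?lee_fin// fin_numM//; exact: fin_num_measure.
Qed.

Let q_circle t : q (circle_map t) = 2^-1 * ln 2.
Proof. by rewrite qE /nsq /= cos2Dsin2. Qed.

Let lambda_q : lambda.-integrable setT (EFin \o q).
Proof. by apply: (@lambda_integrable _ (`|2^-1 * ln 2|)) => // t; rewrite q_circle. Qed.

Variable rho : probability bS R.
Variable g : S -> R.
Hypothesis gc : continuous g.
Hypothesis glap : sphere_laplacian g (SignedMeasure rho lambda).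

Let A e (z : R[i]) : R := \int[leb2]_p (g (chart0 (e * p.1 + complex.Re z, e * p.2 + complex.Im z)) * FS p).

Let gcc : continuous (fun p : R * R => g (chart0 p)).
Proof. by move=> p; apply: continuous_comp; [exact: continuous_chart0|exact: gc]. Qed.

Let GM : exists2 M, 0 <= M & forall x, `|g x| <= M.
Proof.
have [M MP] := sphere_bounded gc; exists M => //.
exact: le_trans (normr_ge0 (g None)) (MP None).
Qed.

Let A_bound : exists B, forall e z, 0 < e -> `|A e z| <= B.
Proof.
have [M M0 MP] := GM; exists (M * fs_mass R) => e z e0.
have iA := (@bounded_fs_integrable R (fun p => g (chart0 (e * p.1 + complex.Re z, e * p.2 + complex.Im z))) M).
have iA' : leb2.-integrable setT (EFin \o (fun p => g (chart0 (e * p.1 + complex.Re z, e * p.2 + complex.Im z)) * FS p)).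
  apply: iA => [p|p]; last exact: MP.
  exact: (@continuous_plane_affine R (fun p => g (chart0 p)) e _ e _ gcc p).
apply: le_trans (le_normr_Rintegral measurableT iA') _.
rewrite /fs_mass -RintegralZl//; last exact: fubini_study_integrable.
apply: le_Rintegral => //; first by have := integrable_norm iA'.
  by have := integrableZl measurableT M (fubini_study_integrable R).
by move=> p _; rewrite normrM (ger0_norm (fubini_study_ge0 _ _ _ _)) ler_wpM2r// fubini_study_ge0.
Qed.

(** The equation for g tested on [test_function]: its Laplacian is a difference of two Fubini-Study
    forms, so the left side becomes a difference of averages of g, bounded independently of e and
    z. *)
Let test_identity e z : 0 < e ->
  A e z - A 1 0 = \int[rho]_w test_function (complex.Re z) (complex.Im z) e w
    - \int[lambda]_w test_function (complex.Re z) (complex.Im z) e w.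
Proof.
move=> e0; have := glap (test_function_smooth (complex.Re z) (complex.Im z) e0).
rewrite /signed_integral /= => <-; have [M _ MP] := GM.
have [i1 h1] := fs_change_of_variables (complex.Re z) (complex.Im z) gcc (fun p => MP (chart0 p)) e0.
have [i2 h2] := fs_change_of_variables 0 0 gcc (fun p => MP (chart0 p)) ltr01.
rewrite /A -h1 -h2 -RintegralB//; apply: eq_Rintegral => p _.
by rewrite (test_function_laplace _ _ p e0) -mulrBr.
Qed.

(** Test functions at scale n + 1, lowered by log (n + 1), decrease to -(1/2) log (|z|^2 + 1) at
    finite points and to minus infinity at infinity. Their integrals are bounded below by
    [test_identity], which forces infinity to be null and the limit to be integrable. *)
Lemma sphere_infty_null : rho [set None] = 0%E /\ rho.-integrable setT (EFin \o q).
Proof.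
have [B BP] := A_bound.
have n0 (n : nat) : 0 < n.+1%:R :> R by [].
pose t n : bS -> R := test_function 0 0 n.+1%:R.
pose u (n : nat) (w : bS) : R := t n w - ln n.+1%:R.
have sE (w : R[i]) : (complex.Re w - 0) ^+ 2 + (complex.Im w - 0) ^+ 2 = nsq w by rewrite !subr0.
have uE n w : u n (Some w) = 2^-1 * (ln (nsq w / n.+1%:R ^+ 2 + 1) - ln (nsq w + 1)).
  have w0 := nsq_ge0 w; have N2 : 0 < n.+1%:R ^+ 2 :> R by rewrite exprn_gt0.
  rewrite /u /t /= sE (_ : nsq w + n.+1%:R ^+ 2 = (nsq w / n.+1%:R ^+ 2 + 1) * n.+1%:R ^+ 2).
    rewrite lnM ?posrE//; last by rewrite ltr_wpDl// divr_ge0// ltW.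
    by rewrite lnXn// mulr2n; field.
  by rewrite mulrDl mul1r divfK// gt_eqF.
have mu n : measurable_fun setT (u n).
  by apply: measurable_funB; [exact: mtest|exact: measurable_cst].
have tb n w : 0 <= t n w <= ln n.+1%:R.
  have N2 : 1 <= n.+1%:R ^+ 2 :> R by rewrite exprn_ege1// ler1n.
  have lN : 0 <= ln n.+1%:R :> R by rewrite ln_ge0// ler1n.
  case: w => [w|] /=; last by rewrite lexx.
  rewrite sE; have w0 := nsq_ge0 w.
  have h1 : ln (nsq w + 1) <= ln (nsq w + n.+1%:R ^+ 2) by rewrite ler_ln ?posrE; lra.
  have h2 : ln (nsq w + n.+1%:R ^+ 2) <= ln (nsq w + 1) + ln n.+1%:R + ln n.+1%:R.
    have lN2 : ln n.+1%:R + ln n.+1%:R = ln (n.+1%:R ^+ 2) :> R by rewrite lnXn// mulr2n.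
    rewrite -[leRHS]addrA lN2 -lnM ?posrE; [|lra|lra].
    rewrite ler_ln ?posrE; [|lra|by rewrite mulr_gt0//; lra].
    by rewrite mulrDl mul1r lerD2r ler_peMr.
  by apply/andP; split; lra.
have ui n : rho.-integrable setT (EFin \o u n).
  apply: (@integrableR_le _ _ R rho (u n) (fun=> ln n.+1%:R)) => //; last exact: integrableR_cst.
  by move=> w; have /andP[? ?] := tb n w; rewrite ler_norml /u; apply/andP; split; lra.
have ti n : rho.-integrable setT (EFin \o t n).
  apply: (@integrableR_le _ _ R rho (t n) (fun=> ln n.+1%:R)) => //; [exact: mtest| |exact: integrableR_cst].
  by move=> w; have /andP[? ?] := tb n w; rewrite ger0_norm.
have [||||h1 h2 _] := @decreasing_integral_limit _ _ R rho u (fun w => - q w) (- (2^-1 * ln 2) - B - B) ui.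
- by under eq_fun do rewrite -mulN1r; apply: measurable_funM.
- move=> [w|] n m nm; last first.
    by rewrite /u /t /= !sub0r lerN2 ler_ln ?posrE// ler_nat.
  rewrite !uE ler_pM2l ?invr_gt0// lerD2r ler_ln ?posrE ?ltr_wpDl ?divr_ge0 ?nsq_ge0 ?exprn_ge0//.
  rewrite lerD2r ler_wpM2l ?nsq_ge0// lef_pV2 ?posrE ?exprn_gt0// lerXn2r ?nnegrE// ler_nat ltnS.
  exact: nm.
- move=> n; have := @test_identity n.+1%:R 0 (n0 n); rewrite /= => h.
  rewrite /u RintegralB//; last exact: integrableR_cst.
  rewrite Rintegral_cst// [X in fine X]probability_setT mulr1.
  have hl : \int[lambda]_w t n w = 2^-1 * (ln (1 + n.+1%:R ^+ 2) - ln 2).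
    set c := 2^-1 * _; rewrite (@circle_average R (t n) (fun=> c) `|c|) => //.
    - rewrite Rintegral_cst//= lebesgue_measure_itv /= lte_fin mulr_gt0 ?pi_gt0//= subr0.
      by rewrite mulrCA mulVf ?mulr1// gt_eqF// mulr_gt0 ?pi_gt0.
    - exact: mtest.
    - by move=> s; rewrite /t /= !subr0 /nsq /= cos2Dsin2.
    - by move=> s; exact: cst_continuous.
  have b1 := BP n.+1%:R 0 (n0 n); have b2 := BP 1 0 ltr01.
  have l1 : 2 * ln n.+1%:R <= ln (1 + n.+1%:R ^+ 2) :> R.
    by rewrite mulr_natl -lnXn// ler_ln ?posrE ?ltr_wpDl ?exprn_gt0// lerDr.
  rewrite -/(t n) hl in h; move: b1 b2 h l1; rewrite !ler_norml.
  by move=> /andP[? ?] /andP[? ?]; lra.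
- move=> [w|] [M MP].
    rewrite (_ : - q (Some w) = 2^-1 * (ln (nsq w * 0 + 1) - ln (nsq w + 1))); last first.
      by rewrite mulr0 add0r ln1 qE /= sub0r mulrN.
    under eq_fun do rewrite uE; apply: cvgM; first exact: cvg_cst.
    apply: cvgB; last exact: cvg_cst.
    have c1 : nsq w / n.+1%:R ^+ 2 + 1 @[n --> \oo] --> nsq w * 0 + 1.
      apply: cvgD; last exact: cvg_cst.
      apply: cvgM; first exact: cvg_cst.
      rewrite -[0](expr0n R 2); under eq_fun do rewrite -exprVn.
      by apply: cvg_exprR; exact: cvg_harmonic.
    by apply: (cvg_comp _ _ c1); apply: continuous_ln; rewrite mulr0 add0r.
  exfalso; pose n := Num.trunc (expR (- M + 1)).
  have := MP n; rewrite /u /t /= sub0r => h.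
  have h' : expR (- M + 1) < n.+1%:R by exact: truncnS_gt.
  have : - M + 1 < ln n.+1%:R by rewrite -[ltLHS]expRK ltr_ln ?posrE ?expR_gt0.
  by move: h; lra.
split; last by have := integrableRZ (-1) h2; apply: eq_integrable => // w _ /=; rewrite mulN1r opprK.
have [N [mN N0 NP]] := h1.
apply/eqP; rewrite -measure_le0 -N0 le_measure ?inE//; first exact: measurable_infty.
move=> _ ->; apply: NP => /= -[M MP].
pose n := Num.trunc (expR (- M + 1)).
have := MP n; rewrite /u /t /= sub0r => h.
have h' : expR (- M + 1) < n.+1%:R by exact: truncnS_gt.
have : - M + 1 < ln n.+1%:R by rewrite -[ltLHS]expRK ltr_ln ?posrE ?expR_gt0.
by move: h; lra.
Qed.

Let rho_infty : rho [set None] = 0%E. Proof. exact: sphere_infty_null.1. Qed.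
Let rho_q : rho.-integrable setT (EFin \o q). Proof. exact: sphere_infty_null.2. Qed.

Let c := \int[rho]_w q w - \int[lambda]_w q w - A 1 0.

Let smooth_potential e z : 0 < e <= 1 ->
  \int[rho]_w sk e (Some z) w = \int[lambda]_w sk e (Some z) w + A e z + c.
Proof.
move=> e01; have := @test_identity e z; case/andP: (e01) => -> _ /(_ isT).
rewrite (Rintegral_test rho_infty rho_q)// (Rintegral_test lambda_infty lambda_q)//.
by rewrite /c; lra.
Qed.

Let A_uniform eta : 0 < eta -> exists2 e0 : R, 0 < e0 <= 1 & forall e z, 0 < e <= e0 ->
  `|A e z - fs_mass R * g (Some z)| <= eta.
Proof.
move=> eta0; have [e0 e01 h] := fs_average_uniform gc eta0; exists e0 => // e [a b] ee.
by have := h e a b ee.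
Qed.

Let f_kernel (z : R[i]) (w : bS) : R := 2^-1 * ln (nsq (z - pi0 w)).

Lemma sphere_kernelE (x y : bS) : sphere_kernel (x, y) =
  2^-1 * ln (nsq (pi0 x - pi0 y)) * ((if x is Some _ then 1 else 0) * (if y is Some _ then 1 else 0)).
Proof.
case: x y => [z|] [w|]; rewrite ?mulr0 ?mul0r ?mulr0// !mulr1 /=.
rewrite [LHS](_ : _ = ln (Num.sqrt (nsq (z - w)))); last by case: (z - w).
have [N0|N0] := eqVneq (nsq (z - w)) 0; first by rewrite N0 sqrtr0 ln0// mulr0.
have N1 : 0 < nsq (z - w) by rewrite lt_neqAle eq_sym N0 nsq_ge0.
by rewrite -{2}[nsq _]sqr_sqrtr ?nsq_ge0// lnXn ?sqrtr_gt0// mulr2n; field.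
Qed.

Let mfin : measurable_fun setT (fun x : bS => if x is Some _ then (1 : R) else 0).
Proof. by apply: (@measurable_lift2 R (fun=> 1) 0); exact: cst_continuous. Qed.

Lemma measurable_sphere_kernel : measurable_fun setT (@sphere_kernel R).
Proof.
rewrite (_ : @sphere_kernel R = fun p => 2^-1 * ln (nsq (pi0 p.1 - pi0 p.2)) *
  ((if p.1 is Some _ then 1 else 0) * (if p.2 is Some _ then 1 else 0))); last first.
  by apply/funext => -[x y]; exact: sphere_kernelE.
apply: measurable_funM.
  apply: measurable_funM; first exact: measurable_cst.
  by apply: measurableT_comp; [exact: measurable_ln|exact: measurable_nsq_dist].
by apply: measurable_funM; apply: measurableT_comp mfin _.
Qed.

Let mkx x : measurable_fun setT (fun y => @sphere_kernel R (x, y)).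
Proof. exact: (measurableT_comp measurable_sphere_kernel (pair1_measurable x)). Qed.

Let h (n : nat) : R := n.+1%:R^-1.
Let h01 n : 0 < h n <= 1.
Proof. by rewrite invr_gt0 ltr0n /= invf_le1 ?ltr0n// ler1n. Qed.
Let h0 : h n @[n --> \oo] --> 0. Proof. exact: cvg_harmonic. Qed.

Let smooth_limit z : \int[rho]_w sk (h n) (Some z) w @[n --> \oo] --> ld (Some z) + fs_mass R * g (Some z) + c.
Proof.
under eq_fun do rewrite smooth_potential//.
apply: cvgD; last exact: cvg_cst.
apply: cvgD.
  apply: (@squeeze_cvgr _ _ _ _ (fun=> ld (Some z)) (fun n => ld (Some z) + h n)).
  - by apply: nearW => n; exact: smooth_circle_potential.
  - exact: cvg_cst.
  - by rewrite -[X in _ --> X]addr0; apply: cvgD; [exact: cvg_cst|exact: h0].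
apply/cvgrPdist_le => eta eta0; have [e0 /andP[e00 _] eP] := A_uniform eta0.
move/cvgrPdist_lt: h0 => /(_ _ e00); apply: filterS => n; rewrite sub0r normrN => hn.
have /andP[hn0 _] := h01 n.
by rewrite distrC; apply: eP; rewrite hn0 /= ltW// (le_lt_trans _ hn)// ler_norm.
Qed.

(** The regularized kernels decrease to the logarithm as e tends to 0. Their integrals are known
    through [smooth_potential] and converge, since the averages of g tend to [fs_mass] times its
    value; the limit theorem gives both claims. *)
Let kernel_potential z : rho.-integrable setT (EFin \o (fun y => @sphere_kernel R (Some z, y))) /\
  \int[rho]_y sphere_kernel (Some z, y) = ld (Some z) + fs_mass R * g (Some z) + c.
Proof.
have [B BP] := A_bound.
have ldz : 0 <= ld (Some z) by rewrite /= mulr_ge0 ?invr_ge0// ln_ge0// le_max lexx.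
have mfz : measurable_fun setT (f_kernel z).
  have := measurableT_comp (@measurable_nsq_dist R) (pair1_measurable (Some z : bS)) => m1.
  by apply: measurable_funM; [exact: measurable_cst|apply: measurableT_comp m1; exact: measurable_ln].
have lim x : nsq (z - pi0 x) != 0 -> sk (h n) (Some z) x @[n --> \oo] --> f_kernel z x.
  move=> N0; have N1 : 0 < nsq (z - pi0 x) by rewrite lt_neqAle eq_sym N0 nsq_ge0.
  apply: cvgM; first exact: cvg_cst.
  have c1 : nsq (z - pi0 x) + h n ^+ 2 @[n --> \oo] --> nsq (z - pi0 x).
    rewrite -[X in _ --> X]addr0; apply: cvgD; first exact: cvg_cst.
    by rewrite -[X in _ --> X](expr0n R 2); apply: cvg_exprR; exact: h0.
  by apply: (cvg_comp _ _ c1); exact: continuous_ln.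
have [|||_ i1 l1] := @decreasing_integral_limit _ _ R rho (fun n => sk (h n) (Some z)) (f_kernel z) (- B + c)
  (fun n => smooth_kernel_integrable rho_q (Some z) (h01 n)) mfz.
- move=> x n m nm; rewrite ler_pM2l ?invr_gt0// ler_ln ?posrE ?ltr_wpDl ?nsq_ge0 ?exprn_gt0//;
    [|by case/andP: (h01 m)|by case/andP: (h01 n)].
  rewrite lerD2l lerXn2r ?nnegrE ?invr_ge0// lef_pV2 ?posrE// ler_nat ltnS; exact: nm.
- move=> n; rewrite smooth_potential//.
  have /andP[l1 _] := smooth_circle_potential z (h01 n); have /andP[hn0 _] := h01 n.
  by have := BP (h n) z hn0; rewrite ler_norml => /andP[? _]; lra.
- move=> x [M MP]; apply: lim; apply/negP => /eqP N0.
  pose n := Num.trunc (expR (- M + 1)); have := MP n.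
  rewrite /smooth_kernel N0 add0r lnXn; last by case/andP: (h01 n).
  rewrite -[ln _ *+ 2]mulr_natl mulKf// /h lnV ?posrE// => hM.
  have h' : expR (- M + 1) < n.+1%:R by exact: truncnS_gt.
  have : - M + 1 < ln n.+1%:R by rewrite -[ltLHS]expRK ltr_ln ?posrE ?expR_gt0.
  by move: hM; lra.
have fk w : f_kernel z (Some w) = sphere_kernel (Some z : bS, Some w : bS).
  by rewrite sphere_kernelE !mulr1.
split; last first.
  rewrite -(Rintegral_ae rho_infty mfz (mkx (Some z)) fk).
  by have := cvg_lim (@Rhausdorff R) l1; rewrite (cvg_lim (@Rhausdorff R) (@smooth_limit z)) => ->.
apply: le_integrable i1 => //; first by apply/measurable_EFinP; exact: mkx.
move=> [w|] _; rewrite /= lee_fin; first by have := fk w; rewrite /= => <-.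
by rewrite normr0.
Qed.

Let p (x : bS) := \int[rho]_y sphere_kernel (x, y).

Let pNone : p None = 0.
Proof. by rewrite /p /Rintegral; under eq_integral do rewrite /=; rewrite integral0. Qed.

Let ki x : rho.-integrable setT (EFin \o (fun y => @sphere_kernel R (x, y))).
Proof.
case: x => [z|]; first by have [] := kernel_potential z.
exact: (integrableR_cst rho 0).
Qed.

Lemma sphere_potential_ln_dist : exists B, forall x, `|p x - ld x| <= B.
Proof.
have [M M0 MP] := GM; exists (fs_mass R * M + `|c|) => -[z|]; last first.
  by rewrite pNone /= subr0 normr0 addr_ge0// mulr_ge0// fs_mass_ge0.
have [_] := kernel_potential z; rewrite /p => ->.
rewrite (_ : _ - _ = fs_mass R * g (Some z) + c); last by ring.
rewrite (le_trans (ler_normD _ _))// lerD2r normrM.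
by rewrite ger0_norm ?fs_mass_ge0// ler_wpM2l ?fs_mass_ge0.
Qed.

Let ld_ge0 x : 0 <= ld x.
Proof. by case: x => [z|] //=; rewrite mulr_ge0 ?invr_ge0// ln_ge0// le_max lexx. Qed.

Let nsq_le (x y : bS) (e : R) : 0 <= e <= 1 -> nsq (pi0 x - pi0 y) + e <= 5 * (expR (2 * ld x) * expR (2 * ld y)).
Proof.
move=> e01.
have E (x' : bS) : expR (2 * ld x') = Num.max 1 (nsq (pi0 x')).
  case: x' => [z|] /=; last by rewrite mulr0 expR0 /nsq /= expr0n addr0 max_l.
  by rewrite mulrA mulfV// mul1r lnK// posrE lt_max ltr01.
rewrite !E; have := nsqB (pi0 x) (pi0 y).
set s := nsq (pi0 x); set t := nsq (pi0 y); set m := Num.max 1 s; set m' := Num.max 1 t.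
have m1 : 1 <= m by rewrite le_max lexx.
have m1' : 1 <= m' by rewrite le_max lexx.
have ms : s <= m by rewrite le_max lexx orbT.
have mt : t <= m' by rewrite le_max lexx orbT.
move=> h'; have : 0 <= (m - 1) * (m' - 1) by rewrite mulr_ge0 ?subr_ge0.
case/andP: e01 => ? ?; nra.
Qed.

Let half_ln_le (x y : bS) (v e : R) : 0 < v -> v <= nsq (pi0 x - pi0 y) + e -> 0 <= e <= 1 ->
  2^-1 * ln v <= ld x + ld y + 2^-1 * ln 5.
Proof.
move=> v0 ve e01; have := le_trans ve (nsq_le x y e01) => h'.
have : ln v <= ln 5 + (2 * ld x + 2 * ld y).
  rewrite -[X in _ <= _ + X]expRK expRD -lnM ?posrE ?mulr_gt0 ?expR_gt0//.
  by rewrite ler_ln ?posrE ?mulr_gt0 ?expR_gt0.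
lra.
Qed.

Let ln5 : 0 <= 2^-1 * ln 5 :> R.
Proof. by rewrite mulr_ge0 ?invr_ge0// ln_ge0// ler1n. Qed.

Let kl x y : sphere_kernel (x, y) <= ld x + ld y + 2^-1 * ln 5.
Proof.
rewrite sphere_kernelE.
have h0' : 2^-1 * ln (nsq (pi0 x - pi0 y)) <= ld x + ld y + 2^-1 * ln 5.
  have [N0|N0] := eqVneq (nsq (pi0 x - pi0 y)) 0; first by rewrite N0 ln0// mulr0; have := ld_ge0 x; have := ld_ge0 y; move: ln5; lra.
  apply: (@half_ln_le _ _ _ 0); rewrite ?addr0 ?lexx ?ler01//.
  by rewrite lt_neqAle eq_sym N0 nsq_ge0.
have := ld_ge0 x; have := ld_ge0 y; have := ln5.
by case: x y h0' => [z|] [w|] h0' l1 l2 l3; rewrite ?mulr1// ?mulr0 ?mul0r ?mulr0; lra.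
Qed.

Let ksym x y : @sphere_kernel R (x, y) = sphere_kernel (y, x).
Proof.
rewrite !sphere_kernelE mulrC [X in _ = _ * X]mulrC [RHS]mulrC; congr (_ * (_ * ln _)).
by rewrite -!normc_sqr normc_distC.
Qed.

Let mld : measurable_fun setT ld.
Proof.
apply: (@measurable_lift2 R (fun z => 2^-1 * ln (Num.max 1 (nsq z))) 0) => z.
have c1 : (fun z : R[i]^o => Num.max 1 (nsq z)) @ z --> Num.max 1 (nsq z).
  apply: (@cvg_maxR _ _ _ (nbhs_filter z)); first exact: cvg_cst.
  rewrite (_ : (@nsq R : R[i]^o -> R) = fun z => Normc.normc z ^+ 2); last by apply/funext => w; rewrite normc_sqr.
  by apply: (@cvg_exprR _ _ _ (nbhs_filter z)); exact: continuous_normc.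
have c2 := cvg_comp _ _ c1 (@continuous_ln R (Num.max 1 (nsq z)) _).
apply: (@cvgM R (R[i]^o) _ (nbhs_filter z)); first exact: cvg_cst.
by apply: c2; rewrite lt_max ltr01.
Qed.

Let li : rho.-integrable setT (EFin \o ld).
Proof.
apply: (@integrableR_le _ _ R rho _ _ mld _ rho_q) => -[z|] /=; last by rewrite normr0 q_ge0.
rewrite ger0_norm; last exact: (ld_ge0 (Some z)).
have := nsq_ge0 z; rewrite qE /= ler_pM2l ?invr_gt0// => z0.
by rewrite ler_ln ?posrE ?lt_max ?ltr01//; [rewrite ge_max; apply/andP; split|]; lra.
Qed.

Lemma sphere_energyE (s : seq bS) : let mu := SignedMeasure (empirical R s) rho in
  sphere_energy mu mu = - ((size s)%:R ^- 2 * \sum_(x <- s) \sum_(y <- s) sphere_kernel (x, y)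
    - 2 / (size s)%:R * \sum_(x <- s) p x + \int[rho]_x p x).
Proof.
have [B BP] := sphere_potential_ln_dist.
apply: (energyE measurable_sphere_kernel ksym ld_ge0 ln5 li kl ki BP) => -[[z|] [w|]] //= nD.
have [<-|/eqP zw] := eqVneq z w; last by case: nD; exists z, w.
by rewrite subrr Normc.normc0 ln0.
Qed.

Let pint : rho.-integrable setT (EFin \o p).
Proof.
have [B BP] := sphere_potential_ln_dist.
exact: (potential_integrable measurable_sphere_kernel ld_ge0 ln5 li kl ki BP).
Qed.

Let pei e : 0 < e <= 1 -> rho.-integrable setT (EFin \o (fun x => \int[rho]_y sk e x y)).
Proof.
move=> e01; have [B BP] := A_bound; have /andP[e0 e1] := e01.
have b z : `|\int[rho]_y sk e (Some z) y - ld (Some z)| <= 1 + B + `|c|.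
  rewrite smooth_potential//; have /andP[h1 h2] := smooth_circle_potential z e01.
  have := BP e z e0; have := ler_norm c; have := ler_norm (- c); rewrite normrN !ler_norml => ? ? /andP[? ?].
  by apply/andP; split; lra.
apply: (@potential_integrable _ _ R rho (fun r => sk e r.1 r.2) ld (2^-1 * ln 5) (1 + B + `|c|)) => //.
- exact: measurable_smooth_kernel.
- move=> x y; apply: (@half_ln_le _ _ _ (e ^+ 2)) => //; first by rewrite ltr_wpDl ?nsq_ge0 ?exprn_gt0.
  by rewrite sqr_ge0 expr_le1// ltW.
- by move=> x; exact: smooth_kernel_integrable.
- case=> [z|] /=; first exact: b.
  have := b 0; rewrite /= (_ : nsq 0 = 0) ?max_l// ?ln1 ?mulr0//.
  by rewrite /nsq /= expr0n addr0.
Qed.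

Let nsq0 : nsq (0 : R[i]) = 0.
Proof. by rewrite /nsq /= expr0n addr0. Qed.

Let sk_diag e x : 0 < e -> sk e x x = ln e.
Proof. by move=> e0; rewrite /smooth_kernel subrr nsq0 add0r lnXn// mulr2n; field. Qed.

Let ppe e x : 0 < e <= 1 -> x <> None -> p x <= \int[rho]_y sk e x y.
Proof.
move=> e01; case: x => // z _; have /andP[e0 _] := e01.
have [_ pz] := kernel_potential z; rewrite /p pz.
apply: ler_cvg_to (@smooth_limit z) (cvg_cst _) _.
move/cvgrPdist_lt: h0 => /(_ _ e0); apply: filterS => n; rewrite sub0r normrN => hn.
have /andP[hn0 _] := h01 n.
apply: le_Rintegral => //; [exact: smooth_kernel_integrable|exact: smooth_kernel_integrable|] => w _.
rewrite ler_pM2l ?invr_gt0// ler_ln ?posrE ?ltr_wpDl ?nsq_ge0 ?exprn_gt0//.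
by rewrite lerD2l lerXn2r ?nnegrE ?ltW// (le_lt_trans _ hn)// ler_norm.
Qed.

Theorem sphere_energy_lower_bound (del : R) : 0 < del -> exists N, forall s : seq bS, uniq s ->
  {in s, forall x, exists z, x = Some z} -> (N <= size s)%N ->
  (size s)%:R ^- 2 * (\sum_(x <- s) \sum_(y <- s) sphere_kernel (x, y))
    - 2 / (size s)%:R * (\sum_(x <- s) p x) + \int[rho]_x p x <= del.
Proof.
apply: (@empirical_energy_lower_bound _ _ R rho (@sphere_kernel R) sk (fun x => exists z, x = Some z) None) => //.
- exact: measurable_infty.
- by move=> e x y _; rewrite /smooth_kernel -!normc_sqr normc_distC.
- by move=> e nu /andP[e0 _]; exact: smooth_kernel_cnd.
- by move=> e x; exact: smooth_kernel_integrable.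
- move=> e /andP[e0 _]; under [X in EFin \o X]eq_fun do rewrite sk_diag//.
  exact: integrableR_cst.
- move=> e x y /andP[e0 _] [z ->] [w ->] zw; rewrite sphere_kernelE !mulr1 ler_pM2l ?invr_gt0//.
  have N1 : 0 < nsq (z - w).
    rewrite lt_neqAle nsq_ge0 andbT eq_sym -normc_sqr sqrf_eq0; apply/eqP => /Normc.eq0_normc/eqP.
    by rewrite subr_eq0 => /eqP zw'; apply: zw; rewrite zw'.
  have e20 : 0 < e ^+ 2 by exact: exprn_gt0.
  by rewrite ler_ln ?posrE//= ?lerDl ?ltW// addr_gt0.
- by move=> x [z ->]; rewrite /= subrr Normc.normc0 ln0.
- by move=> e /andP[e0 _]; exists (- ln e) => x _; rewrite opprK sk_diag.
move=> eta eta0; have eta2 : 0 < eta / 2 by rewrite divr_gt0.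
have [e0 /andP[e00 e01] eP] := A_uniform eta2.
(* One half of [eta] is spent on the potential of the circle, within e of its limit, and the other
   half on the average of g. *)
have e1 : 0 < Num.min e0 (eta / 2) <= 1 by rewrite lt_min e00 eta2 ge_min e01.
exists (Num.min e0 (eta / 2)) => // _ [z ->].
have [_ pz] := kernel_potential z; rewrite smooth_potential// pz.
have /andP[_ h1] := smooth_circle_potential z e1.
have := eP (Num.min e0 (eta / 2)) z; case/andP: (e1) => -> _; rewrite ge_min lexx => /(_ isT).
have : Num.min e0 (eta / 2) <= eta / 2 by rewrite ge_min lexx orbT.
by rewrite ler_distlC => ? /andP[? ?]; lra.
Qed.

End SpherePotential.

(** * Potentials on the Berkovich line *)

Section UltrametricKernel.
Context d (X : measurableType d) (R : realType).
Implicit Type nu : seq (R * X).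

(** The relation decomposes the points into classes, together with points related to nothing; the
    form is the sum over the classes of the squares of their masses. The induction removes the class
    of the first point. *)
Lemma partial_equivalence_psd (r : X -> X -> bool) nu :
  (forall x y, r x y = r y x) -> (forall x y z, r x y -> r y z -> r x z) ->
  0 <= \sum_(a <- nu) \sum_(b <- nu) a.1 * b.1 * (r a.2 b.2)%:R.
Proof.
move=> rs rt; elim: {nu}(size nu) {-2}nu (leqnn (size nu)) => [|n IH] nu.
  by case: nu => // _; rewrite big_nil.
case: nu => [|x nu] sn; first by rewrite big_nil.
pose P (a : R * X) := r x.2 a.2.
have PP a b : P a -> P b -> r a.2 b.2 by move=> Pa Pb; apply: rt Pb; rewrite rs.
have PN a b : P a -> ~~ P b -> r a.2 b.2 = false.
  by move=> Pa; apply: contraNF => rab; exact: rt rab.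
have NP a b : ~~ P a -> P b -> r a.2 b.2 = false by move=> Pa Pb; rewrite rs PN.
rewrite (bigID P) /= addr_ge0//.
  have -> : \sum_(a <- x :: nu | P a) \sum_(b <- x :: nu) a.1 * b.1 * (r a.2 b.2)%:R =
      (\sum_(a <- x :: nu | P a) a.1) ^+ 2.
    rewrite expr2 mulr_suml; apply: eq_bigr => a Pa; rewrite mulr_sumr (bigID P) /=.
    rewrite [X in _ + X]big1 ?addr0; first by apply: eq_bigr => b Pb; rewrite PP// mulr1.
    by move=> b Pb; rewrite PN// mulr0.
  exact: sqr_ge0.
have [xx|xx] := boolP (P x); last first.
  have Pn a : P a = false by apply/negP => Pa; case/negP: xx; apply: (rt _ a.2); rewrite // rs.
  have E0 : \sum_(b <- x :: nu) x.1 * b.1 * (r x.2 b.2)%:R = 0.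
    by apply: big1 => b _; rewrite -/(P b) Pn mulr0.
  rewrite (eq_bigl xpredT) => [|a]; last by rewrite Pn.
  rewrite big_cons E0 add0r.
  rewrite (eq_bigr (fun a => \sum_(b <- nu) a.1 * b.1 * (r a.2 b.2)%:R)) => [|a _]; first exact: IH.
  by rewrite big_cons rs -/(P a) Pn mulr0 add0r.
have := IH [seq a <- x :: nu | ~~ P a] _; rewrite big_filter.
rewrite (eq_bigr (fun a => \sum_(b <- x :: nu) a.1 * b.1 * (r a.2 b.2)%:R)) => [|a Pa].
  apply; rewrite /= xx /= (leq_trans _ (_ : size nu <= n)%N)//.
  by rewrite size_filter count_size.
rewrite big_filter [RHS](bigID P) /= [X in X + _]big1 ?add0r// => b Pb.
by rewrite NP// mulr0.
Qed.

Variable K : X -> X -> R.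
Hypothesis Ksym : forall x y, K x y = K y x.
Hypothesis Kultra : forall x y z, K x z <= Num.max (K x y) (K y z).

(** Lower the truncation level of K through its finitely many values. Passing from a level v1 to the
    next lower value v0 brings out the term (v0 - v1) times the indicator of K < v1, a partial
    equivalence, with a nonpositive coefficient; at the lowest level the kernel is constant and
    contributes nothing. *)
Lemma ultrametric_conditionally_negative nu : \sum_(a <- nu) a.1 = 0 -> quad K nu <= 0.
Proof.
have [->|] := pselect (nu = [::]); first by move=> _; rewrite /quad big_nil.
case: nu => // -[c0 x0] nu' _; set nu := (c0, x0) :: nu' => nu0; pose Q (F : X -> X -> R) := \sum_(a <- nu) \sum_(b <- nu) a.1 * b.1 * F a.2 b.2.
have Qcst c : Q (fun _ _ => c) = 0.
  have -> : Q (fun _ _ => c) = (\sum_(a <- nu) a.1) * (\sum_(a <- nu) a.1) * c.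
    by rewrite /Q !mulr_suml; apply: eq_bigr => a _; rewrite mulr_sumr mulr_suml.
  by rewrite nu0 !mul0r.
have QD F G : Q (fun x y => F x y + G x y) = Q F + Q G.
  rewrite /Q -big_split; apply: eq_bigr => a _; rewrite -big_split; apply: eq_bigr => b _.
  by rewrite mulrDr.
have QZ c F : Q (fun x y => c * F x y) = c * Q F.
  by rewrite /Q mulr_sumr; apply: eq_bigr => a _; rewrite mulr_sumr; apply: eq_bigr => b _; rewrite mulrCA.
have Qeq F G : (forall i j, (i < size nu)%N -> (j < size nu)%N ->
    F (nth (0, x0) nu i).2 (nth (0, x0) nu j).2 = G (nth (0, x0) nu i).2 (nth (0, x0) nu j).2) -> Q F = Q G.
  move=> FG; rewrite /Q (big_nth (0, x0)) [RHS](big_nth (0, x0)) big_nat_cond [RHS]big_nat_cond.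
  apply: eq_bigr => i; rewrite andbT /= => ii.
  rewrite (big_nth (0, x0)) [RHS](big_nth (0, x0)) big_nat_cond [RHS]big_nat_cond.
  by apply: eq_bigr => j; rewrite andbT /= => jj; rewrite FG.
pose k i j := K (nth (0, x0) nu i).2 (nth (0, x0) nu j).2.
have step V v0 : path <=%R v0 V ->
    (forall i j, (i < size nu)%N -> (j < size nu)%N -> k i j <= v0 \/ k i j \in V) ->
    Q K <= Q (fun x y => Num.min (K x y) v0).
  elim: V v0 => [|v1 V IH] v0 /=.
    move=> _ h; rewrite (Qeq K (fun x y => Num.min (K x y) v0))// => i j ii jj.
    by rewrite min_l//; case: (h i j ii jj).
  move=> /andP[v01 pV] h; have sV : all (>= v1) V by exact: order_path_min le_trans pV.
  apply: le_trans (IH v1 pV _) _ => [i j ii jj|].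
    case: (h i j ii jj) => [kv|]; first by left; exact: le_trans v01.
    by rewrite in_cons => /predU1P[->|]; [left|right].
  rewrite (Qeq (fun x y => Num.min (K x y) v1) (fun x y => (Num.min (K x y) v0 + (v1 - v0)) +
      (v0 - v1) * (K x y < v1)%R%:R)) => [|i j ii jj]; last first.
    case: (h i j ii jj) => [kv|]; rewrite -/(k i j).
      rewrite (min_l kv) (min_l (le_trans kv v01)); case: ltP => kv1; rewrite ?mulr1 ?mulr0.
        by lra.
      have -> : k i j = v0 by apply/eqP; rewrite eq_le kv (le_trans v01).
      have -> : v1 = v0 by apply/eqP; rewrite eq_le v01 (le_trans kv1).
      by lra.
    move=> kV; have kv1 : v1 <= k i j.
      by move: kV; rewrite in_cons => /predU1P[->//|/(allP sV)].
    rewrite ltNge kv1 mulr0 addr0 min_r// min_r ?(le_trans v01)//; lra.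
  rewrite 2!QD Qcst addr0 QZ gerDl mulr_le0_ge0 ?subr_le0//.
  apply: (partial_equivalence_psd (r := fun x y => K x y < v1)) => [x y|x y z xy yz].
    by rewrite Ksym.
  by rewrite (le_lt_trans (Kultra x y z))// gt_max xy yz.
pose V := sort <=%R [seq k i j | i <- iota 0 (size nu), j <- iota 0 (size nu)].
have [v0 v0P] : exists v0, forall v, v \in V -> v0 <= v.
  elim: V => [|v V [v0 IH]]; first by exists 0.
  exists (Num.min v v0) => w; rewrite in_cons => /predU1P[->|/IH wv]; rewrite ge_min ?lexx//.
  by rewrite wv orbT.
have kV i j : (i < size nu)%N -> (j < size nu)%N -> k i j \in V.
  by move=> ii jj; rewrite mem_sort; apply: allpairs_f; rewrite mem_iota.
have := step V v0; rewrite (Qeq (fun x y => Num.min (K x y) v0) (fun _ _ => v0)) => [|i j ii jj].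
  rewrite Qcst; apply; last by move=> i j ii jj; right; exact: kV.
  rewrite path_sortedE; last exact: le_trans.
  by rewrite sort_le_sorted andbT; apply/allP.
by rewrite min_r// v0P// kV.
Qed.

End UltrametricKernel.

Lemma RintegralN d (X : measurableType d) (R : realType) (mu : {measure set X -> \bar R}) (f : X -> R) :
  mu.-integrable setT (EFin \o f) -> \int[mu]_x (- f x) = - \int[mu]_x f x.
Proof.
by move=> fi; rewrite -[RHS]mulN1r -RintegralZl//; apply: eq_Rintegral => x _; rewrite mulN1r.
Qed.

(** * Potential and energy on the Berkovich line *)

Section BerkovichMeasure.
Variables (R : realType) (L : valField R).
Hypothesis ultra : forall x y : L, vabs (x + y) <= Num.max (vabs x) (vabs y).
Hypothesis Lclosed : poly_closed [set: L].
Hypothesis Lcomplete : vcomplete L.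
Variable zs : nat -> L.
Hypothesis zs_dense : forall z (e : R), 0 < e -> exists n, vabs (z - zs n) < e.
Let LP := vabsP L.
Local Notation berk := (berk_A1 L).
Local Notation P1 := (berk_P1 L).
Local Notation bP1 := (borel P1).
Local Notation raise := (raise ultra).
Local Notation canon := (canon ultra).

(** Infinity goes to the canonical point, where log^+ vanishes as [ln_dist] does at infinity. *)
Definition affine_point (p : bP1) : berk := if p is Some s then s else canon.

Lemma dist_continuous z : continuous (fun s : berk => dist s z).
Proof. exact: berk_eval_continuous. Qed.

(** The condition J < x means that some z is at distance less than x from both points; by
    ultrametricity z may be taken in the dense sequence, which gives a countable union of measurable
    sets of the product. *)
Lemma measurable_J : measurable_fun setT (fun q : bP1 * bP1 => J (affine_point q.1) (affine_point q.2)).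
Proof.
pose f n (p : bP1) := dist (affine_point p) (zs n).
have mf n : measurable_fun setT (f n).
  have := @measurable_lift R _ (fun s => dist s (zs n)) (dist canon (zs n)) (@dist_continuous (zs n)).
  by congr measurable_fun; apply/funext => -[].
pose F n (q : bP1 * bP1) := Num.max (f n q.1) (f n q.2).
have mF n : measurable_fun setT (F n).
  by apply: measurable_maxr; apply: measurableT_comp.
apply: (measurability (@RGenInftyO.G R)); first exact: RGenInftyO.measurableE.
move=> _ [_ [x ->] <-]; rewrite setTI.
have -> : (fun q : bP1 * bP1 => J (affine_point q.1) (affine_point q.2)) @^-1` `]-oo, x[ =
    \bigcup_n ([set: bP1 * bP1] `&` F n @^-1` `]-oo, x[).
  apply/seteqP; split => [q|q [n _ [_]]]; rewrite /= in_itv /=; last first.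
    by move=> h; rewrite in_itv /= (le_lt_trans _ h)// J_le.
  move=> /J_lt[z [z1 z2]].
  have x0 : 0 < x by rewrite (le_lt_trans _ z1)// dist_ge0.
  have [n nP] := zs_dense z x0; exists n => //; split => //; rewrite /= in_itv /= gt_max.
  by rewrite /f !(le_lt_trans (dist_ultra ultra _ _ z))// gt_max ?z1 ?z2 (av_distC LP) nP.
apply: bigcup_measurable => n _; exact: mF.
Qed.

Lemma measurable_finite : measurable_fun setT (fun p : bP1 => if p is Some _ then (1 : R) else 0).
Proof. by apply: (@measurable_lift R _ (fun=> 1) 0); exact: cst_continuous. Qed.

Lemma berk_kernelE (q : bP1 * bP1) : berk_kernel q = ln (J (affine_point q.1) (affine_point q.2)) *
  ((if q.1 is Some _ then 1 else 0) * (if q.2 is Some _ then 1 else 0)).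
Proof. by case: q => -[s|] [t|] /=; rewrite ?mulr0 ?mul0r ?mulr0 ?mulr1// (berk_supE ultra Lclosed). Qed.

Lemma measurable_berk_kernel : measurable_fun setT (@berk_kernel R L).
Proof.
rewrite (_ : @berk_kernel R L = fun q => ln (J (affine_point q.1) (affine_point q.2)) *
  ((if q.1 is Some _ then 1 else 0) * (if q.2 is Some _ then 1 else 0))); last by apply/funext => q; exact: berk_kernelE.
apply: measurable_funM; first by apply: measurableT_comp measurable_J; exact: measurable_ln.
by apply: measurable_funM; apply: measurableT_comp measurable_finite _.
Qed.

Lemma berk_kernelC x y : @berk_kernel R L (x, y) = berk_kernel (y, x).
Proof. by case: x y => [s|] [t|] //=; rewrite !(berk_supE ultra Lclosed) JC. Qed.

Definition ln_dist (p : bP1) : R := if p is Some s then ln_dist0 s else 0.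

Lemma ln_dist0_continuous : continuous (fun s : berk => ln_dist0 s).
Proof.
move=> s; have c : (fun s : berk => Num.max 1 (dist s 0)) @ s --> Num.max 1 (dist s 0).
  apply: (@cvg_maxR _ _ _ (nbhs_filter s)); [exact: cvg_cst|exact: dist_continuous].
by apply: (cvg_comp _ _ c); apply: continuous_ln; rewrite lt_max ltr01.
Qed.

Lemma measurable_ln_dist : measurable_fun setT ln_dist.
Proof. exact: measurable_lift ln_dist0_continuous. Qed.

Lemma ln_dist0_ge0 (s : berk) : 0 <= ln_dist0 s.
Proof. by rewrite ln_ge0// le_max lexx. Qed.

Lemma ln_dist_ge0 p : 0 <= ln_dist p.
Proof. by case: p => //= s; exact: ln_dist0_ge0. Qed.

Lemma berk_kernel_le x y : @berk_kernel R L (x, y) <= ln_dist x + ln_dist y + 0.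
Proof.
rewrite addr0; case: x y => [s|] [t|]; rewrite ?addr0 ?add0r ?ln_dist0_ge0//=.
rewrite (berk_supE ultra Lclosed).
have := J_ge0 s t; rewrite le_eqVlt => /predU1P[<-|J0].
  by rewrite ln0// addr_ge0 ?ln_dist0_ge0.
rewrite /ln_dist0 -lnM ?posrE ?lt_max ?ltr01// ler_ln ?posrE ?mulr_gt0 ?lt_max ?ltr01//.
have m1 (u : berk) : 1 <= Num.max 1 (dist u 0) by rewrite le_max lexx.
have m2 (u : berk) : dist u 0 <= Num.max 1 (dist u 0) by rewrite le_max lexx orbT.
rewrite (le_trans (J_le s t 0))// ge_max; apply/andP; split.
  by rewrite -[leLHS]mulr1 ler_pM ?dist_ge0.
by rewrite -[leLHS]mul1r ler_pM ?dist_ge0.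
Qed.

Lemma ln_dist_affine x : ln_dist0 (affine_point x) = ln_dist x.
Proof. by case: x => //=; rewrite /ln_dist0 (dist_canon ultra) (av0 LP) (max_l ler01) maxxx ln1. Qed.

Section Potential.
Variable rho : probability bP1 R.
Variable g : P1 -> R.
Hypothesis gc : continuous g.
Hypothesis glap : berk_laplacian g (SignedMeasure rho (gauss_measure L)).

Let G : exists M, forall x, `|g x| <= M.
Proof.
have : compact (g @` [set: P1]).
  by apply: continuous_compact; [exact: continuous_subspaceT|exact: one_point_compactification_compact].
move=> /compact_bounded[M [_ MP]]; exists (M + 1) => x.
by apply: (MP (M + 1)); rewrite ?ltrDl//; exists x.
Qed.

Let f (S : berk) (y : bP1) : R := if y is Some t then ln_dist0 S + ln_dist0 t - ln (J S t) else ln_dist0 S.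

Let pairingE S y : berk_H S -> berk_pairing (Some S) y = (f S y)%:E.
Proof.
move=> SH; case: y => [t|]; first exact: (berk_pairingE ultra Lclosed Lcomplete).
exact: (berk_pairing_infty ultra Lclosed Lcomplete).
Qed.

Let kE S y : berk_kernel (Some S, y) = ln_dist0 S + ln_dist y - f S y.
Proof.
case: y => [t|] /=; last by rewrite addr0 subrr.
by rewrite (berk_supE ultra Lclosed) opprB addrC subrK.
Qed.

Let mk S : measurable_fun setT (fun y => @berk_kernel R L (Some S, y)).
Proof. exact: measurableT_comp measurable_berk_kernel (measurable_pair1 _). Qed.

Let mf S : measurable_fun setT (f S).
Proof.
rewrite (_ : f S = fun y => ln_dist0 S + ln_dist y - berk_kernel (Some S, y)); last first.
  by apply/funext => y; rewrite kE opprB addrC subrK.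
apply: measurable_funB => //; apply: measurable_funD => //; exact: measurable_ln_dist.
Qed.

Let f_ge0 S y : 0 <= f S y.
Proof. by have := berk_kernel_le (Some S) y; rewrite kE addr0 /= gerBl. Qed.

(** The Gauss measure contributes nothing because the pairing with the canonical point is 0. The
    pairing being nonnegative, finiteness of its integral amounts to integrability. *)
Lemma laplacian_pairing : exists c, forall S, berk_H S ->
  rho.-integrable setT (EFin \o f S) /\ \int[rho]_y f S y = c - g (Some S).
Proof.
have [c cP] := glap; exists c => S SH; have := cP S SH.
have -> : (\int[spos (SignedMeasure rho (gauss_measure L))]_y berk_pairing (Some S) y = \int[rho]_y (f S y)%:E)%E.
  by apply: eq_integral => y _; exact: pairingE.
have -> : (\int[sneg (SignedMeasure rho (gauss_measure L))]_y berk_pairing (Some S) y = 0)%E.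
  rewrite (eq_integral (EFin \o f S)) => [|y _]; last exact: pairingE.
  rewrite integral_dirac//; last exact/measurable_EFinP.
  rewrite diracT mul1e /= (berk_canE ultra Lclosed) (J_canon ultra) /ln_dist0 (dist_canon ultra) (av0 LP).
  by rewrite (max_l ler01) maxxx ln1 addr0 subrr.
rewrite sube0 => E.
have Ifin : (\int[rho]_y (f S y)%:E = (c - g (Some S))%:E)%E.
  move: E; case: (\int[rho]_y _)%E => [r|//|//]; rewrite -EFinB => -[->].
  by rewrite opprB addrC subrK.
split; last by rewrite /Rintegral Ifin.
apply/integrableP; split; first exact/measurable_EFinP.
by under eq_integral do rewrite /= ger0_norm//; rewrite Ifin ltry.
Qed.

Let gSome (s : berk) : (fun s : berk => g (Some s)) @ s --> g (Some s).
Proof.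
apply: (@continuous_comp _ _ _ (Some : berk -> P1) g); last exact: gc.
exact: one_point_compactification_some_continuous.
Qed.

Let cvg_infty (u : nat -> berk) : (forall n, n%:R <= dist (u n) 0) -> (Some (u n) : P1) @[n --> \oo] --> (None : P1).
Proof.
move=> un A /nbhs_infty[r rA]; exists (Num.truncn r).+1 => // n /= rn; apply: rA.
by rewrite (lt_le_trans (truncnS_gt r))// (le_trans _ (un n))// ler_nat.
Qed.

(** Evaluate at the points of diameter n + 1 above the canonical point: the pairing with t is the
    minimum of log^+ |t| and log (n + 1), and at infinity it is log (n + 1). Its integral is bounded
    since g is, so infinity is null and log^+ is integrable; continuity of g at infinity gives the
    value of the integral. *)
Lemma infty_null_ln_dist : [/\ rho [set None] = 0%E, rho.-integrable setT (EFin \o ln_dist) &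
  forall S, berk_H S -> rho.-integrable setT (EFin \o (fun y => berk_kernel (Some S, y))) /\
    \int[rho]_y berk_kernel (Some S, y) = ln_dist0 S + g (Some S) - g None].
Proof.
have [c cP] := laplacian_pairing; have [M MP] := G.
pose zn n := raise canon n.+1%:R.
have dz n : diam (zn n) = n.+1%:R.
  by rewrite (diam_raise ultra) (diam_canon ultra) max_r// ler1n.
have zH n : berk_H (zn n) by apply/(berk_H_diam ultra Lclosed Lcomplete); rewrite dz.
have fz n y : f (zn n) y = if y is Some t then Num.min (ln_dist0 t) (ln n.+1%:R) else ln n.+1%:R.
  have d0 : dist (zn n) 0 = n.+1%:R.
    by rewrite (dist_raise ultra) (dist_canon ultra) (av0 LP) (max_l ler01) max_r// ler1n.
  have n1 : 1 <= n.+1%:R :> R by rewrite ler1n.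
  case: y => [t|] /=; rewrite /ln_dist0 d0 max_r//.
  rewrite (J_raise ultra) JC (J_canon ultra); have [h|h] := leP (Num.max 1 (dist t 0)) n.+1%:R.
    by rewrite min_l ?ler_ln ?posrE ?lt_max ?ltr01// addrAC subrr add0r.
  by rewrite min_r ?addrK// ler_ln ?posrE ?lt_max ?ltr01// ltW.
have [|||||ae il cvgl] := @decreasing_integral_limit _ _ R rho (fun n y => - f (zn n) y) (fun y => - ln_dist y) (- (c + M)).
- move=> n; have [fi _] := cP _ (zH n).
  by under eq_fun do rewrite -mulN1r; exact: integrableRZ.
- by apply: measurable_funN; exact: measurable_ln_dist.
- move=> y n m nm; rewrite lerN2 !fz; have lnm : ln n.+1%:R <= ln m.+1%:R :> R by rewrite ler_ln ?posrE// ler_nat.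
  case: y => [t|] //; by rewrite le_min !ge_min lexx lnm orbT.
- move=> n; have [fi fE] := cP _ (zH n).
  rewrite (RintegralN fi).
  rewrite fE lerN2 lerD2l lerNl; have := MP (Some (zn n)); rewrite ler_norml => /andP[]; lra.
- move=> y [B BP]; case: y BP => [t|] BP; last first.
    exfalso; have := BP (Num.truncn (expR (- B))); rewrite fz.
    rewrite lerNr => h; have := truncnS_gt (expR (- B)); rewrite ltNge => /negP; apply.
    by rewrite -[leLHS]lnK ?posrE// ler_expR.
  apply: cvgN; apply: cvg_near_cst; exists (Num.truncn (Num.max 1 (dist t 0))).+1 => // n /= nt.
  change (f (zn n) (Some t) = ln_dist0 t); rewrite fz min_l// /ln_dist0 ler_ln ?posrE ?lt_max ?ltr01//.
  by rewrite ltW// (lt_le_trans (truncnS_gt _))// ler_nat ltnW// ltnS ltnW.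
have il' : rho.-integrable setT (EFin \o ln_dist).
  have := integrableRZ (-1) il; rewrite (_ : (fun x => -1 * - ln_dist x)%R = ln_dist)//.
  by apply/funext => y; rewrite mulN1r opprK.
have lE : \int[rho]_y ln_dist y = c - g None.
  have h1 : (fun n => \int[rho]_x - f (zn n) x) @ \oo --> - (c - g None).
    rewrite (_ : (fun n => \int[rho]_x - f (zn n) x) = fun n => - (c - g (Some (zn n)))); last first.
      apply/funext => n; have [fi fE] := cP _ (zH n).
      by rewrite (RintegralN fi) fE.
    apply: cvgN; apply: cvgB; first exact: cvg_cst.
    apply: (cvg_comp _ _ (@cvg_infty zn _) (@gc None)) => n.
    by rewrite (dist_raise ultra) le_max ler_nat leqnSn orbT.
  have h2 : \int[rho]_x - ln_dist x = - (c - g None).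
    by apply/eqP; rewrite eq_le (ler_cvg_to cvgl h1) ?(ler_cvg_to h1 cvgl)//; exact: nearW.
  by have := RintegralN il'; rewrite h2 => /oppr_inj.
split => //.
- have [N [mN N0 NP]] := ae.
  apply/eqP; rewrite -measure_le0 -N0 le_measure ?inE//; first exact: measurable_infty.
  move=> y /= ->; apply: NP => -[B BP].
  have := BP (Num.truncn (expR (- B))); rewrite fz.
  rewrite lerNr => h; have := truncnS_gt (expR (- B)); rewrite ltNge => /negP; apply.
  by rewrite -[leLHS]lnK ?posrE// ler_expR.
- move=> S SH; have [fi fE] := cP S SH.
  have ci : rho.-integrable setT (EFin \o (fun=> ln_dist0 S)) by exact: integrableR_cst.
  have lci : rho.-integrable setT (EFin \o (fun y => ln_dist0 S + ln_dist y)) by exact: integrableRD.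
  rewrite (_ : (fun y => berk_kernel (Some S, y)) = fun y => ln_dist0 S + ln_dist y - f S y); last first.
    by apply/funext => y; exact: kE.
  split; first exact: integrableRB.
  rewrite RintegralB// RintegralD// Rintegral_cst//= probability_setT mulr1 fE lE; lra.
Qed.

(** The equation for g holds only on H, so S is approached by the points [raise S (1 / (n + 1))] of
    H. The kernels decrease, and the right side converges by continuity of g. *)
Lemma berk_potential S : rho.-integrable setT (EFin \o (fun y => berk_kernel (Some S, y))) /\
  \int[rho]_y berk_kernel (Some S, y) = ln_dist0 S + g (Some S) - g None.
Proof.
have [_ _ hH] := infty_null_ln_dist; have [M MP] := G.
pose e (n : nat) : R := n.+1%:R^-1.
have e0 n : 0 < e n by rewrite invr_gt0.
pose u n := raise S (e n).
have uH n : berk_H (u n).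
  by apply/(berk_H_diam ultra Lclosed Lcomplete); rewrite (diam_raise ultra) lt_max e0 orbT.
have ukE n y : berk_kernel (Some (u n), y) = if y is Some t then ln (Num.max (J S t) (e n)) else 0.
  by case: y => [t|] //=; rewrite (berk_supE ultra Lclosed) (J_raise ultra).
have uS : u @ \oo --> S.
  rewrite -[X in _ --> X](raise_id ultra Lclosed (r := 0)) ?diam_ge0//.
  by apply: raise_cvg; [exact: cvg_cst|exact: cvg_harmonic].
have [|||||ae il cvgl] := @decreasing_integral_limit _ _ R rho (fun n y => berk_kernel (Some (u n), y))
    (fun y => berk_kernel (Some S, y)) (- M - M).
- by move=> n; have [] := hH _ (uH n).
- exact: mk.
- move=> y n m nm; rewrite !ukE; case: y => [t|] //.
  have emn : e m <= e n by rewrite lef_pV2 ?posrE// ler_nat.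
  rewrite ler_ln ?posrE ?lt_max ?e0 ?orbT//.
  by rewrite ge_max !le_max lexx emn orbT.
- move=> n; have [_ ->] := hH _ (uH n); have := ln_dist0_ge0 (u n).
  have := MP (Some (u n)); have := MP None; rewrite !ler_norml => /andP[a b] /andP[a' b']; lra.
- move=> y [B BP]; case: y BP => [t|] BP; last exact: cvg_cst.
  have [J0|J0] := ltP 0 (J S t); last first.
    exfalso; have := BP (Num.truncn (expR (- B))); rewrite ukE.
    rewrite max_r; last by rewrite (le_trans J0)// ltW.
    rewrite lnV ?posrE// lerNr => h; have := truncnS_gt (expR (- B)); rewrite ltNge => /negP; apply.
    by rewrite -[leLHS]lnK ?posrE// ler_expR.
  apply: cvg_near_cst; exists (Num.truncn (J S t)^-1) => // n /= nt.
  change (berk_kernel (Some (u n), Some t : bP1) = berk_kernel (Some S, Some t : bP1)).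
  rewrite ukE /= (berk_supE ultra Lclosed) max_l// invf_ple ?posrE//.
  by rewrite ltW// (lt_le_trans (truncnS_gt _))// ler_nat ltnS.
split => //.
have h2 : (fun n => \int[rho]_y berk_kernel (Some (u n), y)) @ \oo --> ln_dist0 S + g (Some S) - g None.
  rewrite (_ : (fun n => _) = fun n => ln_dist0 (u n) + g (Some (u n)) - g None); last first.
    by apply/funext => n; have [_ ->] := hH _ (uH n).
  apply: cvgB; last exact: cvg_cst.
  apply: cvgD; first exact: (cvg_comp _ _ uS (@ln_dist0_continuous S)).
  exact: (cvg_comp _ _ uS (@gSome S)).
by apply/eqP; rewrite eq_le (ler_cvg_to cvgl h2) ?(ler_cvg_to h2 cvgl)//; exact: nearW.
Qed.

Let p (x : bP1) := \int[rho]_y berk_kernel (x, y).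

Let pE x : p x = if x is Some s then ln_dist0 s + g (Some s) - g None else 0.
Proof.
case: x => [s|]; first by have [] := berk_potential s.
by transitivity (\int[rho]_y (0 : R)); [apply: eq_Rintegral => -[]|rewrite Rintegral_cst// mul0r].
Qed.

Lemma potential_ln_dist : exists B, forall x, `|p x - ln_dist x| <= B.
Proof.
have [M MP] := G; exists (M + M) => x; rewrite pE; case: x => [s|] /=.
  have := MP (Some s); have := MP None; rewrite !ler_norml => /andP[a b] /andP[a' b']; apply/andP; split; lra.
by rewrite subrr normr0; have := MP None; have := normr_ge0 (g None); lra.
Qed.

Let ki x : rho.-integrable setT (EFin \o (fun y => berk_kernel (x, y))).
Proof.
case: x => [s|]; first by have [] := berk_potential s.
rewrite (_ : (fun y : bP1 => _) = fun=> 0); first exact: integrableR_cst.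
by apply/funext => -[].
Qed.

Let li : rho.-integrable setT (EFin \o ln_dist).
Proof. by have [] := infty_null_ln_dist. Qed.

Lemma berk_energyE (s : seq bP1) : let mu := SignedMeasure (empirical R s) rho in
  berk_energy mu mu = - ((size s)%:R ^- 2 * (\sum_(x <- s) \sum_(y <- s) berk_kernel (x, y))
     - 2 * (size s)%:R^-1 * (\sum_(x <- s) p x) + \int[rho]_x p x).
Proof.
have [B pl] := potential_ln_dist.
apply: (energyE measurable_berk_kernel berk_kernelC ln_dist_ge0 (lexx 0) li berk_kernel_le ki pl).
move=> [[S|] [T|]] //= nD; rewrite (berk_supE ultra Lclosed).
have [z [-> ->]] : exists z, S = berk_point z /\ T = berk_point z.
  by apply: contrapT => h; apply: nD; exists S, T.
by rewrite (J_point ultra) subrr (av0 LP) ln0.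
Qed.

Let pint : rho.-integrable setT (EFin \o p).
Proof.
have [B pl] := potential_ln_dist.
exact: (potential_integrable measurable_berk_kernel ln_dist_ge0 (lexx 0) li berk_kernel_le ki pl).
Qed.

(** Truncating the kernel below at e amounts to raising one of the points to diameter e, so the
    potential of the truncated kernel is known from [berk_potential]. *)
Let ke (e : R) (x y : bP1) : R := ln (Num.max (J (affine_point x) (affine_point y)) e).

Let keE e x y : 0 < e -> y <> None -> ke e x y = berk_kernel (Some (raise (affine_point x) e), y).
Proof. by case: y => [t|] // e0 _; rewrite /ke /= (berk_supE ultra Lclosed) (J_raise ultra). Qed.

Let mke e : measurable_fun setT (fun q : bP1 * bP1 => ke e q.1 q.2).
Proof.
apply: measurableT_comp; first exact: measurable_ln.
by apply: measurable_maxr => //; exact: measurable_J.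
Qed.

Let mkex e x : measurable_fun setT (ke e x).
Proof. exact: measurableT_comp (mke e) (measurable_pair1 x). Qed.

Let ae_fin : {ae rho, forall y, y <> None}.
Proof.
have [h _ _] := infty_null_ln_dist; exists [set None]; split => //; first exact: measurable_infty.
by move=> y /= /contrapT.
Qed.

Let ke_int e x : 0 < e -> rho.-integrable setT (EFin \o ke e x) /\
  \int[rho]_y ke e x y = ln_dist0 (raise (affine_point x) e) + g (Some (raise (affine_point x) e)) - g None.
Proof.
move=> e0; have [ii <-] := berk_potential (raise (affine_point x) e).
have E : ae_eq rho setT (EFin \o (fun y => berk_kernel (Some (raise (affine_point x) e), y))) (EFin \o ke e x).
  have [N [mN N0 NP]] := ae_fin; exists N; split => // y h; apply: NP => y0; apply: h => _ /=.
  by rewrite keE.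
have m1 : measurable_fun setT (EFin \o ke e x) by exact/measurable_EFinP.
have m2 : measurable_fun setT (EFin \o (fun y => berk_kernel (Some (raise (affine_point x) e), y))) by exact/measurable_EFinP.
split; last by rewrite /Rintegral; congr fine; apply/esym; exact: (ae_eq_integral _ _ measurableT m2 m1 E).
apply/integrableP; split => //.
rewrite (ae_eq_integral (fun y => `|(berk_kernel (Some (raise (affine_point x) e), y))%:E|%E))//.
- by case/integrableP: ii.
- exact: measurableT_comp.
- exact: measurableT_comp.
by have [N [mN N0 NP]] := E; exists N; split => // y h; apply: NP => h'; apply: h => /h' /= [->].
Qed.

(** Raising is jointly continuous in the point and the radius, and points near infinity stay near
    infinity; compactness of the projective line makes the radius uniform. *)
Let g_raise_uniform eta : 0 < eta -> exists2 e, 0 < e <= 1 &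
  forall s : berk, g (Some (raise s e)) <= g (Some s) + eta.
Proof.
move=> eta0; have eta2 : 0 < eta / 2 by rewrite divr_gt0.
pose Q (e : R) (x : P1) : Prop := if x is Some s then g (Some (raise s e)) <= g (Some s) + eta else True.
have cov : near_covering [set: P1] by apply/compact_near_coveringP; exact: one_point_compactification_compact.
have := cov R (0^'+) Q _; case.
- move=> x _; case: x => [s|].
    have c1 : (fun q : berk * R => raise q.1 q.2) @ filter_prod (nbhs s) (0^'+) --> s.
      rewrite -[X in _ --> X](raise_id ultra Lclosed (r := 0)) ?diam_ge0//.
      have FF : Filter (filter_prod (nbhs s) (0^'+ : set_system R)) by exact: filter_prod_filter.
      have a1 : (fst : berk * R -> berk) @ (filter_prod (nbhs s) (0^'+)) --> s by exact: cvg_fst.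
      have a2 : (snd : berk * R -> R) @ (filter_prod (nbhs s) (0^'+)) --> 0.
        apply: (@cvg_trans _ (0^'+ : set_system R)); first exact: cvg_snd.
        exact: cvg_within.
      by apply: raise_cvg; [exact: a1|exact: a2].
    have g1 := @gSome s.
    have h1 := cvg_comp _ _ c1 g1.
    have h2 : (fun q : berk * R => g (Some q.1)) @ filter_prod (nbhs s) (0^'+) --> g (Some s).
      have a1 : (fst : berk * R -> berk) @ (filter_prod (nbhs s) (0^'+)) --> s by exact: cvg_fst.
      exact: (cvg_comp _ _ a1 g1).
    move/cvgrPdist_lt: h1 => /(_ _ eta2) near1; move/cvgrPdist_lt: h2 => /(_ _ eta2) near2.
    have [[A B] [/= sA B0] AB] := filterI near1 near2.
    exists (Some @` A, B); first by split => //=; exact: one_point_compactification_some_nbhs.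
    move=> [_ e] [[y Ay <-] /= Be]; have [/= q1 q2] := AB (y, e) (conj Ay Be).
    by move: q1 q2; rewrite !ltr_distlC => /andP[? ?] /andP[? ?]; lra.
  have gN := @gc None; move/cvgrPdist_lt: gN => /(_ _ eta2) nA.
  have [r rP] := nbhs_infty nA.
  exists ((Some @` [set x : berk | r < dist x 0]) `|` [set None], setT).
    by split; [exact: near_infty|exact: filterT].
  move=> [_ e] [[[y yr <-]|->] _] //=.
  have h1 := rP _ yr; have h2 : `|g None - g (Some (raise y e))| < eta / 2.
    by apply: rP; rewrite dist_raise lt_max yr.
  by move: h1 h2; rewrite /= !ltr_distlC => /andP[? ?] /andP[? ?]; lra.
- move=> d /= d0 dP; pose e := Num.min 1 (d / 2).
  have e0 : 0 < e by rewrite lt_min ltr01 divr_gt0.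
  exists e; first by rewrite e0 ge_min lexx.
  move=> s; have := dP e _ e0 (Some s) I; apply.
  rewrite /ball_ /= sub0r normrN gtr0_norm// gt_min; apply/orP; right.
  by rewrite ltr_pdivrMr// ltr_pMr// ltr1n.
Qed.

(** Raising by at most 1 leaves log^+ unchanged, so the potentials of the kernel and of its
    truncation differ only by the variation of g between a point and the raised point. *)
Theorem berk_energy_lower_bound (del : R) : 0 < del -> exists N, forall s : seq bP1, uniq s ->
  {in s, forall x, exists z, x = Some (berk_point z)} -> (N <= size s)%N ->
  (size s)%:R ^- 2 * (\sum_(x <- s) \sum_(y <- s) berk_kernel (x, y))
     - 2 / (size s)%:R * (\sum_(x <- s) p x) + \int[rho]_x p x <= del.
Proof.
have [rho0 _ _] := infty_null_ln_dist; have [M MP] := G; have [B pl] := potential_ln_dist.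
have ln_pi e s : 0 < e <= 1 -> ln_dist0 (raise s e) = ln_dist0 s.
  move=> /andP[e0 e1]; rewrite /ln_dist0 dist_raise [Num.max (dist s 0) e]maxC maxA.
  by rewrite (max_l e1).
have peE e x : 0 < e <= 1 -> \int[rho]_y ke e x y = ln_dist0 (affine_point x) + g (Some (raise (affine_point x) e)) - g None.
  by move=> e01; have [_ ->] := ke_int x (andP e01).1; rewrite ln_pi.
apply: (@empirical_energy_lower_bound _ _ _ rho (@berk_kernel R L) ke
  [set x | exists z, x = Some (berk_point z)] None) => //.
- exact: measurable_infty.
- by move=> e x y _; rewrite /ke JC.
- move=> e nu /andP[e0 _] nu0; apply: ultrametric_conditionally_negative nu0 => [x y|x y z].
    by rewrite /ke JC.
  pose m u v := Num.max (J (affine_point u) (affine_point v)) e.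
  have m0 u v : 0 < m u v by rewrite lt_max e0 orbT.
  have : m x z <= Num.max (m x y) (m y z).
    rewrite ge_max !le_max lexx !orbT andbT.
    by have := J_ultra ultra (affine_point x) (affine_point y) (affine_point z); rewrite le_max => /orP[->|->]; rewrite ?orbT.
  move=> h; rewrite le_max /ke -/(m x z) -/(m x y) -/(m y z) !ler_ln ?posrE//.
  by rewrite -le_max.
- by move=> e x /andP[e0 _]; have [] := ke_int x e0.
- move=> e e01 /=; apply: (@integrableR_le _ _ _ _ _ (fun x => ln_dist x + (M + M))).
  + have [e0 _] := andP e01.
    rewrite (_ : (fun x => \int[rho]_y ke e x y) = fun x => if x is Some s then ln_dist0 s + g (Some (raise s e)) - g None
        else ln_dist0 canon + g (Some (raise canon e)) - g None); last by apply/funext => -[s|]; rewrite peE.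
    apply: (@measurable_lift R _ (fun s => ln_dist0 s + g (Some (raise s e)) - g None)) => s.
    have c1 : (fun s : berk => raise s e) @ s --> raise s e by apply: (raise_cvg (F := nbhs s) (Y := id) (e := fun=> e)); [exact: cvg_id|exact: cvg_cst].
    exact: (cvgB (cvgD (@ln_dist0_continuous s) (cvg_comp _ _ c1 (@gSome (raise s e)))) (cvg_cst _)).
  + move=> x; rewrite peE//; have a := MP None; have b := MP (Some (raise (affine_point x) e)).
    rewrite ln_dist_affine.
    have := ln_dist_ge0 x; move: a b; rewrite !ler_norml => /andP[? ?] /andP[? ?] ?.
    apply/andP; split; lra.
  + by apply: integrableRD => //; exact: integrableR_cst.
- move=> e /andP[e0 e1]; apply: (@integrableR_le _ _ _ _ _ (fun x => ln_dist x + `|ln e|)).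
  + have md : measurable_fun setT (fun x : bP1 => (x, x)) by exact: measurable_fun_pair.
    exact: (measurableT_comp (mke e) md).
  + move=> x; rewrite /ke; have D0 : dist (affine_point x) 0 <= Num.max 1 (dist (affine_point x) 0) by rewrite le_max lexx orbT.
    have D1 : 1 <= Num.max 1 (dist (affine_point x) 0) by rewrite le_max lexx.
    have -> : ln_dist x = ln (Num.max 1 (dist (affine_point x) 0)) by rewrite -ln_dist_affine.
    have m : 0 < Num.max (J (affine_point x) (affine_point x)) e by rewrite lt_max e0 orbT.
    have h1 : ln e <= ln (Num.max (J (affine_point x) (affine_point x)) e) by rewrite ler_ln ?posrE// le_max lexx orbT.
    have h2 : ln (Num.max (J (affine_point x) (affine_point x)) e) <= ln (Num.max 1 (dist (affine_point x) 0)).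
      have D2 : 0 < Num.max 1 (dist (affine_point x) 0) by exact: lt_le_trans D1.
      rewrite ler_ln ?posrE// ge_max (le_trans e1 D1) andbT -diamE.
      by rewrite (le_trans (diam_le _ 0)).
    have h3 : 0 <= ln (Num.max 1 (dist (affine_point x) 0)) by rewrite ln_ge0.
    have := ler_norm (ln e); have := ler_norm (- ln e); rewrite normrN => ? ?.
    rewrite ler_norml; apply/andP; split; lra.
  + by apply: integrableRD => //; exact: integrableR_cst.
- move=> e [s|//] e01 _ /=; rewrite peE// -/(p (Some s)) pE /=.
  have [e0 e1] := andP e01; rewrite lerD2r lerD2l.
  pose en (n : nat) : R := n.+1%:R^-1 * e.
  have en0 n : 0 < en n by rewrite mulr_gt0 ?invr_gt0.
  have ene n : en n <= e by rewrite ler_piMl ?(ltW e0)// invf_le1// ler1n.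
  have uS : (fun n => raise s (en n)) @ \oo --> s.
    rewrite -[X in _ --> X](raise_id ultra Lclosed (r := 0)) ?diam_ge0//.
    apply: raise_cvg; first exact: cvg_cst.
    by rewrite -[X in _ --> X](mul0r e); apply: cvgM; [exact: cvg_harmonic|exact: cvg_cst].
  apply: (ler_cvg_to (cvg_comp _ _ uS (@gSome s)) (cvg_cst (g (Some (raise s e))))).
  apply: nearW => n /=.
  have [i1 E1] := berk_potential (raise s (en n)); have [i2 E2] := berk_potential (raise s e).
  have en01 : 0 < en n <= 1 by rewrite en0 (le_trans (ene n)).
  have : \int[rho]_y berk_kernel (Some (raise s (en n)), y) <= \int[rho]_y berk_kernel (Some (raise s e), y).
    apply: le_Rintegral => // -[t|] _ //=; rewrite !(berk_supE ultra Lclosed) !(J_raise ultra).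
    rewrite ler_ln ?posrE ?lt_max ?e0 ?en0 ?orbT//.
    by rewrite ge_max !le_max lexx (ene n) !orbT.
  by rewrite E1 E2 !ln_pi// lerD2r lerD2l.
- move=> e x y /andP[e0 _] [z ->] [w ->] zw; rewrite /ke /= (berk_supE ultra Lclosed) (J_point ultra).
  rewrite ler_ln ?posrE ?lt_max ?e0 ?orbT// ?le_max ?lexx// (av_gt0 LP) subr_eq0.
  by apply/eqP => zw'; apply: zw; rewrite zw'.
- by move=> x [z ->] /=; rewrite (berk_supE ultra Lclosed) (J_point ultra) subrr (av0 LP) ln0.
- move=> e /andP[e0 _]; exists (- ln e) => x [z ->]; rewrite opprK /ke /= (J_point ultra) subrr (av0 LP).
  by rewrite max_r// ltW.
- move=> eta eta0; have [e e01 eP] := g_raise_uniform eta0; exists e => // x [z ->].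
  by rewrite peE// -/(p _) pE /=; have := eP (berk_point z); lra.
Qed.

End Potential.
End BerkovichMeasure.

(** * Separability of the completed field *)

Section Separable.
Variables (R : realType) (K : fieldExtType rat) (v : K -> R) (L : valField R) (s : {rmorphism K -> L}).
Hypothesis Cv : is_Cv v s.
Hypothesis ultra : forall x y : L, vabs (x + y) <= Num.max (vabs x) (vabs y).
Let LP := vabsP L.

Lemma is_Cv_poly_closed : poly_closed [set: L].
Proof.
by have [_ Lc [W [[_ WF _ Wc] Wd]]] := Cv; exact: (dense_poly_closed ultra WF Wc Wd Lc).
Qed.

Let of_coords (r : 'rV[rat]_(\dim {:K})) : K := \sum_i r 0 i *: (vbasis {:K})`_i.

Let of_coordsK x : of_coords (\row_i coord (vbasis {:K}) i x) = x.
Proof. by rewrite [RHS](coord_vbasis (memvf x)); apply: eq_bigr => i _; rewrite mxE. Qed.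

Let P_of (l : seq 'rV[rat]_(\dim {:K})) : {poly L} := Poly [seq s (of_coords r) | r <- l].
Let roots l : seq L := sval (cid (L_split is_Cv_poly_closed (P_of l))).

(* roots of polynomials over K are dense, since the roots depend continuously on the coefficients *)
Definition root_sequence (n : nat) : L :=
  if choice.unpickle n : option (seq 'rV[rat]_(\dim {:K}) * nat) is Some (l, k) then nth 0 (roots l) k else 0.

Lemma root_sequence_dense z (e : R) : 0 < e -> exists n, vabs (z - root_sequence n) < e.
Proof.
move=> e0; have [_ _ [W [[_ _ Walg _] Wd]]] := Cv.
have [w Ww zw] : exists2 w, W w & vabs (z - w) < e.
  have : vclosure W z by rewrite Wd.
  by move=> /(_ e e0).
have [P [P0 Pc /rootP Pw]] := Walg w Ww.
set m := size P; have m0 : (0 < m)%N by rewrite size_poly_gt0.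
pose c := vabs (lead_coef P); have c0 : 0 < c by rewrite /c (av_gt0 LP) lead_coef_eq0.
pose M := Num.max 1 (vabs w) ^+ m.
have M1 : 1 <= M by rewrite exprn_ege1// le_max lexx.
(* The bound [c] preserves the size of the leading coefficient, hence the degree; the other bound
   makes the value at w smaller than c e^(m - 1), which forces a root within e of w. *)
pose d := Num.min c (c * e ^+ m.-1 / M).
have M0 : 0 < M by exact: lt_le_trans M1.
have d0 : 0 < d by rewrite lt_min c0 divr_gt0// mulr_gt0// exprn_gt0.
have ex i : exists x : K, vabs (P`_i - s x) < d by have [_ [x _ <-] h] := Pc i d d0; exists x.
have [k kP] := choice ex.
pose l := [seq \row_j coord (vbasis {:K}) j (k i) | i <- iota 0 m].
have Qi i : (i < m)%N -> (P_of l)`_i = s (k i).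
  move=> im; rewrite coef_Poly (nth_map 0) ?size_map ?size_iota// (nth_map 0%N) ?size_iota// nth_iota//.
  by rewrite add0n of_coordsK.
have lead1 : vabs (s (k m.-1)) = c.
  apply/eqP; rewrite eq_le; have h : vabs (P`_m.-1 - s (k m.-1)) < c.
    by apply: lt_le_trans (kP _) _; rewrite ge_min lexx.
  have e1 : vabs (s (k m.-1)) <= Num.max (vabs P`_m.-1) (vabs (s (k m.-1) - P`_m.-1)).
    by rewrite -{1}(subrK P`_m.-1 (s (k m.-1))) addrC ultra.
  have e2 : vabs P`_m.-1 <= Num.max (vabs (s (k m.-1))) (vabs (P`_m.-1 - s (k m.-1))).
    by rewrite -{1}(subrK (s (k m.-1)) P`_m.-1) addrC ultra.
  rewrite -[P`_m.-1]/(lead_coef P) in h e1 e2; rewrite -/c in e1 e2.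
  apply/andP; split.
    by apply: le_trans e1 _; rewrite ge_max lexx (av_distC LP) ltW.
  by move: e2; rewrite le_max => /orP[//|/le_lt_trans /(_ h)]; rewrite ltxx.
have szQ : size (P_of l) = m.
  apply/eqP; rewrite eqn_leq; apply/andP; split.
    by apply: leq_trans (size_Poly _) _; rewrite !size_map size_iota.
  rewrite leqNgt; apply/negP => h.
  have : (P_of l)`_m.-1 = 0 by apply: nth_default; rewrite -ltnS prednK.
  rewrite Qi ?prednK// => h0; move: c0; rewrite -lead1 h0 (av0 LP) ltxx //.
have lcQ : vabs (lead_coef (P_of l)) = c by rewrite lead_coefE szQ Qi ?prednK.
have Qw : vabs (P_of l).[w] < d * M.
  have -> : (P_of l).[w] = \sum_(i < m) (s (k i) - P`_i) * w ^+ i.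
    transitivity ((P_of l).[w] - P.[w]); first by rewrite Pw subr0.
  rewrite !horner_coef szQ -sumrB; apply: eq_bigr => i _.
    by rewrite Qi// mulrBl.
  apply: (Nsum_lt (av0 LP) ultra); first by rewrite mulr_gt0.
  move=> i _; rewrite (avM LP) (avX LP) (av_distC LP).
  have wi : vabs w ^+ i <= M.
    apply: (@le_trans _ _ (Num.max 1 (vabs w) ^+ i)).
      by rewrite lerXn2r ?nnegrE ?(av_ge0 LP)// ?le_max ?lexx ?orbT// ler01.
    by rewrite /M ler_weXn2l ?le_max ?lexx// ltnW.
  apply: (@le_lt_trans _ _ (vabs (P`_i - s (k i)) * M)).
    by rewrite ler_wpM2l ?(av_ge0 LP).
  by rewrite ltr_pM2r.
have rE := svalP (cid (L_split is_Cv_poly_closed (P_of l))); rewrite -/(roots l) in rE.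
have szr : size (roots l) = m.-1.
  have := szQ; rewrite {1}rE size_scale ?size_prod_XsubC; first by move=> <-.
  by rewrite -(av_eq0 LP) lcQ gt_eqF.
have [j jr jP] : exists2 j, (j < size (roots l))%N & vabs (w - nth 0 (roots l) j) < e.
  apply: contrapT => no.
  have far r : r \in roots l -> e <= vabs (w - r).
    move=> rr; rewrite leNgt; apply/negP => h; apply: no; exists (index r (roots l)); first by rewrite index_mem.
    by rewrite nth_index.
  have : c * e ^+ m.-1 <= vabs (P_of l).[w].
    rewrite rE hornerZ (avM LP) lcQ ler_wpM2l ?(ltW c0)// horner_prod -szr.
    move: far; elim: (roots l) => [_|r rs IH far]; first by rewrite big_nil expr0 (av1 LP).
    rewrite big_cons (avM LP) exprS !hornerE ler_pM ?exprn_ge0 ?(ltW e0)//; first by apply: far; rewrite inE eqxx.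
    by apply: IH => r' r's; apply: far; rewrite inE r's orbT.
  have : d * M <= c * e ^+ m.-1 by rewrite -ler_pdivlMr// ge_min lexx orbT.
  by move: Qw => /lt_le_trans h /h; move=> /lt_le_trans h2 /h2; rewrite ltxx.
exists (choice.pickle (l, j)); rewrite /root_sequence choice.pickleK.
rewrite -(subrK w z) -addrA; apply: le_lt_trans (ultra _ _) _.
by rewrite gt_max zw jP.
Qed.

End Separable.

(** * Local and global heights *)

Section LocalEnergies.
Variables (R : realType) (K : fieldExtType rat) (C : completions R K).
Variables (Kbar : closedFieldType) (iota : {rmorphism K -> Kbar}).
Variables (tau : embeddings C iota) (rho : adelic_measure C).

Definition inf_energy (v : infinite_place R K) (F : seq (option Kbar)) : R :=
  let mu := SignedMeasure (empirical R [seq inf_point tau v a | a <- F]) (rho_inf rho v) in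
  sphere_energy mu mu.

Definition fin_energy (v : finite_place R K) (F : seq (option Kbar)) : R :=
  let mu := SignedMeasure (empirical R [seq fin_point tau v a | a <- F]) (rho_fin rho v) in
  berk_energy mu mu.

(** What the global argument has to know of a place, whether finite or infinite: an expansion of the
    energy with a potential within [B] of log^+, and an asymptotic lower bound. The list [[:: None]]
    stands for the point at infinity. *)
Definition local_energy_bound (a : Kbar -> R) (E : seq (option Kbar) -> R) (B : R) : Prop :=
  (exists p : Kbar -> R, (forall y, `|p y - ln (Num.max 1 (a y))| <= B) /\
    forall s, E (map Some s) = E [:: None] + 2 / (size s)%:R * (\sum_(y <- s) p y)
      - (size s)%:R ^- 2 * (\sum_(y <- s) \sum_(z <- s) ln (a (y - z)))) /\
  (forall del, 0 < del -> exists N, forall s, uniq s -> (N <= size s)%N -> - del <= E (map Some s)).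

Lemma half_ln_max_sqr (x : R) : 0 <= x -> 2^-1 * ln (Num.max 1 (x ^+ 2)) = ln (Num.max 1 x).
Proof.
move=> x0; have [x1|x1] := leP x 1.
  by rewrite max_l ?expr_le1// ln1 mulr0.
have x0' : 0 < x by exact: lt_trans x1.
by rewrite max_r ?exprn_ege1 ?ltW// lnXn// mulr2n; field.
Qed.

Lemma inf_energy_bound v : exists B, local_energy_bound (abs_inf tau v) (inf_energy v) B.
Proof.
have [g gc glap] := rho_inf_potential rho v.
pose p (x : borel (riemann_sphere R)) := \int[rho_inf rho v]_y sphere_kernel (x, y).
have [B BP] := sphere_potential_ln_dist gc glap.
have pN : p None = 0 by rewrite /p /Rintegral; under eq_integral do rewrite /=; rewrite integral0.
have kE y z : sphere_kernel (inf_point tau v (Some y), inf_point tau v (Some z)) = ln (abs_inf tau v (y - z)).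
  by rewrite /abs_inf rmorphB.
have EN : inf_energy v [:: None] = - \int[rho_inf rho v]_x p x.
  by rewrite /inf_energy (sphere_energyE gc glap) /= !big_seq1 -/(p None) pN /= !mulr0 subr0 add0r.
have Es s : inf_energy v (map Some s) = inf_energy v [:: None] +
    2 / (size s)%:R * (\sum_(y <- s) p (inf_point tau v (Some y)))
    - (size s)%:R ^- 2 * (\sum_(y <- s) \sum_(z <- s) ln (abs_inf tau v (y - z))).
  rewrite EN /inf_energy (sphere_energyE gc glap) !size_map !big_map.
  transitivity (- ((size s)%:R ^- 2 * (\sum_(y <- s) \sum_(z <- s) ln (abs_inf tau v (y - z)))
    - 2 / (size s)%:R * (\sum_(y <- s) p (inf_point tau v (Some y))) + \int[rho_inf rho v]_x p x)); last by ring.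
  congr (- (_ * _ - _ + _)); apply: eq_bigr => y _; rewrite !big_map; apply: eq_bigr => z _; exact: kE.
exists B; split.
  exists (fun y => p (inf_point tau v (Some y))); split=> [y|s]; last exact: Es.
  have := BP (inf_point tau v (Some y)); rewrite /= -normc_sqr half_ln_max_sqr//.
  exact: normc_ge0.
move=> del del0; have [N NP] := sphere_energy_lower_bound gc glap del0.
exists N => s us Ns; rewrite /inf_energy (sphere_energyE gc glap) lerN2 -map_comp.
apply: NP; rewrite ?size_map//.
- by rewrite map_inj_uniq// => y z [] /fmorph_inj.
- by move=> _ /mapP[y _ ->]; exists (tau_inf tau v y).
Qed.

Section Finite.
Variable v : finite_place R K.
Local Notation L := (Cfin C v).
Let ultra : forall x y : L, vabs (x + y) <= Num.max (vabs x) (vabs y).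
Proof. exact: fin_completion_ultra. Qed.
Let Cv := fin_embP L.
Let Lclosed : poly_closed [set: L]. Proof. exact: (is_Cv_poly_closed Cv ultra). Qed.
Let Lcomplete : vcomplete L. Proof. by have [] := Cv. Qed.
Let dense := root_sequence_dense Cv ultra.
Local Notation mu := (rho_fin rho v).
Let p (x : borel (berk_P1 L)) := \int[mu]_y berk_kernel (x, y).

Let pN : p None = 0.
Proof. by rewrite /p /Rintegral; under eq_integral do rewrite /=; rewrite integral0. Qed.

Let kE y z : berk_kernel (fin_point tau v (Some y), fin_point tau v (Some z)) = ln (abs_fin tau v (y - z)).
Proof. by rewrite /= (berk_supE ultra Lclosed) (J_point ultra) /abs_fin rmorphB. Qed.

Let Es g : continuous g -> berk_laplacian g (SignedMeasure mu (gauss_measure L)) ->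
  fin_energy v [:: None] = - (\int[mu]_x p x) /\
  forall s, fin_energy v (map Some s) = fin_energy v [:: None] +
    2 / (size s)%:R * (\sum_(y <- s) p (fin_point tau v (Some y)))
    - (size s)%:R ^- 2 * (\sum_(y <- s) \sum_(z <- s) ln (abs_fin tau v (y - z))).
Proof.
move=> gc glap.
have EN : fin_energy v [:: None] = - \int[mu]_x p x.
  by rewrite /fin_energy (berk_energyE ultra Lclosed Lcomplete dense gc glap) /= !big_seq1 -/(p None) pN /= !mulr0 subr0 add0r.
split=> // s; rewrite EN /fin_energy (berk_energyE ultra Lclosed Lcomplete dense gc glap) /= !size_map !big_map.
rewrite [X in _ * X - _](eq_bigr (fun y => \sum_(z <- s) ln (abs_fin tau v (y - z)))); last first.
  by move=> y _; rewrite !big_map; apply: eq_bigr => z _; exact: kE.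
by rewrite -/p; ring.
Qed.

Let fin_point_inj : injective (fun y => fin_point tau v (Some y)).
Proof.
move=> y z [] h; have : dist (berk_point (tau_fin tau v y)) (tau_fin tau v z) = 0.
  have h' := congr1 (@^~ ('X - (tau_fin tau v z)%:P)) h; rewrite /= in h'.
  by rewrite /dist /= h' hornerXsubC subrr (av0 (vabsP L)).
by rewrite dist_point => /eqP; rewrite (av_eq0 (vabsP L)) subr_eq0 => /eqP /fmorph_inj.
Qed.

Let ln_distE y : ln_dist (fin_point tau v (Some y)) = ln (Num.max 1 (abs_fin tau v y)).
Proof. by rewrite /= /ln_dist0 dist_point subr0. Qed.

Lemma fin_energy_bound : exists B, local_energy_bound (abs_fin tau v) (fin_energy v) B.
Proof.
have [g gc glap] := rho_fin_potential rho v.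
have [B BP] := potential_ln_dist ultra Lclosed Lcomplete dense gc glap.
have [_ E] := Es gc glap.
exists B; split.
  exists (fun y => p (fin_point tau v (Some y))); split=> [y|s]; last exact: E.
  by rewrite -ln_distE; exact: BP.
move=> del del0; have [N NP] := berk_energy_lower_bound ultra Lclosed Lcomplete dense gc glap del0.
exists N => s us Ns; rewrite /fin_energy (berk_energyE ultra Lclosed Lcomplete dense gc glap) lerN2 -map_comp.
apply: NP; rewrite ?size_map//; first by rewrite map_inj_uniq//; exact: fin_point_inj.
by move=> _ /mapP[y _ ->]; exists (tau_fin tau v y).
Qed.

(** Integration against the Gauss measure is evaluation at the canonical point, where the kernel
    equals log^+; the expansion is then exact, with no error term. *)
Lemma fin_energy_gauss : (forall A, measurable A -> mu A = gauss_measure L A) ->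
  fin_energy v [:: None] = 0 /\ forall s, fin_energy v (map Some s) =
    2 / (size s)%:R * (\sum_(y <- s) ln (Num.max 1 (abs_fin tau v y)))
    - (size s)%:R ^- 2 * (\sum_(y <- s) \sum_(z <- s) ln (abs_fin tau v (y - z))).
Proof.
move=> muE; have [g gc glap] := rho_fin_potential rho v.
have mk := measurable_berk_kernel ultra Lclosed dense.
have int (f : borel (berk_P1 L) -> R) : measurable_fun setT f -> \int[mu]_y f y = f (Some (berk_can L)).
  move=> mf; rewrite /Rintegral (eq_measure_integral (gauss_measure L)); last by move=> A mA _; exact: muE.
  transitivity (fine (\d_(Some (berk_can L) : borel (berk_P1 L)) setT * (f (Some (berk_can L)))%:E)%E).
    by congr fine; apply: integral_dirac => //; exact/measurable_EFinP.
  by rewrite diracT mul1e.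
have pE x : p x = berk_kernel (x, Some (berk_can L)).
  by rewrite /p int//; exact: (measurableT_comp mk (pair1_measurable x)).
have EN : fin_energy v [:: None] = 0.
  have [-> _] := Es gc glap; rewrite int.
    rewrite pE /= (berk_supE ultra Lclosed) (berk_canE ultra Lclosed) -(diamE (canon ultra)).
    by rewrite (diam_canon ultra) ln1 oppr0.
  rewrite (_ : p = fun x => berk_kernel (x, Some (berk_can L))); last by apply/funext.
  exact: (measurableT_comp mk (pair2_measurable _)).
split=> // s; have [_ ->] := Es gc glap; rewrite EN add0r; congr (_ * _ - _); apply: eq_bigr => y _.
rewrite pE -ln_distE /= (berk_supE ultra Lclosed) (berk_canE ultra Lclosed) (J_canon ultra).
by [].
Qed.

(* ln|y - z| <= ln^+|y| + ln^+|z| at a nonarchimedean place *)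
Lemma fin_energy_gauss_ge0 s : (forall A, measurable A -> mu A = gauss_measure L A) ->
  0 <= fin_energy v (map Some s).
Proof.
move=> /fin_energy_gauss[_ ->].
case: s => [|y0 s0]; first by rewrite !big_nil !mulr0 subr0.
set s := y0 :: s0; set n := (size s)%:R; have n0 : 0 < n :> R by rewrite ltr0n.
pose l y := ln (Num.max 1 (abs_fin tau v y)).
have l0 y : 0 <= l y by rewrite ln_ge0// le_max lexx.
have k y z : ln (abs_fin tau v (y - z)) <= l y + l z.
  have aP := abs_finP tau v.
  have [yz|yz] := eqVneq (y - z) 0; first by rewrite yz (av0 aP) ln0// addr_ge0.
  have m1 y' : 0 < Num.max 1 (abs_fin tau v y') by rewrite lt_max ltr01.
  rewrite -lnM ?posrE// ler_ln ?posrE ?mulr_gt0 ?(av_gt0 aP)//.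
  apply: le_trans (abs_fin_ultra tau v _ _) _; rewrite (avN aP) ge_max.
  have my y' : 1 <= Num.max 1 (abs_fin tau v y') by rewrite le_max lexx.
  have ay y' : abs_fin tau v y' <= Num.max 1 (abs_fin tau v y') by rewrite le_max lexx orbT.
  by rewrite (le_trans (ay y))?ler_peMr ?(ltW (m1 _))//= (le_trans (ay z))// ler_peMl ?(ltW (m1 _)).
rewrite subr_ge0 -/n; have S : \sum_(y <- s) \sum_(z <- s) ln (abs_fin tau v (y - z)) <= 2 * n * \sum_(y <- s) l y.
  apply: (@le_trans _ _ (\sum_(y <- s) \sum_(z <- s) (l y + l z))).
    by apply: ler_sum => y _; apply: ler_sum => z _; exact: k.
  under eq_bigr do rewrite big_split /= big_const_seq count_predT iter_addr_0.
  rewrite big_split /= sumrMnl [X in _ + X]big_const_seq count_predT iter_addr_0 -[X in X + _]mulr_natl.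
  by rewrite -[X in _ + X]mulr_natl -/n le_eqVlt; apply/orP; left; apply/eqP; ring.
have n2 : 0 <= n ^- 2 by rewrite invr_ge0 exprn_ge0// ltW.
apply: le_trans (ler_wpM2l n2 S) _; rewrite le_eqVlt; apply/orP; left; apply/eqP.
by field; rewrite gt_eqF.
Qed.

End Finite.
End LocalEnergies.

(** * Comparison of heights and the essential minimum *)

Section GlobalHeight.
Variables (R : realType) (K : fieldExtType rat) (C : completions R K).
Variables (Kbar : closedFieldType) (iota : {rmorphism K -> Kbar}).
Hypothesis alg : forall x : Kbar, algebraicOver iota x.
Variables (tau : embeddings C iota) (rho : adelic_measure C).
Local Notation Ei := (inf_energy tau rho).
Local Notation Ef := (fin_energy tau rho).
Local Notation ai := (abs_inf tau).
Local Notation af := (abs_fin tau).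
Local Notation Ni := (N_inf C).
Local Notation Nf := (N_fin C).
Local Notation s x := (conjugates iota x).

Definition good_place (v : finite_place R K) : Prop :=
  forall A, measurable A -> rho_fin rho v A = gauss_measure (Cfin C v) A.

Lemma fsum_seq (F : finite_place R K -> R) u : uniq u -> (forall v, v \notin u -> F v = 0) ->
  \sum_(v \in setT) F v = \sum_(v <- u) F v.
Proof.
move=> uu F0; rewrite [RHS]fsbig_seq//; apply/esym/fsbig_widen => // v [_ /= /negP]; exact: F0.
Qed.

Let inf_bounds : exists B : infinite_place R K -> R, forall v, local_energy_bound (ai v) (Ei v) (B v).
Proof. by have [f fP] := choice (inf_energy_bound tau rho); exists f. Qed.

(** The constant is 0 at the places where rho is standard, so that the errors have a finite sum over
    all places. *)
Let fin_bounds : exists B : finite_place R K -> R, forall v,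
  local_energy_bound (af v) (Ef v) (B v) /\ (good_place v -> B v = 0).
Proof.
suff ex v : exists B : R, local_energy_bound (af v) (Ef v) B /\ (good_place v -> B = 0) by have [f fP] := choice ex; exists f.
have [g|ng] := pselect (good_place v); last first.
  by have [B BP] := fin_energy_bound tau rho v; exists B; split.
exists 0; split => //; have [E0 Es] := fin_energy_gauss tau g; split.
  exists (fun y => ln (Num.max 1 (af v y))); split => [y|t]; first by rewrite subrr normr0.
  by rewrite Es E0 add0r.
move=> del del0; exists 0%N => t _ _; apply: le_trans (fin_energy_gauss_ge0 tau t g).
by rewrite oppr_le0 ltW.
Qed.

Lemma height_orbitE x : height tau rho (Some x) = 2^-1 *
  (\sum_(v \in setT) Ni v * Ei v (map Some (s x)) + \sum_(v \in setT) Nf v * Ef v (map Some (s x))).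
Proof. by rewrite /height /height_set galois_orbitE. Qed.

(** Outside a finite set of places depending on x, the measure is standard, the conjugates are
    integral and their differences are units, so all local terms vanish. *)
Let places_of x : exists u0 : seq (finite_place R K), uniq u0 /\ forall v, v \notin u0 ->
  [/\ good_place v, forall y, y \in s x -> af v y <= 1 &
    forall y z, y \in s x -> z \in s x -> z != y -> af v (y - z) = 1].
Proof.
have h1 : almost_all_fin (fun v => forall y, y \in s x -> af v y <= 1).
  by apply: almost_all_fin_seq => y _; exact: almost_all_fin_abs_le1.
have h2 : almost_all_fin (fun v => forall y, y \in s x -> forall z, z \in s x -> z != y -> af v (y - z) = 1).
  apply: almost_all_fin_seq => y _; apply: almost_all_fin_seq => z _.
  have [->|zy] := eqVneq z y; first by exists 0%N.
  have yz : y - z != 0 by rewrite subr_eq0 eq_sym.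
  by apply: almost_all_finW (almost_all_fin_abs_eq1 alg tau yz).
have f2 := almost_all_fin_finite C (almost_all_finI h1 h2).
have : finite_set ([set v | ~ good_place v] `|` [set v | ~ ((forall y, y \in s x -> af v y <= 1) /\ (forall y, y \in s x -> forall z, z \in s x -> z != y -> af v (y - z) = 1))]).
  by rewrite finite_setU; split; [exact: rho_fin_cofinite|exact: f2].
move=> /finite_fsetP[A AE]; exists (A : seq _); split; first exact: fset_uniq.
move=> v /negP vA.
have nU : ~ ([set v | ~ good_place v] `|` [set v | ~ ((forall y, y \in s x -> af v y <= 1) /\ (forall y, y \in s x -> forall z, z \in s x -> z != y -> af v (y - z) = 1))]) v.
  by rewrite AE.
have gv : good_place v by apply: contrapT => h; apply: nU; left.
have [p1 p2] : (forall y, y \in s x -> af v y <= 1) /\ (forall y, y \in s x -> forall z, z \in s x -> z != y -> af v (y - z) = 1).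
  by apply: contrapT => h; apply: nU; right.
by split => // y z ys zs; exact: p2.
Qed.

Let D (a : Kbar -> R) x := \sum_(y <- s x) \sum_(z <- s x) ln (a (y - z)).
Let l (a : Kbar -> R) x := \sum_(y <- s x) ln (Num.max 1 (a y)).

Let DE (a : Kbar -> R) x : absolute_value a ->
  D a x = \sum_(y <- s x) \sum_(z <- s x | z != y) ln (a (y - z)).
Proof.
move=> aP; apply: eq_bigr => y _; rewrite [RHS]big_mkcond /=; apply: eq_bigr => z _.
by case: eqVneq => // ->; rewrite subrr (av0 aP) ln0.
Qed.

Let covers x (u : seq (finite_place R K)) := uniq u /\ forall v, v \notin u ->
  [/\ good_place v, forall y, y \in s x -> af v y <= 1 &
    forall y z, y \in s x -> z \in s x -> z != y -> af v (y - z) = 1].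

Let D0 x u v : covers x u -> v \notin u -> D (af v) x = 0.
Proof.
move=> [_ h] /h[_ _ h2]; rewrite DE; last exact: abs_finP.
rewrite big1_seq// => y /= ys; rewrite big1_seq// => z /andP[zy zs].
by rewrite h2// ln1.
Qed.

Let l0 x u v : covers x u -> v \notin u -> l (af v) x = 0.
Proof. by move=> [_ h] /h[_ h1 _]; rewrite /l big1_seq// => y /= ys; rewrite max_l ?ln1//; exact: h1. Qed.

Let E0 x u v : covers x u -> v \notin u -> Ef v (map Some (s x)) = 0.
Proof.
move=> cu vu; have [_ h] := cu; have [g _ _] := h v vu.
have [_ ->] := fin_energy_gauss tau g; rewrite -/(l (af v) x) -/(D (af v) x).
by rewrite (l0 cu vu) (D0 cu vu) !mulr0 subr0.
Qed.

Let disc_sum x t u : uniq t -> (forall v, v \in t) -> covers x u ->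
  \sum_(v <- t) Ni v * D (ai v) x + \sum_(v <- u) Nf v * D (af v) x = 0.
Proof.
move=> ut tP cu; have := sum_ln_disc alg tau x.
rewrite (fsum_inf_places _ ut tP) (@fsum_seq _ u); last 2 first.
- by case: cu.
- by move=> v vu; rewrite -DE ?(D0 cu vu) ?mulr0//; exact: abs_finP.
move=> h; rewrite -[RHS]h; congr (_ + _); apply: eq_bigr => v _; rewrite DE//; [exact: abs_infP|exact: abs_finP].
Qed.

Let naive_sum x t u : uniq t -> (forall v, v \in t) -> covers x u ->
  naive_height tau (Some x) = (size (s x))%:R^-1 *
    (\sum_(v <- t) Ni v * l (ai v) x + \sum_(v <- u) Nf v * l (af v) x).
Proof.
move=> ut tP cu; have [uu h] := cu.
have cE : #|` galois_orbit iota (Some x)| = size (s x) by rewrite -[RHS](size_map (@Some Kbar)) -galois_orbitE.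
have sE F : \sum_(b <- galois_orbit iota (Some x)) F b = \sum_(y <- s x) F (Some y) :> R.
  have sG r : r = map Some (s x) -> \sum_(b <- r) F b = \sum_(y <- s x) F (Some y) by move=> ->; rewrite big_map.
  exact: sG (galois_orbitE alg x).
rewrite /naive_height cE sE; congr (_ * _).
transitivity (\sum_(y <- s x) (\sum_(v <- t) Ni v * ln (Num.max 1 (ai v y)) + \sum_(v <- u) Nf v * ln (Num.max 1 (af v y)))).
  apply: eq_big_seq => y ys; congr (_ + _).
    rewrite (fsum_inf_places _ ut tP); apply: eq_bigr => v _.
    by rewrite log_plus_powR ?N_inf_ge0 ?(av_ge0 (vabsP _)).
  rewrite (@fsum_seq _ u)//.
    by apply: eq_bigr => v _; rewrite log_plus_powR ?N_fin_ge0 ?(av_ge0 (vabsP _)).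
  move=> v /h[_ h1 _]; rewrite log_plus_powR ?N_fin_ge0 ?(av_ge0 (vabsP _))//.
  by rewrite max_l ?ln1 ?mulr0//; exact: h1.
rewrite big_split /=; congr (_ + _); rewrite exchange_big; apply: eq_bigr => v _; by rewrite -mulr_sumr.
Qed.

(** Once the discriminant terms are added back, each place contributes half the energy at infinity
    and the average deviation of the potential from log^+. *)
Let part (V : eqType) (t : seq V) (N E Eoo P L DD B : V -> R) (n : R) : 0 < n -> (forall v, 0 <= N v) ->
  (forall v, E v = Eoo v + 2 / n * P v - n ^- 2 * DD v) -> (forall v, `|P v - L v| <= n * B v) ->
  `|2^-1 * (\sum_(v <- t) N v * E v) - n^-1 * (\sum_(v <- t) N v * L v) + 2^-1 * n ^- 2 * (\sum_(v <- t) N v * DD v)|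
    <= \sum_(v <- t) N v * (B v + `|Eoo v|).
Proof.
move=> n0 N0 EE PL; rewrite !mulr_sumr -sumrB -big_split /=.
apply: le_trans (ler_norm_sum _ _ _) _; apply: ler_sum => v _.
rewrite (_ : _ + _ = N v * (2^-1 * Eoo v + n^-1 * (P v - L v))); last by rewrite EE; field; rewrite gt_eqF.
rewrite normrM (ger0_norm (N0 v)) ler_wpM2l//.
apply: le_trans (ler_normD _ _) _; rewrite addrC lerD//.
  rewrite normrM gtr0_norm ?invr_gt0// ler_pdivrMl//.
by rewrite normrM ger0_norm// ler_piMl// invf_le1// ler1n.
Qed.

Lemma height_naive_bounded : exists B : R, forall alpha : option Kbar,
  `|height tau rho alpha - naive_height tau alpha| <= B.
Proof.
have [t [ut tP _ _]] := inf_places C.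
have [Bi BiP] := inf_bounds; have [Bf BfP] := fin_bounds.
pose M := \sum_(v <- t) Ni v * (Bi v + `|Ei v [:: None]|) + \sum_(v \in setT) Nf v * (Bf v + `|Ef v [:: None]|).
exists (Num.max M `|height tau rho None - naive_height tau None|) => -[x|]; last by rewrite le_max lexx orbT.
rewrite le_max; apply/orP; left.
have [u cu] := places_of x; have [uu h] := cu.
set n : R := (size (s x))%:R; have n0 : 0 < n by rewrite ltr0n size_conjugates_gt0.
(* The finite set [u] depends on x, but the places outside it contribute 0 to [M], which does not
   depend on x. *)
have -> : M = \sum_(v <- t) Ni v * (Bi v + `|Ei v [:: None]|) + \sum_(v <- u) Nf v * (Bf v + `|Ef v [:: None]|).
  congr (_ + _); apply: fsum_seq => // v /h[g _ _]; have [_ /(_ g) ->] := BfP v.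
  by have [-> _] := fin_energy_gauss tau g; rewrite normr0 addr0 mulr0.
rewrite height_orbitE (naive_sum ut tP cu) (fsum_inf_places _ ut tP) (@fsum_seq _ u)//; last first.
  by move=> v vu; rewrite (E0 cu vu) mulr0.
have d0 := disc_sum ut tP cu.
have [pi piP] : exists p : infinite_place R K -> Kbar -> R, forall v, (forall y, `|p v y - ln (Num.max 1 (ai v y))| <= Bi v) /\
    forall s', Ei v (map Some s') = Ei v [:: None] + 2 / (size s')%:R * (\sum_(y <- s') p v y)
      - (size s')%:R ^- 2 * (\sum_(y <- s') \sum_(z <- s') ln (ai v (y - z))).
  by have [f fP] := choice (fun v => (BiP v).1); exists f.
have [pf pfP] : exists p : finite_place R K -> Kbar -> R, forall v, (forall y, `|p v y - ln (Num.max 1 (af v y))| <= Bf v) /\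
    forall s', Ef v (map Some s') = Ef v [:: None] + 2 / (size s')%:R * (\sum_(y <- s') p v y)
      - (size s')%:R ^- 2 * (\sum_(y <- s') \sum_(z <- s') ln (af v (y - z))).
  by have [f fP] := choice (fun v => (BfP v).1.1); exists f.
have pl (a p : Kbar -> R) B : (forall y, `|p y - ln (Num.max 1 (a y))| <= B) ->
    `|\sum_(y <- s x) p y - l a x| <= n * B.
  move=> pB; rewrite /l -sumrB; apply: le_trans (ler_norm_sum _ _ _) _.
  rewrite (_ : n * B = \sum_(y <- s x) B); first by apply: ler_sum => y _; exact: pB.
  by rewrite big_const_seq count_predT iter_addr_0 mulr_natl.
have h1 := @part _ t Ni (fun v => Ei v (map Some (s x))) (fun v => Ei v [:: None]) (fun v => \sum_(y <- s x) pi v y)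
  (fun v => l (ai v) x) (fun v => D (ai v) x) Bi n n0 (N_inf_ge0 C) (fun v => (piP v).2 (s x)) (fun v => pl _ _ _ (piP v).1).
have h2 := @part _ u Nf (fun v => Ef v (map Some (s x))) (fun v => Ef v [:: None]) (fun v => \sum_(y <- s x) pf v y)
  (fun v => l (af v) x) (fun v => D (af v) x) Bf n n0 (N_fin_ge0 C) (fun v => (pfP v).2 (s x)) (fun v => pl _ _ _ (pfP v).1).
apply: le_trans (lerD h1 h2); apply: le_trans (ler_normD _ _).
rewrite le_eqVlt; apply/orP; left; apply/eqP; congr `|_|.
move: d0; set Da := \sum_(v <- t) _ * D _ _; set Db := \sum_(v <- u) _ * D _ _ => d0.
(* The discriminant terms of all places cancel by the product formula. *)
have -> : Db = - Da by apply/eqP; rewrite -addr_eq0 addrC d0.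
by rewrite -/n; ring.
Qed.

(** Only the infinite places and the finitely many finite places where rho is not standard can have
    negative energy; at each of them a large orbit has energy at least [- del]. *)
Lemma height_orbit_lower_bound (eps : R) : 0 < eps -> exists N, forall x,
  (N <= size (s x))%N -> - eps <= height tau rho (Some x).
Proof.
move=> e0; have [t [ut tP _ _]] := inf_places C.
have /finite_fsetP[A AE] := rho_fin_cofinite rho.
pose W := \sum_(v <- t) Ni v + \sum_(v <- A) Nf v.
have W0 : 0 <= W by rewrite addr_ge0// sumr_ge0// => v _; [exact: N_inf_ge0|exact: N_fin_ge0].
(* [W] is the total weight of the places that may contribute negatively, so that [W * del <= eps];
   adding 1 keeps the denominator positive. *)
pose del := eps / (W + 1); have del0 : 0 < del by rewrite divr_gt0// ltr_wpDl.
have [Bi BiP] := inf_bounds; have [Bf BfP] := fin_bounds.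
have [ni niP] : exists n : infinite_place R K -> nat, forall v, forall s', uniq s' -> (n v <= size s')%N -> - del <= Ei v (map Some s').
  by have [f fP] := choice (fun v => (BiP v).2 del del0); exists f.
have [nf nfP] : exists n : finite_place R K -> nat, forall v, forall s', uniq s' -> (n v <= size s')%N -> - del <= Ef v (map Some s').
  by have [f fP] := choice (fun v => (BfP v).1.2 del del0); exists f.
exists (maxn (\max_(v <- t) ni v) (\max_(v <- A) nf v)) => x; rewrite geq_max => /andP[n1 n2].
have us := conjugates_uniq alg x.
have [u cu] := places_of x; have [uu h] := cu.
have gA v : v \notin (A : seq _) -> good_place v.
  move=> /negP vA; apply: contrapT => ng; apply: vA.
  by have : [set v | ~ good_place v] v by []; rewrite AE.
rewrite height_orbitE (fsum_inf_places _ ut tP).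
have ui : uniq (undup (u ++ A)) by exact: undup_uniq.
rewrite (@fsum_seq _ (undup (u ++ A)))//; last first.
  by move=> v; rewrite mem_undup mem_cat negb_or => /andP[vu _]; rewrite (E0 cu vu) mulr0.
have b1 : - (\sum_(v <- t) Ni v * del) <= \sum_(v <- t) Ni v * Ei v (map Some (s x)).
  rewrite -sumrN big_seq [leRHS]big_seq; apply: ler_sum => v vt; rewrite -mulrN ler_wpM2l ?N_inf_ge0//.
  by apply: niP => //; apply: leq_trans n1; exact: leq_bigmax_seq.
have b2 : - (\sum_(v <- A) Nf v * del) <= \sum_(v <- undup (u ++ A)) Nf v * Ef v (map Some (s x)).
  apply: (@le_trans _ _ (\sum_(v <- undup (u ++ A) | v \in (A : seq _)) Nf v * Ef v (map Some (s x)))).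
    have pA : perm_eq [seq v <- undup (u ++ A) | v \in (A : seq _)] A.
      apply: uniq_perm; [exact: filter_uniq|exact: fset_uniq|] => v.
      by rewrite mem_filter mem_undup mem_cat andb_orr andbb; case: (v \in (A : seq _)); rewrite ?orbT.
    rewrite -[leRHS]big_filter (perm_big _ pA) /= -sumrN big_seq [leRHS]big_seq; apply: ler_sum => v vt.
    rewrite -mulrN ler_wpM2l ?N_fin_ge0//.
    by apply: nfP => //; apply: leq_trans n2; exact: leq_bigmax_seq.
  rewrite [leRHS](bigID (fun v => v \in (A : seq _))) /= lerDl sumr_ge0// => v /gA g.
  by rewrite mulr_ge0 ?N_fin_ge0//; exact: fin_energy_gauss_ge0.
have : W * del <= eps.
  by rewrite /del mulrCA -[leRHS]mulr1 ler_pM2l// ler_pdivrMr ?mul1r ?lerDl ?ler01// ltr_wpDl.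
rewrite /W mulrDl !mulr_suml => We; move: (lerD b1 b2); rewrite -opprD => /(le_trans _) b12.
set S := (X in 2^-1 * X); have hS : - eps <= S by apply: b12; rewrite lerN2.
by clearbody S; lra.
Qed.

(** Points of height below [- eps] have fewer than N conjugates, and naive height at most B by
    comparison; hence their local sums are at most N B and Northcott's theorem applies. The point at
    infinity is put aside. *)
Lemma height_essential_minimum (eps : R) : 0 < eps ->
  finite_set [set alpha : option Kbar | height tau rho alpha < - eps].
Proof.
move=> e0; have [t [ut tP _ _]] := inf_places C.
have [N NP] := height_orbit_lower_bound e0; have [B BP] := height_naive_bounded.
have fin := northcott alg tau N (N%:R * B).
apply: (@sub_finite_set _ _ ([set None] `|` Some @` _)); last first.
  by rewrite finite_setU; split; [exact: finite_set1|exact: finite_image fin].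
move=> [x|]; last by left.
move=> /= hx; right; exists x => //.
have sN : (size (s x) < N)%N by rewrite ltnNge; apply/negP => /NP; rewrite leNgt hx.
split; first exact: ltnW.
move=> t' u' ut' uu'; have [u0 cu0] := places_of x.
pose u := undup (u0 ++ u').
have cu : covers x u.
  split; first exact: undup_uniq.
  by move=> v; rewrite mem_undup mem_cat negb_or => /andP[vu _]; have [_ /(_ v vu)] := cu0.
have ll0 a : 0 <= l a x by apply: sumr_ge0 => y _; rewrite ln_ge0// le_max lexx.
have n0 : 0 < (size (s x))%:R :> R by rewrite ltr0n size_conjugates_gt0.
have nB : naive_height tau (Some x) <= B.
  have := BP (Some x); rewrite ler_norml => /andP[h _]; move: h hx e0; lra.
apply: (@le_trans _ _ (\sum_(v <- t) Ni v * l (ai v) x + \sum_(v <- u) Nf v * l (af v) x)).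
  apply: lerD; apply: sum_uniq_sub => //.
  - by move=> v; exact: mulr_ge0 (N_inf_ge0 C v) (ll0 _).
  - exact: undup_uniq.
  - by move=> v vu; rewrite mem_undup mem_cat vu orbT.
  - by move=> v; exact: mulr_ge0 (N_fin_ge0 C v) (ll0 _).
have nE := naive_sum ut tP cu; set T := (X in X <= _).
have -> : T = (size (s x))%:R * naive_height tau (Some x) by rewrite nE mulVKf// gt_eqF.
have h0 : 0 <= naive_height tau (Some x).
  rewrite nE; apply: mulr_ge0; first by rewrite invr_ge0 ltW.
  apply: addr_ge0; apply: sumr_ge0 => v _.
    exact: mulr_ge0 (N_inf_ge0 C v) (ll0 _).
  exact: mulr_ge0 (N_fin_ge0 C v) (ll0 _).
by apply: ler_pM => //; rewrite ?ler_nat ltnW.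
Qed.

End GlobalHeight.

Theorem mainTheorem1 (R : realType) (K : fieldExtType rat)
    (Kbar : closedFieldType) (iota : {rmorphism K -> Kbar})
    (Kbar_algebraic : forall x : Kbar, algebraicOver iota x)
    (C : completions R K) (tau : embeddings C iota) (rho : adelic_measure C) :
  (exists B : R, forall alpha : option Kbar,
     `|height tau rho alpha - naive_height tau alpha| <= B) /\
  (forall eps : R, 0 < eps ->
     finite_set [set alpha : option Kbar | height tau rho alpha < - eps]).
Proof. by split; [exact: height_naive_bounded|move=> eps; exact: height_essential_minimum]. Qed.
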